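(* Let $\theta_s=\theta_s(K,\rho)$ be the dominant singularity in the $\theta$-plane (the least negative pole) of the Laplace transforms $\widehat p_n(\theta)$ of the conditional sojourn time densities in the $M/M/1$ processor sharing queue with finite capacity $K$, arrival rate $\rho>0$ and service rate $1$. Then $\theta_s$ has the following asymptotic expansions as $K\to\infty$. (1) If $\rho<1$ (fixed), $$\theta_s=-(1-\sqrt\rho)^2-\frac{\sqrt\rho}{K}+\frac{\sqrt\rho\,r_0}{K^{4/3}}-\frac{8\sqrt\rho\,r_0^2}{15K^{5/3}}+O(K^{-2}),$$ where $r_0\approx-2.3381$ is the largest root of the Airy function $Ai(z)$. (2) If $\rho=1+\eta K^{-2/3}$ with $\eta=O(1)$ ($\eta$ a fixed real number), $$\theta_s=-\frac1K+\frac{r_1}{K^{4/3}}-\frac{16r_1^3+8\eta^2r_1^2+(\eta^4+19\eta)r_1+\eta^3+9}{30\,r_1\,K^{5/3}}+O(K^{-2}),$$ where $r_1=r_1(\eta)$ is the largest (real) root of $$\frac{Ai'(r_1+\eta^2/4)}{Ai(r_1+\eta^2/4)}=-\frac{\eta}{2}.$$ (3) If $\rho>1$ (fixed), $$\theta_s=-\frac1K-\frac{1}{(\rho-1)K^2}-\frac{1}{(\rho-1)^2K^3}+\frac{\rho^2+1}{(\rho-1)^4K^4}+O(K^{-5}).$$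
   Context: Model: a single-server queue with the processor sharing discipline (when $m\geq 1$ customers are present each is served at rate $1/m$), Poisson arrivals with rate $\lambda=\rho>0$, i.i.d. exponential service requirements with mean $1/\mu=1$, and capacity of at most $K$ customers; arrivals that find the system full are lost. Let $\mathbf V$ be the sojourn time of a tagged (accepted) customer, $\mathbf N(0^-)$ the number of customers present immediately before it arrives, and $p_n(t)\,dt=\Pr[\mathbf V\in(t,t+dt)\mid\mathbf N(0^-)=n]$, $0\le n\le K-1$. Let $\widehat p_n(\theta)=\int_0^\infty p_n(t)e^{-\theta t}\,dt$. The functions $p_n(t)$ are characterized by $$p_n'(t)=\rho\,p_{n+1}(t)-(1+\rho)\,p_n(t)+\frac{n}{n+1}\,p_{n-1}(t),\qquad 0\le n\le K-1,\ t>0,$$ with $p_n(0)=\frac1{n+1}$ and the artificial boundary condition $p_K(t)=p_{K-1}(t)$. Equivalently, $$(n+1)\rho\,\widehat p_{n+1}(\theta)-(n+1)(1+\rho+\theta)\,\widehat p_n(\theta)+n\,\widehat p_{n-1}(\theta)=-1,\qquad n=0,1,\dots,K-1,$$ with $\widehat p_K(\theta)=\widehat p_{K-1}(\theta)$. Thus each $\widehat p_n$ extends to a meromorphic (indeed rational) function of $\theta\in\mathbb C$. Its singularities are poles, all of them real and negative. The dominant singularity $\theta_s$ is the pole closest to $0$ (the largest one); it is also the tail exponent, $\theta_s=\lim_{t\to\infty}t^{-1}\log\Pr[\mathbf V>t]$. $Ai$ denotes the Airy function, $Ai(z)=\frac{1}{2\pi}\int_{-\infty}^\infty e^{-i(t^3/3+zt)}\,dt$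 for real $z$. *)

(* Defs.v *)
(* Stdlib reals with Coquelicot. *)
From Stdlib Require Import Reals.
From Coquelicot Require Import Coquelicot.
Open Scope R_scope.

Definition Cexp (z : C) : C :=
  (exp (Re z) * cos (Im z), exp (Re z) * sin (Im z)).

(* [p n] is the density of the sojourn time conditioned on N(0^-) = n; only
   the values at n <= K and t >= 0 are constrained, and [p K] is the artificial
   boundary term.  The one-sided limit at 0 is what ties the initial value to
   the differential equation, which is only imposed for t > 0.  When n = 0 the
   truncated index [n - 1] is harmless, its coefficient being 0. *)
Definition sojourn_densities (rho : R) (K : nat) (p : nat -> R -> R) : Prop :=
  (forall (n : nat) (t : R), (n < K)%nat -> 0 < t ->
     is_derive (p n) t
       (rho * p (n + 1)%nat t - (1 + rho) * p n t
        + INR n / INR (n + 1) * p (n - 1)%nat t)) /\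
  (forall n : nat, (n < K)%nat ->
     p n 0 = 1 / INR (n + 1) /\
     filterlim (p n) (at_right 0) (locally (p n 0))) /\
  (forall t : R, 0 <= t -> p K t = p (K - 1)%nat t).

Definition is_Cpoly (P : C -> C) : Prop :=
  exists (a : nat -> C) (d : nat),
    forall z : C, P z = sum_n (fun k : nat => (a k * z ^ k)%C) d.

(* The values of [F] at the zeros of the denominator are unconstrained. *)
Definition is_rational (F : C -> C) : Prop :=
  exists P Q : C -> C,
    is_Cpoly P /\ is_Cpoly Q /\ (exists z : C, Q z <> 0%C) /\
    (forall z : C, Q z <> 0%C -> F z = (P z / Q z)%C).

(* [F] is a rational continuation to the complex plane of the Laplace
   transform of [f]; it is determined by [f] up to finitely many values. *)
Definition laplace_continuation (f : R -> R) (F : C -> C) : Prop :=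
  is_rational F /\
  (forall z : C, 0 < Re z ->
     is_RInt_gen (V := C_R_NormedModule)
       (fun t : R => (RtoC (f t) * Cexp (- (z * RtoC t)))%C)
       (at_point 0) (Rbar_locally p_infty) (F z)).

Definition is_pole (F : C -> C) (z0 : C) : Prop :=
  filterlim (fun z : C => Cmod (F z)) (locally' z0) (Rbar_locally p_infty).

Definition dominant_singularity (K : nat) (rho theta : R) : Prop :=
  exists (p : nat -> R -> R) (phat : nat -> C -> C),
    sojourn_densities rho K p /\
    (forall n : nat, (n < K)%nat -> laplace_continuation (p n) (phat n)) /\
    (exists n : nat, (n < K)%nat /\ is_pole (phat n) (RtoC theta)) /\
    (forall (n : nat) (z : C), (n < K)%nat -> is_pole (phat n) z ->
       Cmod (RtoC theta) <= Cmod z).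

(* The integral is conditionally convergent.  For real z its imaginary part
   vanishes, the integrand's imaginary part being odd; so taking the real part
   only turns the value into an element of R. *)
Definition Ai (z : R) : R :=
  / (2 * PI) *
  Re (RInt_gen (V := C_R_CompleteNormedModule)
        (fun t : R => Cexp (- Ci * RtoC (t ^ 3 / 3 + z * t))%C)
        (Rbar_locally m_infty) (Rbar_locally p_infty)).

Definition is_largest (P : R -> Prop) (r : R) : Prop :=
  P r /\ (forall x : R, P x -> x <= r).

(* Division is total in Rocq, so nonvanishing of the denominator is explicit. *)
Definition Airy_quotient_root (eta r : R) : Prop :=
  Ai (r + eta ^ 2 / 4) <> 0 /\
  Derive Ai (r + eta ^ 2 / 4) / Ai (r + eta ^ 2 / 4) = - (eta / 2).

Definition big_O (u v : nat -> R) : Prop :=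
  exists M : R, eventually (fun K : nat => Rabs (u K) <= M * Rabs (v K)).

(* Main.v *)
Require Import Defs.
From Stdlib Require Import Reals Lra Lia List Classical IndefiniteDescription.
From Coquelicot Require Import Coquelicot.
Open Scope R_scope.

(** Why the expansions hold.

    Solving the recurrence for the transforms upwards from [n = 0], and then using
    the boundary condition at [K], exhibits them as rational functions whose common
    denominator vanishes exactly at the eigenvalues of the tridiagonal generator
    [gen] with a reflecting end. The largest eigenvalue has a positive eigenvector,
    and pairing the numerator with it shows that nothing cancels; so the dominant
    singularity is this Perron eigenvalue ([dominant_singularity_perron]). The
    generator is symmetric for the weights [rho ^ n * (n + 1)], hence a positive
    supersolution bounds the eigenvalue from above and a nonnegative subsolution
    bounds it from below ([perron_le_of_supersolution],
    [perron_ge_of_subsolution]). Each expansion thus reduces to a pair of trial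
    vectors for which the equation holds up to the order of the error term.

    For [rho > 1] the eigenvector is nearly constant close to the boundary. Its
    corrections in powers of [/ K] are polynomials in the distance [j] from the
    boundary and are computed order by order. A multiple of [kap ^ j / K ^ 5] with
    [1 < kap < rho], on which the generator is negative, absorbs the remainder with
    either sign ([supercritical_expansion]).

    For [rho <= 1], and near [1], conjugation by [sqrt (rho ^ n * (n + 1))] makes the
    generator symmetric. With [e = K ^ (-1/3)] and [x = (K - n) * e ^ 2] the equation
    is, to leading order, a second difference equation [w'' = (nu + x) * w] of Airy
    type, the potential being the beginning of a geometric series in [e * x]. The
    trial function is a Langer transform [w = A (phi) / b] with [phi' = al * b ^ 2]
    and a decaying Airy solution [A]; it solves [w'' = W * w] exactly, and a parameter
    [sg] puts the error of order [e ^ 2] in [W] below or above the true potential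
    ([lg_w_derive], [lg_W_bounds]). Discretizing and adding the boundary inequality
    gives the two bounds [langer_upper] and [langer_lower], which agree to
    [O(e ^ 6) = O(/ K ^ 2)].

    What remains is the boundary condition. A change of the phase by [m * e ^ 2]
    leaves the eigenvalue unchanged to the required order, and suffices to get the
    boundary inequality with either sign. For [rho < 1] the ratio of the last two
    values of [w] has to fall short of, or exceed, [sqrt rho < 1], so [A] vanishes at
    the boundary to leading order and its last zero [r0] appears
    ([dirichlet_boundary_upper]). For [rho = 1 + eta * e ^ 2] the condition is the
    Robin condition [A1 = - (eta / 2) * A], which determines [r1]; the effect of [m] is
    proportional to [r1], and [r1 < 0] ([robin_boundary],
    [airy_largest_quotient_root]).

    The facts on the Airy function come from its integral. Moving the line of
    integration from [t] to [t - i] makes it absolutely convergent, which gives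
    [Ai'' = z * Ai] and exponential decay of [Ai] and [Ai'] ([Ai_equation]). Monotone
    quantities such as [Ai' ^ 2 - z * Ai ^ 2], of derivative [- Ai ^ 2], then control
    the logarithmic derivative and the position of the zeros. *)


(** * Balls of the real line *)

Lemma ball_R (x y e : R) : ball x e y -> Rabs (y - x) < e.
Proof. intros H; exact H. Qed.

Lemma R_ball (x y e : R) : Rabs (y - x) < e -> ball x e y.
Proof. intros H; exact H. Qed.

(** * Complex polynomials as coefficient lists *)

Fixpoint peval (l : list C) (z : C) : C :=
  match l with
  | nil => 0%C
  | a :: l' => (a + z * peval l' z)%C
  end.

Definition polyfun (f : C -> C) : Prop := exists l, forall z, f z = peval l z.

Lemma polyfun_const (c : C) : polyfun (fun _ => c).
Proof. exists (c :: nil). intros z; simpl; ring. Qed.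

Lemma polyfun_id : polyfun (fun z => z).
Proof. exists (RtoC 0 :: RtoC 1 :: nil). intros z; simpl; ring. Qed.

Lemma peval_add (l m : list C) :
  exists q, forall z, (peval l z + peval m z)%C = peval q z.
Proof.
  revert m; induction l as [|a l IH]; intros m.
  - exists m; intros z; simpl; ring.
  - destruct m as [|b m].
    + exists (a :: l); intros z; simpl; ring.
    + destruct (IH m) as [q Hq].
      exists ((a + b)%C :: q); intros z; simpl.
      rewrite <- Hq; ring.
Qed.

Lemma peval_scal (c : C) (l : list C) :
  exists q, forall z, (c * peval l z)%C = peval q z.
Proof.
  induction l as [|a l [q Hq]].
  - exists nil; intros z; simpl; ring.
  - exists ((c * a)%C :: q); intros z; simpl. rewrite <- Hq; ring.
Qed.

Lemma peval_mul (l m : list C) :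
  exists q, forall z, (peval l z * peval m z)%C = peval q z.
Proof.
  induction l as [|a l [q Hq]].
  - exists nil; intros z; simpl; ring.
  - destruct (peval_scal a m) as [r Hr].
    destruct (peval_add r (RtoC 0 :: q)) as [s Hs].
    exists s; intros z. rewrite <- Hs, <- Hr. simpl. rewrite <- Hq; ring.
Qed.

Lemma polyfun_add (f g : C -> C) :
  polyfun f -> polyfun g -> polyfun (fun z => f z + g z)%C.
Proof.
  intros [l Hl] [m Hm]. destruct (peval_add l m) as [q Hq].
  exists q; intros z. rewrite Hl, Hm; apply Hq.
Qed.

Lemma polyfun_mul (f g : C -> C) :
  polyfun f -> polyfun g -> polyfun (fun z => f z * g z)%C.
Proof.
  intros [l Hl] [m Hm]. destruct (peval_mul l m) as [q Hq].
  exists q; intros z. rewrite Hl, Hm; apply Hq.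
Qed.

Lemma polyfun_ext (f g : C -> C) :
  (forall z, f z = g z) -> polyfun f -> polyfun g.
Proof. intros E [l Hl]; exists l; intros z; rewrite <- E; apply Hl. Qed.

Lemma polyfun_sub (f g : C -> C) :
  polyfun f -> polyfun g -> polyfun (fun z => f z - g z)%C.
Proof.
  intros Hf Hg.
  apply polyfun_ext with (fun z => f z + (- (1)) * g z)%C.
  - intros z; ring.
  - apply polyfun_add; [exact Hf|].
    apply (polyfun_mul (fun _ => (- (1))%C)); [apply polyfun_const | exact Hg].
Qed.

Lemma is_Cpoly_polyfun (P : C -> C) : is_Cpoly P -> polyfun P.
Proof.
  intros [a [d H]].
  apply polyfun_ext with (fun z => sum_n (fun k : nat => (a k * z ^ k)%C) d).
  - intros z; symmetry; apply H.
  - clear H P.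
    assert (Hpow : forall k, polyfun (fun z => z ^ k)%C).
    { induction k as [|k IH]; simpl.
      - apply polyfun_const.
      - apply polyfun_mul; [apply polyfun_id | exact IH]. }
    assert (Hmon : forall k, polyfun (fun z => a k * z ^ k)%C).
    { intros k. apply (polyfun_mul (fun _ => a k)); [apply polyfun_const | apply Hpow]. }
    induction d as [|d IH].
    + apply polyfun_ext with (fun z => a O * z ^ O)%C; [| apply Hmon].
      intros z; rewrite sum_O; reflexivity.
    + apply polyfun_ext with
        (fun z => sum_n (fun k : nat => (a k * z ^ k)%C) d + a (S d) * z ^ (S d))%C.
      * intros z. rewrite sum_Sn; reflexivity.
      * apply polyfun_add; [exact IH | apply Hmon].
Qed.

Lemma peval_divide (l : list C) (r : C) :
  exists q c, (length q <= pred (length l))%nat /\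
    forall z, peval l z = ((z - r) * peval q z + c)%C.
Proof.
  induction l as [|a l [q [c [Hlen Hq]]]].
  - exists nil, (RtoC 0); split; [simpl; lia | intros z; simpl; ring].
  - destruct l as [|b l].
    + exists nil, a; split; [simpl; lia | intros z; simpl; ring].
    + exists (c :: q), (a + r * c)%C; split; [simpl in *; lia |].
      intros z. change (peval (a :: b :: l) z) with (a + z * peval (b :: l) z)%C.
      rewrite Hq. simpl. ring.
Qed.

Lemma peval_zeros_finite (l : list C) :
  (forall z, peval l z = 0%C) \/
  exists zs : list C, forall z, peval l z = 0%C -> In z zs.
Proof.
  remember (length l) as n eqn:Hn.
  assert (Hle : (length l <= n)%nat) by lia. clear Hn.
  revert l Hle; induction n as [|n IH]; intros l Hle.
  - left; intros z. destruct l; [reflexivity | simpl in Hle; lia].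
  - destruct (classic (exists r, peval l r = 0%C)) as [[r Hr] | Hno].
    + destruct (peval_divide l r) as [q [c [Hlen Hq]]].
      assert (Hc : c = 0%C).
      { rewrite Hq in Hr. rewrite <- Hr. ring. }
      subst c.
      destruct (IH q) as [Hz | [zs Hzs]]; [lia | |].
      * left; intros z; rewrite Hq, Hz; ring.
      * right; exists (r :: zs); intros z Hz.
        rewrite Hq in Hz.
        destruct (classic (z = r)) as [-> | Hne]; [left; reflexivity | right].
        apply Hzs. apply NNPP; intros Hne'.
        assert (Hzr : (z - r)%C <> 0%C).
        { intros E; apply Hne.
          replace z with ((z - r) + r)%C by ring. rewrite E; ring. }
        apply (Cmult_neq_0 _ _ Hzr Hne'). rewrite <- Hz; ring.
    + right; exists nil; intros z Hz; exfalso; apply Hno; exists z; exact Hz.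
Qed.

Lemma polyfun_zeros_finite (f : C -> C) (z0 : C) :
  polyfun f -> f z0 <> 0%C ->
  exists zs : list C, forall z, f z = 0%C -> In z zs.
Proof.
  intros [l Hl] H0. destruct (peval_zeros_finite l) as [Hz | [zs Hzs]].
  - exfalso; apply H0; rewrite Hl; apply Hz.
  - exists zs; intros z Hz; apply Hzs; rewrite <- Hl; exact Hz.
Qed.

Lemma list_Cmod_bound (zs : list C) :
  exists B, 0 < B /\ forall z, In z zs -> Cmod z < B.
Proof.
  induction zs as [|a zs [B [HB H]]].
  - exists 1; split; [lra | intros z []].
  - exists (B + Cmod a + 1). pose proof (Cmod_ge_0 a).
    split; [lra |]. intros z [<- | Hz]; [lra | specialize (H z Hz); lra].
Qed.

(** A nonzero polynomial has finitely many zeros, whereas the positive reals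
    are unbounded. *)
Lemma polyfun_zero_on_positive_reals (f : C -> C) :
  polyfun f -> (forall x : R, 0 < x -> f (RtoC x) = 0%C) ->
  forall z, f z = 0%C.
Proof.
  intros Hf Hx z. apply NNPP; intros Hz.
  destruct (polyfun_zeros_finite f z Hf Hz) as [zs Hzs].
  destruct (list_Cmod_bound zs) as [B [HB H]].
  specialize (H (RtoC B) (Hzs _ (Hx B HB))).
  rewrite Cmod_R, Rabs_pos_eq in H; lra.
Qed.

Lemma avoid_finite_set (zs : list C) (z0 : C) :
  exists d, 0 < d /\ forall z, z <> z0 -> Cmod (z - z0) < d -> ~ In z zs.
Proof.
  induction zs as [|a zs [d [Hd H]]].
  - exists 1; split; [lra | intros z _ _ []].
  - destruct (classic (a = z0)) as [-> | Ha].
    + exists d; split; [exact Hd |]. intros z Hz Hlt [E | Hin].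
      * apply Hz; symmetry; exact E.
      * exact (H z Hz Hlt Hin).
    + assert (Hp : 0 < Cmod (a - z0)).
      { apply Cmod_gt_0. intros E; apply Ha.
        replace a with ((a - z0) + z0)%C by ring. rewrite E; ring. }
      exists (Rmin d (Cmod (a - z0))). split; [apply Rmin_glb_lt; lra |].
      intros z Hz Hlt [E | Hin].
      * subst a. pose proof (Rmin_r d (Cmod (z - z0))). lra.
      * pose proof (Rmin_l d (Cmod (a - z0))). apply (H z Hz); [lra | exact Hin].
Qed.

Lemma peval_bounded (l : list C) (r : R) :
  exists B, 0 < B /\ forall z, Cmod z <= r -> Cmod (peval l z) <= B.
Proof.
  induction l as [|a l [B [HB H]]].
  - exists 1; split; [lra |]. intros z _; simpl. rewrite Cmod_0; lra.
  - pose proof (Cmod_ge_0 a). pose proof (Rabs_pos r). pose proof (Rle_abs r).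
    exists (Cmod a + Rabs r * B + 1).
    split; [nra |]. intros z Hz; simpl.
    eapply Rle_trans; [apply Cmod_triangle |].
    rewrite Cmod_mult. specialize (H z Hz).
    pose proof (Cmod_ge_0 z). pose proof (Cmod_ge_0 (peval l z)). nra.
Qed.

Lemma polyfun_continuous (f : C -> C) (z0 : C) (e : R) :
  polyfun f -> 0 < e ->
  exists d, 0 < d /\ forall z, Cmod (z - z0) < d -> Cmod (f z - f z0) < e.
Proof.
  intros [l Hl] He.
  destruct (peval_divide l z0) as [q [c [_ Hq]]].
  destruct (peval_bounded q (Cmod z0 + 1)) as [B [HB HqB]].
  exists (Rmin 1 (e / B)). split.
  { apply Rmin_glb_lt; [lra | apply Rdiv_lt_0_compat; lra]. }
  intros z Hz.
  pose proof (Rmin_l 1 (e / B)). pose proof (Rmin_r 1 (e / B)).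
  replace (f z - f z0)%C with ((z - z0) * peval q z)%C by (rewrite !Hl, !Hq; ring).
  rewrite Cmod_mult.
  assert (Hz1 : Cmod z <= Cmod z0 + 1).
  { replace z with (z0 + (z - z0))%C by ring.
    eapply Rle_trans; [apply Cmod_triangle | lra]. }
  specialize (HqB z Hz1).
  apply Rle_lt_trans with (Cmod (z - z0) * B).
  - apply Rmult_le_compat_l; [apply Cmod_ge_0 | exact HqB].
  - apply Rlt_le_trans with (e / B * B); [| right; field; lra].
    apply Rmult_lt_compat_r; lra.
Qed.

(** ** Poles *)

Lemma locally'_Cmod (z0 : C) (P : C -> Prop) :
  locally' z0 P ->
  exists d, 0 < d /\ forall z, z <> z0 -> Cmod (z - z0) < d -> P z.
Proof.
  intros [d H]. exists d; split; [apply cond_pos |].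
  intros z Hz Hlt. apply H; [| exact Hz].
  assert (Hre := Rmax_Cmod (Cminus z z0)).
  pose proof (Rmax_l (Rabs (fst (Cminus z z0))) (Rabs (snd (Cminus z z0)))).
  pose proof (Rmax_r (Rabs (fst (Cminus z z0))) (Rabs (snd (Cminus z z0)))).
  split; unfold ball; simpl; unfold AbsRing_ball, abs, minus, plus, opp; simpl;
  simpl in *; unfold Rminus in *; lra.
Qed.

Lemma Cmod_locally' (z0 : C) (P : C -> Prop) (d : R) :
  0 < d -> (forall z, z <> z0 -> Cmod (z - z0) < d -> P z) -> locally' z0 P.
Proof.
  intros Hd H.
  assert (Hd2 : 0 < d / 2) by lra.
  exists (mkposreal _ Hd2). intros z [H1 H2] Hz. apply H; [exact Hz |].
  unfold ball in H1, H2; simpl in H1, H2;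
  unfold AbsRing_ball, abs, minus, plus, opp in H1, H2; simpl in H1, H2.
  eapply Rle_lt_trans; [apply Cmod_2Rmax |].
  assert (Hs : sqrt 2 < 2).
  { rewrite <- (sqrt_Rsqr 2) at 2; [| lra]. apply sqrt_lt_1; unfold Rsqr; lra. }
  assert (Hs0 : 0 < sqrt 2) by (apply sqrt_lt_R0; lra).
  assert (Hm : Rmax (Rabs (fst (Cminus z z0))) (Rabs (snd (Cminus z z0))) < d / 2).
  { apply Rmax_lub_lt; simpl; [exact H1 | exact H2]. }
  assert (0 <= Rmax (Rabs (fst (Cminus z z0))) (Rabs (snd (Cminus z z0)))).
  { eapply Rle_trans; [apply Rabs_pos | apply Rmax_l]. }
  nra.
Qed.

Lemma is_pole_not_bounded (F : C -> C) (z0 : C) (B d : R) :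
  0 < d -> is_pole F z0 ->
  (forall z, z <> z0 -> Cmod (z - z0) < d -> Cmod (F z) <= B) -> False.
Proof.
  intros Hd Hp HB.
  assert (H : locally' z0 (fun z => B < Cmod (F z))).
  { apply (Hp (fun y => B < y)). exists B; intros; assumption. }
  destruct (locally'_Cmod _ _ H) as [d' [Hd' H']].
  set (t := Rmin d d' / 2).
  assert (Ht : 0 < t /\ t < d /\ t < d').
  { unfold t. pose proof (Rmin_l d d'); pose proof (Rmin_r d d').
    assert (0 < Rmin d d') by (apply Rmin_glb_lt; lra). lra. }
  assert (Hm : Cmod (z0 + RtoC t - z0) = t).
  { assert (E : Cminus (Cplus z0 (RtoC t)) z0 = RtoC t) by ring.
    rewrite E,  Cmod_R, Rabs_pos_eq; lra. }
  assert (Hn : (z0 + RtoC t)%C <> z0).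
  { intros E. rewrite E in Hm. assert (E0 : Cminus z0 z0 = RtoC 0) by ring.
    rewrite E0, Cmod_0 in Hm; lra. }
  specialize (H' _ Hn). specialize (HB _ Hn). rewrite Hm in H', HB.
  specialize (H' ltac:(lra)). specialize (HB ltac:(lra)). simpl in H'. lra.
Qed.

(** * The Laplace transforms satisfy a three-term recurrence *)

(** The integral over [0, T] is only asked to exist for large [T], which is all
    that convergence along the filter at infinity provides. *)
Definition laplace_at (f : R -> R) (x l : R) : Prop :=
  exists M, 0 <= M /\
  (forall T, M < T -> ex_RInt (fun t => f t * exp (- (x * t))) 0 T) /\
  is_lim (fun T => RInt (fun t => f t * exp (- (x * t))) 0 T) p_infty l.

Lemma laplace_at_of_continuation (f : R -> R) (F : C -> C) (x : R) :
  laplace_continuation f F -> 0 < x ->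
  exists l, laplace_at f x l /\ F (RtoC x) = RtoC l.
Proof.
  intros [_ H] Hx. specialize (H (RtoC x) Hx).
  set (l := F (RtoC x)) in *.
  set (g := fun t => f t * exp (- (x * t))).
  assert (Hg : forall t, (RtoC (f t) * Cexp (- (RtoC x * RtoC t)))%C = (g t, 0)).
  { intros t. unfold g, Cexp, RtoC, Cmult, Copp; simpl.
    f_equal.
    - replace (- (x * 0 + 0 * t)) with 0 by ring.
      replace (- (x * t - 0 * 0)) with (- (x * t)) by ring.
      rewrite cos_0, sin_0; ring.
    - replace (- (x * 0 + 0 * t)) with 0 by ring.
      rewrite sin_0; ring. }
  assert (H1 : forall e : posreal, exists M, 0 <= M /\ forall T, M < T ->
     exists I : R, is_RInt g 0 T I /\ Rabs (I - fst l) < e /\ Rabs (snd l) < e).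
  { intros e.
    specialize (H (fun y => ball (M := C_UniformSpace) l e y) (locally_ball l e)).
    destruct H as [P Q HP HQ HPQ].
    destruct HQ as [M HM].
    exists (Rmax M 0); split; [apply Rmax_r |].
    intros T HT. pose proof (Rmax_l M 0).
    destruct (HPQ 0 T HP (HM T ltac:(lra))) as [y [Hy1 Hy2]].
    simpl in Hy1.
    exists (fst y). destruct Hy2 as [B1 B2].
    unfold ball in B1, B2; simpl in B1, B2;
    unfold AbsRing_ball, abs, minus, plus, opp in B1, B2; simpl in B1, B2.
    assert (Hs : snd y = 0).
    { assert (A := is_RInt_fct_extend_snd (U := R_NormedModule) (V := R_NormedModule) _ _ _ _ Hy1).
      apply (is_RInt_unique (V := R_CompleteNormedModule)) in A. refine (eq_trans (eq_sym A) _).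
      rewrite (RInt_ext (V:=R_CompleteNormedModule) _ (fun _ => 0)).
      - rewrite RInt_const. apply Rmult_0_r.
      - intros t _. rewrite Hg; reflexivity. }
    split; [| split].
    - apply (is_RInt_ext (V := R_NormedModule)
        (fun t => fst ((RtoC (f t) * Cexp (- (RtoC x * RtoC t)))%C))).
      + intros t _; rewrite Hg; reflexivity.
      + exact (is_RInt_fct_extend_fst (U := R_NormedModule) (V := R_NormedModule) _ _ _ _ Hy1).
    - exact B1.
    - rewrite Hs in B2. replace (snd l) with (- (0 + - snd l)) by ring.
      rewrite Rabs_Ropp; exact B2. }
  exists (fst l); split.
  - destruct (H1 (mkposreal 1 Rlt_0_1)) as [M [HM0 HM]].
    exists M; split; [exact HM0 | split].
    + intros T HT; destruct (HM T HT) as [I [HI _]]; exists I; exact HI.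
    + apply is_lim_spec. intros e.
      destruct (H1 e) as [M' [_ HM']]. exists M'. intros T HT.
      destruct (HM' T HT) as [I [HI [HI2 _]]].
      change (Rabs (RInt g 0 T - fst l) < e).
      rewrite (is_RInt_unique (V := R_CompleteNormedModule) g 0 T I HI). exact HI2.
  - assert (Hs : snd l = 0).
    { apply NNPP; intros Hne.
      destruct (H1 (mkposreal _ (Rabs_pos_lt _ Hne))) as [M [_ HM]].
      destruct (HM (M + 1) ltac:(lra)) as [I [_ [_ HI]]]. simpl in HI. lra. }
    unfold RtoC. rewrite <- Hs. destruct l; reflexivity.
Qed.

(** The integral over [T, T + 1] tends both to [0] and to [L]. *)
Lemma limit_zero_of_integral_cv (g : R -> R) (M L l : R) :
  (forall T, M < T -> ex_RInt g 0 T) ->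
  is_lim (fun T => RInt g 0 T) p_infty l ->
  is_lim g p_infty L -> L = 0.
Proof.
  intros Hex Hint Hg. apply NNPP; intros HL.
  assert (HL2 : 0 < Rabs L / 4) by (pose proof (Rabs_pos_lt _ HL); lra).
  apply is_lim_spec in Hint. apply is_lim_spec in Hg.
  destruct (Hint (mkposreal _ HL2)) as [M1 H1].
  destruct (Hg (mkposreal _ HL2)) as [M2 H2]. simpl in H1, H2.
  set (T := Rmax M (Rmax M1 M2) + 1).
  assert (HT : M < T /\ M1 < T /\ M2 < T).
  { unfold T. pose proof (Rmax_l M (Rmax M1 M2)). pose proof (Rmax_r M (Rmax M1 M2)).
    pose proof (Rmax_l M1 M2); pose proof (Rmax_r M1 M2). lra. }
  assert (E1 := H1 T ltac:(lra)). assert (E2 := H1 (T + 1) ltac:(lra)).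
  assert (X0 := Hex T ltac:(lra)). assert (X1 := Hex (T + 1) ltac:(lra)).
  assert (X2 : ex_RInt g T (T + 1)).
  { apply (ex_RInt_Chasles g T 0 (T + 1)); [apply ex_RInt_swap; exact X0 | exact X1]. }
  assert (E3 : RInt g 0 T + RInt g T (T + 1) = RInt g 0 (T + 1)).
  { apply (RInt_Chasles g); assumption. }
  assert (E4 : Rabs (RInt g T (T + 1) - L) <= Rabs L / 4).
  { assert (A : RInt g T (T + 1) - L = RInt (fun t => g t - L) T (T + 1)).
    { rewrite (RInt_minus (V := R_CompleteNormedModule) g (fun _ => L)); [| exact X2 | apply ex_RInt_const].
      rewrite RInt_const. unfold minus, plus, opp, scal; simpl. unfold mult; simpl. ring. }
    rewrite A.
    replace (Rabs L / 4) with ((T + 1 - T) * (Rabs L / 4)) by ring.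
    apply abs_RInt_le_const; [lra | | ].
    - apply (ex_RInt_minus (V := R_NormedModule)); [exact X2 | apply ex_RInt_const].
    - intros t Ht. left. apply H2. lra. }
  revert E1 E2 E3 E4. unfold Rabs; repeat destruct Rcase_abs; lra.
Qed.

(** Integrating the derivative of [f t * exp (- x * t)] over [0, T] shows that
    this product converges as [T] grows; its integral converges too, so the limit
    is zero. The functions are extended by constants to the left of [0], where
    nothing is known about them. *)
Lemma laplace_recurrence (f fm fp : R -> R) (x a b c L Lm Lp : R) :
  0 < x ->
  (forall t, 0 < t -> is_derive f t (a * fp t - b * f t + c * fm t)) ->
  (forall g, g = f \/ g = fm \/ g = fp ->
     (forall t, 0 < t -> continuous g t) /\
     filterlim g (at_right 0) (locally (g 0))) ->
  laplace_at f x L -> laplace_at fm x Lm -> laplace_at fp x Lp ->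
  a * Lp - (b + x) * L + c * Lm = - f 0.
Proof.
  intros Hx Hd Hc [M [HM0 [Hex Hl]]] [Mm [_ [Hexm Hlm]]] [Mp [_ [Hexp Hlp]]].
  set (ext := fun (g : R -> R) t => g (Rmax t 0)).
  assert (Hcont : forall g, g = f \/ g = fm \/ g = fp -> forall t, continuous (ext g) t).
  { intros g Hg t. destruct (Hc g Hg) as [H1 H2].
    destruct (Rtotal_order t 0) as [Ht | [-> | Ht]].
    - apply (continuous_ext_loc _ (fun _ => g 0)).
      + assert (Ht' : 0 < - t) by lra.
        exists (mkposreal _ Ht'). intros y Hy. unfold ext. rewrite Rmax_right; [reflexivity |].
        apply ball_R in Hy; cbn [pos] in Hy.
        apply Rabs_def2 in Hy. lra.
      + apply continuous_const.
    - intros P HP. unfold ext in HP. rewrite Rmax_right in HP by lra.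
      assert (Hloc := locally_singleton _ _ HP).
      destruct (H2 P HP) as [e He]. exists e. intros y Hy.
      destruct (Rle_dec y 0) as [Hy0 | Hy0]; unfold ext.
      + rewrite Rmax_right by exact Hy0. exact Hloc.
      + rewrite Rmax_left by lra. apply He; [exact Hy | lra].
    - apply (continuous_ext_loc _ g).
      + exists (mkposreal _ Ht). intros y Hy. unfold ext. rewrite Rmax_left; [reflexivity |].
        apply ball_R in Hy; cbn [pos] in Hy.
        apply Rabs_def2 in Hy. lra.
      + apply H1; exact Ht. }
  assert (Cf := Hcont f (or_introl eq_refl)).
  assert (Cm := Hcont fm (or_intror (or_introl eq_refl))).
  assert (Cp := Hcont fp (or_intror (or_intror eq_refl))).
  set (E := fun t => exp (- (x * t))).
  assert (CE : forall t, continuous E t).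
  { intros t. apply (ex_derive_continuous (V := R_NormedModule)). unfold E. auto_derive; trivial. }
  set (h := fun t => a * (ext fp t * E t) - (b + x) * (ext f t * E t) + c * (ext fm t * E t)).
  assert (Ch : forall t, continuous h t).
  { intros t. unfold h.
    apply (continuous_plus (V := R_NormedModule)); [apply (continuous_minus (V := R_NormedModule)) |];
      apply (continuous_scal_r (V := R_NormedModule)); apply (continuous_mult (K := R_AbsRing)); auto. }
  assert (Xh : forall T, ex_RInt h 0 T).
  { intros T. apply (ex_RInt_continuous (V := R_CompleteNormedModule)). intros; apply Ch. }
  set (G := fun T => ext f T * E T - RInt h 0 T).
  assert (HG : forall T, 0 < T -> G T = G 0).
  { intros T HT.
    destruct (MVT_gen G 0 T (fun _ => 0)) as [z [_ Hz]].
    - intros t Ht. rewrite Rmin_left in Ht by lra.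
      assert (D1 : is_derive (fun T => RInt h 0 T) t (h t)).
      { apply (is_derive_RInt (V := R_NormedModule) h _ 0 t).
        - apply filter_forall. intros y. apply (RInt_correct (V := R_CompleteNormedModule)). apply Xh.
        - apply Ch. }
      assert (D2 : is_derive (ext f) t (a * fp t - b * f t + c * fm t)).
      { apply (is_derive_ext_loc f); [| apply Hd; lra].
        assert (Ht0 : 0 < t) by lra.
        exists (mkposreal _ Ht0). intros y Hy. unfold ext. rewrite Rmax_left; [reflexivity |].
        apply ball_R in Hy; cbn [pos] in Hy.
        apply Rabs_def2 in Hy. lra. }
      assert (D3 : is_derive E t (- x * E t)).
      { unfold E. auto_derive; trivial. ring. }
      assert (D4 := is_derive_minus _ _ _ _ _ (is_derive_mult _ _ _ _ _ D2 D3 Rmult_comm) D1).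
      eapply is_derive_ext; [| eapply (eq_rect _ (is_derive _ _) D4)].
      + intros y; reflexivity.
      + unfold h, ext, minus, plus, opp, mult; simpl. rewrite Rmax_left by lra. ring.
    - intros t _. apply continuity_pt_filterlim.
      apply (continuous_minus (V := R_NormedModule)).
      + apply (continuous_mult (K := R_AbsRing)); auto.
      + apply (ex_derive_continuous (V := R_NormedModule)). exists (h t).
        apply (is_derive_RInt (V := R_NormedModule) h _ 0 t).
        * apply filter_forall. intros y. apply (RInt_correct (V := R_CompleteNormedModule)). apply Xh.
        * apply Ch.
    - lra. }
  assert (HG0 : G 0 = f 0).
  { unfold G, ext, E. rewrite RInt_point, Rmax_left by lra.
    rewrite Rmult_0_r, Ropp_0, exp_0. unfold zero; simpl. ring. }
  (* the extension agrees with the original functions where it is integrated *)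
  assert (Hi : forall g T, 0 < T -> RInt (fun t => ext g t * E t) 0 T = RInt (fun t => g t * exp (- (x * t))) 0 T).
  { intros g T HT. apply RInt_ext. intros t Ht. rewrite Rmin_left in Ht by lra.
    unfold ext, E. rewrite Rmax_left by lra. reflexivity. }
  assert (Xe : forall g, (forall t, continuous (ext g) t) -> forall T, ex_RInt (fun t => ext g t * E t) 0 T).
  { intros g Hg T. apply (ex_RInt_continuous (V := R_CompleteNormedModule)). intros t _.
    apply (continuous_mult (K := R_AbsRing)); auto. }
  assert (Hlim : is_lim (fun T => RInt h 0 T) p_infty (a * Lp - (b + x) * L + c * Lm)).
  { apply (is_lim_ext_loc (fun T => a * RInt (fun t => fp t * exp (- (x * t))) 0 T
      - (b + x) * RInt (fun t => f t * exp (- (x * t))) 0 T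
      + c * RInt (fun t => fm t * exp (- (x * t))) 0 T)).
    - exists 0. intros T HT. rewrite <- (Hi fp T HT), <- (Hi f T HT), <- (Hi fm T HT). symmetry. unfold h.
      apply is_RInt_unique.
      apply (is_RInt_plus (V := R_NormedModule)); [apply (is_RInt_minus (V := R_NormedModule)) |];
        apply (is_RInt_scal (V := R_NormedModule)); apply (RInt_correct (V := R_CompleteNormedModule)); auto.
    - apply is_lim_plus'; [apply is_lim_minus' |];
      match goal with |- is_lim (fun T => ?k * _) _ _ => idtac end;
      apply (is_lim_scal_l _ _ _ (Finite _)); assumption. }
  assert (Hlg : is_lim (fun t => f t * exp (- (x * t))) p_infty
     (f 0 + (a * Lp - (b + x) * L + c * Lm))).
  { apply (is_lim_ext_loc (fun T => f 0 + RInt h 0 T)).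
    - exists 0. intros T HT. rewrite <- HG0, <- (HG T HT). unfold G, ext, E.
      rewrite Rmax_left by lra. ring.
    - apply is_lim_plus'; [apply is_lim_const | exact Hlim]. }
  assert (Z := limit_zero_of_integral_cv _ M _ _ Hex Hl Hlg). lra.
Qed.

(** * The generator and comparison with its positive eigenvector *)

Definition gen (rho : R) (v : nat -> R) (n : nat) : R :=
  rho * v (n + 1)%nat - (1 + rho) * v n + INR n / INR (n + 1) * v (n - 1)%nat.

Definition perron_vector (rho : R) (K : nat) (theta : R) (Q : nat -> R) : Prop :=
  (forall n, (n < K)%nat -> 0 < Q n) /\
  (forall n, (n < K)%nat -> gen rho Q n = theta * Q n) /\
  Q K = Q (K - 1)%nat.

Lemma sum_f_R0_nonneg (f : nat -> R) (N : nat) :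
  (forall n, (n <= N)%nat -> 0 <= f n) -> 0 <= sum_f_R0 f N.
Proof.
  induction N as [|N IH]; intros H; simpl.
  - apply H; lia.
  - apply Rplus_le_le_0_compat; [apply IH; intros; apply H; lia | apply H; lia].
Qed.

Lemma sum_f_R0_positive (f : nat -> R) (N : nat) :
  (forall n, (n <= N)%nat -> 0 <= f n) -> 0 < f N -> 0 < sum_f_R0 f N.
Proof.
  intros H HN. destruct N as [|N]; simpl; [exact HN |].
  assert (0 <= sum_f_R0 f N) by (apply sum_f_R0_nonneg; intros; apply H; lia). lra.
Qed.

(** The generator is symmetric for the weights [rho ^ n * (n + 1)], so the sum
    telescopes to a boundary Wronskian. *)
Lemma wronskian_sum (rho : R) (u v : nat -> R) (N : nat) :
  sum_f_R0 (fun n => rho ^ n * INR (n + 1) * (u n * gen rho v n - v n * gen rho u n)) N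
  = rho ^ S N * INR (S N) * (u N * v (S N) - u (S N) * v N).
Proof.
  induction N as [|N IH].
  - simpl. unfold gen. simpl. field.
  - rewrite tech5, IH. unfold gen.
    replace (S N + 1)%nat with (S (S N)) by lia.
    replace (S N - 1)%nat with N by lia.
    rewrite (S_INR (S N)). pose proof (pos_INR (S N)).
    simpl pow. field. lra.
Qed.

(** Paired with the positive eigenvector under the symmetrizing weights, the
    inequality for [v] becomes [boundary term <= (lam - theta) * positive], and the
    boundary term is nonnegative. *)
Lemma perron_le_of_supersolution (rho lam theta : R) (K : nat) (Q v : nat -> R) :
  0 < rho -> (1 <= K)%nat -> perron_vector rho K theta Q ->
  (forall n, (n < K)%nat -> 0 < v n) ->
  (forall n, (n < K)%nat -> gen rho v n <= lam * v n) ->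
  v (K - 1)%nat <= v K ->
  theta <= lam.
Proof.
  intros Hr HK [HQ [HQe HQK]] Hv Hs Hb.
  destruct K as [|N]; [lia |].
  replace (S N - 1)%nat with N in * by lia.
  assert (W := wronskian_sum rho Q v N).
  rewrite HQK in W.
  assert (P : forall n, (n <= N)%nat -> 0 < rho ^ n * INR (n + 1) * (Q n * v n)).
  { intros n Hn. assert (0 < Q n) by (apply HQ; lia). assert (0 < v n) by (apply Hv; lia).
    assert (0 < INR (n + 1)) by (apply lt_0_INR; lia).
    assert (0 < rho ^ n) by (apply pow_lt; exact Hr).
    apply Rmult_lt_0_compat; apply Rmult_lt_0_compat; assumption. }
  assert (S1 : sum_f_R0 (fun n => rho ^ n * INR (n + 1) * (Q n * gen rho v n - v n * gen rho Q n)) N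
     <= sum_f_R0 (fun n => rho ^ n * INR (n + 1) * (Q n * v n) * (lam - theta)) N).
  { apply sum_Rle. intros n Hn. rewrite (HQe n) by lia.
    assert (G := Hs n ltac:(lia)). assert (0 < Q n) by (apply HQ; lia).
    assert (0 < INR (n + 1)) by (apply lt_0_INR; lia).
    assert (0 < rho ^ n) by (apply pow_lt; exact Hr).
    assert (0 < rho ^ n * INR (n + 1)) by (apply Rmult_lt_0_compat; assumption).
    replace (rho ^ n * INR (n + 1) * (Q n * v n) * (lam - theta))
      with (rho ^ n * INR (n + 1) * (Q n * v n * (lam - theta))) by ring.
    apply Rmult_le_compat_l; [lra |]. nra. }
  rewrite W, <- scal_sum in S1.
  assert (S2 : 0 < sum_f_R0 (fun n => rho ^ n * INR (n + 1) * (Q n * v n)) N).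
  { apply sum_f_R0_positive; [intros n Hn; left; apply P; exact Hn | apply P; lia]. }
  assert (S3 : 0 <= rho ^ S N * INR (S N) * (Q N * v (S N) - Q N * v N)).
  { assert (0 < Q N) by (apply HQ; lia).
    assert (0 < INR (S N)) by (apply lt_0_INR; lia).
    assert (0 < rho ^ S N) by (apply pow_lt; exact Hr).
    apply Rmult_le_pos; [apply Rmult_le_pos; lra | nra]. }
  nra.
Qed.

Lemma perron_ge_of_subsolution (rho lam theta : R) (K : nat) (Q v : nat -> R) :
  0 < rho -> (1 <= K)%nat -> perron_vector rho K theta Q ->
  (forall n, (n < K)%nat -> 0 <= v n) -> 0 < v (K - 1)%nat ->
  (forall n, (n < K)%nat -> lam * v n <= gen rho v n) ->
  v K <= v (K - 1)%nat ->
  lam <= theta.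
Proof.
  intros Hr HK [HQ [HQe HQK]] Hv Hv1 Hs Hb.
  destruct K as [|N]; [lia |].
  replace (S N - 1)%nat with N in * by lia.
  assert (W := wronskian_sum rho Q v N).
  rewrite HQK in W.
  assert (C : forall n, (n <= N)%nat -> 0 < rho ^ n * INR (n + 1) * Q n).
  { intros n Hn. assert (0 < Q n) by (apply HQ; lia).
    assert (0 < INR (n + 1)) by (apply lt_0_INR; lia).
    assert (0 < rho ^ n) by (apply pow_lt; exact Hr).
    repeat apply Rmult_lt_0_compat; assumption. }
  assert (S1 : sum_f_R0 (fun n => rho ^ n * INR (n + 1) * Q n * v n * (lam - theta)) N <=
   sum_f_R0 (fun n => rho ^ n * INR (n + 1) * (Q n * gen rho v n - v n * gen rho Q n)) N).
  { apply sum_Rle. intros n Hn. rewrite (HQe n) by lia.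
    assert (G := Hs n ltac:(lia)). specialize (C n Hn).
    replace (rho ^ n * INR (n + 1) * Q n * v n * (lam - theta))
      with (rho ^ n * INR (n + 1) * Q n * (lam * v n - theta * v n)) by ring.
    replace (rho ^ n * INR (n + 1) * (Q n * gen rho v n - v n * (theta * Q n)))
      with (rho ^ n * INR (n + 1) * Q n * (gen rho v n - theta * v n)) by ring.
    apply Rmult_le_compat_l; lra. }
  rewrite W, <- scal_sum in S1.
  assert (S2 : 0 < sum_f_R0 (fun n => rho ^ n * INR (n + 1) * Q n * v n) N).
  { apply sum_f_R0_positive.
    - intros n Hn. apply Rmult_le_pos; [left; apply C; exact Hn | apply Hv; lia].
    - apply Rmult_lt_0_compat; [apply C; lia | exact Hv1]. }
  assert (S3 : rho ^ S N * INR (S N) * (Q N * v (S N) - Q N * v N) <= 0).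
  { assert (0 < Q N) by (apply HQ; lia).
    assert (0 < INR (S N)) by (apply lt_0_INR; lia).
    assert (0 < rho ^ S N) by (apply pow_lt; exact Hr).
    assert (0 < rho ^ S N * INR (S N)) by (apply Rmult_lt_0_compat; assumption).
    assert (Q N * v (S N) - Q N * v N <= 0) by nra. nra. }
  nra.
Qed.

(** * Shooting solutions *)

(** [shoot rho s u0 x n] is the pair of the values at [n] and [n - 1] of the
    solution of [gen rho u n - x * u n = - s / (n + 1)] starting from [u0]; [s = 0] gives
    the homogeneous equation and [s = 1] the one satisfied by the Laplace
    transforms. *)
Fixpoint shoot (rho s u0 x : R) (n : nat) : R * R :=
  match n with
  | O => (u0, 0)
  | S m => let p := shoot rho s u0 x m in
      (((1 + rho + x) * fst p - INR m / INR (m + 1) * snd p - s / INR (m + 1)) / rho, fst p)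
  end.

Fixpoint Cshoot (rho s u0 : R) (z : C) (n : nat) : C * C :=
  match n with
  | O => (RtoC u0, RtoC 0)
  | S m => let p := Cshoot rho s u0 z m in
      (((RtoC (1 + rho) + z) * fst p - RtoC (INR m / INR (m + 1)) * snd p
         - RtoC (s / INR (m + 1))) * RtoC (/ rho), fst p)%C
  end.

Notation sol rho s u0 x n := (fst (shoot rho s u0 x n)).
Notation Csol rho s u0 z n := (fst (Cshoot rho s u0 z n)).

Lemma Cshoot_RtoC (rho s u0 x : R) (n : nat) :
  Csol rho s u0 (RtoC x) n = RtoC (sol rho s u0 x n) /\
  snd (Cshoot rho s u0 (RtoC x) n) = RtoC (snd (shoot rho s u0 x n)).
Proof.
  induction n as [|n [IH1 IH2]]; simpl; [split; reflexivity |].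
  rewrite IH1, IH2. split; [| reflexivity].
  rewrite <- RtoC_plus, <- !RtoC_mult, <- !RtoC_minus, <- RtoC_mult. reflexivity.
Qed.

Lemma polyfun_Cshoot (rho s u0 : R) (n : nat) :
  polyfun (fun z => Csol rho s u0 z n) /\ polyfun (fun z => snd (Cshoot rho s u0 z n)).
Proof.
  induction n as [|n [IH1 IH2]]; simpl; [split; apply polyfun_const |].
  split; [| exact IH1].
  apply (polyfun_mul _ (fun _ => RtoC (/ rho))); [| apply polyfun_const].
  apply (polyfun_sub _ (fun _ => RtoC (s / INR (n + 1)))); [| apply polyfun_const].
  apply polyfun_sub; apply polyfun_mul; try assumption; try apply polyfun_const.
  apply polyfun_add; [apply polyfun_const | apply polyfun_id].
Qed.

Lemma shoot_gen (rho s u0 x : R) (n : nat) :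
  rho <> 0 ->
  gen rho (fun k => sol rho s u0 x k) n = x * sol rho s u0 x n - s / INR (n + 1).
Proof.
  intros Hr. unfold gen. replace (n + 1)%nat with (S n) by lia.
  destruct n as [|n].
  - simpl. field. exact Hr.
  - replace (S n - 1)%nat with n by lia.
    cbn [shoot fst snd]. replace (S n + 1)%nat with (S (S n)) by lia.
    field. repeat split; first [exact Hr | apply not_0_INR; lia].
Qed.

Lemma recurrence_sol (rho x : R) (l : nat -> R) (K : nat) :
  rho <> 0 ->
  (forall n, (n < K)%nat -> gen rho l n = x * l n - 1 / INR (n + 1)) ->
  forall n, (n <= K)%nat -> l n = sol rho 0 1 x n * l O + sol rho 1 0 x n.
Proof.
  intros Hr Hrec.
  assert (H : forall n, (n <= K)%nat ->
    l n = sol rho 0 1 x n * l O + sol rho 1 0 x n /\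
    ((0 < n)%nat -> l (n - 1)%nat
      = snd (shoot rho 0 1 x n) * l O + snd (shoot rho 1 0 x n))).
  { induction n as [|n IH]; intros Hn.
    - split; [simpl; ring | lia].
    - destruct (IH ltac:(lia)) as [I1 I2].
      split; [| intros _; replace (S n - 1)%nat with n by lia; exact I1].
      assert (E := Hrec n ltac:(lia)). unfold gen in E.
      replace (n + 1)%nat with (S n) in E by lia.
      assert (E2 : INR n / INR (S n) * l (n - 1)%nat = INR n / INR (S n) *
        (snd (shoot rho 0 1 x n) * l O + snd (shoot rho 1 0 x n))).
      { destruct n as [|n]; [simpl; field | rewrite I2 by lia; reflexivity]. }
      rewrite E2, I1 in E.
      apply (Rmult_eq_reg_l rho); [| exact Hr].
      cbn [shoot fst snd]. replace (n + 1)%nat with (S n) by lia.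
      assert (INR (S n) <> 0) by (apply not_0_INR; lia).
      transitivity (x * (sol rho 0 1 x n * l O + sol rho 1 0 x n) - 1 / INR (S n)
        + (1 + rho) * (sol rho 0 1 x n * l O + sol rho 1 0 x n)
        - INR n / INR (S n) * (snd (shoot rho 0 1 x n) * l O + snd (shoot rho 1 0 x n))).
      + lra.
      + field. split; assumption. }
  intros n Hn; apply H; exact Hn.
Qed.

Lemma sol_continuous (rho s u0 : R) (n : nat) (x : R) :
  continuous (fun x => sol rho s u0 x n) x /\
  continuous (fun x => snd (shoot rho s u0 x n)) x.
Proof.
  induction n as [|n [IH1 IH2]]; simpl; [split; apply continuous_const |].
  split; [| exact IH1].
  apply (continuous_mult (K := R_AbsRing)); [| apply continuous_const].
  apply (continuous_minus (V := R_NormedModule)); [| apply continuous_const].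
  apply (continuous_minus (V := R_NormedModule));
    apply (continuous_mult (K := R_AbsRing)); try assumption; try apply continuous_const.
  apply (continuous_plus (V := R_NormedModule)); [apply continuous_const | apply continuous_id].
Qed.

Definition boundary_defect (rho s u0 x : R) (K : nat) : R :=
  sol rho s u0 x K - sol rho s u0 x (K - 1).

(** To the right of the largest eigenvalue the homogeneous solution, read as a
    Sturm sequence, stays positive up to and including the boundary condition. *)
Definition above_spectrum (rho : R) (K : nat) (x : R) : Prop :=
  (forall n, (n < K)%nat -> 0 < sol rho 0 1 x n) /\ 0 < boundary_defect rho 0 1 x K.

Lemma boundary_defect_continuous (rho s u0 : R) (K : nat) (x : R) :
  continuous (fun x => boundary_defect rho s u0 x K) x.
Proof.
  apply (continuous_minus (V := R_NormedModule) (fun x => sol rho s u0 x K) (fun x => sol rho s u0 x (K - 1)));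
    [apply (sol_continuous rho s u0 K x) | apply (sol_continuous rho s u0 (K - 1) x)].
Qed.

Lemma continuous_pos_nbhd (f : R -> R) (x : R) :
  continuous f x -> 0 < f x -> locally x (fun y => 0 < f y).
Proof.
  intros Hc Hp. apply (Hc (fun y => 0 < y)).
  exists (mkposreal _ Hp). intros y Hy.
  apply ball_R in Hy; cbn [pos] in Hy.
  apply Rabs_def2 in Hy. lra.
Qed.

Lemma above_spectrum_open (rho : R) (K : nat) (x : R) :
  above_spectrum rho K x -> locally x (above_spectrum rho K).
Proof.
  intros [H1 H2]. apply filter_and.
  - assert (H : forall m, (m <= K)%nat ->
      locally x (fun y => forall n, (n < m)%nat -> 0 < sol rho 0 1 y n)).
    { induction m as [|m IH]; intros Hm.
      - apply filter_forall; intros y n Hn; lia.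
      - apply (filter_imp (fun y => (forall n, (n < m)%nat -> 0 < sol rho 0 1 y n) /\
          0 < sol rho 0 1 y m)).
        + intros y [A B] n Hn. destruct (Nat.eq_dec n m) as [-> | Hne]; [exact B | apply A; lia].
        + apply filter_and; [apply IH; lia |].
          apply (continuous_pos_nbhd (fun y => sol rho 0 1 y m)); [apply sol_continuous | apply H1; lia]. }
    apply H; lia.
  - apply (continuous_pos_nbhd (fun y => boundary_defect rho 0 1 y K)); [apply boundary_defect_continuous | exact H2].
Qed.

Lemma above_spectrum_nonneg (rho : R) (K : nat) (x : R) :
  0 < rho -> (1 <= K)%nat -> 0 <= x -> above_spectrum rho K x.
Proof.
  intros Hr HK Hx.
  assert (H : forall n, 0 < sol rho 0 1 x n /\
     sol rho 0 1 x n < sol rho 0 1 x (S n)).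
  { assert (H : forall n, 0 < sol rho 0 1 x n /\
      0 <= snd (shoot rho 0 1 x n) <= sol rho 0 1 x n).
    { induction n as [|n [I1 I2]]; [simpl; lra |].
      cbn [shoot fst snd].
      assert (Hn : 0 <= INR n / INR (n + 1) <= 1).
      { assert (0 < INR (n + 1)) by (apply lt_0_INR; lia). pose proof (pos_INR n).
        split; [apply Rdiv_le_0_compat; lra |].
        apply Rle_div_l; [lra |]. rewrite plus_INR; simpl; lra. }
      assert (E : sol rho 0 1 x n <=
       ((1 + rho + x) * sol rho 0 1 x n - INR n / INR (n + 1) * snd (shoot rho 0 1 x n) - 0 / INR (n + 1)) / rho).
      { apply Rle_div_r; [lra |]. unfold Rdiv at 2. rewrite Rmult_0_l. nra. }
      lra. }
    intros n. destruct (H n) as [I1 I2]. split; [exact I1 |].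
    cbn [shoot fst snd].
    assert (Hn : 0 <= INR n / INR (n + 1) < 1).
    { assert (0 < INR (n + 1)) by (apply lt_0_INR; lia). pose proof (pos_INR n).
      split; [apply Rdiv_le_0_compat; lra |].
      apply Rlt_div_l; [lra |]. rewrite plus_INR; simpl; lra. }
    apply Rlt_div_r; [lra |]. unfold Rdiv at 2. rewrite Rmult_0_l. nra. }
  split.
  - intros n _; apply H.
  - unfold boundary_defect. destruct K as [|N]; [lia |].
    replace (S N - 1)%nat with N by lia. destruct (H N); lra.
Qed.

(** The infimum of the points above the spectrum is a zero of the boundary
    defect at which the homogeneous solution stays positive: a vanishing
    interior value would force the next one to be negative. *)
Lemma perron_root_exists (rho : R) (K : nat) :
  0 < rho -> (1 <= K)%nat ->
  exists xs, (forall x, xs < x -> above_spectrum rho K x) /\ xs < 0 /\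
    boundary_defect rho 0 1 xs K = 0 /\
    (forall n, (n < K)%nat -> 0 < sol rho 0 1 xs n).
Proof.
  intros Hr HK.
  set (E := fun x => ~ above_spectrum rho K x).
  assert (HE0 : forall x, E x -> x < 0).
  { intros x Hx. apply Rnot_le_lt; intros Hx0. apply Hx.
    apply above_spectrum_nonneg; assumption. }
  assert (Hb : bound E).
  { exists 0. intros x Hx. left; apply HE0; exact Hx. }
  assert (Hne : exists x, E x).
  { exists (- (1 + rho)). intros [H1 H2].
    destruct K as [|[|N]]; [lia | |].
    - unfold boundary_defect in H2. simpl in H2.
      replace (((1 + rho + - (1 + rho)) * 1 - 0 / 1 * 0 - 0 / 1) / rho - 1) with (- 1) in H2
        by (field; lra). lra.
    - specialize (H1 1%nat ltac:(lia)). simpl in H1.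
      replace (((1 + rho + - (1 + rho)) * 1 - 0 / 1 * 0 - 0 / 1) / rho) with 0 in H1
        by (field; lra). lra. }
  destruct (completeness E Hb Hne) as [xs [Hub Hlub]].
  assert (Habove : forall x, xs < x -> above_spectrum rho K x).
  { intros x Hx. apply NNPP; intros Hn. specialize (Hub x Hn). lra. }
  assert (Hnot : ~ above_spectrum rho K xs).
  { intros Ha. destruct (above_spectrum_open _ _ _ Ha) as [d Hd].
    assert (Hle : xs <= xs - d / 2).
    { apply Hlub. intros x Hx. apply Rnot_lt_le; intros Hlt.
      apply Hx. destruct (Rlt_or_le xs x) as [H | H]; [apply Habove; exact H |].
      apply Hd. apply R_ball.
      pose proof (cond_pos d). apply Rabs_def1; lra. }
    pose proof (cond_pos d). lra. }
  assert (Hlim : forall f : R -> R, continuous f xs ->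
     (forall x, xs < x -> 0 < f x) -> 0 <= f xs).
  { intros f Hf Hp. apply Rnot_lt_le; intros Hneg.
    assert (Hn : 0 < - f xs) by lra.
    destruct (continuous_pos_nbhd (fun x => - f x) xs) as [d Hd].
    - apply (continuous_opp (V := R_NormedModule)); exact Hf.
    - exact Hn.
    - pose proof (cond_pos d).
      assert (A := Hp (xs + d / 2) ltac:(lra)).
      assert (B : 0 < - f (xs + d / 2)).
      { apply Hd. apply R_ball.
        apply Rabs_def1; lra. }
      lra. }
  assert (Hge : forall n, (n < K)%nat -> 0 <= sol rho 0 1 xs n).
  { intros n Hn. apply (Hlim (fun x => sol rho 0 1 x n)); [apply sol_continuous |].
    intros x Hx; apply (Habove x Hx); exact Hn. }
  assert (HgeD : 0 <= boundary_defect rho 0 1 xs K).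
  { apply (Hlim (fun x => boundary_defect rho 0 1 x K)); [apply boundary_defect_continuous |].
    intros x Hx; apply (Habove x Hx). }
  assert (Hpos : forall n, (n < K)%nat -> 0 < sol rho 0 1 xs n).
  { induction n as [|n IH]; intros Hn; [simpl; lra |].
    specialize (IH ltac:(lia)).
    destruct (Hge (S n) Hn) as [H | H]; [exact H | exfalso].
    assert (Hneg : sol rho 0 1 xs (S (S n)) < 0).
    { assert (G := shoot_gen rho 0 1 xs (S n) ltac:(lra)). unfold gen in G.
      replace (S n + 1)%nat with (S (S n)) in G by lia.
      replace (S n - 1)%nat with n in G by lia. rewrite <- H in G.
      assert (0 < INR (S n) / INR (S (S n))).
      { apply Rdiv_lt_0_compat; apply lt_0_INR; lia. }
      unfold Rdiv in G at 2. rewrite Rmult_0_l in G. nra. }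
    destruct (Nat.eq_dec (S (S n)) K) as [HK2 | HK2].
    - unfold boundary_defect in HgeD. rewrite <- HK2 in HgeD.
      replace (S (S n) - 1)%nat with (S n) in HgeD by lia. lra.
    - specialize (Hge (S (S n)) ltac:(lia)). lra. }
  exists xs. split; [exact Habove | split; [| split; [| exact Hpos]]].
  - apply Rnot_le_lt; intros H. apply Hnot. apply above_spectrum_nonneg; assumption.
  - apply NNPP; intros HD. apply Hnot. split; [exact Hpos | lra].
Qed.

(** * The dominant singularity is the Perron eigenvalue *)

(** Both sides are rational; after clearing denominators a polynomial vanishes on
    the positive half-line, hence everywhere. Only the zeros of the denominators,
    where the values of the functions are arbitrary, remain excluded. *)
Lemma rational_relation (F1 F2 A B1 : C -> C) :
  is_rational F1 -> is_rational F2 -> polyfun A -> polyfun B1 ->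
  forall A1, polyfun A1 ->
  (forall x : R, 0 < x -> (A1 (RtoC x) * F1 (RtoC x) = A (RtoC x) * F2 (RtoC x) + B1 (RtoC x))%C) ->
  exists zs : list C, forall z, ~ In z zs -> (A1 z * F1 z = A z * F2 z + B1 z)%C.
Proof.
  intros [P1 [Q1 [HP1 [HQ1 [[z1 Hz1] HF1]]]]] [P2 [Q2 [HP2 [HQ2 [[z2 Hz2] HF2]]]]] HA HB A1 HA1 Hx.
  apply is_Cpoly_polyfun in HP1. apply is_Cpoly_polyfun in HQ1.
  apply is_Cpoly_polyfun in HP2. apply is_Cpoly_polyfun in HQ2.
  destruct (polyfun_zeros_finite Q1 z1 HQ1 Hz1) as [zs1 Hs1].
  destruct (polyfun_zeros_finite Q2 z2 HQ2 Hz2) as [zs2 Hs2].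
  assert (HZ : forall z, ((A1 z * (P1 z * Q2 z) - (A z * (P2 z * Q1 z) + B1 z * (Q1 z * Q2 z)))
                          * (Q1 z * Q2 z))%C = 0%C).
  { apply polyfun_zero_on_positive_reals.
    - repeat first [assumption | apply polyfun_mul | apply polyfun_sub | apply polyfun_add].
    - intros x Hpos. specialize (Hx x Hpos).
      destruct (classic (Q1 (RtoC x) = 0%C)) as [E1 | E1]; [rewrite E1; ring |].
      destruct (classic (Q2 (RtoC x) = 0%C)) as [E2 | E2]; [rewrite E2; ring |].
      rewrite (HF1 _ E1), (HF2 _ E2) in Hx.
      assert (E : (A1 (RtoC x) * (P1 (RtoC x) * Q2 (RtoC x)))%C =
        ((A1 (RtoC x) * (P1 (RtoC x) / Q1 (RtoC x))) * (Q1 (RtoC x) * Q2 (RtoC x)))%C).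
      { field. exact E1. }
      rewrite E, Hx. field; repeat split; assumption. }
  exists (zs1 ++ zs2). intros z Hz.
  assert (E1 : Q1 z <> 0%C) by (intros E; apply Hz, in_or_app; left; apply Hs1; exact E).
  assert (E2 : Q2 z <> 0%C) by (intros E; apply Hz, in_or_app; right; apply Hs2; exact E).
  rewrite (HF1 _ E1), (HF2 _ E2).
  assert (HZ1 : (A1 z * (P1 z * Q2 z) - (A z * (P2 z * Q1 z) + B1 z * (Q1 z * Q2 z)))%C = 0%C).
  { apply NNPP; intros Hne. apply (Cmult_neq_0 _ _ Hne (Cmult_neq_0 _ _ E1 E2)). apply HZ. }
  assert (E : (A1 z * (P1 z * Q2 z))%C = (A z * (P2 z * Q1 z) + B1 z * (Q1 z * Q2 z))%C).
  { replace (A1 z * (P1 z * Q2 z))%C with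
     ((A1 z * (P1 z * Q2 z) - (A z * (P2 z * Q1 z) + B1 z * (Q1 z * Q2 z)))
      + (A z * (P2 z * Q1 z) + B1 z * (Q1 z * Q2 z)))%C by ring.
    rewrite HZ1; ring. }
  replace (A1 z * (P1 z / Q1 z))%C with ((A1 z * (P1 z * Q2 z)) / (Q1 z * Q2 z))%C
    by (field; repeat split; assumption).
  rewrite E. field; repeat split; assumption.
Qed.

(** The index [Nat.min n (K - 1)] encodes the reflecting boundary condition, which
    is imposed on the functions for all times and so passes to the transforms. *)
Lemma laplace_system (K : nat) (rho : R) (p : nat -> R -> R) (phat : nat -> C -> C) (x : R) :
  (1 <= K)%nat -> 0 < x -> sojourn_densities rho K p ->
  (forall n, (n < K)%nat -> laplace_continuation (p n) (phat n)) ->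
  exists l : nat -> R,
    (forall n, (n < K)%nat -> phat n (RtoC x) = RtoC (l n)) /\
    l K = l (K - 1)%nat /\
    (forall n, (n < K)%nat -> gen rho l n = x * l n - 1 / INR (n + 1)).
Proof.
  intros HK Hx [Hd [H0 Hb]] Hl.
  set (m := fun n => Nat.min n (K - 1)).
  assert (Hm : forall n, (n < K)%nat -> m n = n) by (intros; unfold m; lia).
  assert (HmK : forall n, (m n < K)%nat) by (intros; unfold m; lia).
  exists (fun n => fst (phat (m n) (RtoC x))).
  assert (HL : forall n, laplace_at (p (m n)) x (fst (phat (m n) (RtoC x))) /\
     phat (m n) (RtoC x) = RtoC (fst (phat (m n) (RtoC x)))).
  { intros n. destruct (laplace_at_of_continuation _ _ x (Hl (m n) (HmK n)) Hx) as [l [H1 H2]].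
    rewrite H2. split; [exact H1 | reflexivity]. }
  split; [| split].
  - intros n Hn. destruct (HL n) as [_ E]. rewrite Hm in E by exact Hn.
    rewrite (Hm n Hn). exact E.
  - unfold m. rewrite Nat.min_r, Nat.min_l by lia. reflexivity.
  - intros n Hn.
    assert (Hreg : forall k, (forall t, 0 < t -> continuous (p (m k)) t) /\
        filterlim (p (m k)) (at_right 0) (locally (p (m k) 0))).
    { intros k. split.
      - intros t Ht. apply (ex_derive_continuous (V := R_NormedModule)).
        eexists. apply Hd; [apply HmK | exact Ht].
      - apply H0, HmK. }
    assert (R1 := laplace_recurrence (p (m n)) (p (m (n - 1)%nat)) (p (m (n + 1)%nat)) x
      rho (1 + rho) (INR n / INR (n + 1)) (fst (phat (m n) (RtoC x))) (fst (phat (m (n - 1)%nat) (RtoC x)))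
       (fst (phat (m (n + 1)%nat) (RtoC x))) Hx).
    assert (R2 : rho * fst (phat (m (n + 1)%nat) (RtoC x)) - (1 + rho + x) * fst (phat (m n) (RtoC x))
       + INR n / INR (n + 1) * fst (phat (m (n - 1)%nat) (RtoC x)) = - p (m n) 0).
    { apply R1; try apply HL.
      - intros t Ht. assert (D := Hd n t Hn Ht).
        rewrite (Hm n Hn). rewrite (Hm (n - 1)%nat) by lia.
        destruct (Nat.eq_dec (n + 1) K) as [E | E].
        + unfold m. rewrite E. rewrite Nat.min_r by lia. rewrite <- (Hb t) by lra.
          rewrite <- E. exact D.
        + rewrite (Hm (n + 1)%nat) by lia. exact D.
      - intros g [-> | [-> | ->]]; apply Hreg. }
    assert (Em : p (m n) 0 = 1 / INR (n + 1)) by (rewrite (Hm n Hn); apply (H0 n Hn)).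
    unfold gen. rewrite Em in R2. lra.
Qed.

Lemma polyfun_locally_bounded (f : C -> C) (z0 : C) :
  polyfun f -> exists B d, 0 < d /\ 0 < B /\ forall z, Cmod (z - z0) < d -> Cmod (f z) <= B.
Proof.
  intros Hf. destruct (polyfun_continuous f z0 1 Hf Rlt_0_1) as [d [Hd H]].
  exists (Cmod (f z0) + 1), d. pose proof (Cmod_ge_0 (f z0)).
  split; [exact Hd | split; [lra |]]. intros z Hz. specialize (H z Hz).
  replace (f z) with (f z0 + (f z - f z0))%C by ring.
  eapply Rle_trans; [apply Cmod_triangle | lra].
Qed.

Lemma polyfun_locally_away_from_zero (f : C -> C) (z0 : C) :
  polyfun f -> f z0 <> 0%C ->
  exists b d, 0 < d /\ 0 < b /\ forall z, Cmod (z - z0) < d -> b <= Cmod (f z).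
Proof.
  intros Hf H0. apply Cmod_gt_0 in H0.
  destruct (polyfun_continuous f z0 (Cmod (f z0) / 2) Hf ltac:(lra)) as [d [Hd H]].
  exists (Cmod (f z0) / 2), d. split; [exact Hd | split; [lra |]].
  intros z Hz. specialize (H z Hz).
  assert (T : Cmod (f z0) <= Cmod (f z) + Cmod (f z - f z0)).
  { replace (f z0) with (f z + - (f z - f z0))%C at 1 by ring.
    eapply Rle_trans; [apply Cmod_triangle |]. rewrite Cmod_opp. lra. }
  lra.
Qed.

(** Shooting from [n = 0] gives [phat n = Q_n * phat 0 + P_n] with polynomials
    [Q_n] and [P_n], and the boundary condition becomes [D * phat 0 = N]. A real pole
    of any transform is thus a zero of [D]. At the largest one, [xs], the sequence
    [Q_n] is a positive eigenvector, and pairing it with the inhomogeneous solution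
    shows that [N] does not vanish there. Hence [xs] is a pole of [phat 0]; the
    dominant pole is at most [xs] and, both being negative, at least [xs]. *)
Lemma dominant_singularity_perron (K : nat) (rho theta : R) :
  (1 <= K)%nat -> 0 < rho -> dominant_singularity K rho theta ->
  exists Q, perron_vector rho K theta Q.
Proof.
  intros HK Hr [p [phat [Hp [Hl [[n0 [Hn0 Hpole]] Hdom]]]]].
  set (D := fun z => (Csol rho 0 1 z K - Csol rho 0 1 z (K - 1))%C).
  set (N := fun z => (- (1) * (Csol rho 1 0 z K - Csol rho 1 0 z (K - 1)))%C).
  assert (HD : polyfun D) by (apply polyfun_sub; apply polyfun_Cshoot).
  assert (HN : polyfun N).
  { apply (polyfun_mul (fun _ => (- (1))%C)); [apply polyfun_const |].
    apply polyfun_sub; apply polyfun_Cshoot. }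
  assert (HDR : forall x, D (RtoC x) = RtoC (boundary_defect rho 0 1 x K)).
  { intros x. unfold D, boundary_defect.
    rewrite (proj1 (Cshoot_RtoC _ _ _ _ _)), (proj1 (Cshoot_RtoC _ _ _ _ _)), <- RtoC_minus.
    reflexivity. }
  assert (HNR : forall x, N (RtoC x) = RtoC (- boundary_defect rho 1 0 x K)).
  { intros x. unfold N, boundary_defect.
    rewrite (proj1 (Cshoot_RtoC _ _ _ _ _)), (proj1 (Cshoot_RtoC _ _ _ _ _)), <- RtoC_minus.
    rewrite RtoC_opp. ring. }
  assert (Hrat : forall n, (n < K)%nat -> is_rational (phat n)).
  { intros n Hn; apply (Hl n Hn). }
  assert (Hrat0 := Hrat O ltac:(lia)).
  assert (Hrel : forall x, 0 < x ->
     (forall n, (n < K)%nat -> phat n (RtoC x) =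
         (Csol rho 0 1 (RtoC x) n * phat O (RtoC x) + Csol rho 1 0 (RtoC x) n)%C) /\
     (D (RtoC x) * phat O (RtoC x))%C = N (RtoC x)).
  { intros x Hx. destruct (laplace_system K rho p phat x HK Hx Hp Hl) as [l [L1 [L2 L3]]].
    assert (R1 := recurrence_sol rho x l K ltac:(lra) L3).
    split.
    - intros n Hn. rewrite !L1, !(proj1 (Cshoot_RtoC _ _ _ _ _)), <- RtoC_mult, <- RtoC_plus by lia.
      f_equal. apply R1; lia.
    - rewrite HDR, HNR, L1, <- RtoC_mult by lia. f_equal. unfold boundary_defect.
      assert (A := R1 K ltac:(lia)). assert (B := R1 (K - 1)%nat ltac:(lia)).
      rewrite L2, B in A. lra. }
  assert (H0 : exists zs, forall z, ~ In z zs -> (D z * phat O z)%C = N z).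
  { destruct (rational_relation (phat O) (phat O) (fun _ => RtoC 0) N Hrat0 Hrat0
       (polyfun_const _) HN D HD) as [zs Hzs].
    - intros x Hx. destruct (Hrel x Hx) as [_ E]. rewrite E. ring.
    - exists zs; intros z Hz. rewrite (Hzs z Hz). ring. }
  destruct H0 as [zs0 Hzs0].
  destruct (perron_root_exists rho K Hr HK) as [xs [Habove [Hxs [HDxs Hpos]]]].
  (* where [D] does not vanish, [phat 0 = N / D] is bounded and so is every transform *)
  assert (HDtheta : boundary_defect rho 0 1 theta K = 0).
  { apply NNPP; intros Hne.
    assert (HneC : D (RtoC theta) <> 0%C).
    { rewrite HDR. intros E. apply Hne. apply RtoC_inj. exact E. }
    destruct (rational_relation (phat n0) (phat O) (fun z => Csol rho 0 1 z n0)
       (fun z => Csol rho 1 0 z n0) (Hrat n0 Hn0) Hrat0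
       (proj1 (polyfun_Cshoot _ _ _ _)) (proj1 (polyfun_Cshoot _ _ _ _)) (fun _ => RtoC 1)
       (polyfun_const _)) as [zs1 Hzs1].
    { intros x Hx. destruct (Hrel x Hx) as [E _]. rewrite (E n0 Hn0). ring. }
    destruct (avoid_finite_set (zs0 ++ zs1) (RtoC theta)) as [d0 [Hd0 Hav]].
    destruct (polyfun_locally_away_from_zero D _ HD HneC) as [b [d1 [Hd1 [Hb HbD]]]].
    destruct (polyfun_locally_bounded N (RtoC theta) HN) as [B2 [d2 [Hd2 [HB2 HbN]]]].
    destruct (polyfun_locally_bounded (fun z => Csol rho 0 1 z n0) (RtoC theta)
      (proj1 (polyfun_Cshoot _ _ _ _))) as [B3 [d3 [Hd3 [HB3 HbQ]]]].
    destruct (polyfun_locally_bounded (fun z => Csol rho 1 0 z n0) (RtoC theta)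
      (proj1 (polyfun_Cshoot _ _ _ _))) as [B4 [d4 [Hd4 [HB4 HbP]]]].
    apply (is_pole_not_bounded (phat n0) (RtoC theta) (B3 * (B2 / b) + B4)
      (Rmin d0 (Rmin (Rmin d1 d2) (Rmin d3 d4)))); [| exact Hpole |].
    { repeat apply Rmin_glb_lt; assumption. }
    intros z Hz Hlt.
    apply Rmin_Rgt_l in Hlt. destruct Hlt as [L0 Hlt].
    apply Rmin_Rgt_l in Hlt. destruct Hlt as [L12 L34].
    apply Rmin_Rgt_l in L12. destruct L12 as [L1 L2].
    apply Rmin_Rgt_l in L34. destruct L34 as [L3 L4].
    assert (Hnin := Hav z Hz L0).
    assert (E0 := Hzs0 z (fun h => Hnin (in_or_app _ _ _ (or_introl h)))).
    assert (E1 := Hzs1 z (fun h => Hnin (in_or_app _ _ _ (or_intror h)))).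
    specialize (HbD z L1). specialize (HbN z L2). specialize (HbQ z L3). specialize (HbP z L4).
    simpl in HbQ, HbP.
    replace (phat n0 z) with (Csol rho 0 1 z n0 * phat O z + Csol rho 1 0 z n0)%C
      by (rewrite <- E1; ring).
    eapply Rle_trans; [apply Cmod_triangle |]. apply Rplus_le_compat; [| exact HbP].
    rewrite Cmod_mult.
    apply Rmult_le_compat; try apply Cmod_ge_0; [exact HbQ |].
    apply Rle_div_r; [exact Hb |].
    apply Rle_trans with (Cmod (phat O z) * Cmod (D z)).
    - apply Rmult_le_compat_l; [apply Cmod_ge_0 | exact HbD].
    - rewrite <- Cmod_mult, Cmult_comm, E0. exact HbN. }
  assert (Hle : theta <= xs).
  { apply Rnot_lt_le; intros Hlt. destruct (Habove theta Hlt) as [_ A]. lra. }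
  (* the numerator does not vanish at xs: pair with the positive left eigenvector *)
  assert (HNxs : boundary_defect rho 1 0 xs K < 0).
  { destruct K as [|M]; [lia |]. unfold boundary_defect in *.
    replace (S M - 1)%nat with M in * by lia.
    assert (W := wronskian_sum rho (fun k => sol rho 0 1 xs k) (fun k => sol rho 1 0 xs k) M).
    cbv beta in W.
    replace (sol rho 0 1 xs (S M)) with (sol rho 0 1 xs M) in W by lra.
    assert (S1 : 0 < sum_f_R0 (fun n => rho ^ n * sol rho 0 1 xs n) M).
    { apply sum_f_R0_positive.
      - intros n Hn. left. apply Rmult_lt_0_compat; [apply pow_lt; exact Hr | apply Hpos; lia].
      - apply Rmult_lt_0_compat; [apply pow_lt; exact Hr | apply Hpos; lia]. }
    assert (S2 : sum_f_R0 (fun n => rho ^ n * INR (n + 1) *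
       (sol rho 0 1 xs n * gen rho (fun k => sol rho 1 0 xs k) n
        - sol rho 1 0 xs n * gen rho (fun k => sol rho 0 1 xs k) n)) M
       = (-1) * sum_f_R0 (fun n => rho ^ n * sol rho 0 1 xs n) M).
    { rewrite scal_sum. apply sum_eq. intros n Hn.
      rewrite !shoot_gen by lra. field. apply not_0_INR; lia. }
    rewrite S2 in W.
    assert (0 < sol rho 0 1 xs M) by (apply Hpos; lia).
    assert (0 < rho ^ S M * INR (S M)).
    { apply Rmult_lt_0_compat; [apply pow_lt; exact Hr | apply lt_0_INR; lia]. }
    apply Rnot_le_lt; intros Hge.
    assert (0 <= rho ^ S M * INR (S M) *
       (sol rho 0 1 xs M * sol rho 1 0 xs (S M) - sol rho 0 1 xs M * sol rho 1 0 xs M)).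
    { apply Rmult_le_pos; [lra |]. nra. }
    lra. }
  assert (Hpolexs : is_pole (phat O) (RtoC xs)).
  { intros P [B HB]. unfold filtermap.
    destruct (avoid_finite_set zs0 (RtoC xs)) as [d0 [Hd0 Hav]].
    destruct (polyfun_locally_away_from_zero N (RtoC xs) HN) as [b [d1 [Hd1 [Hb HbN]]]].
    { rewrite HNR. intros E. apply RtoC_inj in E. lra. }
    set (B' := Rabs B + 1). assert (HB' : 0 < B') by (unfold B'; pose proof (Rabs_pos B); lra).
    destruct (polyfun_continuous D (RtoC xs) (b / B') HD) as [d2 [Hd2 HcD]].
    { apply Rdiv_lt_0_compat; assumption. }
    apply (Cmod_locally' _ _ (Rmin d0 (Rmin d1 d2))).
    { repeat apply Rmin_glb_lt; assumption. }
    intros z Hz Hlt.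
    apply Rmin_Rgt_l in Hlt. destruct Hlt as [L0 Hlt].
    apply Rmin_Rgt_l in Hlt. destruct Hlt as [L1 L2].
    apply HB. apply Rlt_trans with B'; [unfold B'; pose proof (Rle_abs B); lra |].
    assert (E := Hzs0 z (Hav z Hz L0)).
    specialize (HbN z L1). specialize (HcD z L2).
    assert (ED : D (RtoC xs) = RtoC 0) by (rewrite HDR, HDxs; reflexivity).
    rewrite ED in HcD. replace (D z - 0)%C with (D z) in HcD by ring.
    rewrite <- E, Cmod_mult in HbN.
    apply Rnot_le_lt; intros Hle'.
    assert (Cmod (D z) * Cmod (phat O z) < b / B' * B').
    { pose proof (Cmod_ge_0 (D z)). pose proof (Cmod_ge_0 (phat O z)).
      apply Rle_lt_trans with (Cmod (D z) * B'); [apply Rmult_le_compat_l; lra |].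
      apply Rmult_lt_compat_r; lra. }
    replace (b / B' * B') with b in H by (field; lra). lra. }
  assert (Hge : xs <= theta).
  { assert (A := Hdom O (RtoC xs) ltac:(lia) Hpolexs).
    rewrite !Cmod_R, !Rabs_left in A; lra. }
  assert (E : theta = xs) by lra. subst theta.
  exists (fun n => sol rho 0 1 xs n). split; [exact Hpos | split].
  - intros n Hn. rewrite shoot_gen by lra. unfold Rdiv. ring.
  - unfold boundary_defect in HDxs. lra.
Qed.

(** * Supercritical arrivals *)

Definition poly_growth (f : R -> R -> R) : Prop :=
  exists B P, 0 <= B /\ forall j X, 1 <= j -> 0 <= X <= 1 -> Rabs (f j X) <= B * j ^ P.

Lemma pow_ge_1 (j : R) (P : nat) : 1 <= j -> 1 <= j ^ P.
Proof. intros H. apply pow_R1_Rle; exact H. Qed.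

Lemma poly_growth_const (c : R) : poly_growth (fun _ _ => c).
Proof.
  exists (Rabs c), O. split; [apply Rabs_pos |]. intros; simpl; lra.
Qed.

Lemma poly_growth_j : poly_growth (fun j _ => j).
Proof.
  exists 1, 1%nat. split; [lra |]. intros j X Hj _. simpl. rewrite Rabs_pos_eq; lra.
Qed.

Lemma poly_growth_X : poly_growth (fun _ X => X).
Proof.
  exists 1, O. split; [lra |]. intros j X _ HX. simpl. rewrite Rabs_pos_eq; lra.
Qed.

Lemma poly_growth_add f g :
  poly_growth f -> poly_growth g -> poly_growth (fun j X => f j X + g j X).
Proof.
  intros [B [P [HB H]]] [B' [P' [HB' H']]].
  exists (B + B'), (P + P')%nat. split; [lra |]. intros j X Hj HX.
  specialize (H j X Hj HX). specialize (H' j X Hj HX).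
  pose proof (pow_ge_1 j P Hj). pose proof (pow_ge_1 j P' Hj).
  eapply Rle_trans; [apply Rabs_triang |]. rewrite pow_add.
  assert (j ^ P <= j ^ P * j ^ P') by nra. assert (j ^ P' <= j ^ P * j ^ P') by nra.
  nra.
Qed.

Lemma poly_growth_mul f g :
  poly_growth f -> poly_growth g -> poly_growth (fun j X => f j X * g j X).
Proof.
  intros [B [P [HB H]]] [B' [P' [HB' H']]].
  exists (B * B'), (P + P')%nat. split; [nra |]. intros j X Hj HX.
  specialize (H j X Hj HX). specialize (H' j X Hj HX).
  rewrite Rabs_mult, pow_add.
  replace (B * B' * (j ^ P * j ^ P')) with ((B * j ^ P) * (B' * j ^ P')) by ring.
  apply Rmult_le_compat; try apply Rabs_pos; assumption.
Qed.

Lemma poly_growth_opp f : poly_growth f -> poly_growth (fun j X => - f j X).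
Proof.
  intros [B [P [HB H]]]. exists B, P. split; [exact HB |]. intros j X Hj HX.
  rewrite Rabs_Ropp; apply H; assumption.
Qed.

Lemma poly_growth_sub f g :
  poly_growth f -> poly_growth g -> poly_growth (fun j X => f j X - g j X).
Proof.
  intros Hf Hg. apply (poly_growth_add f (fun j X => - g j X)); [exact Hf |].
  apply poly_growth_opp; exact Hg.
Qed.

Lemma poly_growth_pow f n : poly_growth f -> poly_growth (fun j X => f j X ^ n).
Proof.
  intros Hf. induction n as [|n IH]; simpl; [apply poly_growth_const |].
  apply poly_growth_mul; assumption.
Qed.

Ltac poly_growth :=
  repeat first
    [ apply poly_growth_const | apply poly_growth_j | apply poly_growth_X
    | apply poly_growth_add | apply poly_growth_sub | apply poly_growth_mul
    | apply poly_growth_pow | apply poly_growth_opp ].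

Lemma geometric_dominates_power (P : nat) :
  forall kap, 1 < kap -> exists M, 0 < M /\ forall j : nat, INR j ^ P <= M * kap ^ j.
Proof.
  induction P as [|P IH]; intros kap Hk.
  - exists 1; split; [lra |]. intros j. pose proof (pow_ge_1 kap j ltac:(lra)). simpl; lra.
  - assert (Hs : 1 < sqrt kap) by (rewrite <- sqrt_1; apply sqrt_lt_1; lra).
    destruct (IH _ Hs) as [M [HM H]].
    exists (M * / (sqrt kap - 1)). split.
    { apply Rmult_lt_0_compat; [lra | apply Rinv_0_lt_compat; lra]. }
    intros j. specialize (H j).
    assert (Hb : INR j <= / (sqrt kap - 1) * sqrt kap ^ j).
    { assert (A := poly j (sqrt kap - 1) ltac:(lra)).
      replace (1 + (sqrt kap - 1)) with (sqrt kap) in A by ring.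
      apply (Rmult_le_reg_l (sqrt kap - 1)); [lra |].
      rewrite <- Rmult_assoc, Rinv_r by lra. lra. }
    assert (E : kap ^ j = sqrt kap ^ j * sqrt kap ^ j).
    { rewrite <- Rpow_mult_distr, sqrt_sqrt by lra. reflexivity. }
    rewrite E. simpl pow.
    replace (M * / (sqrt kap - 1) * (sqrt kap ^ j * sqrt kap ^ j))
      with ((/ (sqrt kap - 1) * sqrt kap ^ j) * (M * sqrt kap ^ j)) by ring.
    apply Rmult_le_compat; try assumption; [apply pos_INR | apply pow_le, pos_INR].
Qed.

Lemma geometric_dominates (f : R -> R -> R) (kap : R) :
  1 < kap -> poly_growth f ->
  exists M, 0 < M /\ forall (j : nat) X, (1 <= j)%nat -> 0 <= X <= 1 ->
    Rabs (f (INR j) X) <= M * kap ^ j.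
Proof.
  intros Hk [B [P [HB H]]]. destruct (geometric_dominates_power P kap Hk) as [M [HM HMj]].
  exists ((B + 1) * M). split; [nra |]. intros j X Hj HX.
  assert (Hj1 : 1 <= INR j) by (apply (le_INR 1); exact Hj).
  eapply Rle_trans; [apply H; assumption |]. specialize (HMj j).
  assert (0 <= INR j ^ P) by (apply pow_le; lra).
  assert (0 < kap ^ j) by (apply pow_lt; lra). nra.
Qed.

(** The formal solution in powers of [X = / K] at distance [j] from the boundary,
    with [d = rho - 1]. Each coefficient is a polynomial in [j], found from the lower
    orders; it vanishes at [j = 0] and [j = 1], so that the boundary condition holds
    exactly and fixes the coefficients of the eigenvalue. *)
Definition sc_a2 (d : R) (j : R) : R := - (j ^ 2 - j) / (2 * d).
Definition sc_p (d : R) : R := - 1 / (3 * d).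
Definition sc_q (d : R) : R := (d - 1) / (2 * d ^ 2).
Definition sc_r (d : R) : R := 1 / (2 * d ^ 2) - 1 / (6 * d).
Definition sc_a3 (d : R) (j : R) : R := sc_p d * j ^ 3 + sc_q d * j ^ 2 + sc_r d * j.
Definition sc_th4 (d : R) : R := (d ^ 2 + 2 * d + 2) / d ^ 4.
Definition sc_s4 (d : R) : R := - 1 / (4 * d) + 1 / (8 * d ^ 2).
Definition sc_t4 (d : R) : R := ((12 + 6 * d) * sc_s4 d - (- 3 + 3 * sc_p d + 1 / (2 * d ^ 2))) / (3 * d).
Definition sc_u4 (d : R) : R :=
  (- 4 * d * sc_s4 d + (6 + 3 * d) * sc_t4 d
   - (3 + 1 / (2 * d) + 3 * sc_p d + 2 * sc_q d - 1 / (2 * d ^ 2))) / (2 * d).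
Definition sc_v4 (d : R) : R := - (sc_s4 d + sc_t4 d + sc_u4 d).
Definition sc_a4 (d : R) (j : R) : R := sc_s4 d * j ^ 4 + sc_t4 d * j ^ 3 + sc_u4 d * j ^ 2 + sc_v4 d * j.

Definition sc_V (d : R) (j X : R) : R := 1 + sc_a2 d j * X ^ 2 + sc_a3 d j * X ^ 3 + sc_a4 d j * X ^ 4.
Definition sc_theta (d : R) (X : R) : R := - X - X ^ 2 / d - X ^ 3 / d ^ 2 + sc_th4 d * X ^ 4.

(** The terms of order [X ^ 5] and higher divided by [X ^ 5], once [/ (n + 1)] is
    replaced by its expansion to order [X ^ 4]. *)
Definition sc_rest (d : R) (j X : R) : R :=
  - (sc_a2 d (j + 1) * ((j - 1) ^ 2 + (j - 1) ^ 3 * X)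
     + sc_a3 d (j + 1) * ((j - 1) + (j - 1) ^ 2 * X + (j - 1) ^ 3 * X ^ 2)
     + sc_a4 d (j + 1) * (1 + (j - 1) * X + (j - 1) ^ 2 * X ^ 2 + (j - 1) ^ 3 * X ^ 3))
  - (- sc_a4 d j - (sc_a3 d j + sc_a4 d j * X) / d
     - (sc_a2 d j + sc_a3 d j * X + sc_a4 d j * X ^ 2) / d ^ 2
     + sc_th4 d * (sc_a2 d j * X + sc_a3 d j * X ^ 2 + sc_a4 d j * X ^ 3)).

Lemma sc_residual (d j X y : R) :
  d <> 0 -> y = X + y * (j - 1) * X ->
  (1 + d) * (sc_V d (j - 1) X - sc_V d j X) + (sc_V d (j + 1) X - sc_V d j X)
    - y * sc_V d (j + 1) X - sc_theta d X * sc_V d j X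
  = X ^ 5 * sc_rest d j X - y * ((j - 1) * X) ^ 4 * sc_V d (j + 1) X.
Proof.
  intros Hd Hy.
  assert (E : y = X * (1 + (j - 1) * X + (j - 1) ^ 2 * X ^ 2 + (j - 1) ^ 3 * X ^ 3)
                + y * ((j - 1) * X) ^ 4).
  (* four rounds of the equation for [y] expand it geometrically in [X] *)
  { rewrite Hy at 1. rewrite Hy at 1. rewrite Hy at 1. rewrite Hy at 1. ring. }
  set (S4 := X * (1 + (j - 1) * X + (j - 1) ^ 2 * X ^ 2 + (j - 1) ^ 3 * X ^ 3)) in *.
  replace (y * sc_V d (j + 1) X) with (S4 * sc_V d (j + 1) X + y * ((j - 1) * X) ^ 4 * sc_V d (j + 1) X)
    by (rewrite E at 2; ring).
  assert (F : (1 + d) * (sc_V d (j - 1) X - sc_V d j X) + (sc_V d (j + 1) X - sc_V d j X)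
    - S4 * sc_V d (j + 1) X - sc_theta d X * sc_V d j X = X ^ 5 * sc_rest d j X).
  { unfold S4, sc_rest, sc_theta, sc_V, sc_a4, sc_v4, sc_u4, sc_t4, sc_s4, sc_th4, sc_a3, sc_a2, sc_p, sc_q, sc_r.
    field. exact Hd. }
  lra.
Qed.

(** On [kap ^ j] the generator acts by a multiple of [(kap - 1) * (kap - rho)],
    which is negative for [kap] between [1] and [rho]; [1 + d / 2] is the midpoint. *)
Definition sc_trial (d s : R) (K n : nat) : R :=
  sc_V d (INR K - INR n) (/ INR K) + s * (/ INR K) ^ 5 * (1 + d / 2) ^ (K - n).

Lemma sc_trial_gen (d s : R) (K n : nat) :
  0 < d -> (n < K)%nat ->
  let X := / INR K in let j := INR (K - n) in let y := / INR (n + 1) in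
  gen (1 + d) (sc_trial d s K) n - sc_theta d X * sc_trial d s K n =
  X ^ 5 * sc_rest d j X - y * ((j - 1) * X) ^ 4 * sc_V d (j + 1) X
  + s * X ^ 5 * (1 + d / 2) ^ (K - n - 1) *
    (- (d ^ 2 / 4) - y * (1 + d / 2) ^ 2 - sc_theta d X * (1 + d / 2)).
Proof.
  intros Hd Hn X j y.
  assert (HK0 : 0 < INR K) by (apply lt_0_INR; lia).
  assert (Hn0 : 0 < INR (n + 1)) by (apply lt_0_INR; lia).
  assert (Hj : j = INR K - INR n) by (unfold j; rewrite minus_INR by lia; ring).
  assert (Hn1 : INR (n + 1) = INR n + 1) by (rewrite plus_INR; reflexivity).
  assert (Hy : y = X + y * (j - 1) * X).
  { unfold y, X. rewrite Hj, Hn1 in *. field. split; lra. }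
  assert (R1 := sc_residual d j X y ltac:(lra) Hy).
  set (kap := 1 + d / 2) in *.
  assert (E1 : sc_trial d s K (n + 1) = sc_V d (j - 1) X + s * X ^ 5 * kap ^ (K - n - 1)).
  { unfold sc_trial. fold X kap. rewrite Hn1. replace (INR K - (INR n + 1)) with (j - 1) by (rewrite Hj; ring).
    replace (K - (n + 1))%nat with (K - n - 1)%nat by lia. reflexivity. }
  assert (E0 : sc_trial d s K n = sc_V d j X + s * X ^ 5 * (kap * kap ^ (K - n - 1))).
  { unfold sc_trial. fold X kap. rewrite <- Hj.
    replace (K - n)%nat with (S (K - n - 1)) at 1 by lia. reflexivity. }
  assert (Em : INR n / INR (n + 1) * sc_trial d s K (n - 1) =
     (1 - y) * (sc_V d (j + 1) X + s * X ^ 5 * (kap * (kap * kap ^ (K - n - 1))))).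
  { replace (INR n / INR (n + 1)) with (1 - y) by (unfold y; rewrite Hn1 in *; field; lra).
    destruct n as [|n].
    - unfold y. simpl. field.
    - f_equal. unfold sc_trial. fold X kap.
      replace (S n - 1)%nat with n by lia.
      replace (INR K - INR n) with (j + 1) by (rewrite Hj, S_INR; ring).
      replace (K - n)%nat with (S (S (K - S n - 1))) by lia. reflexivity. }
  unfold gen. rewrite E1, E0, Em.
  replace (1 + (1 + d)) with (2 + d) by ring.
  assert (Hk : - (d ^ 2 / 4) = (kap - 1) * (kap - (1 + d))) by (unfold kap; field).
  rewrite Hk. set (g := kap ^ (K - n - 1)) in *.
  set (A := X ^ 5 * sc_rest d j X) in *. set (B := y * ((j - 1) * X) ^ 4 * sc_V d (j + 1) X) in *.
  assert (R2 : A - B = (1 + d) * (sc_V d (j - 1) X - sc_V d j X) + (sc_V d (j + 1) X - sc_V d j X) -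
     y * sc_V d (j + 1) X - sc_theta d X * sc_V d j X) by lra.
  rewrite R2. ring.
Qed.

Lemma poly_growth_rest (d : R) : poly_growth (sc_rest d).
Proof.
  unfold sc_rest, sc_a4, sc_a3, sc_a2, Rdiv. poly_growth.
Qed.

Lemma poly_growth_V_shift (d : R) : poly_growth (fun j X => j ^ 5 * sc_V d (j + 1) X).
Proof.
  unfold sc_V, sc_a4, sc_a3, sc_a2, Rdiv. poly_growth.
Qed.

Lemma sc_theta_small (d e : R) :
  0 < d -> 0 < e -> exists X0, 0 < X0 /\ forall X, 0 <= X <= X0 -> Rabs (sc_theta d X) <= e.
Proof.
  intros Hd He.
  set (c := 1 + / d + / d ^ 2 + Rabs (sc_th4 d)).
  assert (H1 : 0 < / d) by (apply Rinv_0_lt_compat; exact Hd).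
  assert (H2 : 0 < / d ^ 2) by (apply Rinv_0_lt_compat, pow_lt; exact Hd).
  pose proof (Rabs_pos (sc_th4 d)).
  assert (Hc : 0 < c) by (unfold c; lra).
  exists (Rmin 1 (e / c)). split; [apply Rmin_glb_lt; [lra | apply Rdiv_lt_0_compat; lra] |].
  intros X [HX HX0]. pose proof (Rmin_l 1 (e / c)). pose proof (Rmin_r 1 (e / c)).
  apply Rle_trans with (c * X).
  - unfold sc_theta.
    assert (X2 : 0 <= X ^ 2 <= X) by (simpl; nra).
    assert (X3 : 0 <= X ^ 3 <= X) by (simpl in *; nra).
    assert (X4 : 0 <= X ^ 4 <= X) by (simpl in *; nra).
    assert (T2 : 0 <= X ^ 2 / d <= X * / d) by (unfold Rdiv; split; nra).
    assert (T3 : 0 <= X ^ 3 / d ^ 2 <= X * / d ^ 2) by (unfold Rdiv; split; nra).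
    assert (T4 : Rabs (sc_th4 d * X ^ 4) <= Rabs (sc_th4 d) * X).
    { rewrite Rabs_mult, (Rabs_pos_eq (X ^ 4)) by lra. nra. }
    unfold c. apply Rabs_le. apply Rabs_le_between in T4. lra.
  - replace e with (c * (e / c)) by (field; lra). apply Rmult_le_compat_l; lra.
Qed.

Lemma supercritical_residual (d : R) :
  0 < d -> exists M0, 0 < M0 /\ forall K n, (n < K)%nat ->
  let X := / INR K in let j := INR (K - n) in let y := / INR (n + 1) in
  Rabs (X ^ 5 * sc_rest d j X - y * ((j - 1) * X) ^ 4 * sc_V d (j + 1) X)
    <= M0 * X ^ 5 * (1 + d / 2) ^ (K - n).
Proof.
  intros Hd.
  destruct (geometric_dominates _ (1 + d / 2) ltac:(lra) (poly_growth_rest d)) as [M1 [HM1 H1]].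
  destruct (geometric_dominates _ (1 + d / 2) ltac:(lra) (poly_growth_V_shift d)) as [M2 [HM2 H2]].
  exists (M1 + M2). split; [lra |]. intros K n Hn X j y.
  assert (HK1 : 1 <= INR K) by (apply (le_INR 1); lia).
  assert (HX : 0 < X <= 1).
  { unfold X. split; [apply Rinv_0_lt_compat; lra |]. rewrite <- Rinv_1. apply Rinv_le_contravar; lra. }
  assert (Hj : 1 <= j) by (apply (le_INR 1); lia).
  assert (Hn1 : 1 <= INR (n + 1)) by (apply (le_INR 1); lia).
  assert (Hy : 0 < y <= 1).
  { unfold y. split; [apply Rinv_0_lt_compat; lra |]. rewrite <- Rinv_1. apply Rinv_le_contravar; lra. }
  assert (Hyj : y <= j * X).
  { assert (E : y = X + y * (j - 1) * X).
    { unfold y, X, j. rewrite minus_INR, plus_INR by lia. simpl. field.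
      rewrite plus_INR in Hn1; simpl in Hn1. lra. }
    assert (0 <= (j - 1) * X) by (apply Rmult_le_pos; lra). nra. }
  specialize (H1 (K - n)%nat X ltac:(lia) ltac:(lra)).
  specialize (H2 (K - n)%nat X ltac:(lia) ltac:(lra)). fold j in H1, H2.
  set (g := (1 + d / 2) ^ (K - n)) in *.
  assert (HX5 : 0 < X ^ 5) by (apply pow_lt; lra).
  eapply Rle_trans; [apply Rabs_triang |]. rewrite Rabs_Ropp, Rabs_mult.
  rewrite (Rabs_pos_eq (X ^ 5)) by lra.
  assert (B : Rabs (y * ((j - 1) * X) ^ 4 * sc_V d (j + 1) X) <= X ^ 5 * (M2 * g)).
  { apply Rle_trans with (X ^ 5 * Rabs (j ^ 5 * sc_V d (j + 1) X)).
    - rewrite !Rabs_mult, (Rabs_pos_eq y), (Rabs_pos_eq (j ^ 5)), (Rabs_pos_eq (((j - 1) * X) ^ 4)).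
      + rewrite <- Rmult_assoc. apply Rmult_le_compat_r; [apply Rabs_pos |].
        replace (X ^ 5 * j ^ 5) with ((j * X) * (j * X) ^ 4) by ring.
        apply Rmult_le_compat; [lra | apply pow_le, Rmult_le_pos; lra | exact Hyj |].
        apply pow_incr. split; [apply Rmult_le_pos; lra | apply Rmult_le_compat_r; lra].
      + apply pow_le, Rmult_le_pos; lra.
      + apply pow_le; lra.
      + lra.
    - apply Rmult_le_compat_l; lra. }
  nra.
Qed.

(** Each order in [1 / K] is solved exactly, and the remainder, polynomial in
    the distance to the boundary, is absorbed by a multiple of a geometric
    sequence on which the generator is strictly negative. *)
Lemma supercritical_expansion (theta : nat -> R) (d : R) :
  0 < d ->
  (forall K, (1 <= K)%nat -> exists Q, perron_vector (1 + d) K (theta K) Q) ->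
  exists M, eventually (fun K => Rabs (theta K - sc_theta d (/ INR K)) <= M * / INR K ^ 5).
Proof.
  intros Hd HP.
  set (kap := 1 + d / 2). assert (Hk : 1 < kap) by (unfold kap; lra).
  destruct (supercritical_residual d Hd) as [M0 [HM0 Hres]].
  assert (HV : poly_growth (fun j X => sc_a2 d j + sc_a3 d j * X + sc_a4 d j * X ^ 2)).
  { unfold sc_a4, sc_a3, sc_a2, Rdiv. poly_growth. }
  assert (HV1 := poly_growth_pow _ 3 HV). destruct HV as [B [P [HB HVb]]].
  destruct (geometric_dominates_power (3 * P) kap Hk) as [M3 [HM3 H3]].
  set (M := 16 * M0 * kap / d ^ 2 + 4 * (B + 1) ^ 3 * M3).
  assert (Hd2 : 0 < d ^ 2) by (apply pow_lt; exact Hd).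
  assert (HMa : 16 * M0 * kap / d ^ 2 <= M).
  { unfold M. assert (0 < (B + 1) ^ 3) by (apply pow_lt; lra). nra. }
  assert (HMb : 4 * (B + 1) ^ 3 * M3 <= M).
  { unfold M. assert (0 < 16 * M0 * kap / d ^ 2) by (apply Rdiv_lt_0_compat; nra). lra. }
  assert (HM : 0 < M).
  { assert (0 < (B + 1) ^ 3) by (apply pow_lt; lra). nra. }
  set (M2 := 2 * (1 + d) * M * (kap - 1)).
  assert (HM2 : 0 < M2) by (unfold M2; repeat apply Rmult_lt_0_compat; lra).
  assert (Hc : 0 < d ^ 2 / (8 * kap)) by (apply Rdiv_lt_0_compat; lra).
  destruct (sc_theta_small d (d ^ 2 / (8 * kap)) Hd Hc) as [X0 [HX0 Hsm]].
  set (X1 := Rmin X0 (/ (2 * (M * kap + 1)))).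
  assert (HX1 : 0 < X1).
  { apply Rmin_glb_lt; [exact HX0 |]. apply Rinv_0_lt_compat. nra. }
  destruct (nfloor_ex (/ X1)) as [K0 [_ HK0]]; [left; apply Rinv_0_lt_compat; exact HX1 |].
  exists M2. exists (S K0). intros K HK.
  assert (HK1 : (1 <= K)%nat) by lia.
  set (X := / INR K).
  assert (HKR : 1 <= INR K) by (apply (le_INR 1); lia).
  assert (HX : 0 < X <= 1).
  { unfold X. split; [apply Rinv_0_lt_compat; lra |]. rewrite <- Rinv_1. apply Rinv_le_contravar; lra. }
  assert (HXX1 : X <= X1).
  { unfold X. rewrite <- (Rinv_inv X1). apply Rinv_le_contravar; [apply Rinv_0_lt_compat; exact HX1 |].
    apply le_INR in HK. rewrite S_INR in HK. lra. }
  assert (HXX0 : X <= X0) by (pose proof (Rmin_l X0 (/ (2 * (M * kap + 1)))); unfold X1 in HXX1; lra).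
  assert (HXM : M * X * kap <= 1 / 2).
  { assert (X <= / (2 * (M * kap + 1))) by (pose proof (Rmin_r X0 (/ (2 * (M * kap + 1)))); unfold X1 in HXX1; lra).
    assert (0 < M * kap) by nra.
    apply Rle_trans with (M * kap * / (2 * (M * kap + 1))); [nra |].
    apply (Rmult_le_reg_r (2 * (M * kap + 1))); [lra |]. rewrite Rmult_assoc, Rinv_l by lra. lra. }
  assert (HX5 : 0 < X ^ 5) by (apply pow_lt; lra).
  assert (HX5X : X ^ 5 <= X).
  { replace (X ^ 5) with (X * X ^ 4) by ring. assert (0 <= X ^ 4 <= 1) by (split; [apply pow_le; lra |
     rewrite <- (pow1 4); apply pow_incr; lra]). nra. }
  assert (Hth := Hsm X ltac:(lra)).
  assert (Hthk : Rabs (sc_theta d X) * kap <= d ^ 2 / 8).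
  { replace (d ^ 2 / 8) with (d ^ 2 / (8 * kap) * kap) by (field; lra). apply Rmult_le_compat_r; lra. }
  assert (Hbeat : forall n, (n < K)%nat ->
    gen (1 + d) (sc_trial d M K) n - sc_theta d X * sc_trial d M K n <= 0 /\
    0 <= gen (1 + d) (sc_trial d (- M) K) n - sc_theta d X * sc_trial d (- M) K n).
  { intros n Hn. specialize (Hres K n Hn). cbv zeta in Hres.
    assert (T1 := sc_trial_gen d M K n Hd Hn). assert (T2 := sc_trial_gen d (- M) K n Hd Hn).
    cbv zeta in T1, T2. fold X kap in T1, T2, Hres.
    set (RR := X ^ 5 * sc_rest d (INR (K - n)) X
        - / INR (n + 1) * ((INR (K - n) - 1) * X) ^ 4 * sc_V d (INR (K - n) + 1) X) in *.
    rewrite T1, T2.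
    assert (Hn1 : 0 < / INR (n + 1)) by (apply Rinv_0_lt_compat, lt_0_INR; lia).
    replace (K - n)%nat with (S (K - n - 1)) in Hres by lia. simpl pow in Hres at 2.
    set (g := kap ^ (K - n - 1)) in *. assert (Hg : 0 < g) by (apply pow_lt; lra).
    set (EE := - (d ^ 2 / 4) - / INR (n + 1) * kap ^ 2 - sc_theta d X * kap).
    assert (HEE : EE <= - (d ^ 2 / 8)).
    { unfold EE. assert (0 < kap ^ 2) by (apply pow_lt; lra).
      assert (0 < / INR (n + 1) * kap ^ 2) by nra.
      pose proof (Rle_abs (- sc_theta d X)) as Hab. rewrite Rabs_Ropp in Hab. nra. }
    assert (Hbig : M0 * X ^ 5 * (kap * g) <= M * X ^ 5 * g * (d ^ 2 / 8)).
    { assert (A : M0 * kap <= M * (d ^ 2 / 8)).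
      { apply Rle_trans with (16 * M0 * kap / d ^ 2 * (d ^ 2 / 8)).
        - replace (16 * M0 * kap / d ^ 2 * (d ^ 2 / 8)) with (2 * (M0 * kap)) by (field; lra). nra.
        - apply Rmult_le_compat_r; lra. }
      assert (0 < X ^ 5 * g) by (apply Rmult_lt_0_compat; assumption). nra. }
    assert (HEg : M * X ^ 5 * g * EE <= - (M * X ^ 5 * g * (d ^ 2 / 8))).
    { assert (0 < M * X ^ 5 * g) by (repeat apply Rmult_lt_0_compat; lra). nra. }
    apply Rabs_le_between in Hres.
    replace (- M * X ^ 5 * g * EE) with (- (M * X ^ 5 * g * EE)) by ring.
    fold EE. split; lra. }
  assert (Htop : forall s, sc_trial d s K K = 1 + s * X ^ 5).
  { intros s. unfold sc_trial. fold X kap. rewrite Rminus_diag, Nat.sub_diag. simpl pow.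
    unfold sc_V, sc_a2, sc_a3, sc_a4. unfold Rdiv. ring. }
  assert (Htop1 : forall s, sc_trial d s K (K - 1) = 1 + s * X ^ 5 * kap).
  { intros s. unfold sc_trial. fold X kap. rewrite minus_INR by lia.
    replace (INR K - (INR K - INR 1)) with 1 by (simpl; ring).
    replace (K - (K - 1))%nat with 1%nat by lia.
    assert (V1 : sc_V d 1 X = 1).
    { unfold sc_V, sc_a2, sc_a3, sc_a4, sc_p, sc_q, sc_r, sc_v4. field. lra. }
    rewrite V1. simpl. ring. }
  assert (Hpos : forall n, (n < K)%nat -> 0 < sc_trial d M K n).
  { intros n Hn. unfold sc_trial. fold X kap.
    assert (Hj : 1 <= INR K - INR n).
    { rewrite <- minus_INR by lia. apply (le_INR 1); lia. }
    assert (HVn := HVb (INR K - INR n) X Hj ltac:(lra)).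
    rewrite <- minus_INR in * by lia.
    set (j := INR (K - n)) in *.
    set (U := sc_a2 d j + sc_a3 d j * X + sc_a4 d j * X ^ 2) in *.
    assert (EV : sc_V d j X = 1 + X ^ 2 * U) by (unfold sc_V, U; ring).
    rewrite EV. specialize (H3 (K - n)%nat). fold j in H3.
    set (g := kap ^ (K - n)) in *. assert (Hg : 0 < g) by (apply pow_lt; lra).
    set (b := (B + 1) * j ^ P).
    assert (Hb1 : 1 <= b) by (unfold b; pose proof (pow_ge_1 j P Hj); nra).
    assert (HUb : Rabs U <= b).
    { unfold b. pose proof (pow_ge_1 j P Hj). lra. }
    apply Rabs_le_between in HUb.
    (* where [X ^ 2 * U] may fall below [-1] the geometric term, which dominates
       [b ^ 3], takes over *)
    destruct (Rlt_or_le (X ^ 2 * b) 1) as [Hs | Hs].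
    - assert (0 < X ^ 2) by (apply pow_lt; lra).
      assert (0 < M * X ^ 5 * g) by (repeat apply Rmult_lt_0_compat; lra). nra.
    - assert (Hm : b ^ 3 <= M * g / 4).
      { unfold b. rewrite Rpow_mult_distr, <- pow_mult.
        replace (P * 3)%nat with (3 * P)%nat by lia.
        assert (0 < (B + 1) ^ 3) by (apply pow_lt; lra). nra. }
      assert (Hx4 : X ^ 2 * b <= X ^ 5 * b ^ 3).
      { replace (X ^ 5 * b ^ 3) with (X * b * ((X ^ 2 * b) * (X ^ 2 * b))) by ring.
        assert (Hxb : X ^ 2 * b <= X * b).
        { replace (X ^ 2 * b) with (X * (X * b)) by ring. assert (0 < X * b) by nra. nra. }
        set (y := X ^ 2 * b) in *. assert (1 <= y * y) by nra.
        apply Rle_trans with (X * b * 1); [lra | apply Rmult_le_compat_l; lra]. }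
      assert (0 < X ^ 5 * (M * g / 4)) by (apply Rmult_lt_0_compat; nra).
      assert (X ^ 5 * b ^ 3 <= X ^ 5 * (M * g / 4)) by (apply Rmult_le_compat_l; lra).
      assert (0 < X ^ 2) by (apply pow_lt; lra).
      assert (- (X ^ 2 * b) <= X ^ 2 * U) by nra.
      lra. }
  destruct (HP K HK1) as [Q HQ].
  (* resetting the value at [K] makes the boundary condition exact and costs only
     [O(X ^ 5)] in the equation at [K - 1] *)
  assert (Hupd : forall (v : nat -> R) n, (n < K)%nat ->
     let w := fun k => if Nat.eq_dec k K then v (K - 1)%nat else v k in
     gen (1 + d) w n = gen (1 + d) v n + (if Nat.eq_dec (n + 1) K then (1 + d) * (v (K - 1)%nat - v K) else 0)).
  { intros v n Hn w. unfold gen, w.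
    destruct (Nat.eq_dec n K); [lia |]. destruct (Nat.eq_dec (n - 1) K); [lia |].
    destruct (Nat.eq_dec (n + 1) K) as [E | E]; [rewrite E |]; ring. }
  assert (Upper : theta K <= sc_theta d X + M2 * X ^ 5).
  { apply (perron_le_of_supersolution (1 + d) _ _ K Q
      (fun k => if Nat.eq_dec k K then sc_trial d M K (K - 1) else sc_trial d M K k)); try assumption; try lra.
    - intros n Hn. destruct (Nat.eq_dec n K); [lia | apply Hpos; exact Hn].
    - intros n Hn. rewrite (Hupd _ n Hn). destruct (Hbeat n Hn) as [T _].
      specialize (Hpos n Hn). destruct (Nat.eq_dec n K); [lia |].
      assert (0 < M2 * X ^ 5) by (apply Rmult_lt_0_compat; assumption).
      destruct (Nat.eq_dec (n + 1) K) as [E | E]; [| nra].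
      assert (En : n = (K - 1)%nat) by lia.
      assert (Hge : 1 <= sc_trial d M K n).
      { rewrite En, Htop1. assert (0 < M * X ^ 5 * kap) by (repeat apply Rmult_lt_0_compat; lra). lra. }
      rewrite Htop, Htop1.
      assert ((1 + d) * (1 + M * X ^ 5 * kap - (1 + M * X ^ 5)) <= M2 * X ^ 5 * sc_trial d M K n).
      { replace ((1 + d) * (1 + M * X ^ 5 * kap - (1 + M * X ^ 5))) with (M2 * X ^ 5 / 2) by (unfold M2; field). nra. }
      lra.
    - destruct (Nat.eq_dec (K - 1) K); [lia |]. destruct (Nat.eq_dec K K); [lra | lia]. }
  assert (Lower : sc_theta d X - M2 * X ^ 5 <= theta K).
  { set (v := fun k => Rmax (sc_trial d (- M) K k) 0).
    assert (Hsmall : M * X ^ 5 * kap <= 1 / 2).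
    { apply Rle_trans with (M * X * kap); [| exact HXM].
      apply Rmult_le_compat_r; [lra |]. apply Rmult_le_compat_l; lra. }
    assert (Hv1 : v (K - 1)%nat = 1 - M * X ^ 5 * kap).
    { unfold v. rewrite Htop1. rewrite Rmax_left; lra. }
    apply (perron_ge_of_subsolution (1 + d) _ _ K Q
      (fun k => if Nat.eq_dec k K then v (K - 1)%nat else v k)); try assumption; try lra.
    - intros n Hn. destruct (Nat.eq_dec n K); [lia | apply Rmax_r].
    - destruct (Nat.eq_dec (K - 1) K); [lia |]. lra.
    - intros n Hn. rewrite (Hupd v n Hn). destruct (Nat.eq_dec n K); [lia |].
      destruct (Hbeat n Hn) as [_ T].
      assert (Hnn : 0 <= INR n / INR (n + 1)).
      { apply Rdiv_le_0_compat; [apply pos_INR | apply lt_0_INR; lia]. }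
      assert (HvK : v K = 1 - M * X ^ 5).
      { unfold v. rewrite Htop. assert (0 < M * X ^ 5) by (apply Rmult_lt_0_compat; assumption).
        assert (M * X ^ 5 * 1 <= M * X ^ 5 * kap) by (apply Rmult_le_compat_l; lra).
        rewrite Rmax_left; lra. }
      assert (0 < M2 * X ^ 5) by (apply Rmult_lt_0_compat; assumption).
      destruct (Rle_lt_dec (sc_trial d (- M) K n) 0) as [Hz | Hz].
      + assert (Hvn : v n = 0) by (unfold v; apply Rmax_right; exact Hz).
        rewrite Hvn, Rmult_0_r.
        destruct (Nat.eq_dec (n + 1) K) as [E | E].
        * assert (En : n = (K - 1)%nat) by lia. rewrite En, Htop1 in Hz. lra.
        * unfold gen. rewrite Hvn.
          assert (0 <= v (n + 1)%nat) by apply Rmax_r. assert (0 <= v (n - 1)%nat) by apply Rmax_r.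
          assert (0 <= INR n / INR (n + 1) * v (n - 1)%nat) by (apply Rmult_le_pos; assumption). nra.
      + assert (Hvn : v n = sc_trial d (- M) K n) by (unfold v; apply Rmax_left; lra).
        assert (G : gen (1 + d) (sc_trial d (- M) K) n <= gen (1 + d) v n).
        { unfold gen. rewrite Hvn.
          assert (sc_trial d (- M) K (n + 1) <= v (n + 1)%nat) by apply Rmax_l.
          assert (sc_trial d (- M) K (n - 1) <= v (n - 1)%nat) by apply Rmax_l.
          assert (INR n / INR (n + 1) * sc_trial d (- M) K (n - 1) <= INR n / INR (n + 1) * v (n - 1)%nat)
            by (apply Rmult_le_compat_l; assumption).
          nra. }
        rewrite <- Hvn in *.
        destruct (Nat.eq_dec (n + 1) K) as [E | E]; [| nra].
        assert (En : n = (K - 1)%nat) by lia.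
        assert (Hge : 1 / 2 <= v n) by (rewrite En, Hv1; lra).
        rewrite HvK, Hv1.
        assert ((1 + d) * (1 - M * X ^ 5 * kap - (1 - M * X ^ 5)) >= - (M2 * X ^ 5 * v n)).
        { replace ((1 + d) * (1 - M * X ^ 5 * kap - (1 - M * X ^ 5))) with (- (M2 * X ^ 5 * (1 / 2))) by (unfold M2; field). nra. }
        lra.
    - destruct (Nat.eq_dec (K - 1) K); [lia |]. destruct (Nat.eq_dec K K); [lra | lia]. }
  replace (M2 * / INR K ^ 5) with (M2 * X ^ 5) by (unfold X; rewrite pow_inv; reflexivity).
  apply Rabs_le. lra.
Qed.

(** * Integrals over the whole line *)

Lemma locally_of_Rabs (x : R) (P : R -> Prop) (d : R) :
  0 < d -> (forall y, Rabs (y - x) < d -> P y) -> locally x P.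
Proof. intros Hd H. exists (mkposreal d Hd). intros y Hy. apply H. exact Hy. Qed.

Definition ends : (R * R -> Prop) -> Prop :=
  filter_prod (Rbar_locally m_infty) (Rbar_locally p_infty).

Definition whole_integral (g : R -> R) (I : R) : Prop :=
  filterlim (fun ab => RInt g (fst ab) (snd ab)) ends (locally I).

#[local] Instance ends_proper : ProperFilter ends.
Proof. unfold ends; typeclasses eauto. Qed.

Definition dominated (g : R -> R) (B : R) : Prop :=
  (forall t, continuous g t) /\ forall t, Rabs (g t) <= B / (1 + t ^ 2).

Lemma continuous_ex_RInt (g : R -> R) (a b : R) :
  (forall t, continuous g t) -> ex_RInt g a b.
Proof.
  intros Hg. apply (ex_RInt_continuous (V := R_CompleteNormedModule)). intros; apply Hg.
Qed.

Lemma is_RInt_arctan_density (B a b : R) :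
  is_RInt (fun t => B / (1 + t ^ 2)) a b (B * atan b - B * atan a).
Proof.
  apply (is_RInt_derive (V := R_CompleteNormedModule) (fun t => B * atan t)).
  - intros t _. auto_derive; [trivial | field; nra].
  - intros t _. apply (ex_derive_continuous (V := R_NormedModule)). auto_derive. nra.
Qed.

Lemma dominated_RInt_le (g : R -> R) (B a b : R) :
  dominated g B -> a <= b -> Rabs (RInt g a b) <= B * (atan b - atan a).
Proof.
  intros [Hc Hb] Hab.
  assert (E := is_RInt_arctan_density B a b).
  replace (B * (atan b - atan a)) with (RInt (fun t => B / (1 + t ^ 2)) a b).
  - eapply Rle_trans; [apply abs_RInt_le; [exact Hab | apply continuous_ex_RInt; exact Hc] |].
    apply RInt_le; [exact Hab | | eexists; exact E | intros t _; apply Hb].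
    apply continuous_ex_RInt. intros t.
    apply (continuous_comp g Rabs); [apply Hc |].
    apply continuity_pt_filterlim, Rcontinuity_abs.
  - assert (Eq : RInt (fun t => B / (1 + t ^ 2)) a b = B * atan b - B * atan a) by (apply is_RInt_unique, E).
    rewrite Eq. change (B * atan b - B * atan a = B * (atan b - atan a) :> R). ring.
Qed.

Lemma dominated_RInt_abs_le (g : R -> R) (B a b : R) :
  dominated g B -> 0 <= B -> Rabs (RInt g a b) <= B * Rabs (atan b - atan a).
Proof.
  intros Hd HB. destruct (Rle_or_lt a b) as [H | H].
  - eapply Rle_trans; [apply (dominated_RInt_le g B); assumption |].
    apply Rmult_le_compat_l; [exact HB | apply Rle_abs].
  - rewrite <- (opp_RInt_swap (V := R_CompleteNormedModule)) by (apply continuous_ex_RInt, Hd).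
    change (Rabs (- RInt g b a) <= B * Rabs (atan b - atan a)).
    rewrite Rabs_Ropp, Rabs_minus_sym.
    eapply Rle_trans; [apply (dominated_RInt_le g B); [exact Hd | lra] |].
    apply Rmult_le_compat_l; [exact HB | apply Rle_abs].
Qed.

Lemma ends_ball (M : R) : ends (fun ab => fst ab < - M /\ M < snd ab).
Proof.
  exists (fun a => a < - M) (fun b => M < b).
  - exists (- M); intros; assumption.
  - exists M; intros; assumption.
  - intros a b Ha Hb; split; assumption.
Qed.

Lemma atan_near_end (e : R) : 0 < e -> exists M, forall b, M < b -> PI / 2 - e < atan b < PI / 2.
Proof.
  intros He. set (e' := Rmin e (PI / 4)).
  assert (HPI := PI_RGT_0).
  assert (H0 : 0 < e') by (apply Rmin_glb_lt; lra).
  assert (H1 : e' <= e) by apply Rmin_l. assert (H2 : e' <= PI / 4) by apply Rmin_r.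
  exists (tan (PI / 2 - e')). intros b Hb.
  split; [| apply atan_bound].
  apply Rle_lt_trans with (PI / 2 - e'); [lra |].
  rewrite <- (atan_tan (PI / 2 - e')) by lra. apply atan_increasing; exact Hb.
Qed.

Lemma whole_integral_exists (g : R -> R) (B : R) :
  dominated g B -> 0 <= B -> exists I, whole_integral g I.
Proof.
  intros Hd HB.
  apply (proj1 (filterlim_locally_cauchy (U := R_CompleteSpace) (F := ends)
    (fun ab => RInt g (fst ab) (snd ab)))).
  intros e.
  assert (He : 0 < e / (4 * (B + 1))) by (apply Rdiv_lt_0_compat; [apply cond_pos | lra]).
  destruct (atan_near_end _ He) as [M HM].
  exists (fun ab => fst ab < - M /\ M < snd ab). split; [apply ends_ball |].
  intros [a b] [a' b'] [Ha Hb] [Ha' Hb']. simpl in *.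
  assert (Hc : forall u v, ex_RInt g u v) by (intros; apply continuous_ex_RInt, Hd).
  assert (E : RInt g a' b' - RInt g a b = RInt g a' a + RInt g b b').
  { assert (E1 := RInt_Chasles (V := R_CompleteNormedModule) g a' a b (Hc _ _) (Hc _ _)).
    assert (E2 := RInt_Chasles (V := R_CompleteNormedModule) g a' b b' (Hc _ _) (Hc _ _)).
    unfold plus in E1, E2; simpl in E1, E2. lra. }
  apply R_ball.
  change (RInt g a' b' + - RInt g a b) with (RInt g a' b' - RInt g a b). rewrite E.
  eapply Rle_lt_trans; [apply Rabs_triang |].
  assert (A1 := dominated_RInt_abs_le g B a' a Hd HB).
  assert (A2 := dominated_RInt_abs_le g B b b' Hd HB).
  assert (X1 := HM b Hb). assert (X2 := HM b' Hb').
  assert (X3 := HM (- a) ltac:(lra)). assert (X4 := HM (- a') ltac:(lra)).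
  rewrite atan_opp in X3, X4.
  set (q := e / (4 * (B + 1))) in *.
  assert (Q1 : Rabs (atan a - atan a') <= q) by (apply Rabs_le; lra).
  assert (Q2 : Rabs (atan b' - atan b) <= q) by (apply Rabs_le; lra).
  assert (Eq : e = (B + 1) * (4 * q) :> R) by (unfold q; field; lra).
  assert (B * Rabs (atan a - atan a') <= B * q) by (apply Rmult_le_compat_l; assumption).
  assert (B * Rabs (atan b' - atan b) <= B * q) by (apply Rmult_le_compat_l; assumption).
  nra.
Qed.

Lemma whole_integral_unique (g : R -> R) (I J : R) :
  whole_integral g I -> whole_integral g J -> I = J.
Proof.
  intros H1 H2. apply (filterlim_locally_unique (V := R_NormedModule) _ _ _ H1 H2).
Qed.

Lemma whole_integral_abs_le (g : R -> R) (I B : R) :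
  whole_integral g I -> (forall a b, a <= b -> Rabs (RInt g a b) <= B) -> Rabs I <= B.
Proof.
  intros HI Hb. apply Rnot_lt_le; intros Hlt.
  assert (He : 0 < Rabs I - B) by lra.
  specialize (HI (ball I (mkposreal _ He)) (locally_ball I _)).
  assert (Hand := filter_and (F := ends) _ _ HI (ends_ball 1)).
  destruct (filter_ex _ Hand) as [[a b] [H1 [H2 H3]]]. simpl in *.
  specialize (Hb a b ltac:(lra)).
  apply ball_R in H1; cbn [pos] in H1.
  revert H1 Hb; unfold Rabs; repeat destruct Rcase_abs; lra.
Qed.

Lemma whole_integral_lin (f g : R -> R) (I J k l : R) :
  (forall t, continuous f t) -> (forall t, continuous g t) ->
  whole_integral f I -> whole_integral g J ->
  whole_integral (fun t => k * f t + l * g t) (k * I + l * J).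
Proof.
  intros Hf Hg HI HJ.
  apply (filterlim_ext (fun ab => k * RInt f (fst ab) (snd ab) + l * RInt g (fst ab) (snd ab))).
  - intros [a b]; simpl. symmetry. apply is_RInt_unique.
    apply (is_RInt_plus (V := R_NormedModule)); apply (is_RInt_scal (V := R_NormedModule));
      apply (RInt_correct (V := R_CompleteNormedModule)), continuous_ex_RInt; assumption.
  - apply (filterlim_comp_2 (G := locally (k * I)) (H := locally (l * J))
      (F := ends) (fun ab => k * RInt f (fst ab) (snd ab)) (fun ab => l * RInt g (fst ab) (snd ab)) Rplus).
    + apply (filterlim_comp _ _ _ _ (fun y => k * y) _ _ _ HI).
      apply (filterlim_scal_r (V := R_NormedModule) k I).
    + apply (filterlim_comp _ _ _ _ (fun y => l * y) _ _ _ HJ).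
      apply (filterlim_scal_r (V := R_NormedModule) l J).
    + apply (filterlim_plus (V := R_NormedModule)).
Qed.

Lemma whole_integral_of_derivative (h h' : R -> R) (B : R) :
  (forall t, is_derive h t (h' t)) -> (forall t, continuous h' t) ->
  (forall t, Rabs (h t) <= B / (1 + t ^ 2)) ->
  whole_integral h' 0.
Proof.
  intros Hd Hc Hb.
  assert (E : forall a b, RInt h' a b = h b - h a).
  { intros a b. apply is_RInt_unique.
    apply (is_RInt_derive (V := R_CompleteNormedModule) h h'); intros; auto. }
  intros P [e He].
  set (M := 2 * (Rabs B + 1) / e + 1).
  assert (HM : 1 <= M).
  { unfold M. assert (0 < 2 * (Rabs B + 1) / e); [| lra].
    apply Rdiv_lt_0_compat; [pose proof (Rabs_pos B); lra | apply cond_pos]. }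
  unfold filtermap.
  apply (filter_imp (F := ends) (fun ab => fst ab < - M /\ M < snd ab)); [| apply ends_ball].
  intros [a b] [Ha Hb']; simpl in *. apply He.
  rewrite E. apply R_ball. unfold Rminus at 1. cbn [pos].
  assert (S : forall t, M < Rabs t -> Rabs (h t) < e / 2).
  { intros t Ht. eapply Rle_lt_trans; [apply Hb |].
    assert (Ht2 : M < t ^ 2).
    { rewrite <- (pow2_abs t). nra. }
    pose proof (Rabs_pos B). pose proof (Rle_abs B). pose proof (cond_pos e).
    apply Rlt_div_l; [nra |].
    assert (e * M = 2 * (Rabs B + 1) + e) by (unfold M; field; lra). nra. }
  assert (S1 := S a ltac:(rewrite Rabs_left; lra)).
  assert (S2 := S b ltac:(rewrite Rabs_pos_eq; lra)).
  replace (h b - h a + - 0) with (h b + - h a) by ring.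
  eapply Rle_lt_trans; [apply Rabs_triang |]. rewrite Rabs_Ropp. lra.
Qed.

Lemma taylor1_bound (f f' f'' : R -> R) (x h M : R) :
  (forall y, Rabs (y - x) <= Rabs h -> is_derive f y (f' y) /\ is_derive f' y (f'' y) /\ Rabs (f'' y) <= M) ->
  Rabs (f (x + h) - f x - h * f' x) <= M * h ^ 2.
Proof.
  intros H.
  assert (HM : 0 <= M).
  { destruct (H x) as [_ [_ A]]; [rewrite Rminus_diag, Rabs_R0; apply Rabs_pos |].
    pose proof (Rabs_pos (f'' x)); lra. }
  assert (Hb : forall y, Rmin x (x + h) <= y <= Rmax x (x + h) -> Rabs (y - x) <= Rabs h).
  { intros y. unfold Rmin, Rmax, Rabs. destruct (Rle_dec x (x + h)); repeat destruct Rcase_abs; lra. }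
  destruct (MVT_gen f x (x + h) f') as [c [Hc Ec]].
  - intros y Hy. apply H, Hb; lra.
  - intros y Hy. apply continuity_pt_filterlim.
    apply (ex_derive_continuous (V := R_NormedModule)). exists (f' y). apply H, Hb; exact Hy.
  - assert (Hc' := Hb c Hc).
    assert (Hb2 : forall y, Rmin x c <= y <= Rmax x c -> Rabs (y - x) <= Rabs h).
    { intros y Hy. eapply Rle_trans; [| exact Hc']. revert Hy.
      unfold Rmin, Rmax, Rabs. destruct (Rle_dec x c); repeat destruct Rcase_abs; lra. }
    destruct (MVT_gen f' x c f'') as [c2 [Hc2 Ec2]].
    + intros y Hy. apply H, Hb2; lra.
    + intros y Hy. apply continuity_pt_filterlim.
      apply (ex_derive_continuous (V := R_NormedModule)). exists (f'' y). apply H, Hb2; exact Hy.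
    + replace (f (x + h) - f x - h * f' x) with (f'' c2 * (c - x) * h).
      * rewrite !Rabs_mult. rewrite <- (pow2_abs h).
        assert (A : Rabs (f'' c2) <= M) by (apply H, Hb2; exact Hc2).
        replace (M * Rabs h ^ 2) with (M * Rabs h * Rabs h) by ring.
        apply Rmult_le_compat_r; [apply Rabs_pos |].
        apply Rmult_le_compat; try apply Rabs_pos; assumption.
      * rewrite Ec, <- Ec2. ring.
Qed.

Lemma is_derive_of_quadratic_bound (f : R -> R) (x l M : R) :
  (forall h, Rabs h <= 1 -> Rabs (f (x + h) - f x - h * l) <= M * h ^ 2) ->
  is_derive f x l.
Proof.
  intros H. split; [apply (is_linear_scal_l (K := R_AbsRing) (V := R_NormedModule)) |].
  intros y Hy. apply (is_filter_lim_locally_unique (K := R_AbsRing) (V := AbsRing_NormedModule R_AbsRing) x y) in Hy. subst y.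
  intros e.
  assert (HM : 0 < Rabs M + 1) by (pose proof (Rabs_pos M); lra).
  apply (locally_of_Rabs _ _ (Rmin 1 (e / (Rabs M + 1)))).
  { apply Rmin_glb_lt; [lra | apply Rdiv_lt_0_compat; [apply cond_pos | exact HM]]. }
  intros y Hy.
  assert (H1 := Rmin_l 1 (e / (Rabs M + 1))). assert (H2 := Rmin_r 1 (e / (Rabs M + 1))).
  specialize (H (y - x) ltac:(lra)). replace (x + (y - x)) with y in H by ring.
  unfold norm, minus, plus, opp, scal; simpl. unfold abs, mult; simpl.
  replace (f y + - f x + - ((y + - x) * l)) with (f y - f x - (y - x) * l) by ring.
  eapply Rle_trans; [exact H |]. rewrite <- (pow2_abs (y - x)).
  change (y + - x) with (y - x).
  pose proof (Rabs_pos (y - x)). pose proof (Rle_abs M).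
  assert (A : (Rabs M + 1) * Rabs (y - x) <= e).
  { replace (e : R) with ((Rabs M + 1) * (e / (Rabs M + 1))) by (field; lra).
    apply Rmult_le_compat_l; lra. }
  simpl. nra.
Qed.

(** The first-order Taylor remainder of the integrand is dominated by its second
    derivative, so its integral is [O(h ^ 2)]. *)
Lemma whole_integral_derive (f f1 f2 : R -> R -> R) (z B : R) (I I1 : R -> R) :
  0 <= B ->
  (forall t x, is_derive (fun u => f u t) x (f1 x t)) ->
  (forall t x, is_derive (fun u => f1 u t) x (f2 x t)) ->
  (forall x t, continuous (f x) t) -> (forall x t, continuous (f1 x) t) ->
  (forall x t, Rabs (x - z) <= 1 -> Rabs (f2 x t) <= B / (1 + t ^ 2)) ->
  (forall x, whole_integral (f x) (I x)) -> (forall x, whole_integral (f1 x) (I1 x)) ->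
  is_derive I z (I1 z).
Proof.
  intros HB D1 D2 C0 C1 Hb HI HI1.
  apply (is_derive_of_quadratic_bound _ _ _ (B * PI)). intros h Hh.
  set (g := fun t => 1 * (1 * f (z + h) t + (- 1) * f z t) + (- h) * f1 z t).
  assert (Cd : forall t, continuous (fun t => 1 * f (z + h) t + (- 1) * f z t) t).
  { intros t. apply (continuous_plus (V := R_NormedModule));
      apply (continuous_scal_r (V := R_NormedModule)); apply C0. }
  assert (Hg : whole_integral g (I (z + h) - I z - h * I1 z)).
  { replace (I (z + h) - I z - h * I1 z) with (1 * (1 * I (z + h) + (-1) * I z) + (- h) * I1 z) by ring.
    apply whole_integral_lin; [exact Cd | apply C1 | | apply HI1].
    apply whole_integral_lin; auto. }
  apply (whole_integral_abs_le g); [exact Hg |].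
  intros a b Hab.
  assert (Hdom : dominated g (B * h ^ 2)).
  { split.
    - intros t. apply (continuous_plus (V := R_NormedModule));
        apply (continuous_scal_r (V := R_NormedModule)); auto.
    - intros t. unfold g.
      replace (1 * (1 * f (z + h) t + -1 * f z t) + - h * f1 z t)
        with (f (z + h) t - f z t - h * f1 z t) by ring.
      replace (B * h ^ 2 / (1 + t ^ 2)) with (B / (1 + t ^ 2) * h ^ 2) by (field; nra).
      apply (taylor1_bound (fun u => f u t) (fun u => f1 u t) (fun u => f2 u t)).
      intros y Hy. split; [apply D1 | split; [apply D2 | apply Hb; lra]]. }
  eapply Rle_trans; [apply (dominated_RInt_le g _ a b Hdom Hab) |].
  pose proof (atan_bound a). pose proof (atan_bound b).
  assert (0 <= B * h ^ 2) by (apply Rmult_le_pos; [exact HB | apply pow2_ge_0]).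
  replace (B * PI * h ^ 2) with (B * h ^ 2 * PI) by ring.
  apply Rmult_le_compat_l; lra.
Qed.

(** * The Airy integral on a shifted line *)

(** The Airy integrand at the point [t - i s] has modulus [airy_env s z t] and
    argument [- airy_phase s z t]. *)
Definition airy_env (s z t : R) : R := exp (- s * t ^ 2 + s ^ 3 / 3 - z * s).
Definition airy_phase (s z t : R) : R := t ^ 3 / 3 - t * s ^ 2 + z * t.
(** The real part for [al = 0] and the imaginary part for [al = PI / 2] of the
    integrand on the line at height [s]. *)
Definition airy_line (al s z t : R) : R := airy_env s z t * cos (airy_phase s z t + al).
Definition airy_line_conj (al s z t : R) : R := - (airy_env s z t * sin (airy_phase s z t + al)).

(** The common value of the two partial derivatives in the Cauchy-Riemann
    equation for [airy_line] and [airy_line_conj]. *)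
Definition airy_line_ds (al s z t : R) : R :=
  airy_env s z t * ((- t ^ 2 + s ^ 2 - z) * cos (airy_phase s z t + al)
                    + 2 * t * s * sin (airy_phase s z t + al)).

Ltac fold_airy e c sn :=
  set (E := exp e); set (P := cos c); set (Q := sin sn);
  repeat match goal with |- context [exp ?x] => change (exp x) with E end;
  repeat match goal with |- context [cos ?x] => change (cos x) with P end;
  repeat match goal with |- context [sin ?x] => change (sin x) with Q end.

Lemma airy_line_derive_s (al s z t : R) :
  is_derive (fun s => airy_line al s z t) s (airy_line_ds al s z t).
Proof.
  unfold airy_line, airy_line_ds, airy_env, airy_phase. auto_derive; [trivial |].
  fold_airy (- s * t ^ 2 + s ^ 3 / 3 - z * s) (t ^ 3 / 3 - t * s ^ 2 + z * t + al)
    (t ^ 3 / 3 - t * s ^ 2 + z * t + al).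
  field.
Qed.

Lemma airy_line_conj_derive_t (al s z t : R) :
  is_derive (fun t => airy_line_conj al s z t) t (airy_line_ds al s z t).
Proof.
  unfold airy_line_conj, airy_line_ds, airy_env, airy_phase. auto_derive; [trivial |].
  fold_airy (- s * t ^ 2 + s ^ 3 / 3 - z * s) (t ^ 3 / 3 - t * s ^ 2 + z * t + al)
    (t ^ 3 / 3 - t * s ^ 2 + z * t + al).
  field.
Qed.

Lemma continuity_2d_airy_line_ds (al z s t : R) :
  continuity_2d_pt (fun s t => airy_line_ds al s z t) s t.
Proof.
  assert (Cs : continuity_2d_pt (fun s t => s) s t) by apply continuity_2d_pt_id1.
  assert (Ct : continuity_2d_pt (fun s t => t) s t) by apply continuity_2d_pt_id2.
  assert (Cc : forall c, continuity_2d_pt (fun s t => c) s t) by (intros; apply continuity_2d_pt_const).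
  assert (P2 : forall f, continuity_2d_pt f s t -> continuity_2d_pt (fun s t => f s t ^ 2) s t).
  { intros f Hf. apply continuity_2d_pt_mult; [exact Hf |].
    apply continuity_2d_pt_mult; [exact Hf | apply Cc]. }
  assert (P3 : forall f, continuity_2d_pt f s t -> continuity_2d_pt (fun s t => f s t ^ 3) s t).
  { intros f Hf. apply (continuity_2d_pt_mult f (fun s t => f s t ^ 2)); [exact Hf | apply P2; exact Hf]. }
  assert (Cph : continuity_2d_pt (fun s t => airy_phase s z t + al) s t).
  { unfold airy_phase, Rdiv.
    apply continuity_2d_pt_plus; [| apply Cc].
    apply continuity_2d_pt_plus; [apply continuity_2d_pt_minus |].
    - apply continuity_2d_pt_mult; [apply (P3 (fun s t => t)); exact Ct | apply Cc].
    - apply continuity_2d_pt_mult; [exact Ct | apply (P2 (fun s t => s)); exact Cs].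
    - apply continuity_2d_pt_mult; [apply Cc | exact Ct]. }
  unfold airy_line_ds. apply continuity_2d_pt_mult.
  - unfold airy_env. apply (continuity_1d_2d_pt_comp exp).
    + apply derivable_continuous_pt, derivable_pt_exp.
    + unfold Rdiv. apply continuity_2d_pt_minus; [apply continuity_2d_pt_plus |].
      * apply continuity_2d_pt_mult; [apply continuity_2d_pt_opp; exact Cs | apply (P2 (fun s t => t)); exact Ct].
      * apply continuity_2d_pt_mult; [apply (P3 (fun s t => s)); exact Cs | apply Cc].
      * apply continuity_2d_pt_mult; [apply Cc | exact Cs].
  - apply continuity_2d_pt_plus; apply continuity_2d_pt_mult.
    + apply continuity_2d_pt_minus; [apply continuity_2d_pt_plus |].
      * apply (continuity_2d_pt_ext (fun s t => - (t ^ 2))); [intros; ring |].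
        apply continuity_2d_pt_opp, (P2 (fun s t => t)); exact Ct.
      * apply (P2 (fun s t => s)); exact Cs.
      * apply Cc.
    + apply (continuity_1d_2d_pt_comp cos); [apply continuity_cos | exact Cph].
    + apply continuity_2d_pt_mult; [apply continuity_2d_pt_mult; [apply Cc | exact Ct] | exact Cs].
    + apply (continuity_1d_2d_pt_comp sin); [apply continuity_sin | exact Cph].
Qed.

Lemma airy_line_continuous (al s z t : R) : continuous (airy_line al s z) t.
Proof.
  apply (ex_derive_continuous (V := R_NormedModule)).
  unfold airy_line, airy_env, airy_phase. auto_derive. trivial.
Qed.

(** Analyticity in [t - i s] turns the derivative in [s] into a derivative in
    [t], so moving the line costs only boundary terms. *)
Lemma airy_segment_derive (al z a b s : R) :
  is_derive (fun s => RInt (airy_line al s z) a b) s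
    (airy_line_conj al s z b - airy_line_conj al s z a).
Proof.
  assert (E : RInt (fun t => Derive (fun u => airy_line al u z t) s) a b
     = airy_line_conj al s z b - airy_line_conj al s z a).
  { apply is_RInt_unique.
    apply (is_RInt_ext (V := R_NormedModule) (fun t => airy_line_ds al s z t)).
    - intros t _. symmetry. apply is_derive_unique, airy_line_derive_s.
    - apply (is_RInt_derive (V := R_CompleteNormedModule) (fun t => airy_line_conj al s z t)).
      + intros t _; apply airy_line_conj_derive_t.
      + intros t _. apply (ex_derive_continuous (V := R_NormedModule)).
        unfold airy_line_ds, airy_env, airy_phase. auto_derive. trivial. }
  rewrite <- E.
  apply (is_derive_RInt_param (fun s t => airy_line al s z t)).
  - apply filter_forall. intros y t _. eexists. apply airy_line_derive_s.
  - intros t _. apply (continuity_2d_pt_ext (fun s t => airy_line_ds al s z t)).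
    + intros u v. symmetry. apply is_derive_unique, airy_line_derive_s.
    + apply continuity_2d_airy_line_ds.
  - apply filter_forall. intros y. apply continuous_ex_RInt. intros; apply airy_line_continuous.
Qed.

Lemma airy_line_conj_le (al s z b : R) :
  0 <= s <= 1 -> 2 * Rabs z + 1 <= b ^ 2 ->
  Rabs (airy_line_conj al s z b) <= exp (- (b ^ 2 / 2) * s).
Proof.
  intros Hs Hb. unfold airy_line_conj. rewrite Rabs_Ropp, Rabs_mult.
  assert (S1 : Rabs (sin (airy_phase s z b + al)) <= 1) by (apply Rabs_le, SIN_bound).
  assert (E1 : 0 < airy_env s z b) by apply exp_pos.
  rewrite (Rabs_pos_eq (airy_env s z b)) by lra.
  apply Rle_trans with (airy_env s z b); [pose proof (Rabs_pos (sin (airy_phase s z b + al))); nra |].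
  unfold airy_env.
  assert (Hle : - s * b ^ 2 + s ^ 3 / 3 - z * s <= - (b ^ 2 / 2) * s).
  { assert (s ^ 3 <= s) by (assert (s ^ 2 <= 1) by nra; simpl in *; nra).
    pose proof (Rle_abs (- z)) as Hz. rewrite Rabs_Ropp in Hz. nra. }
  destruct (Rle_lt_or_eq _ _ Hle) as [H | ->]; [left; apply exp_increasing; exact H | lra].
Qed.

Lemma decreasing_of_derive_nonpos (f f' : R -> R) (a b : R) :
  a <= b -> (forall x, a <= x <= b -> is_derive f x (f' x)) ->
  (forall x, a <= x <= b -> f' x <= 0) -> f b <= f a.
Proof.
  intros Hab Hd Hn.
  destruct (MVT_gen f a b f') as [c [Hc E]].
  - intros x Hx. rewrite Rmin_left, Rmax_right in Hx by lra. apply Hd; lra.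
  - intros x Hx. rewrite Rmin_left, Rmax_right in Hx by lra.
    apply continuity_pt_filterlim, (ex_derive_continuous (V := R_NormedModule)).
    exists (f' x); apply Hd; lra.
  - rewrite Rmin_left, Rmax_right in Hc by lra. specialize (Hn c Hc). nra.
Qed.

Lemma airy_shift_error (al z a b : R) :
  2 * Rabs z + 1 <= a ^ 2 -> 2 * Rabs z + 1 <= b ^ 2 ->
  Rabs (RInt (airy_line al 1 z) a b - RInt (airy_line al 0 z) a b) <= 2 / a ^ 2 + 2 / b ^ 2.
Proof.
  intros Ha Hb. pose proof (Rabs_pos z).
  set (h := fun s => 2 / a ^ 2 * exp (- (a ^ 2 / 2) * s) + 2 / b ^ 2 * exp (- (b ^ 2 / 2) * s)).
  set (h' := fun s => - exp (- (a ^ 2 / 2) * s) - exp (- (b ^ 2 / 2) * s)).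
  assert (Ha0 : a <> 0) by (intros ->; simpl in Ha; lra).
  assert (Hb0 : b <> 0) by (intros ->; simpl in Hb; lra).
  assert (Dh : forall s, is_derive h s (h' s)).
  { intros s. unfold h, h'. auto_derive; [trivial |].
    replace (a * (a * 1)) with (a ^ 2) by ring. replace (b * (b * 1)) with (b ^ 2) by ring. field. split; assumption. }
  assert (H0 : h 0 = 2 / a ^ 2 + 2 / b ^ 2) by (unfold h; rewrite !Rmult_0_r, exp_0; ring).
  assert (H1 : 0 <= h 1).
  { unfold h. pose proof (exp_pos (- (a ^ 2 / 2) * 1)). pose proof (exp_pos (- (b ^ 2 / 2) * 1)).
    assert (0 < 2 / a ^ 2) by (apply Rdiv_lt_0_compat; lra).
    assert (0 < 2 / b ^ 2) by (apply Rdiv_lt_0_compat; lra). nra. }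
  set (G := fun s => RInt (airy_line al s z) a b).
  assert (DG := airy_segment_derive al z a b). fold G in DG.
  change (Rabs (G 1 - G 0) <= 2 / a ^ 2 + 2 / b ^ 2).
  assert (B : forall s, 0 <= s <= 1 ->
     Rabs (airy_line_conj al s z b - airy_line_conj al s z a) <= - h' s).
  { intros s Hs. assert (B1 := airy_line_conj_le al s z b Hs Hb).
    assert (B2 := airy_line_conj_le al s z a Hs Ha). unfold h'.
    unfold Rminus at 1. eapply Rle_trans; [apply Rabs_triang |]. rewrite Rabs_Ropp. lra. }
  apply Rabs_le. split.
  - assert (A := decreasing_of_derive_nonpos (fun s => h s - G s)
       (fun s => h' s - (airy_line_conj al s z b - airy_line_conj al s z a)) 0 1 ltac:(lra)).
    cbv beta in A. enough (h 1 - G 1 <= h 0 - G 0) by lra. apply A.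
    + intros s Hs. apply (is_derive_minus (V := R_NormedModule)); [apply Dh | apply DG].
    + intros s Hs. specialize (B s Hs). apply Rabs_le_between in B. lra.
  - assert (A := decreasing_of_derive_nonpos (fun s => h s + G s)
       (fun s => h' s + (airy_line_conj al s z b - airy_line_conj al s z a)) 0 1 ltac:(lra)).
    cbv beta in A. enough (h 1 + G 1 <= h 0 + G 0) by lra. apply A.
    + intros s Hs. apply (is_derive_plus (V := R_NormedModule)); [apply Dh | apply DG].
    + intros s Hs. specialize (B s Hs). apply Rabs_le_between in B. lra.
Qed.

(** The integrand decays like [exp (- s * b ^ 2 / 2)] on the vertical segments at
    the ends, so the boundary terms integrate to [O(1 / b ^ 2)] even though the line
    [s = 0] is only conditionally convergent. *)
Lemma whole_integral_shift (al z I : R) :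
  whole_integral (airy_line al 1 z) I -> whole_integral (airy_line al 0 z) I.
Proof.
  intros HI P [e He].
  assert (He2 : 0 < e / 2) by (pose proof (cond_pos e); lra).
  specialize (HI (ball I (mkposreal _ He2)) (locally_ball I _)).
  pose proof (Rabs_pos z). pose proof (cond_pos e).
  set (M := 2 * Rabs z + 1 + 8 / e).
  assert (He8 : 0 < 8 / e) by (apply Rdiv_lt_0_compat; lra).
  unfold filtermap.
  apply (filter_imp (F := ends) (fun ab => ball I (mkposreal _ He2) (RInt (airy_line al 1 z) (fst ab) (snd ab)) /\
    (fst ab < - M /\ M < snd ab))).
  - intros [a b] [H1 [H2 H3]]. simpl in *. apply He.
    assert (Ha : M <= a ^ 2) by (unfold M in *; nra).
    assert (Hb : M <= b ^ 2) by (unfold M in *; nra).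
    assert (S := airy_shift_error al z a b ltac:(unfold M in *; lra) ltac:(unfold M in *; lra)).
    assert (Q : forall x, M <= x -> 2 / x <= e / 4).
    { intros x Hx. apply Rle_div_l; [unfold M in Hx; lra |].
      assert (e * (8 / e) = 8) by (field; lra). unfold M in Hx. nra. }
    assert (Q1 := Q _ Ha). assert (Q2 := Q _ Hb).
    unfold ball in H1 |- *; simpl in H1 |- *; unfold AbsRing_ball, abs, minus, plus, opp in H1 |- *; simpl in H1 |- *.
    change (Rabs (RInt (airy_line al 1 z) a b - I) < e / 2) in H1.
    change (Rabs (RInt (airy_line al 0 z) a b - I) < e).
    apply Rabs_le_between in S. apply Rabs_def2 in H1. apply Rabs_def1; lra.
  - apply filter_and; [exact HI | apply ends_ball].
Qed.

(** The derivatives in [z] of the integrand on the line [s = 1]; the phase is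
    that of the real part. *)
Definition airy_d0 (z t : R) : R := airy_env 1 z t * cos (airy_phase 1 z t).
Definition airy_d1 (z t : R) : R :=
  airy_env 1 z t * (- cos (airy_phase 1 z t) - t * sin (airy_phase 1 z t)).
Definition airy_d2 (z t : R) : R :=
  airy_env 1 z t * ((1 - t ^ 2) * cos (airy_phase 1 z t) + 2 * t * sin (airy_phase 1 z t)).
Definition airy_d3 (z t : R) : R :=
  airy_env 1 z t * ((3 * t ^ 2 - 1) * cos (airy_phase 1 z t) + (t ^ 3 - 3 * t) * sin (airy_phase 1 z t)).

Lemma airy_d0_derive (z t : R) : is_derive (fun u => airy_d0 u t) z (airy_d1 z t).
Proof.
  unfold airy_d0, airy_d1, airy_env, airy_phase. auto_derive; [trivial |].
  fold_airy (- 1 * t ^ 2 + 1 ^ 3 / 3 - z * 1) (t ^ 3 / 3 - t * 1 ^ 2 + z * t)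
    (t ^ 3 / 3 - t * 1 ^ 2 + z * t).
  ring.
Qed.

Lemma airy_d1_derive (z t : R) : is_derive (fun u => airy_d1 u t) z (airy_d2 z t).
Proof.
  unfold airy_d1, airy_d2, airy_env, airy_phase. auto_derive; [trivial |].
  fold_airy (- 1 * t ^ 2 + 1 ^ 3 / 3 - z * 1) (t ^ 3 / 3 - t * 1 ^ 2 + z * t)
    (t ^ 3 / 3 - t * 1 ^ 2 + z * t).
  ring.
Qed.

Lemma airy_d2_derive (z t : R) : is_derive (fun u => airy_d2 u t) z (airy_d3 z t).
Proof.
  unfold airy_d2, airy_d3, airy_env, airy_phase. auto_derive; [trivial |].
  fold_airy (- 1 * t ^ 2 + 1 ^ 3 / 3 - z * 1) (t ^ 3 / 3 - t * 1 ^ 2 + z * t)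
    (t ^ 3 / 3 - t * 1 ^ 2 + z * t).
  ring.
Qed.

(** The constant is [216 = 8 * 27], where [27] bounds [exp (- u) * (1 + u) ^ 3] for
    [u >= 0] by way of [1 + u / 3 <= exp (u / 3)]. *)
Lemma gaussian_polynomial_le (z t p q c s : R) :
  Rabs p <= 4 * (1 + t ^ 2) ^ 2 -> Rabs q <= 4 * (1 + t ^ 2) ^ 2 -> Rabs c <= 1 -> Rabs s <= 1 ->
  Rabs (airy_env 1 z t * (p * c + q * s)) <= 216 * exp (1 / 3 - z) / (1 + t ^ 2).
Proof.
  intros Hp Hq Hc Hs.
  assert (Ht : 0 < 1 + t ^ 2) by nra.
  assert (E : airy_env 1 z t = exp (1 / 3 - z) * exp (- t ^ 2)).
  { unfold airy_env. rewrite <- exp_plus. f_equal. field. }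
  assert (G : exp (- t ^ 2) * (1 + t ^ 2) ^ 3 <= 27).
  { assert (A := exp_ineq1_le (t ^ 2 / 3)).
    assert (A3 : (1 + t ^ 2 / 3) ^ 3 <= exp (t ^ 2)).
    { replace (exp (t ^ 2)) with (exp (t ^ 2 / 3) ^ 3).
      - apply pow_incr. split; [nra | exact A].
      - replace (exp (t ^ 2 / 3) ^ 3) with (exp (t ^ 2 / 3) * exp (t ^ 2 / 3) * exp (t ^ 2 / 3)) by ring.
        rewrite <- !exp_plus. f_equal. field. }
    assert (A4 : (1 + t ^ 2) ^ 3 <= 27 * (1 + t ^ 2 / 3) ^ 3).
    { replace (27 * (1 + t ^ 2 / 3) ^ 3) with ((3 + t ^ 2) ^ 3) by field.
      apply pow_incr. nra. }
    apply Rle_trans with (exp (- t ^ 2) * (27 * exp (t ^ 2))).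
    - apply Rmult_le_compat_l; [left; apply exp_pos | lra].
    - replace (exp (- t ^ 2) * (27 * exp (t ^ 2))) with (27 * (exp (- t ^ 2) * exp (t ^ 2))) by ring.
      rewrite <- exp_plus. replace (- t ^ 2 + t ^ 2) with 0 by ring. rewrite exp_0. lra. }
  rewrite Rabs_mult, (Rabs_pos_eq (airy_env 1 z t)) by (left; apply exp_pos).
  assert (Hpq : Rabs (p * c + q * s) <= 8 * (1 + t ^ 2) ^ 2).
  { eapply Rle_trans; [apply Rabs_triang |]. rewrite !Rabs_mult.
    pose proof (Rabs_pos p); pose proof (Rabs_pos q). nra. }
  rewrite E. apply (proj1 (Rle_div_r _ _ _ Ht)).
  pose proof (exp_pos (1 / 3 - z)). pose proof (exp_pos (- t ^ 2)).
  apply Rle_trans with (exp (1 / 3 - z) * (8 * (exp (- t ^ 2) * (1 + t ^ 2) ^ 3))).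
  - replace (exp (1 / 3 - z) * (8 * (exp (- t ^ 2) * (1 + t ^ 2) ^ 3)))
      with (exp (1 / 3 - z) * exp (- t ^ 2) * (8 * (1 + t ^ 2) ^ 2) * (1 + t ^ 2)) by ring.
    apply Rmult_le_compat_r; [lra |]. apply Rmult_le_compat_l; [nra | exact Hpq].
  - nra.
Qed.

Lemma airy_derivatives_dominated (z : R) :
  dominated (airy_d0 z) (216 * exp (1 / 3 - z)) /\
  dominated (airy_d1 z) (216 * exp (1 / 3 - z)) /\
  dominated (airy_d2 z) (216 * exp (1 / 3 - z)) /\
  (forall t, Rabs (airy_d3 z t) <= 216 * exp (1 / 3 - z) / (1 + t ^ 2)).
Proof.
  assert (Hc : forall t, Rabs (cos (airy_phase 1 z t)) <= 1) by (intros; apply Rabs_le, COS_bound).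
  assert (Hs : forall t, Rabs (sin (airy_phase 1 z t)) <= 1) by (intros; apply Rabs_le, SIN_bound).
  assert (T4 : forall t, t ^ 4 = t ^ 2 * t ^ 2) by (intros; ring).
  split; [| split; [| split]].
  - split.
    + intros t. apply (ex_derive_continuous (V := R_NormedModule)).
      unfold airy_d0, airy_env, airy_phase. auto_derive. trivial.
    + intros t. unfold airy_d0.
      replace (cos (airy_phase 1 z t)) with (1 * cos (airy_phase 1 z t) + 0 * sin (airy_phase 1 z t)) by ring.
      apply gaussian_polynomial_le; auto; apply Rabs_le; nra.
  - split.
    + intros t. apply (ex_derive_continuous (V := R_NormedModule)).
      unfold airy_d1, airy_env, airy_phase. auto_derive. trivial.
    + intros t. unfold airy_d1.
      replace (- cos (airy_phase 1 z t) - t * sin (airy_phase 1 z t))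
        with ((- 1) * cos (airy_phase 1 z t) + (- t) * sin (airy_phase 1 z t)) by ring.
      apply gaussian_polynomial_le; auto; apply Rabs_le; nra.
  - split.
    + intros t. apply (ex_derive_continuous (V := R_NormedModule)).
      unfold airy_d2, airy_env, airy_phase. auto_derive. trivial.
    + intros t. unfold airy_d2.
      apply gaussian_polynomial_le; auto; apply Rabs_le; nra.
  - intros t. unfold airy_d3.
    assert (0 <= t ^ 2) by apply pow2_ge_0.
    apply gaussian_polynomial_le; auto; apply Rabs_le.
    + nra.
    + replace (t ^ 3) with (t * t ^ 2) by ring.
      assert (0 <= (1 + t) * (1 + t)) by apply Rle_0_sqr.
      assert (0 <= (1 - t) * (1 - t)) by apply Rle_0_sqr.
      assert (- (1 + t ^ 2) <= 2 * t <= 1 + t ^ 2) by (split; lra).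
      set (u := t ^ 2) in *.
      assert (0 <= (1 + u - 2 * t) * u) by (apply Rmult_le_pos; lra).
      assert (0 <= (1 + u + 2 * t) * u) by (apply Rmult_le_pos; lra).
      assert (0 <= u * u) by (apply Rmult_le_pos; assumption).
      simpl pow. split; lra.
Qed.

Lemma Ai_whole_integral (z I : R) :
  whole_integral (airy_d0 z) I -> Ai z = / (2 * PI) * I.
Proof.
  intros HI.
  assert (HR : whole_integral (airy_line 0 0 z) I).
  { apply whole_integral_shift. eapply filterlim_ext; [| exact HI].
    intros ab. apply RInt_ext. intros t _. unfold airy_d0, airy_line. rewrite Rplus_0_r. reflexivity. }
  assert (HJ : exists J, whole_integral (airy_line (PI / 2) 0 z) J).
  { destruct (whole_integral_exists (airy_line (PI / 2) 1 z) (216 * exp (1 / 3 - z))) as [J HJ].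
    - split; [intros; apply airy_line_continuous |]. intros t. unfold airy_line.
      replace (cos (airy_phase 1 z t + PI / 2)) with (0 * 0 + 1 * cos (airy_phase 1 z t + PI / 2)) by ring.
      apply gaussian_polynomial_le.
      + apply Rabs_le. nra.
      + apply Rabs_le. nra.
      + rewrite Rabs_R0; lra.
      + apply Rabs_le, COS_bound.
    - pose proof (exp_pos (1 / 3 - z)); lra.
    - exists J. apply whole_integral_shift. exact HJ. }
  destruct HJ as [J HJ].
  unfold Ai. f_equal.
  rewrite (is_RInt_gen_unique (V := C_R_CompleteNormedModule) _ ((I, J) : C)); [reflexivity |].
  intros P HP.
  assert (Hlim : filterlim (fun ab => (RInt (airy_line 0 0 z) (fst ab) (snd ab),
     RInt (airy_line (PI / 2) 0 z) (fst ab) (snd ab))) ends (filter_prod (locally I) (locally J))).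
  { apply filterlim_pair; assumption. }
  assert (HP' : filter_prod (locally I) (locally J) P).
  { destruct HP as [e He].
    exists (ball I e) (ball J e); [apply locally_ball | apply locally_ball |].
    intros x y Hx Hy. apply He. split; assumption. }
  specialize (Hlim P HP'). unfold filtermap in Hlim. unfold filtermapi.
  eapply filter_imp; [| exact Hlim].
  intros [a b] HPab. simpl in *.
  eexists; split; [| exact HPab].
  apply (is_RInt_fct_extend_pair (U := R_NormedModule) (V := R_NormedModule)).
  - apply (is_RInt_ext (V := R_NormedModule) (airy_line 0 0 z)).
    + intros t _. unfold airy_line, airy_env, airy_phase, Cexp; simpl.
      match goal with |- exp ?x * cos ?y = exp ?x' * cos ?y' =>
        replace x with x' by (simpl; field); replace (cos y) with (cos y'); [reflexivity |];
        rewrite <- cos_neg; f_equal; simpl; field end.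
    + apply (RInt_correct (V := R_CompleteNormedModule)), continuous_ex_RInt.
      intros; apply airy_line_continuous.
  - apply (is_RInt_ext (V := R_NormedModule) (airy_line (PI / 2) 0 z)).
    + intros t _. unfold airy_line, airy_env, airy_phase, Cexp; simpl.
      rewrite cos_plus, cos_PI2, sin_PI2.
      match goal with |- exp ?x * (cos ?p * 0 - sin ?p * 1) = exp ?x' * sin ?q =>
        replace x with x' by (simpl; field);
        replace (sin q) with (- sin p) by (rewrite <- sin_neg; f_equal; simpl; field) end.
      ring.
    + apply (RInt_correct (V := R_CompleteNormedModule)), continuous_ex_RInt.
      intros; apply airy_line_continuous.
Qed.

(** The shifted integrals converge absolutely and may be differentiated; the
    integrand of [Ai'' z - z * Ai z] is a total derivative in [t]. *)
Lemma Ai_equation :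
  exists (Ai' : R -> R) (B : R), 0 <= B /\ forall z : R,
    is_derive Ai z (Ai' z) /\ is_derive Ai' z (z * Ai z) /\
    Rabs (Ai z) <= B * exp (- z) /\ Rabs (Ai' z) <= B * exp (- z).
Proof.
  assert (Hpos : forall z, 0 <= 216 * exp (1 / 3 - z)) by (intros z; pose proof (exp_pos (1 / 3 - z)); lra).
  assert (X0 : forall z, exists I, whole_integral (airy_d0 z) I).
  { intros z. apply (whole_integral_exists _ _ (proj1 (airy_derivatives_dominated z))), Hpos. }
  assert (X1 : forall z, exists I, whole_integral (airy_d1 z) I).
  { intros z. apply (whole_integral_exists _ _ (proj1 (proj2 (airy_derivatives_dominated z)))), Hpos. }
  assert (X2 : forall z, exists I, whole_integral (airy_d2 z) I).
  { intros z. apply (whole_integral_exists _ _ (proj1 (proj2 (proj2 (airy_derivatives_dominated z))))), Hpos. }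
  apply functional_choice in X0. apply functional_choice in X1. apply functional_choice in X2.
  destruct X0 as [I0 HI0]. destruct X1 as [I1 HI1]. destruct X2 as [I2 HI2].
  assert (Hexp : forall x z, Rabs (x - z) <= 1 -> 216 * exp (1 / 3 - x) <= 216 * exp (4 / 3 - z)).
  { intros x z Hx. apply Rabs_le_between in Hx. apply Rmult_le_compat_l; [lra |].
    destruct (Rle_lt_or_eq (1 / 3 - x) (4 / 3 - z)) as [H | ->]; [lra | left; apply exp_increasing; exact H | lra]. }
  assert (Hdiv : forall a b t, a <= b -> a / (1 + t ^ 2) <= b / (1 + t ^ 2)).
  { intros a b t H. apply Rmult_le_compat_r; [left; apply Rinv_0_lt_compat; nra | exact H]. }
  assert (D0 : forall z, is_derive I0 z (I1 z)).
  { intros z. apply (whole_integral_derive airy_d0 airy_d1 airy_d2 z (216 * exp (4 / 3 - z))); auto.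
    - pose proof (exp_pos (4 / 3 - z)); lra.
    - intros; apply airy_d0_derive.
    - intros; apply airy_d1_derive.
    - intros x; apply (airy_derivatives_dominated x).
    - intros x; apply (airy_derivatives_dominated x).
    - intros x t Hx. eapply Rle_trans; [apply (proj1 (proj2 (proj2 (airy_derivatives_dominated x)))) |].
      apply Hdiv, Hexp, Hx. }
  assert (D1 : forall z, is_derive I1 z (I2 z)).
  { intros z. apply (whole_integral_derive airy_d1 airy_d2 airy_d3 z (216 * exp (4 / 3 - z))); auto.
    - pose proof (exp_pos (4 / 3 - z)); lra.
    - intros; apply airy_d1_derive.
    - intros; apply airy_d2_derive.
    - intros x; apply (airy_derivatives_dominated x).
    - intros x; apply (airy_derivatives_dominated x).
    - intros x t Hx. eapply Rle_trans; [apply (airy_derivatives_dominated x) |].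
      apply Hdiv, Hexp, Hx. }
  assert (E2 : forall z, I2 z = z * I0 z).
  { intros z.
    assert (L : whole_integral (fun t => 1 * airy_d2 z t + (- z) * airy_d0 z t) (1 * I2 z + (- z) * I0 z)).
    { apply whole_integral_lin; auto; apply (airy_derivatives_dominated z). }
    assert (Z : whole_integral (fun t => 1 * airy_d2 z t + (- z) * airy_d0 z t) 0).
    { apply (whole_integral_of_derivative (fun t => - (airy_env 1 z t * sin (airy_phase 1 z t))) _
        (216 * exp (1 / 3 - z))).
      - intros t. unfold airy_d2, airy_d0, airy_env, airy_phase. auto_derive; [trivial |].
        fold_airy (- 1 * t ^ 2 + 1 ^ 3 / 3 - z * 1) (t ^ 3 / 3 - t * 1 ^ 2 + z * t)
          (t ^ 3 / 3 - t * 1 ^ 2 + z * t).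
        field.
      - intros t. apply (continuous_plus (V := R_NormedModule));
          apply (continuous_scal_r (V := R_NormedModule)); apply (airy_derivatives_dominated z).
      - intros t. rewrite Rabs_Ropp.
        replace (sin (airy_phase 1 z t)) with (0 * 0 + 1 * sin (airy_phase 1 z t)) by ring.
        apply gaussian_polynomial_le.
        + apply Rabs_le. nra.
        + apply Rabs_le. nra.
        + rewrite Rabs_R0; lra.
        + apply Rabs_le, SIN_bound. }
    assert (E := whole_integral_unique _ _ _ L Z). lra. }
  assert (HPI := PI_RGT_0).
  assert (Hk : 0 < / (2 * PI)) by (apply Rinv_0_lt_compat; lra).
  assert (EAi : forall z, Ai z = / (2 * PI) * I0 z) by (intros z; apply Ai_whole_integral, HI0).
  assert (Hbd : forall g B z I, 0 <= B -> dominated g (216 * exp (1 / 3 - z)) -> whole_integral g I ->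
    B = 108 * exp (1 / 3) -> Rabs (/ (2 * PI) * I) <= B * exp (- z)).
  { intros g B z I HB Hd HI EB. rewrite Rabs_mult, Rabs_pos_eq by lra.
    assert (A : Rabs I <= 216 * exp (1 / 3 - z) * PI).
    { apply (whole_integral_abs_le g); [exact HI |]. intros a b Hab.
      eapply Rle_trans; [apply (dominated_RInt_le g _ a b Hd Hab) |].
      apply Rmult_le_compat_l; [apply Hpos |].
      pose proof (atan_bound a); pose proof (atan_bound b); lra. }
    apply Rle_trans with (/ (2 * PI) * (216 * exp (1 / 3 - z) * PI)).
    - apply Rmult_le_compat_l; lra.
    - rewrite EB. unfold Rminus at 1. rewrite exp_plus. right. field. lra. }
  exists (fun z => / (2 * PI) * I1 z), (108 * exp (1 / 3)).
  pose proof (exp_pos (1 / 3)).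
  split; [lra |]. intros z. split; [| split; [| split]].
  - apply (is_derive_ext (fun z => / (2 * PI) * I0 z)); [intros; symmetry; apply EAi |].
    apply (is_derive_scal I0 z (/ (2 * PI))), D0.
  - rewrite EAi. replace (z * (/ (2 * PI) * I0 z)) with (/ (2 * PI) * I2 z) by (rewrite E2; ring).
    apply (is_derive_scal I1 z (/ (2 * PI))), D1.
  - rewrite EAi. apply (Hbd (airy_d0 z)); auto; [lra | apply (airy_derivatives_dominated z)].
  - apply (Hbd (airy_d1 z)); auto; [lra | apply (airy_derivatives_dominated z)].
Qed.

(** * Decaying solutions of the Airy equation *)

Lemma increasing_of_derive_nonneg (f f' : R -> R) (a b : R) :
  a <= b -> (forall x, a <= x <= b -> is_derive f x (f' x)) ->
  (forall x, a <= x <= b -> 0 <= f' x) -> f a <= f b.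
Proof.
  intros Hab Hd Hn.
  assert (A := decreasing_of_derive_nonpos (fun x => - f x) (fun x => - f' x) a b Hab).
  enough (- f b <= - f a) by lra. apply A.
  - intros x Hx. apply (is_derive_opp (V := R_NormedModule)), Hd, Hx.
  - intros x Hx. specialize (Hn x Hx). lra.
Qed.

Lemma gronwall (f f' : R -> R) (L a b : R) :
  a <= b -> (forall x, a <= x <= b -> is_derive f x (f' x)) ->
  (forall x, a <= x <= b -> Rabs (f' x) <= L * f x) ->
  f b <= exp (L * (b - a)) * f a /\ f a <= exp (L * (b - a)) * f b.
Proof.
  intros Hab Hd Hb.
  assert (De : forall k x, is_derive (fun x => exp (k * x)) x (k * exp (k * x))).
  { intros k x. auto_derive; [trivial | ring]. }
  assert (Dm : forall k x, a <= x <= b ->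
     is_derive (fun x => exp (k * x) * f x) x (exp (k * x) * (k * f x + f' x))).
  { intros k x Hx.
    eapply (eq_rect _ (is_derive _ _)).
    - apply (is_derive_mult (fun x => exp (k * x)) f x _ _ (De k x) (Hd x Hx)). exact Rmult_comm.
    - unfold plus, mult; simpl. ring. }
  assert (S : forall k u v, exp (k * (u - v)) = exp (k * u) * exp (- (k * v))).
  { intros k u v. rewrite <- exp_plus. f_equal. ring. }
  split.
  - assert (A : exp (- L * b) * f b <= exp (- L * a) * f a).
    { apply (decreasing_of_derive_nonpos (fun x => exp (- L * x) * f x)
        (fun x => exp (- L * x) * (- L * f x + f' x)) a b Hab (Dm (- L))).
      intros x Hx. specialize (Hb x Hx). apply Rabs_le_between in Hb.
      pose proof (exp_pos (- L * x)). nra. }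
    replace (exp (L * (b - a)) * f a) with (exp (L * b) * (exp (- L * a) * f a)).
    + replace (f b) with (exp (L * b) * (exp (- L * b) * f b)).
      * apply Rmult_le_compat_l; [left; apply exp_pos | exact A].
      * rewrite <- Rmult_assoc, <- exp_plus. replace (L * b + - L * b) with 0 by ring. rewrite exp_0; ring.
    + rewrite S, Rmult_assoc. do 3 f_equal. ring.
  - assert (A : exp (L * a) * f a <= exp (L * b) * f b).
    { apply (increasing_of_derive_nonneg (fun x => exp (L * x) * f x)
        (fun x => exp (L * x) * (L * f x + f' x)) a b Hab (Dm L)).
      intros x Hx. specialize (Hb x Hx). apply Rabs_le_between in Hb.
      pose proof (exp_pos (L * x)). nra. }
    rewrite S. rewrite (Rmult_comm (exp (L * b))), Rmult_assoc.
    replace (f a) with (exp (- (L * a)) * (exp (L * a) * f a)).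
    + apply Rmult_le_compat_l; [left; apply exp_pos | exact A].
    + rewrite <- Rmult_assoc, <- exp_plus. replace (- (L * a) + L * a) with 0 by ring. rewrite exp_0; ring.
Qed.

Lemma nonneg_of_decreasing_to_zero (g g' : R -> R) (a B : R) :
  (forall x, a <= x -> is_derive g x (g' x)) -> (forall x, a <= x -> g' x <= 0) ->
  (forall x, a <= x -> Rabs (g x) <= B * exp (- x)) -> forall x, a <= x -> 0 <= g x.
Proof.
  intros Hd Hn Hb x Hx. apply Rnot_lt_le; intros Hneg.
  set (y := Rmax x ((Rabs B + 1) / (- g x))).
  assert (Hy1 : x <= y) by apply Rmax_l. assert (Hy2 : (Rabs B + 1) / (- g x) <= y) by apply Rmax_r.
  assert (H1 : g y <= g x).
  { apply (decreasing_of_derive_nonpos g g' x y Hy1); intros; [apply Hd | apply Hn]; lra. }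
  assert (H2 := Hb y ltac:(lra)).
  pose proof (Rabs_pos B). pose proof (Rle_abs B).
  assert (H3 : Rabs B + 1 <= y * (- g x)).
  { apply (Rmult_le_compat_r (- g x)) in Hy2; [| lra].
    unfold Rdiv in Hy2. rewrite Rmult_assoc, Rinv_l, Rmult_1_r in Hy2 by lra. exact Hy2. }
  assert (H4 : exp (- y) * (1 + y) <= 1).
  { apply Rle_trans with (exp (- y) * exp y).
    - apply Rmult_le_compat_l; [left; apply exp_pos | apply exp_ineq1_le].
    - rewrite <- exp_plus, Rplus_opp_l, exp_0. lra. }
  pose proof (exp_pos (- y)) as He.
  apply Rabs_le_between in H2.
  assert (Hy0 : 0 < y) by nra.
  assert (Hgx : - g x <= Rabs B * exp (- y)) by nra.
  assert (H5 : y * (- g x) <= Rabs B * (exp (- y) * y)) by nra.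
  assert (exp (- y) * y <= 1) by nra. nra.
Qed.

Lemma Derive_eta (f : R -> R) (x l : R) : is_derive f x l -> Derive (fun u : R => f u) x = l.
Proof. intros H. apply is_derive_unique. exact H. Qed.

Definition airy_decaying (A A1 : R -> R) (B : R) : Prop :=
  (forall z, is_derive A z (A1 z)) /\ (forall z, is_derive A1 z (z * A z)) /\
  0 <= B /\ forall z, Rabs (A z) <= B * exp (- z) /\ Rabs (A1 z) <= B * exp (- z).

Lemma airy_decaying_opp (A A1 : R -> R) (B : R) :
  airy_decaying A A1 B -> airy_decaying (fun z => - A z) (fun z => - A1 z) B.
Proof.
  intros [H1 [H2 [H3 H4]]]. split; [| split; [| split]].
  - intros z; apply (is_derive_opp (V := R_NormedModule)), H1.
  - intros z. replace (z * - A z) with (- (z * A z)) by ring.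
    apply (is_derive_opp (V := R_NormedModule)), H2.
  - exact H3.
  - intros z. rewrite !Rabs_Ropp; apply H4.
Qed.

(** Gronwall for [A ^ 2 + A1 ^ 2]. *)
Lemma airy_unique (A A1 : R -> R) (B x : R) :
  airy_decaying A A1 B -> A x = 0 -> A1 x = 0 -> forall y, A y = 0.
Proof.
  intros [H1 [H2 _]] HA HA1 y.
  set (N := fun z => A z ^ 2 + A1 z ^ 2).
  set (N' := fun z => 2 * A z * A1 z * (1 + z)).
  assert (DN : forall z, is_derive N z (N' z)).
  { intros z. unfold N, N'. auto_derive.
    - split; [eexists; apply H1 | split; [eexists; apply H2 | trivial]].
    - rewrite (Derive_eta A _ _ (H1 z)), (Derive_eta A1 _ _ (H2 z)). ring. }
  set (L := 1 + Rabs x + Rabs y).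
  assert (HL : forall z, Rmin x y <= z <= Rmax x y -> Rabs (N' z) <= L * N z).
  { intros z Hz. assert (Hz1 : Rabs (1 + z) <= L).
    { unfold L. revert Hz. unfold Rmin, Rmax, Rabs.
      destruct (Rle_dec x y); repeat destruct Rcase_abs; lra. }
    unfold N'. rewrite Rabs_mult.
    assert (Rabs (2 * A z * A1 z) <= N z).
    { unfold N. apply Rabs_le.
      assert (0 <= (A z + A1 z) ^ 2) by apply pow2_ge_0.
      assert (0 <= (A z - A1 z) ^ 2) by apply pow2_ge_0. simpl in *. lra. }
    pose proof (Rabs_pos (1 + z)). pose proof (Rabs_pos (2 * A z * A1 z)). nra. }
  assert (N0 : N x = 0) by (unfold N; rewrite HA, HA1; ring).
  assert (Ny : N y <= 0).
  { destruct (Rle_or_lt x y) as [H | H].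
    - rewrite Rmin_left, Rmax_right in HL by lra.
      destruct (gronwall N N' L x y H) as [G _]; [intros; apply DN | exact HL |].
      rewrite N0, Rmult_0_r in G. exact G.
    - rewrite Rmin_right, Rmax_left in HL by lra.
      destruct (gronwall N N' L y x ltac:(lra)) as [_ G]; [intros; apply DN | exact HL |].
      rewrite N0, Rmult_0_r in G. exact G. }
  unfold N in Ny. simpl in Ny. nra.
Qed.

Lemma airy_continuous (A A1 : R -> R) (B z : R) :
  airy_decaying A A1 B -> continuous A z /\ continuous A1 z.
Proof.
  intros [H1 [H2 _]]. split; apply (ex_derive_continuous (V := R_NormedModule)); eexists; auto.
Qed.

Lemma exp_poly_decay (x : R) : 0 <= x -> exp (- x) ^ 2 * (1 + x) <= exp (- x).
Proof.
  intros Hx. assert (H : exp (- x) * (1 + x) <= 1).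
  { apply Rle_trans with (exp (- x) * exp x).
    - apply Rmult_le_compat_l; [left; apply exp_pos | apply exp_ineq1_le].
    - rewrite <- exp_plus, Rplus_opp_l, exp_0. lra. }
  pose proof (exp_pos (- x)). simpl. nra.
Qed.

Lemma airy_quadratic_decay (A A1 : R -> R) (B x : R) :
  airy_decaying A A1 B -> 0 <= x ->
  A1 x ^ 2 + (1 + x) * A x ^ 2 <= 2 * B ^ 2 * exp (- x).
Proof.
  intros [_ [_ [HB Hb]]] Hx. destruct (Hb x) as [B1 B2].
  assert (E := exp_poly_decay x Hx). pose proof (exp_pos (- x)) as He.
  assert (Q1 : A x ^ 2 <= B ^ 2 * exp (- x) ^ 2).
  { rewrite <- (pow2_abs (A x)), <- Rpow_mult_distr. apply pow_incr. split; [apply Rabs_pos | exact B1]. }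
  assert (Q2 : A1 x ^ 2 <= B ^ 2 * exp (- x) ^ 2).
  { rewrite <- (pow2_abs (A1 x)), <- Rpow_mult_distr. apply pow_incr. split; [apply Rabs_pos | exact B2]. }
  assert (HB2 : 0 <= B ^ 2) by apply pow2_ge_0.
  assert (He2 : 0 <= exp (- x) ^ 2) by apply pow2_ge_0.
  assert (R1 : (1 + x) * A x ^ 2 <= B ^ 2 * exp (- x)).
  { apply Rle_trans with ((1 + x) * (B ^ 2 * exp (- x) ^ 2)); [apply Rmult_le_compat_l; lra |].
    replace ((1 + x) * (B ^ 2 * exp (- x) ^ 2)) with (B ^ 2 * (exp (- x) ^ 2 * (1 + x))) by ring.
    apply Rmult_le_compat_l; assumption. }
  assert (R2 : B ^ 2 * exp (- x) ^ 2 <= B ^ 2 * exp (- x)).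
  { apply Rmult_le_compat_l; [exact HB2 |]. nra. }
  lra.
Qed.

(** [A1 ^ 2 - z * A ^ 2] has derivative [- A ^ 2] and vanishes at infinity. *)
Lemma airy_slope_lower (A A1 : R -> R) (B x0 : R) :
  airy_decaying A A1 B -> A x0 <> 0 -> forall x, x * A x ^ 2 < A1 x ^ 2.
Proof.
  intros H Hx0.
  set (E := fun z => A1 z ^ 2 - z * A z ^ 2). set (E' := fun z => - A z ^ 2).
  assert (DE : forall z, is_derive E z (E' z)).
  { destruct H as [H1 [H2 _]]. intros z. unfold E, E'. auto_derive.
    - split; [eexists; apply H2 | split; [eexists; apply H1 | trivial]].
    - rewrite (Derive_eta A _ _ (H1 z)), (Derive_eta A1 _ _ (H2 z)). ring. }
  assert (HE' : forall z, E' z <= 0) by (intros z; unfold E'; pose proof (pow2_ge_0 (A z)); lra).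
  assert (Hge0 : forall z, 0 <= z -> 0 <= E z).
  { intros z Hz. apply (nonneg_of_decreasing_to_zero E E' 0 (2 * B ^ 2)); auto.
    intros y Hy. assert (D := airy_quadratic_decay A A1 B y H Hy).
    unfold E. pose proof (pow2_ge_0 (A y)). pose proof (pow2_ge_0 (A1 y)).
    assert (0 <= y * A y ^ 2) by (apply Rmult_le_pos; assumption).
    apply Rabs_le. split; lra. }
  assert (Hge : forall z, 0 <= E z).
  { intros z. destruct (Rle_or_lt 0 z) as [Hz | Hz]; [apply Hge0; exact Hz |].
    apply Rle_trans with (E 0); [apply Hge0; lra |].
    apply (decreasing_of_derive_nonpos E E' z 0); auto; lra. }
  intros x. apply Rnot_le_lt; intros Hle.
  assert (Ez : forall y, x <= y -> E y = 0).
  { intros y Hy. apply Rle_antisym; [| apply Hge].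
    apply Rle_trans with (E x); [| unfold E; lra].
    apply (decreasing_of_derive_nonpos E E' x y); auto. }
  assert (Az : forall y, x < y -> A y = 0).
  { intros y Hy.
    assert (D0 : is_derive E y 0).
    { apply (is_derive_ext_loc (fun _ => 0)); [| apply (is_derive_const (V := R_NormedModule))].
      apply (locally_of_Rabs _ _ (y - x)); [lra |]. intros u Hu. apply Rabs_def2 in Hu.
      symmetry; apply Ez; lra. }
    assert (U := is_derive_unique _ _ _ D0). rewrite (is_derive_unique _ _ _ (DE y)) in U.
    unfold E' in U. simpl in U. nra. }
  apply Hx0. apply (airy_unique A A1 B (x + 1) H); [apply Az; lra |].
  assert (U := Ez (x + 1) ltac:(lra)). unfold E in U. rewrite (Az (x + 1)) in U by lra. simpl in U. nra.
Qed.

(** [A * A1] has derivative [A1 ^ 2 + z * A ^ 2] and vanishes at infinity. *)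
Lemma airy_product_nonpos (A A1 : R -> R) (B x : R) :
  airy_decaying A A1 B -> 0 <= x -> A x * A1 x <= 0.
Proof.
  intros H Hx.
  enough (0 <= - (A x * A1 x)) by lra.
  apply (nonneg_of_decreasing_to_zero (fun z => - (A z * A1 z)) (fun z => - (A1 z ^ 2 + z * A z ^ 2)) 0 (2 * B ^ 2)); auto.
  - destruct H as [H1 [H2 _]]. intros z _. auto_derive.
    + split; [eexists; apply H1 | split; [eexists; apply H2 | trivial]].
    + rewrite (Derive_eta A _ _ (H1 z)), (Derive_eta A1 _ _ (H2 z)). ring.
  - intros z Hz. pose proof (pow2_ge_0 (A z)). pose proof (pow2_ge_0 (A1 z)).
    assert (0 <= z * A z ^ 2) by (apply Rmult_le_pos; assumption). lra.
  - intros y Hy. assert (D := airy_quadratic_decay A A1 B y H Hy).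
    pose proof (pow2_ge_0 (A y)).
    assert (0 <= y * A y ^ 2) by (apply Rmult_le_pos; assumption).
    assert (0 <= (A y + A1 y) ^ 2) by apply pow2_ge_0.
    assert (0 <= (A y - A1 y) ^ 2) by apply pow2_ge_0.
    rewrite Rabs_Ropp. apply Rabs_le. simpl in *. split; lra.
Qed.

Lemma airy_product_neg (A A1 : R -> R) (B x0 x : R) :
  airy_decaying A A1 B -> A x0 <> 0 -> 0 <= x -> A x * A1 x < 0.
Proof.
  intros H Hx0 Hx.
  destruct (Rle_lt_or_eq _ _ (airy_product_nonpos A A1 B x H Hx)) as [Hlt | Heq]; [exact Hlt | exfalso].
  set (g := fun z => A z * A1 z). set (g' := fun z => A1 z ^ 2 + z * A z ^ 2).
  assert (Dg : forall z, is_derive g z (g' z)).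
  { destruct H as [H1 [H2 _]]. intros z. unfold g, g'. auto_derive.
    - split; [eexists; apply H1 | split; [eexists; apply H2 | trivial]].
    - rewrite (Derive_eta A _ _ (H1 z)), (Derive_eta A1 _ _ (H2 z)). ring. }
  destruct (MVT_gen g x (x + 1) g') as [c [Hc Ec]].
  - intros; apply Dg.
  - intros y _. apply continuity_pt_filterlim, (ex_derive_continuous (V := R_NormedModule)).
    eexists; apply Dg.
  - rewrite Rmin_left, Rmax_right in Hc by lra.
    assert (S := airy_slope_lower A A1 B x0 H Hx0 c).
    assert (P := airy_product_nonpos A A1 B (x + 1) H ltac:(lra)).
    assert (0 <= c * A c ^ 2) by (apply Rmult_le_pos; [lra | apply pow2_ge_0]).
    unfold g in Ec. unfold g' in Ec. rewrite Heq in Ec. nra.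
Qed.

(** [(x + 1) * A ^ 2 - A1 ^ 2] has derivative [A * (A + 2 * A1)] and vanishes at
    infinity; the derivative is nonpositive because [A * A1 <= 0] and
    [|A| <= |A1|]. *)
Lemma airy_slope_upper (A A1 : R -> R) (B x0 x : R) :
  airy_decaying A A1 B -> A x0 <> 0 -> 1 <= x -> A1 x ^ 2 <= (x + 1) * A x ^ 2.
Proof.
  intros H Hx0 Hx.
  enough (0 <= (x + 1) * A x ^ 2 - A1 x ^ 2) by lra.
  apply (nonneg_of_decreasing_to_zero (fun z => (z + 1) * A z ^ 2 - A1 z ^ 2)
     (fun z => A z ^ 2 + 2 * (A z * A1 z)) 1 (2 * B ^ 2)); auto.
  - destruct H as [H1 [H2 _]]. intros z _. auto_derive.
    + split; [eexists; apply H1 | split; [eexists; apply H2 | trivial]].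
    + rewrite (Derive_eta A _ _ (H1 z)), (Derive_eta A1 _ _ (H2 z)). ring.
  - intros z Hz. assert (P := airy_product_nonpos A A1 B z H ltac:(lra)).
    assert (S := airy_slope_lower A A1 B x0 H Hx0 z).
    assert (S2 : A z ^ 2 <= A1 z ^ 2) by (pose proof (pow2_ge_0 (A z)); nra).
    (* both factors have opposite signs and |A| <= |A1| *)
    assert (S3 : Rabs (A z) <= Rabs (A1 z)).
    { apply Rsqr_le_abs_0. unfold Rsqr. simpl in S2. lra. }
    assert (S4 : Rabs (A z) * Rabs (A1 z) = - (A z * A1 z)).
    { rewrite <- Rabs_mult. destruct (Rle_lt_or_eq _ _ P) as [Q | Q]; [apply Rabs_left; exact Q | rewrite Q, Rabs_R0; ring]. }
    rewrite <- (pow2_abs (A z)). pose proof (Rabs_pos (A z)). nra.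
  - intros y Hy. assert (D := airy_quadratic_decay A A1 B y H ltac:(lra)).
    pose proof (pow2_ge_0 (A y)). pose proof (pow2_ge_0 (A1 y)).
    assert (0 <= y * A y ^ 2) by (apply Rmult_le_pos; lra).
    apply Rabs_le. split; lra.
Qed.

Lemma continuous_no_zero_same_sign (f : R -> R) (a b : R) :
  (forall x, continuous f x) -> a <= b -> (forall x, a <= x <= b -> f x <> 0) ->
  0 < f a -> 0 < f b.
Proof.
  intros Hc Hab Hnz Ha. apply Rnot_le_lt; intros Hb.
  destruct (IVT_gen f a b 0) as [x [Hx Ex]].
  - intros x. apply continuity_pt_filterlim, Hc.
  - unfold Rmin, Rmax; repeat destruct Rle_dec; lra.
  - rewrite Rmin_left, Rmax_right in Hx by lra. exact (Hnz x Hx Ex).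
Qed.

(** Compactness on bounded intervals and the slope bound at infinity. The term
    [/ (y - c0)] accounts for a zero at [c0], which is simple. *)
Lemma airy_ratio_facts (A A1 : R -> R) (B c0 : R) :
  airy_decaying A A1 B -> (forall x, c0 < x -> 0 < A x) ->
  0 < A c0 \/ (A c0 = 0 /\ 0 < A1 c0) ->
  (forall Y, exists k, 0 < k /\ forall y, c0 <= y <= Y -> k * (y - c0) <= A y) /\
  exists C, 0 < C /\ forall y, c0 < y -> Rabs (A1 y) <= C * (1 + Rabs y + / (y - c0)) * A y.
Proof.
  intros H Hpos Hc0.
  assert (Cn := fun z => airy_continuous A A1 B z H).
  assert (Hnz : A (c0 + 1) <> 0) by (assert (0 < A (c0 + 1)) by (apply Hpos; lra); lra).
  assert (Hk : forall Y, exists k, 0 < k /\ forall y, c0 <= y <= Y -> k * (y - c0) <= A y).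
  { intros Y.
    assert (Hnear : exists d k, 0 < d /\ 0 < k /\ forall y, c0 <= y <= c0 + d -> k * (y - c0) <= A y).
    { destruct Hc0 as [Hc | [Hc Hc1]].
      - assert (A2 : 0 < A c0 / 2) by lra.
        destruct (Cn c0) as [Ca _].
        destruct (Ca _ (locally_ball _ (mkposreal _ A2))) as [d Hd].
        pose proof (cond_pos d).
        exists (Rmin (d / 2) 1), (A c0 / 2). split; [apply Rmin_glb_lt; lra | split; [lra |]].
        intros y Hy. assert (M1 := Rmin_l (d / 2) 1). assert (M2 := Rmin_r (d / 2) 1).
        assert (Hb : ball (A c0) (A c0 / 2) (A y)).
        { apply Hd. apply R_ball.
          apply Rabs_def1; lra. }
        apply ball_R in Hb; cbn [pos] in Hb.
        apply Rabs_def2 in Hb. nra.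
      - assert (A2 : 0 < A1 c0 / 2) by lra.
        destruct (Cn c0) as [_ Ca].
        destruct (Ca _ (locally_ball _ (mkposreal _ A2))) as [d Hd].
        pose proof (cond_pos d).
        exists (d / 2), (A1 c0 / 2). split; [lra | split; [lra |]].
        intros y Hy.
        enough (A c0 - A1 c0 / 2 * (c0 - c0) <= A y - A1 c0 / 2 * (y - c0)) by (rewrite Hc in *; lra).
        apply (increasing_of_derive_nonneg (fun y => A y - A1 c0 / 2 * (y - c0)) (fun y => A1 y - A1 c0 / 2)); [lra | |].
        + intros x _. auto_derive; [exists (A1 x); exact (proj1 H x) |].
          rewrite (Derive_eta A _ _ (proj1 H x)). ring.
        + intros x Hx. assert (Hb : ball (A1 c0) (A1 c0 / 2) (A1 x)).
          { apply Hd. apply R_ball.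
            apply Rabs_def1; lra. }
          apply ball_R in Hb; cbn [pos] in Hb.
          apply Rabs_def2 in Hb. lra. }
    destruct Hnear as [d [k [Hd [Hk Hn]]]].
    destruct (Rle_or_lt Y (c0 + d)) as [HY | HY].
    - exists k. split; [exact Hk |]. intros y Hy. apply Hn; lra.
    - destruct (continuity_ab_min A (c0 + d) Y) as [mx [Hmx1 Hmx2]]; [lra | |].
      + intros y _. apply continuity_pt_filterlim, Cn.
      + assert (Hm : 0 < A mx) by (apply Hpos; lra).
        exists (Rmin k (A mx / (Y - c0))). split.
        { apply Rmin_glb_lt; [exact Hk | apply Rdiv_lt_0_compat; lra]. }
        assert (M1 := Rmin_l k (A mx / (Y - c0))). assert (M2 := Rmin_r k (A mx / (Y - c0))).
        intros y Hy. destruct (Rle_or_lt y (c0 + d)) as [Hyd | Hyd].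
        * apply Rle_trans with (k * (y - c0)); [apply Rmult_le_compat_r; lra | apply Hn; lra].
        * apply Rle_trans with (A mx / (Y - c0) * (y - c0)); [apply Rmult_le_compat_r; lra |].
          apply Rle_trans with (A mx); [| apply Hmx1; lra].
          apply Rle_trans with (A mx / (Y - c0) * (Y - c0)); [| right; field; lra].
          apply Rmult_le_compat_l; [left; apply Rdiv_lt_0_compat; lra | lra]. }
  split; [exact Hk |].
  set (Y := Rmax 1 c0 + 1).
  assert (HY : 1 < Y /\ c0 < Y) by (unfold Y; pose proof (Rmax_l 1 c0); pose proof (Rmax_r 1 c0); lra).
  destruct (Hk Y) as [k [Hk0 HkY]].
  destruct (continuity_ab_maj (fun y => Rabs (A1 y)) c0 Y) as [mx [Hmx _]]; [lra | |].
  { intros y _. apply continuity_pt_filterlim. apply (continuous_comp A1 Rabs); [apply Cn |].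
    apply continuity_pt_filterlim, Rcontinuity_abs. }
  pose proof (Rabs_pos (A1 mx)).
  exists (1 + Rabs (A1 mx) / k).
  assert (Hq : 0 <= Rabs (A1 mx) / k) by (apply Rdiv_le_0_compat; lra).
  split; [lra |]. intros y Hy.
  assert (HAy := Hpos y Hy).
  assert (Hi : 0 < / (y - c0)) by (apply Rinv_0_lt_compat; lra).
  pose proof (Rabs_pos y). pose proof (Rle_abs y).
  destruct (Rle_or_lt y Y) as [HyY | HyY].
  - apply Rle_trans with (Rabs (A1 mx)); [apply Hmx; lra |].
    specialize (HkY y ltac:(lra)).
    assert (E : Rabs (A1 mx) = Rabs (A1 mx) / k * / (y - c0) * (k * (y - c0))) by (field; lra).
    rewrite E at 1.
    apply Rmult_le_compat; [apply Rmult_le_pos; lra | apply Rmult_le_pos; lra | | exact HkY].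
    set (q := Rabs (A1 mx) / k) in *. set (i := / (y - c0)) in *.
    assert (0 <= q * Rabs y) by (apply Rmult_le_pos; lra). nra.
  - assert (S := airy_slope_upper A A1 B _ y H Hnz ltac:(lra)).
    assert (S1 : Rabs (A1 y) <= (1 + y) * A y).
    { apply Rsqr_incr_0_var; [| nra]. rewrite <- Rsqr_abs. unfold Rsqr.
      assert (0 < A y * A y) by nra.
      assert (A1 y * A1 y <= (y + 1) * (A y * A y)) by (simpl in S; lra). nra. }
    eapply Rle_trans; [exact S1 |]. apply Rmult_le_compat_r; [lra |]. nra.
Qed.

Lemma continuous_constant_sign (f : R -> R) (a : R) :
  (forall x, continuous f x) -> (forall x, a < x -> f x <> 0) ->
  (forall x, a < x -> 0 < f x) \/ (forall x, a < x -> 0 < - f x).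
Proof.
  intros Hc Hnz.
  assert (H : forall g : R -> R, (forall x, continuous g x) -> (forall x, a < x -> g x <> 0) ->
     0 < g (a + 1) -> forall x, a < x -> 0 < g x).
  { intros g Hg Hgz H1 x Hx. destruct (Rle_or_lt (a + 1) x) as [H | H].
    - apply (continuous_no_zero_same_sign g (a + 1) x); auto. intros y Hy; apply Hgz; lra.
    - apply Rnot_le_lt; intros Hle.
      assert (Hlt : 0 < - g x) by (assert (g x <> 0) by (apply Hgz; lra); lra).
      assert (Hm := continuous_no_zero_same_sign (fun y => - g y) x (a + 1)
        (fun y => continuous_opp (V := R_NormedModule) g y (Hg y)) ltac:(lra)).
      assert (0 < - g (a + 1)); [| lra].
      apply Hm; [| exact Hlt]. intros y Hy E. apply (Hgz y); lra. }
  assert (Hnz1 : f (a + 1) <> 0) by (apply Hnz; lra).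
  destruct (Rlt_or_le 0 (f (a + 1))) as [Hp | Hp].
  - left. apply H; auto.
  - right. apply (H (fun x => - f x)); [| | lra].
    + intros x. apply (continuous_opp (V := R_NormedModule)), Hc.
    + intros x Hx E. apply (Hnz x Hx). lra.
Qed.

Lemma airy_slope_at_last_zero (A A1 : R -> R) (B z : R) :
  airy_decaying A A1 B -> A z = 0 -> (forall x, z < x -> 0 < A x) -> 0 < A1 z.
Proof.
  intros H Hz Hpos.
  assert (Hne : A1 z <> 0).
  { intros E. assert (U := airy_unique A A1 B z H Hz E (z + 1)).
    assert (0 < A (z + 1)) by (apply Hpos; lra). lra. }
  apply Rnot_le_lt; intros Hle.
  assert (A2 : 0 < - A1 z) by lra.
  destruct (continuous_pos_nbhd (fun x => - A1 x) z) as [d Hd].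
  - apply (continuous_opp (V := R_NormedModule)), (airy_continuous A A1 B z H).
  - exact A2.
  - pose proof (cond_pos d).
    assert (M := decreasing_of_derive_nonpos A A1 z (z + d / 2) ltac:(lra)).
    assert (A (z + d / 2) <= A z).
    { apply M; [intros; apply H |]. intros x Hx.
      assert (0 < - A1 x); [| lra]. apply Hd.
      apply R_ball. apply Rabs_def1; lra. }
    assert (0 < A (z + d / 2)) by (apply Hpos; lra). lra.
Qed.

Lemma airy_largest_zero (r0 : R) :
  is_largest (fun x : R => Ai x = 0) r0 ->
  exists A A1 B, airy_decaying A A1 B /\ A r0 = 0 /\ 0 < A1 r0 /\ forall x, r0 < x -> 0 < A x.
Proof.
  intros [H0 Hmax]. destruct Ai_equation as [Ai' [B [HB HAi]]].
  assert (HD : airy_decaying Ai Ai' B).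
  { split; [intros; apply HAi | split; [intros; apply HAi | split; [exact HB | intros; split; apply HAi]]]. }
  destruct (continuous_constant_sign Ai r0) as [Hs | Hs].
  - intros x; apply (airy_continuous _ _ _ x HD).
  - intros x Hx E. specialize (Hmax x E). lra.
  - exists Ai, Ai', B. split; [exact HD | split; [exact H0 | split; [| exact Hs]]].
    apply (airy_slope_at_last_zero Ai Ai' B r0); assumption.
  - exists (fun x => - Ai x), (fun x => - Ai' x), B.
    assert (HD' := airy_decaying_opp _ _ _ HD).
    split; [exact HD' | split; [rewrite H0; ring | split; [| exact Hs]]].
    apply (airy_slope_at_last_zero _ _ B r0 HD'); [rewrite H0; ring | exact Hs].
Qed.

(** Past its last zero the logarithmic derivative of [Ai] runs from [+oo] to
    [-oo], so the largest solution of the quotient equation lies beyond every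
    zero, and a sign can be fixed there. That [r1] is negative is the inequality
    [x * A x ^ 2 < A1 x ^ 2] at that solution. *)
Lemma airy_largest_quotient_root (eta r1 : R) :
  is_largest (Airy_quotient_root eta) r1 ->
  exists A A1 B, airy_decaying A A1 B /\ (forall x, r1 + eta ^ 2 / 4 <= x -> 0 < A x) /\
    A1 (r1 + eta ^ 2 / 4) = - (eta / 2) * A (r1 + eta ^ 2 / 4) /\ r1 < 0.
Proof.
  intros [[Hc0 Hq] Hmax]. destruct Ai_equation as [Ai' [B [HB HAi]]].
  assert (HD : airy_decaying Ai Ai' B).
  { split; [intros; apply HAi | split; [intros; apply HAi | split; [exact HB | intros; split; apply HAi]]]. }
  assert (EqD : forall x, Derive Ai x = Ai' x) by (intros x; apply is_derive_unique, HAi).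
  set (c := r1 + eta ^ 2 / 4) in *.
  rewrite EqD in Hq.
  assert (Hq' : Ai' c = - (eta / 2) * Ai c).
  { rewrite <- Hq. field. exact Hc0. }
  assert (Cn : forall x, continuous Ai x) by (intros x; apply (airy_continuous _ _ _ x HD)).
  assert (Cn1 : forall x, continuous Ai' x) by (intros x; apply (airy_continuous _ _ _ x HD)).
  assert (Hr1 : r1 < 0).
  { assert (S := airy_slope_lower Ai Ai' B c HD Hc0 c). rewrite Hq' in S. unfold c in S at 1.
    assert (0 < Ai c ^ 2) by (simpl; nra). simpl in *. nra. }
  (* after a last zero at or beyond [c] the logarithmic derivative would take
     the value [- eta / 2] once more *)
  assert (Hnz : forall x, c <= x -> Ai x <> 0).
  { intros x0 Hx0 Ex0.
    set (Z := fun x => c <= x /\ Ai x = 0).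
    assert (HZb : forall x, Z x -> x <= 0).
    { intros x [_ Ex]. apply Rnot_lt_le; intros Hx.
      assert (P := airy_product_neg Ai Ai' B c x HD Hc0 ltac:(lra)). rewrite Ex in P. lra. }
    destruct (completeness Z) as [zs [Hub Hlub]].
    - exists 0. intros x Hx; apply HZb; exact Hx.
    - exists x0. split; assumption.
    - assert (Hcz : c <= zs) by (apply Rle_trans with x0; [exact Hx0 | apply Hub; split; assumption]).
      assert (Hgt : forall x, zs < x -> Ai x <> 0).
      { intros x Hx E. assert (x <= zs); [| lra]. apply Hub. split; [lra | exact E]. }
      assert (Ez : Ai zs = 0).
      { apply NNPP; intros Hne.
        assert (Hloc : exists d, 0 < d /\ forall x, Rabs (x - zs) < d -> Ai x <> 0).
        { assert (Hp : 0 < Ai zs * Ai zs) by nra.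
          destruct (continuous_pos_nbhd (fun x => Ai x * Ai x) zs) as [d Hd].
          - apply (continuous_mult (K := R_AbsRing)); apply Cn.
          - exact Hp.
          - exists d. split; [apply cond_pos |]. intros x Hx E.
            assert (0 < Ai x * Ai x) by (apply Hd; exact Hx). rewrite E in H. lra. }
        destruct Hloc as [d [Hd Hl]].
        assert (zs <= zs - d / 2); [| lra].
        apply Hlub. intros x [Hx Ex]. apply Rnot_lt_le; intros Hlt.
        assert (x <= zs) by (apply Hub; split; assumption).
        apply (Hl x); [apply Rabs_def1; lra | exact Ex]. }
      assert (Hcz' : c < zs) by (destruct (Rle_lt_or_eq _ _ Hcz) as [L | L]; [exact L | rewrite <- L in Ez; lra]).
      assert (Key : forall A A1, airy_decaying A A1 B -> (forall x, zs < x -> 0 < A x) -> A zs = 0 ->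
         (forall x, zs < x -> A1 x + eta / 2 * A x <> 0) -> False).
      { intros A A1 HA Hpos HAz Hh.
        assert (Hs := airy_slope_at_last_zero A A1 B zs HA HAz Hpos).
        set (h := fun x => A1 x + eta / 2 * A x).
        set (X := Rabs zs + eta ^ 2 / 4 + 1).
        pose proof (Rabs_pos zs). pose proof (Rle_abs zs). pose proof (pow2_ge_0 eta).
        assert (HX : zs < X /\ 0 < X /\ eta ^ 2 / 4 < X) by (unfold X; lra).
        assert (HhX : 0 < h X).
        { apply (continuous_no_zero_same_sign h zs X); [| lra | |].
          - intros x. destruct (airy_continuous A A1 B x HA).
            apply (continuous_plus (V := R_NormedModule)); [assumption |].
            apply (continuous_scal_r (V := R_NormedModule)); assumption.
          - intros x Hx. destruct (Rle_lt_or_eq zs x) as [L | <-]; [lra | apply Hh; exact L |].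
            unfold h. rewrite HAz. lra.
          - unfold h. rewrite HAz. lra. }
        assert (HpX : 0 < A X) by (apply Hpos; lra).
        assert (S := airy_slope_lower A A1 B X HA ltac:(lra) X).
        assert (P := airy_product_nonpos A A1 B X HA ltac:(lra)).
        assert (HA1 : A1 X <= 0) by nra.
        assert (S2 : (eta / 2) ^ 2 * A X ^ 2 < A1 X ^ 2).
        { apply Rle_lt_trans with (X * A X ^ 2); [| exact S].
          apply Rmult_le_compat_r; [apply pow2_ge_0 |]. simpl in *. lra. }
        (* A1 X < 0 and |A1 X| > |eta / 2| A X contradict h X > 0 *)
        unfold h in HhX. assert (0 <= - A1 X < eta / 2 * A X) by lra.
        assert (A1 X * A1 X < (eta / 2 * A X) * (eta / 2 * A X)) by nra.
        simpl in S2. nra. }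
      assert (Hroot : forall x, zs < x -> Ai' x + eta / 2 * Ai x <> 0).
      { intros x Hx E. assert (x - eta ^ 2 / 4 <= r1).
        { apply Hmax. unfold Airy_quotient_root. replace (x - eta ^ 2 / 4 + eta ^ 2 / 4) with x by ring.
          split; [apply Hgt; exact Hx |]. rewrite EqD.
          assert (Ai x <> 0) by (apply Hgt; exact Hx).
          replace (Ai' x) with (- (eta / 2) * Ai x) by lra. field. assumption. }
        unfold c in Hcz'. lra. }
      destruct (continuous_constant_sign Ai zs Cn Hgt) as [Hs | Hs].
      + exact (Key Ai Ai' HD Hs Ez Hroot).
      + apply (Key (fun x => - Ai x) (fun x => - Ai' x) (airy_decaying_opp _ _ _ HD) Hs).
        * rewrite Ez; ring.
        * intros x Hx E. apply (Hroot x Hx). lra. }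
  destruct (Rlt_or_le 0 (Ai c)) as [Hp | Hp].
  - exists Ai, Ai', B. split; [exact HD | split; [| split; [exact Hq' | exact Hr1]]].
    intros x Hx. apply (continuous_no_zero_same_sign Ai c x); [exact Cn | exact Hx | | exact Hp].
    intros y Hy; apply Hnz; lra.
  - exists (fun x => - Ai x), (fun x => - Ai' x), B.
    split; [apply airy_decaying_opp; exact HD | split; [| split; [rewrite Hq'; ring | exact Hr1]]].
    intros x Hx. apply (continuous_no_zero_same_sign (fun x => - Ai x) c x); auto.
    + intros y; apply (continuous_opp (V := R_NormedModule)), Cn.
    + intros y Hy E; apply (Hnz y); lra.
    + lra.
Qed.

(** * Second differences of solutions of a linear equation *)

(** Integrate [w2 (x + s) + w2 (x - s) <= 2 * f x + 2 * M * h ^ 2] twice in [s]. The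
    smooth majorant [f] of [w2] spares a fourth derivative of [w]. *)
Lemma second_difference_le (w w1 w2 f f1 f2 : R -> R) (x h M : R) :
  0 <= h ->
  (forall y, Rabs (y - x) <= h ->
     is_derive w y (w1 y) /\ is_derive w1 y (w2 y) /\ w2 y <= f y) ->
  (forall y, Rabs (y - x) <= h ->
     is_derive f y (f1 y) /\ is_derive f1 y (f2 y) /\ Rabs (f2 y) <= M) ->
  w (x + h) + w (x - h) - 2 * w x <= h ^ 2 * f x + M * h ^ 4.
Proof.
  intros Hh Hw Hf.
  assert (HM : 0 <= M).
  { destruct (Hf x) as [_ [_ A]]; [rewrite Rminus_diag, Rabs_R0; exact Hh |].
    pose proof (Rabs_pos (f2 x)); lra. }
  assert (Hs : forall s, 0 <= s <= h -> Rabs (x + s - x) <= h /\ Rabs (x - s - x) <= h).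
  { intros s H. replace (x + s - x) with s by ring. replace (x - s - x) with (- s) by ring.
    rewrite Rabs_Ropp, Rabs_pos_eq; lra. }
  assert (F2 : forall s, 0 <= s <= h -> f (x + s) + f (x - s) - 2 * f x <= 2 * M * h ^ 2).
  { intros s H.
    assert (T1 := taylor1_bound f f1 f2 x s M). assert (T2 := taylor1_bound f f1 f2 x (- s) M).
    specialize (T1 ltac:(intros y Hy; apply Hf; rewrite (Rabs_pos_eq s) in Hy; lra)).
    specialize (T2 ltac:(intros y Hy; apply Hf; rewrite Rabs_Ropp, (Rabs_pos_eq s) in Hy; lra)).
    replace (x + - s) with (x - s) in T2 by ring.
    apply Rabs_le_between in T1. apply Rabs_le_between in T2.
    assert (s ^ 2 <= h ^ 2) by (simpl; nra).
    assert (M * s ^ 2 <= M * h ^ 2) by (apply Rmult_le_compat_l; assumption).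
    replace (M * (- s) ^ 2) with (M * s ^ 2) in T2 by ring. lra. }
  set (D1 := fun s => w1 (x + s) - w1 (x - s) - 2 * s * f x - 2 * M * h ^ 2 * s).
  set (D := fun s => w (x + s) + w (x - s) - 2 * w x - s ^ 2 * f x - M * h ^ 2 * s ^ 2).
  assert (dD1 : forall s, 0 <= s <= h -> is_derive D1 s (w2 (x + s) + w2 (x - s) - 2 * f x - 2 * M * h ^ 2)).
  { intros s H. destruct (Hs s H) as [S1 S2].
    destruct (Hw _ S1) as [_ [E1 _]]. destruct (Hw _ S2) as [_ [E2 _]].
    unfold D1. auto_derive.
    - split; [eexists; exact E1 | split; [eexists; exact E2 | trivial]].
    - replace (x + - s) with (x - s) by ring.
      rewrite (Derive_eta w1 _ _ E1), (Derive_eta w1 _ _ E2). ring. }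
  assert (dD : forall s, 0 <= s <= h -> is_derive D s (D1 s)).
  { intros s H. destruct (Hs s H) as [S1 S2].
    destruct (Hw _ S1) as [E1 _]. destruct (Hw _ S2) as [E2 _].
    unfold D, D1. auto_derive.
    - split; [eexists; exact E1 | split; [eexists; exact E2 | trivial]].
    - replace (x + - s) with (x - s) by ring.
      rewrite (Derive_eta w _ _ E1), (Derive_eta w _ _ E2). ring. }
  assert (D1n : forall s, 0 <= s <= h -> D1 s <= 0).
  { intros s H. apply Rle_trans with (D1 0).
    - apply (decreasing_of_derive_nonpos D1 (fun s => w2 (x + s) + w2 (x - s) - 2 * f x - 2 * M * h ^ 2)); [lra | |].
      + intros y Hy; apply dD1; lra.
      + intros y Hy. destruct (Hs y ltac:(lra)) as [S1 S2].
        destruct (Hw _ S1) as [_ [_ E1]]. destruct (Hw _ S2) as [_ [_ E2]].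
        specialize (F2 y ltac:(lra)). lra.
    - unfold D1. rewrite Rplus_0_r, Rminus_0_r. lra. }
  assert (Dn : D h <= D 0).
  { apply (decreasing_of_derive_nonpos D D1); [exact Hh | exact dD | exact D1n]. }
  unfold D in Dn. rewrite Rplus_0_r, Rminus_0_r in Dn.
  replace (h ^ 4) with (h ^ 2 * h ^ 2) by ring. simpl (0 ^ 2) in Dn. lra.
Qed.

Lemma second_difference_ge (w w1 w2 f f1 f2 : R -> R) (x h M : R) :
  0 <= h ->
  (forall y, Rabs (y - x) <= h ->
     is_derive w y (w1 y) /\ is_derive w1 y (w2 y) /\ f y <= w2 y) ->
  (forall y, Rabs (y - x) <= h ->
     is_derive f y (f1 y) /\ is_derive f1 y (f2 y) /\ Rabs (f2 y) <= M) ->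
  h ^ 2 * f x - M * h ^ 4 <= w (x + h) + w (x - h) - 2 * w x.
Proof.
  intros Hh Hw Hf.
  assert (S := second_difference_le (fun y => - w y) (fun y => - w1 y) (fun y => - w2 y)
    (fun y => - f y) (fun y => - f1 y) (fun y => - f2 y) x h M Hh).
  enough (- w (x + h) + - w (x - h) - 2 * - w x <= h ^ 2 * - f x + M * h ^ 4) by lra.
  apply S.
  - intros y Hy. destruct (Hw y Hy) as [E1 [E2 E3]].
    split; [apply (is_derive_opp (V := R_NormedModule)); exact E1 |
      split; [apply (is_derive_opp (V := R_NormedModule)); exact E2 | lra]].
  - intros y Hy. destruct (Hf y Hy) as [E1 [E2 E3]].
    split; [apply (is_derive_opp (V := R_NormedModule)); exact E1 |
      split; [apply (is_derive_opp (V := R_NormedModule)); exact E2 | rewrite Rabs_Ropp; exact E3]].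
Qed.

(** * The comparison function *)

(** With [x = (K - n) * e ^ 2] and [e ^ 3 = / K], the continuum limit of the
    recurrence is [w'' = (nu + x + e * x ^ 2 + e ^ 2 * x ^ 3 + ...) * w], the series being
    geometric. Langer's method looks for [w = A (phi) / b] with [phi] close to
    [nu + x]; truncating [b] after the term [e * x / 5] reproduces the potential up to
    order [e], and the quadratic term [sg] decides on which side of the potential
    the next order falls. *)
Definition lg_b (sg e x : R) : R := 1 + e * x / 5 + sg * (e * x) ^ 2.
Definition lg_b1 (sg e x : R) : R := e / 5 + 2 * sg * e ^ 2 * x.
Definition lg_b2 (sg e : R) : R := 2 * sg * e ^ 2.

Definition lg_F2 (sg s : R) : R := (1 / 25 + 2 * sg) / 3 + sg * s / 10 + sg ^ 2 * s ^ 2 / 5.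
(** The primitive of [al * b ^ 2] with value [p0] at the boundary. *)
Definition lg_phi (sg e al p0 x : R) : R :=
  p0 + al * (x * (1 + e * x / 5 + (e * x) ^ 2 * lg_F2 sg (e * x))).

Definition lg_w (A : R -> R) (sg e al p0 x : R) : R := A (lg_phi sg e al p0 x) / lg_b sg e x.
Definition lg_w1 (A A1 : R -> R) (sg e al p0 x : R) : R :=
  al * lg_b sg e x * A1 (lg_phi sg e al p0 x)
  - lg_b1 sg e x / lg_b sg e x ^ 2 * A (lg_phi sg e al p0 x).
Definition lg_W (sg e al p0 x : R) : R :=
  al ^ 2 * lg_phi sg e al p0 x * lg_b sg e x ^ 4
  + 2 * lg_b1 sg e x ^ 2 / lg_b sg e x ^ 2 - lg_b2 sg e / lg_b sg e x.

Lemma lg_b_derive (sg e x : R) : is_derive (lg_b sg e) x (lg_b1 sg e x).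
Proof. unfold lg_b, lg_b1. auto_derive; [trivial | field]. Qed.

Lemma lg_b1_derive (sg e x : R) : is_derive (lg_b1 sg e) x (lg_b2 sg e).
Proof. unfold lg_b1, lg_b2. auto_derive; [trivial | field]. Qed.

Lemma lg_phi_derive (sg e al p0 x : R) :
  is_derive (lg_phi sg e al p0) x (al * lg_b sg e x ^ 2).
Proof. unfold lg_phi, lg_F2, lg_b. auto_derive; [trivial | field]. Qed.

(** The amplitude [1 / b] is tied to the phase by [phi' = al * b ^ 2], which
    removes the first-order term: [w] solves [w'' = W * w] exactly. *)
Lemma lg_w_derive (A A1 : R -> R) (B sg e al p0 x : R) :
  airy_decaying A A1 B -> 0 < lg_b sg e x ->
  is_derive (lg_w A sg e al p0) x (lg_w1 A A1 sg e al p0 x) /\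
  is_derive (lg_w1 A A1 sg e al p0) x (lg_W sg e al p0 x * lg_w A sg e al p0 x).
Proof.
  intros [H1 [H2 _]] Hb.
  assert (Db := lg_b_derive sg e x). assert (Db1 := lg_b1_derive sg e x).
  assert (Dp := lg_phi_derive sg e al p0 x).
  set (b := lg_b sg e) in *. set (b1 := lg_b1 sg e) in *. set (p := lg_phi sg e al p0) in *.
  assert (DA := H1 (p x)). assert (DA1 := H2 (p x)).
  split.
  - unfold lg_w, lg_w1. fold b b1 p. auto_derive.
    + repeat split; try (eexists; eassumption); try lra.
    + rewrite (Derive_eta A _ _ DA), (Derive_eta p _ _ Dp), (Derive_eta b _ _ Db). field. lra.
  - unfold lg_w1, lg_W, lg_w. fold b b1 p. auto_derive.
    + repeat split; try (eexists; eassumption); try lra.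
      assert (0 < b x * b x) by (apply Rmult_lt_0_compat; exact Hb). lra.
    + rewrite (Derive_eta A _ _ DA), (Derive_eta A1 _ _ DA1), (Derive_eta p _ _ Dp),
        (Derive_eta b _ _ Db), (Derive_eta b1 _ _ Db1). field. lra.
Qed.

Definition bounded_coef (f : R -> R -> R) : Prop :=
  exists C, 0 <= C /\ forall e s, 0 <= e <= 1 -> 0 <= s <= 2 -> Rabs (f e s) <= C.

Lemma bounded_const (c : R) : bounded_coef (fun _ _ => c).
Proof. exists (Rabs c). split; [apply Rabs_pos | intros; lra]. Qed.

Lemma bounded_e : bounded_coef (fun e _ => e).
Proof. exists 1. split; [lra | intros e s He _; rewrite Rabs_pos_eq; lra]. Qed.

Lemma bounded_s : bounded_coef (fun _ s => s).
Proof. exists 2. split; [lra | intros e s _ Hs; rewrite Rabs_pos_eq; lra]. Qed.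

Lemma bounded_add f g : bounded_coef f -> bounded_coef g -> bounded_coef (fun e s => f e s + g e s).
Proof.
  intros [C [HC H]] [C' [HC' H']]. exists (C + C'). split; [lra |]. intros e s He Hs.
  specialize (H e s He Hs). specialize (H' e s He Hs).
  eapply Rle_trans; [apply Rabs_triang | lra].
Qed.

Lemma bounded_mul f g : bounded_coef f -> bounded_coef g -> bounded_coef (fun e s => f e s * g e s).
Proof.
  intros [C [HC H]] [C' [HC' H']]. exists (C * C'). split; [nra |]. intros e s He Hs.
  rewrite Rabs_mult. apply Rmult_le_compat; try apply Rabs_pos; auto.
Qed.

Lemma bounded_opp f : bounded_coef f -> bounded_coef (fun e s => - f e s).
Proof.
  intros [C [HC H]]. exists C. split; [exact HC |]. intros e s He Hs. rewrite Rabs_Ropp; auto.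
Qed.

Lemma bounded_sub f g : bounded_coef f -> bounded_coef g -> bounded_coef (fun e s => f e s - g e s).
Proof.
  intros Hf Hg. apply (bounded_add f (fun e s => - g e s)); [exact Hf | apply bounded_opp; exact Hg].
Qed.

Lemma bounded_pow f n : bounded_coef f -> bounded_coef (fun e s => f e s ^ n).
Proof.
  intros Hf. induction n as [|n IH]; simpl; [apply bounded_const | apply bounded_mul; assumption].
Qed.

Ltac bounded_coef :=
  repeat first
    [ apply bounded_const | apply bounded_e | apply bounded_s
    | apply bounded_add | apply bounded_sub | apply bounded_mul
    | apply bounded_pow | apply bounded_opp ].

Definition lg_u (sg s : R) : R := 1 / 5 + sg * s.
Definition lg_g1 (sg s : R) : R :=
  4 * sg + 6 * lg_u sg s ^ 2 + 4 * s * lg_u sg s ^ 3 + s ^ 2 * lg_u sg s ^ 4.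
Definition lg_g2 (sg s : R) : R :=
  4 / 25 + lg_g1 sg s * (1 + s / 5) + lg_F2 sg s * (1 + 4 * s / 5 + s ^ 2 * lg_g1 sg s).

(** The first-order correction of [al] cancels the term [e * x] of the potential
    produced by the constant [c]. *)
Definition lg_al (c e : R) : R := 1 + e * (- 4 * c / 15).
(** The boundary phase: [c] is fixed by the leading boundary condition, [d] by the
    next order, and [m] is free, for it changes the eigenvalue only at order
    [e ^ 6]. *)
Definition lg_p0 (c d m e : R) : R := c + e * d + e ^ 2 * m.
(** The terms of order [1] and [e] of [al ^ 2 * p0], which become the eigenvalue. *)
Definition lg_nu (c d e : R) : R := c + e * (d + 2 * (- 4 * c / 15) * c).

(** The functions [lg_r1] to [lg_P2] collect the order [e ^ 2] of the potential as
    coefficients of the powers of [x]; only their boundedness matters. *)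
Definition lg_r1 (c d m e : R) : R :=
  let b0 := - 4 * c / 15 in m + b0 ^ 2 * c + 2 * b0 * d + e * (b0 ^ 2 * d + 2 * b0 * m) + e ^ 2 * b0 ^ 2 * m.
Definition lg_r2 (c e : R) : R := let b0 := - 4 * c / 15 in 3 * b0 ^ 2 + e * b0 ^ 3.

Definition lg_P0 (sg c d m e s : R) : R := lg_r1 c d m e * (1 + 4 * s / 5 + s ^ 2 * lg_g1 sg s).
Definition lg_P1 (sg c d e s : R) : R :=
  4 / 5 * (d + 2 * (- 4 * c / 15) * c) + lg_r2 c e * (1 + s + s ^ 2 * lg_g2 sg s).
Definition lg_P2 (sg c d e s : R) : R :=
  lg_nu c d e * lg_g1 sg s + 3 * (- 4 * c / 15) * (1 + s * lg_g2 sg s).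

Lemma lg_potential_expansion (sg c d m e x : R) :
  lg_al c e ^ 2 * lg_phi sg e (lg_al c e) (lg_p0 c d m e) x * lg_b sg e x ^ 4
  = lg_nu c d e + x + e * x ^ 2
    + e ^ 2 * (x ^ 3 * lg_g2 sg (e * x) + x ^ 2 * lg_P2 sg c d e (e * x)
               + x * lg_P1 sg c d e (e * x) + lg_P0 sg c d m e (e * x)).
Proof.
  assert (Eb : lg_b sg e x ^ 4 = 1 + 4 * (e * x) / 5 + (e * x) ^ 2 * lg_g1 sg (e * x)).
  { unfold lg_b, lg_g1, lg_u. field. }
  assert (E0 : lg_al c e ^ 2 * lg_p0 c d m e = lg_nu c d e + e ^ 2 * lg_r1 c d m e).
  { unfold lg_al, lg_p0, lg_nu, lg_r1. field. }
  assert (E3 : lg_al c e ^ 3 = 1 + 3 * e * (- 4 * c / 15) + e ^ 2 * lg_r2 c e).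
  { unfold lg_al, lg_r2. field. }
  assert (EF : (1 + e * x / 5 + (e * x) ^ 2 * lg_F2 sg (e * x)) * lg_b sg e x ^ 4
     = 1 + e * x + (e * x) ^ 2 * lg_g2 sg (e * x)).
  { rewrite Eb. unfold lg_g2. field. }
  unfold lg_phi.
  replace (lg_al c e ^ 2 * (lg_p0 c d m e + lg_al c e * (x * (1 + e * x / 5 + (e * x) ^ 2 * lg_F2 sg (e * x)))) * lg_b sg e x ^ 4)
    with (lg_al c e ^ 2 * lg_p0 c d m e * lg_b sg e x ^ 4
       + lg_al c e ^ 3 * (x * ((1 + e * x / 5 + (e * x) ^ 2 * lg_F2 sg (e * x)) * lg_b sg e x ^ 4))) by ring.
  rewrite E0, E3, EF, Eb. unfold lg_P0, lg_P1, lg_P2, lg_nu. field.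
Qed.

Lemma quadratic_absorbed (C : R) :
  0 <= C -> exists C', 0 <= C' /\ forall x, 0 <= x -> C * (x ^ 2 + x + 1) <= x ^ 3 / 8 + C'.
Proof.
  intros HC. set (T := 24 * C + 1).
  exists (C * (T ^ 2 + T + 1)). split; [apply Rmult_le_pos; [exact HC | unfold T; nra] |].
  intros x Hx. destruct (Rle_or_lt x T) as [H | H].
  - assert (x ^ 2 <= T ^ 2) by (apply pow_incr; lra).
    assert (0 <= x ^ 3) by (apply pow_le; exact Hx).
    assert (C * (x ^ 2 + x + 1) <= C * (T ^ 2 + T + 1)) by (apply Rmult_le_compat_l; lra). lra.
  - assert (0 <= C * (T ^ 2 + T + 1)) by (apply Rmult_le_pos; [exact HC | unfold T; nra]).
    assert (H1 : 1 <= x) by (unfold T in H; lra).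
    assert (H2 : 24 * C <= x) by (unfold T in H; lra).
    assert (Q : 24 * C * x ^ 2 <= x * x ^ 2) by (apply Rmult_le_compat_r; [apply pow2_ge_0 | exact H2]).
    assert (x <= x ^ 2) by (simpl; nra).
    assert (1 <= x ^ 2) by (simpl; nra).
    assert (C * x <= C * x ^ 2) by (apply Rmult_le_compat_l; assumption).
    assert (C * 1 <= C * x ^ 2) by (apply Rmult_le_compat_l; assumption).
    replace (x ^ 3) with (x * x ^ 2) by ring. lra.
Qed.

Lemma lg_coefs_bounded (sg c d m : R) :
  bounded_coef (lg_P0 sg c d m) /\ bounded_coef (lg_P1 sg c d) /\ bounded_coef (lg_P2 sg c d) /\
  bounded_coef (fun _ s => lg_g2 sg s) /\ bounded_coef (fun e _ => lg_nu c d e) /\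
  bounded_coef (fun e _ => lg_p0 c d m e) /\ bounded_coef (fun _ s => lg_F2 sg s).
Proof.
  unfold lg_P0, lg_P1, lg_P2, lg_r1, lg_r2, lg_g2, lg_g1, lg_F2, lg_u, lg_nu, lg_p0, Rdiv.
  cbv zeta. repeat split; bounded_coef.
Qed.

Lemma lg_b_range (sg e x : R) :
  0 <= sg <= 1 -> 0 < e <= 1 -> 0 <= x -> e * x <= 2 ->
  1 <= lg_b sg e x <= 6 /\ 0 <= lg_b1 sg e x <= 5 * e /\ 0 <= lg_b2 sg e <= 2 * e ^ 2.
Proof.
  intros Hsg He Hx Hs. assert (0 <= e * x) by nra.
  unfold lg_b, lg_b1, lg_b2.
  assert (0 <= (e * x) ^ 2 <= 4) by (simpl; nra).
  assert (0 <= e ^ 2) by apply pow2_ge_0.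
  split; [split; [nra |] | split; [split |]].
  - assert (sg * (e * x) ^ 2 <= 1 * 4) by (apply Rmult_le_compat; lra). lra.
  - assert (0 <= 2 * sg * e ^ 2 * x) by (repeat apply Rmult_le_pos; lra). lra.
  - replace (2 * sg * e ^ 2 * x) with (e * (2 * sg * (e * x))) by ring.
    assert (sg * (e * x) <= 1 * 2) by (apply Rmult_le_compat; lra). nra.
  - split; [repeat apply Rmult_le_pos; lra |]. apply Rmult_le_compat_r; lra.
Qed.

(** With [sg = 0] the potential stays below the true one up to the origin of
    the queue; with [sg = 1] the cubic term lifts it above on the first half. *)
Lemma lg_W_bounds (sg c d m : R) :
  0 <= sg <= 1 ->
  exists C, 1 <= C /\ forall e x, 0 < e <= 1 -> 0 <= x -> e * x <= 2 ->
    let W := lg_W sg e (lg_al c e) (lg_p0 c d m e) x in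
    let nu := lg_nu c d e in
    Rabs nu <= C /\ Rabs W <= C * (1 + x) /\
    (sg = 0 -> e * x <= 6 / 5 -> W <= nu + x + e * x ^ 2 + 7 / 8 * e ^ 2 * x ^ 3 + C * e ^ 2) /\
    (sg = 1 -> nu + x + e * x ^ 2 + 3 * e ^ 2 * x ^ 3 - C * e ^ 2 <= W).
Proof.
  intros Hsg.
  destruct (lg_coefs_bounded sg c d m) as [[C0 [HC0 H0]] [[C1 [HC1 H1]] [[C2 [HC2 H2]] [[Cg [HCg Hg]] [[Cn [HCn Hn]] _]]]]].
  destruct (quadratic_absorbed (C0 + C1 + C2) ltac:(lra)) as [C' [HC' Hq]].
  exists (C' + 60 + Cn + 4 * C2 + C0 + 3 + 4 * Cg + C1).
  split; [lra |]. intros e x He Hx Hs W nu.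
  assert (Hs0 : 0 <= e * x) by nra.
  specialize (H0 e (e * x) ltac:(lra) ltac:(lra)). specialize (H1 e (e * x) ltac:(lra) ltac:(lra)).
  specialize (H2 e (e * x) ltac:(lra) ltac:(lra)). specialize (Hg e (e * x) ltac:(lra) ltac:(lra)).
  specialize (Hn e (e * x) ltac:(lra) ltac:(lra)). cbv beta in Hg, Hn. fold nu in Hn.
  specialize (Hq x Hx).
  destruct (lg_b_range sg e x Hsg He Hx Hs) as [Rb [Rb1 Rb2]].
  assert (He2 : 0 < e ^ 2) by (apply pow_lt; lra).
  assert (He21 : e ^ 2 <= 1) by (simpl; nra).
  set (S := 2 * lg_b1 sg e x ^ 2 / lg_b sg e x ^ 2 - lg_b2 sg e / lg_b sg e x).
  assert (HS : - 2 * e ^ 2 <= S <= 50 * e ^ 2).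
  { unfold S. set (b := lg_b sg e x) in *.
    assert (Hb2 : 1 <= b ^ 2) by (simpl; nra).
    assert (Q1 : 0 <= 2 * lg_b1 sg e x ^ 2 / b ^ 2 <= 50 * e ^ 2).
    { assert (0 <= lg_b1 sg e x ^ 2 <= 25 * e ^ 2).
      { split; [apply pow2_ge_0 |]. replace (25 * e ^ 2) with ((5 * e) ^ 2) by ring. apply pow_incr; lra. }
      split; [apply Rdiv_le_0_compat; lra |]. apply Rle_div_l; [lra |]. nra. }
    assert (Q2 : 0 <= lg_b2 sg e / b <= 2 * e ^ 2).
    { split; [apply Rdiv_le_0_compat; lra |]. apply Rle_div_l; [lra |]. nra. }
    lra. }
  assert (EW : W = nu + x + e * x ^ 2
    + e ^ 2 * (x ^ 3 * lg_g2 sg (e * x) + x ^ 2 * lg_P2 sg c d e (e * x)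
               + x * lg_P1 sg c d e (e * x) + lg_P0 sg c d m e (e * x)) + S).
  { unfold W, lg_W. fold S. unfold nu. rewrite <- lg_potential_expansion. unfold S. ring. }
  clearbody S W nu.
  set (g2 := lg_g2 sg (e * x)) in *.
  assert (Eg : g2 = 4 / 25 + lg_g1 sg (e * x) * (1 + (e * x) / 5) + lg_F2 sg (e * x) * (1 + 4 * (e * x) / 5 + (e * x) ^ 2 * lg_g1 sg (e * x))) by reflexivity.
  clearbody g2.
  set (p2 := lg_P2 sg c d e (e * x)) in *. set (p1 := lg_P1 sg c d e (e * x)) in *.
  set (p0 := lg_P0 sg c d m e (e * x)) in *. clearbody p2 p1 p0.
  assert (X2 : 0 <= x ^ 2) by apply pow2_ge_0. assert (X3 : 0 <= x ^ 3) by (apply pow_le; exact Hx).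
  apply Rabs_le_between in H0. apply Rabs_le_between in H1. apply Rabs_le_between in H2.
  apply Rabs_le_between in Hg.
  assert (Hrest : Rabs (x ^ 2 * p2 + x * p1 + p0) <= x ^ 3 / 8 + C').
  { apply Rabs_le.
    assert (- (C2 * x ^ 2) <= x ^ 2 * p2 <= C2 * x ^ 2) by (split; nra).
    assert (- (C1 * x) <= x * p1 <= C1 * x) by (split; nra).
    assert (0 <= C1 * x ^ 2) by (apply Rmult_le_pos; lra). assert (0 <= C0 * x ^ 2) by (apply Rmult_le_pos; lra). assert (0 <= C2 * x) by (apply Rmult_le_pos; lra).
    assert (0 <= C0 * x) by (apply Rmult_le_pos; lra).
    split; nra. }
  apply Rabs_le_between in Hrest.
  split; [| split; [| split]].
  - lra.
  - assert (E1 : e * x ^ 2 = e * x * x) by ring.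
    assert (E3 : e ^ 2 * (x ^ 3 * g2 + x ^ 2 * p2 + x * p1 + p0)
       = (e * x) ^ 2 * x * g2 + (e * x) ^ 2 * p2 + e * (e * x) * p1 + e ^ 2 * p0) by ring.
    rewrite EW, E1, E3.
    assert (Hs2 : 0 <= (e * x) ^ 2 <= 4) by (simpl; nra).
    set (s := e * x) in *.
    assert (B1 : Rabs (s ^ 2 * x * g2) <= 4 * Cg * x).
    { rewrite !Rabs_mult, (Rabs_pos_eq (s ^ 2)), (Rabs_pos_eq x) by lra.
      assert (Rabs g2 <= Cg) by (apply Rabs_le; lra).
      replace (4 * Cg * x) with (4 * x * Cg) by ring.
      apply Rmult_le_compat; [apply Rmult_le_pos; lra | apply Rabs_pos | apply Rmult_le_compat_r; lra | assumption]. }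
    assert (B2 : Rabs (s ^ 2 * p2) <= 4 * C2).
    { rewrite Rabs_mult, (Rabs_pos_eq (s ^ 2)) by lra. apply Rmult_le_compat; [lra | apply Rabs_pos | lra | apply Rabs_le; lra]. }
    assert (B3 : Rabs (e * s * p1) <= C1 * (1 + x)).
    { replace (e * s * p1) with (e ^ 2 * x * p1) by (unfold s; ring).
      rewrite !Rabs_mult, (Rabs_pos_eq (e ^ 2)), (Rabs_pos_eq x) by lra.
      assert (Rabs p1 <= C1) by (apply Rabs_le; lra).
      replace (C1 * (1 + x)) with ((1 + x) * C1) by ring.
      apply Rmult_le_compat; [apply Rmult_le_pos; lra | apply Rabs_pos | | assumption].
      apply Rle_trans with (1 * x); [apply Rmult_le_compat_r; lra | lra]. }
    assert (B4 : Rabs (e ^ 2 * p0) <= C0).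
    { rewrite Rabs_mult, (Rabs_pos_eq (e ^ 2)) by lra. replace C0 with (1 * C0) by ring.
      apply Rmult_le_compat; [lra | apply Rabs_pos | lra | apply Rabs_le; lra]. }
    apply Rabs_le_between in B1. apply Rabs_le_between in B2. apply Rabs_le_between in B3.
    apply Rabs_le_between in B4. apply Rabs_le_between in Hn.
    assert (0 <= s * x <= 2 * x) by (split; [apply Rmult_le_pos | apply Rmult_le_compat_r]; lra).
    assert (0 <= C' * x) by (apply Rmult_le_pos; lra). assert (0 <= Cn * x) by (apply Rmult_le_pos; lra). assert (0 <= C2 * x) by (apply Rmult_le_pos; lra).
    assert (0 <= C0 * x) by (apply Rmult_le_pos; lra). assert (0 <= Cg * x) by (apply Rmult_le_pos; lra). assert (0 <= C1 * x) by (apply Rmult_le_pos; lra).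
    apply Rabs_le. split; lra.
  - intros -> Hs6.
    assert (G : g2 <= 3 / 4).
    { rewrite Eg. unfold lg_g1, lg_F2, lg_u. set (s := e * x) in *.
      replace (1 / 5 + 0 * s) with (1 / 5) by ring.
      assert (0 <= s ^ 2 <= (6 / 5) ^ 2) by (split; [apply pow2_ge_0 | apply pow_incr; lra]).
      set (s2 := s ^ 2) in *.
      set (g1 := 4 * 0 + 6 * (1 / 5) ^ 2 + 4 * s * (1 / 5) ^ 3 + s2 * (1 / 5) ^ 4).
      assert (Hg1 : 0 <= g1 <= 0.281) by (unfold g1; simpl in *; lra).
      replace ((1 / 25 + 2 * 0) / 3 + 0 * s / 10 + 0 ^ 2 * s2 / 5) with (1 / 75) by field.
      assert (g1 * (1 + s / 5) <= 0.281 * 1.24) by (apply Rmult_le_compat; lra).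
      assert (s2 * g1 <= (6 / 5) ^ 2 * 0.281) by (apply Rmult_le_compat; lra).
      simpl in *. lra. }
    rewrite EW.
    assert (x ^ 3 * g2 <= x ^ 3 * (3 / 4)) by (apply Rmult_le_compat_l; lra).
    assert (e ^ 2 * (x ^ 3 * g2 + x ^ 2 * p2 + x * p1 + p0) <= e ^ 2 * (7 / 8 * x ^ 3 + C')) by (apply Rmult_le_compat_l; lra).
    nra.
  - intros ->.
    assert (G : 4 <= g2).
    { rewrite Eg. unfold lg_g1, lg_F2, lg_u. set (s := e * x) in *.
      assert (Hu : 0 <= 1 / 5 + 1 * s) by lra. set (u := 1 / 5 + 1 * s) in *.
      assert (0 <= u ^ 2) by apply pow2_ge_0. assert (0 <= u ^ 3) by (apply pow_le; exact Hu).
      assert (0 <= u ^ 4) by (apply pow_le; exact Hu). assert (0 <= s ^ 2) by apply pow2_ge_0.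
      set (g1 := 4 * 1 + 6 * u ^ 2 + 4 * s * u ^ 3 + s ^ 2 * u ^ 4).
      assert (Hg1 : 4 <= g1) by (unfold g1; nra).
      assert (0 <= (1 / 25 + 2 * 1) / 3 + 1 * s / 10 + 1 ^ 2 * s ^ 2 / 5) by (simpl in *; lra).
      assert (0 <= s ^ 2 * g1) by nra.
      assert (0 <= ((1 / 25 + 2 * 1) / 3 + 1 * s / 10 + 1 ^ 2 * s ^ 2 / 5) * (1 + 4 * s / 5 + s ^ 2 * g1))
        by (apply Rmult_le_pos; lra).
      nra. }
    rewrite EW.
    assert (x ^ 3 * 4 <= x ^ 3 * g2) by (apply Rmult_le_compat_l; lra).
    assert (e ^ 2 * (3 * x ^ 3 - C') <= e ^ 2 * (x ^ 3 * g2 + x ^ 2 * p2 + x * p1 + p0)) by (apply Rmult_le_compat_l; lra).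
    nra.
Qed.

(** What the comparison function takes from a decaying Airy solution. The point
    [c0] is its last zero in the subcritical case, and lies slightly below the root
    of the quotient equation in the near-critical case. *)
Definition airy_profile (A A1 : R -> R) (B c0 : R) : Prop :=
  airy_decaying A A1 B /\ (forall x, c0 < x -> 0 < A x) /\
  (exists C, 0 < C /\ forall y, c0 < y -> Rabs (A1 y) <= C * (1 + Rabs y + / (y - c0)) * A y) /\
  (forall Y, exists k, 0 < k /\ forall y, c0 <= y <= Y -> k * (y - c0) <= A y).

Notation lgw A sg c d m e := (lg_w A sg e (lg_al c e) (lg_p0 c d m e)).
Notation lgw1 A A1 sg c d m e := (lg_w1 A A1 sg e (lg_al c e) (lg_p0 c d m e)).
Notation lgphi sg c d m e := (lg_phi sg e (lg_al c e) (lg_p0 c d m e)).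
Notation lgW sg c d m e := (lg_W sg e (lg_al c e) (lg_p0 c d m e)).

Lemma lg_phi_range (sg c d m c0 e1 : R) :
  0 <= sg <= 1 -> 0 < e1 -> (forall e, 0 < e <= e1 -> c0 <= lg_p0 c d m e) ->
  exists C e0, 1 <= C /\ 0 < e0 <= 1 /\ forall e x, 0 < e <= e0 -> 0 <= x -> e * x <= 2 ->
    x / 2 <= lgphi sg c d m e x - c0 /\ Rabs (lgphi sg c d m e x) <= C * (1 + x) /\
    x / 2 - C <= lgphi sg c d m e x /\ 1 / 2 <= lg_al c e <= 2.
Proof.
  intros Hsg He1 Hc0.
  destruct (lg_coefs_bounded sg c d m) as [_ [_ [_ [_ [_ [[Cp [HCp Hp]] [CF [HCF HF]]]]]]]].
  set (k := Rabs c + 1). assert (Hk : 1 <= k) by (unfold k; pose proof (Rabs_pos c); lra).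
  exists (Cp + 2 * (2 + 4 * CF) + 1), (Rmin e1 (/ k)).
  assert (Hik : 0 < / k <= 1).
  { split; [apply Rinv_0_lt_compat; lra | rewrite <- Rinv_1; apply Rinv_le_contravar; lra]. }
  split; [lra | split].
  { split; [apply Rmin_glb_lt; lra | eapply Rle_trans; [apply Rmin_r | lra]]. }
  intros e x [He Hee] Hx Hs.
  assert (He1' : e <= e1) by (eapply Rle_trans; [exact Hee | apply Rmin_l]).
  assert (Hek : e <= / k) by (eapply Rle_trans; [exact Hee | apply Rmin_r]).
  assert (Hs0 : 0 <= e * x) by nra.
  specialize (Hp e (e * x) ltac:(lra) ltac:(lra)). specialize (HF e (e * x) ltac:(lra) ltac:(lra)).
  specialize (Hc0 e ltac:(lra)). cbv beta in Hp, HF.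
  assert (Hal : 1 / 2 <= lg_al c e <= 2).
  { unfold lg_al. assert (e * k <= 1).
    { apply Rle_trans with (/ k * k); [apply Rmult_le_compat_r; lra | rewrite Rinv_l; lra]. }
    assert (Rabs (e * c) <= 1).
    { rewrite Rabs_mult, (Rabs_pos_eq e) by lra. unfold k in *. nra. }
    apply Rabs_le_between in H0. replace (e * (-4 * c / 15)) with (- (4 / 15) * (e * c)) by field. lra. }
  assert (HF0 : 0 <= lg_F2 sg (e * x)).
  { unfold lg_F2. assert (0 <= sg * (e * x)) by nra.
    assert (0 <= sg ^ 2 * (e * x) ^ 2) by (apply Rmult_le_pos; apply pow2_ge_0). lra. }
  rewrite Rabs_pos_eq in HF by exact HF0.
  unfold lg_phi. set (s := e * x) in *. set (p0 := lg_p0 c d m e) in *. set (al := lg_al c e) in *.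
  assert (Hs2 : 0 <= s ^ 2 <= 4) by (simpl; nra).
  set (q := 1 + s / 5 + s ^ 2 * lg_F2 sg s).
  assert (Hq : 1 <= q <= 2 + 4 * CF).
  { unfold q. assert (0 <= s ^ 2 * lg_F2 sg s <= 4 * CF) by (split; [apply Rmult_le_pos; lra | apply Rmult_le_compat; lra]). lra. }
  assert (Hxq : x <= x * q <= x * (2 + 4 * CF)) by (split; nra).
  assert (Halq : x / 2 <= al * (x * q) <= 2 * (x * (2 + 4 * CF))) by (split; nra).
  apply Rabs_le_between in Hp.
  split; [lra | split; [| split; [lra | exact Hal]]].
  assert (0 <= Cp * x) by nra. assert (0 <= CF * x) by nra.
  apply Rabs_le. split; nra.
Qed.

Lemma lg_w_slope (A A1 : R -> R) (B sg c d m c0 e1 : R) :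
  airy_profile A A1 B c0 -> 0 <= sg <= 1 -> 0 < e1 ->
  (forall e, 0 < e <= e1 -> c0 <= lg_p0 c d m e) ->
  exists C e0, 1 <= C /\ 0 < e0 <= 1 /\ forall e x, 0 < e <= e0 -> 0 < x -> e * x <= 2 ->
    0 < lgw A sg c d m e x /\
    Rabs (lgw1 A A1 sg c d m e x) <= C * (1 + x + / x) * lgw A sg c d m e x.
Proof.
  intros [HA [Hpos [[C1 [HC1 Hr]] _]]] Hsg He1 Hc0.
  destruct (lg_phi_range sg c d m c0 e1 Hsg He1 Hc0) as [Cp [e0 [HCp [He0 Hphi]]]].
  exists (72 * C1 * (1 + Cp + 2) + 5), e0.
  split; [nra | split; [exact He0 |]]. intros e x He Hx Hs.
  destruct (Hphi e x He ltac:(lra) Hs) as [P1 [P2 [_ Hal]]].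
  destruct (lg_b_range sg e x Hsg ltac:(lra) ltac:(lra) Hs) as [Rb [Rb1 _]].
  unfold lg_w, lg_w1. set (p := lgphi sg c d m e x) in *. set (b := lg_b sg e x) in *.
  set (al := lg_al c e) in *. set (b1 := lg_b1 sg e x) in *.
  assert (HAp : 0 < A p) by (apply Hpos; lra).
  assert (Hi : 0 < / x) by (apply Rinv_0_lt_compat; exact Hx).
  assert (Hip : / (p - c0) <= 2 * / x).
  { replace (2 * / x) with (/ (x / 2)) by (field; lra). apply Rinv_le_contravar; lra. }
  split; [apply Rdiv_lt_0_compat; lra |].
  specialize (Hr p ltac:(lra)).
  set (w := A p / b). assert (Hw : A p = b * w) by (unfold w; field; lra).
  assert (Hw0 : 0 < w) by (apply Rdiv_lt_0_compat; lra).
  assert (HZ : 1 + Rabs p + / (p - c0) <= (1 + Cp + 2) * (1 + x + / x)).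
  { assert (0 < Cp * / x) by (apply Rmult_lt_0_compat; lra). assert (0 <= Cp * x) by nra. nra. }
  set (Z := 1 + x + / x) in *. assert (HZ1 : 1 <= Z) by (unfold Z; lra).
  assert (HA1 : Rabs (A1 p) <= C1 * ((1 + Cp + 2) * Z) * (6 * w)).
  { eapply Rle_trans; [exact Hr |].
    apply Rmult_le_compat; [| lra | | rewrite Hw; nra].
    - apply Rmult_le_pos; [lra |]. pose proof (Rabs_pos p).
      assert (0 < / (p - c0)) by (apply Rinv_0_lt_compat; lra). lra.
    - apply Rmult_le_compat_l; lra. }
  assert (T1 : Rabs (al * b * A1 p) <= 12 * (C1 * ((1 + Cp + 2) * Z) * (6 * w))).
  { rewrite !Rabs_mult, (Rabs_pos_eq al), (Rabs_pos_eq b) by lra.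
    apply Rmult_le_compat; [nra | apply Rabs_pos | nra | exact HA1]. }
  assert (T2 : 0 <= b1 / b ^ 2 * A p <= 5 * w).
  { replace (b1 / b ^ 2 * A p) with (b1 * / b * w) by (unfold w; field; lra).
    assert (Hib : 0 < / b <= 1).
    { split; [apply Rinv_0_lt_compat; lra | rewrite <- Rinv_1; apply Rinv_le_contravar; lra]. }
    assert (0 <= b1 * / b <= 5) by (split; nra). split; [apply Rmult_le_pos; lra | apply Rmult_le_compat_r; lra]. }
  assert (T3 : 5 * w <= 5 * Z * w) by nra.
  apply Rabs_le_between in T1. apply Rabs_le. split; nra.
Qed.

Definition cubic_potential (a k e y : R) : R := a + y + e * y ^ 2 + k * e ^ 2 * y ^ 3.

(** Within one lattice step [e ^ 2] of [x] the pair [(w, w1)] changes at most by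
    a bounded factor, by Gronwall with a rate of order [/ e]. The second
    derivative of a cubic times [w] is therefore controlled by [w x] itself, which
    makes the discretization error relative. *)
Lemma lg_trial_second_derivative (A A1 : R -> R) (B sg c d m c0 e1 k Ca : R) :
  airy_profile A A1 B c0 -> 0 <= sg <= 1 -> 0 < e1 -> 0 <= k <= 3 -> 0 <= Ca ->
  (forall e, 0 < e <= e1 -> c0 <= lg_p0 c d m e) ->
  exists C e0, 1 <= C /\ 0 < e0 <= 1 /\ forall a e x, 0 < e <= e0 -> Rabs a <= Ca ->
    e ^ 2 <= x -> e * (x + e ^ 2) <= 2 ->
    exists f1 f2 : R -> R,
    let f := fun y => cubic_potential a k e y * lgw A sg c d m e y in
    forall y, Rabs (y - x) <= e ^ 2 ->
      0 <= y /\ e * y <= 2 /\ is_derive f y (f1 y) /\ is_derive f1 y (f2 y) /\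
      Rabs (f2 y) <= C * (1 + x ^ 3 + / x) * lgw A sg c d m e x.
Proof.
  intros Hprof Hsg He1 Hk HCa Hc0.
  destruct (lg_w_slope A A1 B sg c d m c0 e1 Hprof Hsg He1 Hc0) as [Cs [es [HCs [Hes Hslope]]]].
  destruct (lg_W_bounds sg c d m Hsg) as [CW [HCW HW]].
  assert (HA : airy_decaying A A1 B) by apply Hprof.
  exists (2 * (120 + (Ca + 20) * CW) * 4 * (1 + Cs) * 20),
    (Rmin es (/ (3 + 5 * CW))).
  assert (Hi : 0 < / (3 + 5 * CW) <= 1).
  { split; [apply Rinv_0_lt_compat; lra | rewrite <- Rinv_1; apply Rinv_le_contravar; lra]. }
  split; [| split].
  { assert (0 <= (Ca + 20) * CW) by nra. nra. }
  { split; [apply Rmin_glb_lt; lra | eapply Rle_trans; [apply Rmin_r | lra]]. }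
  intros a e x [He Hee] Ha Hx Hxs.
  assert (Hees : e <= es) by (eapply Rle_trans; [exact Hee | apply Rmin_l]).
  assert (HeC : e <= / (3 + 5 * CW)) by (eapply Rle_trans; [exact Hee | apply Rmin_r]).
  assert (He2 : 0 < e ^ 2) by (apply pow_lt; lra).
  assert (Hx0 : 0 < x) by lra.
  assert (He21 : e ^ 2 <= e) by (simpl; nra).
  set (w := lgw A sg c d m e). set (w1 := lgw1 A A1 sg c d m e). set (W := lgW sg c d m e).
  set (V := cubic_potential a k e).
  set (V1 := fun y => 1 + 2 * e * y + 3 * k * e ^ 2 * y ^ 2).
  set (V2 := fun y => 2 * e + 6 * k * e ^ 2 * y).
  exists (fun y => V1 y * w y + V y * w1 y), (fun y => V2 y * w y + 2 * (V1 y * w1 y) + V y * (W y * w y)).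
  assert (Hrange : forall y, Rabs (y - x) <= e ^ 2 -> 0 <= y /\ e * y <= 2 /\ y <= x + 1).
  { intros y Hy. apply Rabs_le_between in Hy.
    assert (y <= x + e ^ 2) by lra.
    assert (e * y <= e * (x + e ^ 2)) by (apply Rmult_le_compat_l; lra).
    split; [lra | split; [lra | nra]]. }
  assert (Hder : forall y, Rabs (y - x) <= e ^ 2 -> is_derive w y (w1 y) /\ is_derive w1 y (W y * w y)).
  { intros y Hy. destruct (Hrange y Hy) as [Y0 [Y1 _]].
    destruct (lg_b_range sg e y Hsg ltac:(lra) Y0 Y1) as [Rb _].
    apply (lg_w_derive A A1 B); [exact HA | lra]. }
  destruct (Hslope e x ltac:(lra) Hx0 ltac:(nra)) as [Hwpos Hw1]. fold w w1 in Hwpos, Hw1.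
  set (E := w x + Rabs (w1 x)). assert (HE : 0 < E) by (unfold E; pose proof (Rabs_pos (w1 x)); lra).
  (* neighbouring values are controlled by those at x *)
  set (N := fun y => w y ^ 2 + w1 y ^ 2).
  set (N' := fun y => 2 * w y * w1 y * (1 + W y)).
  assert (HNx : N x <= E ^ 2).
  { unfold N, E. rewrite <- (pow2_abs (w1 x)). pose proof (Rabs_pos (w1 x)). simpl. nra. }
  assert (HN : forall y, Rabs (y - x) <= e ^ 2 -> N y <= 3 * N x).
  { set (L := (3 + 5 * CW) / e).
    assert (HL : forall y, Rabs (y - x) <= e ^ 2 -> is_derive N y (N' y) /\ Rabs (N' y) <= L * N y).
    { intros y Hy. destruct (Hder y Hy) as [D1 D2]. destruct (Hrange y Hy) as [Y0 [Y1 _]].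
      split.
      - unfold N, N'. auto_derive.
        + split; [eexists; exact D1 | split; [eexists; exact D2 | trivial]].
        + rewrite (Derive_eta w _ _ D1), (Derive_eta w1 _ _ D2). ring.
      - unfold N'. rewrite Rabs_mult.
        assert (Q : Rabs (2 * w y * w1 y) <= N y).
        { unfold N. apply Rabs_le.
          assert (0 <= (w y + w1 y) ^ 2) by apply pow2_ge_0.
          assert (0 <= (w y - w1 y) ^ 2) by apply pow2_ge_0. simpl in *. lra. }
        assert (QW : Rabs (1 + W y) <= L).
        { destruct (HW e y ltac:(lra) Y0 Y1) as [_ [BW _]]. fold (W y) in BW.
          eapply Rle_trans; [apply Rabs_triang |]. rewrite Rabs_R1.
          apply Rle_trans with (1 + CW * (1 + y)); [lra |].
          unfold L. apply Rle_div_r; [lra |].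
          replace ((1 + CW * (1 + y)) * e) with (e + CW * (e + e * y)) by ring.
          assert (CW * (e + e * y) <= CW * 3) by (apply Rmult_le_compat_l; lra). lra. }
        rewrite (Rmult_comm L). apply Rmult_le_compat; try apply Rabs_pos; assumption. }
    assert (HLe : L * e ^ 2 <= 1).
    { unfold L. replace ((3 + 5 * CW) / e * e ^ 2) with ((3 + 5 * CW) * e) by (field; lra).
      apply Rle_trans with ((3 + 5 * CW) * / (3 + 5 * CW)); [apply Rmult_le_compat_l; lra | rewrite Rinv_r; lra]. }
    assert (HL0 : 0 < L) by (apply Rdiv_lt_0_compat; lra).
    assert (HNx0 : 0 <= N x) by (unfold N; assert (0 <= w x ^ 2) by apply pow2_ge_0; assert (0 <= w1 x ^ 2) by apply pow2_ge_0; lra).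
    assert (Hexp : forall u, 0 <= u <= e ^ 2 -> exp (L * u) <= 3).
    { intros u Hu. apply Rle_trans with (exp 1); [| apply exp_le_3].
      destruct (Rle_lt_or_eq (L * u) 1) as [H | ->]; [nra | left; apply exp_increasing; exact H | lra]. }
    intros y Hy. assert (Hy' := Hy). apply Rabs_le_between in Hy'.
    destruct (Rle_or_lt x y) as [H | H].
    - destruct (gronwall N N' L x y H) as [G _].
      + intros u Hu. apply HL. apply Rabs_le. lra.
      + intros u Hu. apply HL. apply Rabs_le. lra.
      + eapply Rle_trans; [exact G |]. apply Rmult_le_compat_r; [exact HNx0 | apply Hexp; lra].
    - destruct (gronwall N N' L y x ltac:(lra)) as [_ G].
      + intros u Hu. apply HL. apply Rabs_le. lra.
      + intros u Hu. apply HL. apply Rabs_le. lra.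
      + eapply Rle_trans; [exact G |]. apply Rmult_le_compat_r; [exact HNx0 | apply Hexp; lra]. }
  assert (Hnear : forall y, Rabs (y - x) <= e ^ 2 -> Rabs (w y) <= 2 * E /\ Rabs (w1 y) <= 2 * E).
  { intros y Hy. specialize (HN y Hy). unfold N in HN at 1.
    assert (0 <= w y ^ 2) by apply pow2_ge_0. assert (0 <= w1 y ^ 2) by apply pow2_ge_0.
    assert (HE4 : w y ^ 2 <= (2 * E) ^ 2 /\ w1 y ^ 2 <= (2 * E) ^ 2).
    { replace ((2 * E) ^ 2) with (4 * E ^ 2) by ring. assert (0 <= E ^ 2) by apply pow2_ge_0. split; lra. }
    split; apply Rabs_le; simpl in HE4; split; nra. }
  assert (HEw : E <= (1 + Cs) * (1 + x + / x) * w x).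
  { unfold E. assert (Hix : 0 < / x) by (apply Rinv_0_lt_compat; lra).
    assert (w x <= (1 + x + / x) * w x) by nra. nra. }
  intros f y Hy. destruct (Hrange y Hy) as [Y0 [Y1 Y2]]. destruct (Hder y Hy) as [D1 D2].
  destruct (Hnear y Hy) as [N1 N2].
  split; [exact Y0 | split; [exact Y1 | split; [| split]]].
  - unfold f. fold w V. unfold V1, V, cubic_potential. auto_derive; [eexists; exact D1 |].
    rewrite (Derive_eta w _ _ D1). ring.
  - unfold V2, V1, V, cubic_potential. auto_derive.
    + split; [eexists; exact D1 | split; [eexists; exact D2 | trivial]].
    + rewrite (Derive_eta w _ _ D1), (Derive_eta w1 _ _ D2). ring.
  - destruct (HW e y ltac:(lra) Y0 Y1) as [_ [BW _]]. fold (W y) in BW.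
    assert (Hs0 : 0 <= e * y) by (apply Rmult_le_pos; lra).
    assert (BV2 : 0 <= V2 y <= 2 + 36).
    { unfold V2. replace (6 * k * e ^ 2 * y) with (6 * (k * (e * (e * y)))) by ring.
      assert (0 <= e * (e * y) <= 1 * 2) by (split; [apply Rmult_le_pos | apply Rmult_le_compat]; lra).
      assert (0 <= k * (e * (e * y)) <= 3 * 2) by (split; [apply Rmult_le_pos; lra | apply Rmult_le_compat; lra]). lra. }
    assert (BV1 : 0 <= V1 y <= 41).
    { unfold V1. replace (3 * k * e ^ 2 * y ^ 2) with (3 * (k * ((e * y) * (e * y)))) by ring.
      assert (0 <= (e * y) * (e * y) <= 4)
        by (split; [apply Rle_0_sqr | replace 4 with (2 * 2) by ring; apply Rmult_le_compat; lra]).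
      assert (0 <= k * ((e * y) * (e * y)) <= 3 * 4) by (split; [apply Rmult_le_pos; lra | apply Rmult_le_compat; lra]). nra. }
    assert (BV : Rabs (V y) <= (Ca + 20) * (1 + y)).
    { unfold V, cubic_potential.
      replace (a + y + e * y ^ 2 + k * e ^ 2 * y ^ 3) with (a + y * (1 + e * y + k * ((e * y) * (e * y)))) by ring.
      assert (0 <= (e * y) * (e * y) <= 4)
        by (split; [apply Rle_0_sqr | replace 4 with (2 * 2) by ring; apply Rmult_le_compat; lra]).
      assert (0 <= k * ((e * y) * (e * y)) <= 3 * 4) by (split; [apply Rmult_le_pos; lra | apply Rmult_le_compat; lra]).
      set (q := 1 + e * y + k * ((e * y) * (e * y))) in *. assert (0 <= q <= 15) by (unfold q; lra).
      assert (0 <= y * q <= y * 15) by (split; [apply Rmult_le_pos; lra | apply Rmult_le_compat_l; lra]).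
      apply Rabs_le_between in Ha. assert (0 <= Ca * y) by (apply Rmult_le_pos; lra). apply Rabs_le. split; lra. }
    set (G := (1 + y) * (1 + y)). assert (HG : 1 <= G) by (unfold G; nra).
    assert (B3 : Rabs (V y * (W y * w y)) <= (Ca + 20) * CW * G * (2 * E)).
    { rewrite <- Rmult_assoc, !Rabs_mult.
      apply Rmult_le_compat; [apply Rmult_le_pos; apply Rabs_pos | apply Rabs_pos | | exact N1].
      unfold G. replace ((Ca + 20) * CW * ((1 + y) * (1 + y))) with (((Ca + 20) * (1 + y)) * (CW * (1 + y))) by ring.
      apply Rmult_le_compat; try apply Rabs_pos; assumption. }
    assert (B1 : Rabs (V2 y * w y) <= 38 * (2 * E)).
    { rewrite Rabs_mult, (Rabs_pos_eq (V2 y)) by lra. apply Rmult_le_compat; [lra | apply Rabs_pos | lra | exact N1]. }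
    assert (B2 : Rabs (V1 y * w1 y) <= 41 * (2 * E)).
    { rewrite Rabs_mult, (Rabs_pos_eq (V1 y)) by lra. apply Rmult_le_compat; [lra | apply Rabs_pos | lra | exact N2]. }
    assert (HK : 0 <= (Ca + 20) * CW) by (apply Rmult_le_pos; lra).
    set (KK := (Ca + 20) * CW) in *.
    assert (Tot : Rabs (V2 y * w y + 2 * (V1 y * w1 y) + V y * (W y * w y)) <= (120 + KK) * G * (2 * E)).
    { apply Rabs_le_between in B1. apply Rabs_le_between in B2. apply Rabs_le_between in B3.
      assert (1 * (2 * E) <= G * (2 * E)) by (apply Rmult_le_compat_r; lra).
      apply Rabs_le. split; lra. }
    eapply Rle_trans; [exact Tot |].
    assert (Hix : 0 < / x) by (apply Rinv_0_lt_compat; lra).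
    assert (HGx : G * (1 + x + / x) <= 4 * 20 * (1 + x ^ 3 + / x)).
    { assert (G <= (2 + x) * (2 + x)) by (unfold G; apply Rmult_le_compat; lra).
      apply Rle_trans with ((2 + x) * (2 + x) * (1 + x + / x)); [apply Rmult_le_compat_r; lra |].
      replace ((2 + x) * (2 + x) * (1 + x + / x)) with (8 + 9 * x + 5 * x ^ 2 + x ^ 3 + 4 * / x) by (field; lra).
      assert (0 <= x ^ 3) by (apply pow_le; lra).
      assert (x <= 1 + x ^ 3 /\ x ^ 2 <= 1 + x ^ 3).
      { destruct (Rle_or_lt x 1) as [H1 | H1].
        - assert (x ^ 2 <= 1 ^ 2) by (apply pow_incr; lra). lra.
        - assert (x ^ 1 <= x ^ 3) by (apply Rle_pow; [lra | lia]).
          assert (x ^ 2 <= x ^ 3) by (apply Rle_pow; [lra | lia]). lra. }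
      lra. }
    apply Rle_trans with ((120 + KK) * G * (2 * ((1 + Cs) * (1 + x + / x) * w x))).
    + apply Rmult_le_compat_l; [apply Rmult_le_pos; lra | lra].
    + replace ((120 + KK) * G * (2 * ((1 + Cs) * (1 + x + / x) * w x)))
        with (2 * (120 + KK) * (1 + Cs) * (G * (1 + x + / x)) * w x) by ring.
      apply Rmult_le_compat_r; [lra |].
      apply Rle_trans with (2 * (120 + KK) * (1 + Cs) * (4 * 20 * (1 + x ^ 3 + / x))).
      * apply Rmult_le_compat_l; [apply Rmult_le_pos; lra | exact HGx].
      * assert (0 <= x ^ 3) by (apply pow_le; lra).
        set (Z := 1 + x ^ 3 + / x) in *. assert (0 < Z) by (unfold Z; lra).
        right. ring.
Qed.

Lemma lg_w_nonneg (A A1 : R -> R) (B sg c d m c0 e1 : R) :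
  airy_profile A A1 B c0 -> 0 <= sg <= 1 -> 0 < e1 ->
  (forall e, 0 < e <= e1 -> c0 <= lg_p0 c d m e) ->
  exists e0, 0 < e0 <= 1 /\ forall e x, 0 < e <= e0 -> 0 <= x -> e * x <= 2 ->
    0 <= lgw A sg c d m e x.
Proof.
  intros [_ [_ [_ Hk]]] Hsg He1 Hc0.
  destruct (lg_phi_range sg c d m c0 e1 Hsg He1 Hc0) as [Cp [e0 [_ [He0 Hphi]]]].
  exists e0. split; [exact He0 |]. intros e x He Hx Hs.
  destruct (Hphi e x He Hx Hs) as [P1 _].
  destruct (lg_b_range sg e x Hsg ltac:(lra) Hx Hs) as [Rb _].
  destruct (Hk (lgphi sg c d m e x)) as [k [Hk0 Hkk]].
  unfold lg_w. apply Rdiv_le_0_compat; [| lra].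
  eapply Rle_trans; [| apply Hkk; lra]. apply Rmult_le_pos; lra.
Qed.

Lemma lg_discretization_small (C e x w : R) :
  0 <= C -> 0 < e <= 1 -> 8 * C * e <= 1 -> e ^ 2 <= x -> 0 <= w ->
  C * (1 + x ^ 3 + / x) * w * (e ^ 2) ^ 4 <= e ^ 4 * w * (e ^ 2 * x ^ 3 / 8 + 2 * C * e ^ 2).
Proof.
  intros HC He HCe Hx Hw.
  assert (He2 : 0 < e ^ 2) by (apply pow_lt; lra).
  assert (Hx3 : 0 <= x ^ 3) by (apply pow_le; lra).
  replace (C * (1 + x ^ 3 + / x) * w * (e ^ 2) ^ 4)
    with (e ^ 4 * w * (e ^ 2 * (e ^ 2 * (C * (1 + x ^ 3 + / x))))) by ring.
  apply Rmult_le_compat_l; [apply Rmult_le_pos; [apply pow_le; lra | exact Hw] |].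
  replace (e ^ 2 * x ^ 3 / 8 + 2 * C * e ^ 2) with (e ^ 2 * (x ^ 3 / 8 + 2 * C)) by field.
  apply Rmult_le_compat_l; [lra |].
  assert (H1 : e ^ 2 * / x <= 1).
  { apply (Rmult_le_reg_r x); [lra |]. rewrite Rmult_assoc, Rinv_l by lra. lra. }
  assert (H2 : C * e ^ 2 <= 1 / 8).
  { assert (e ^ 2 <= e) by (simpl; nra). assert (C * e ^ 2 <= C * e) by (apply Rmult_le_compat_l; lra). lra. }
  assert (H3 : e ^ 2 <= 1) by (simpl; nra).
  assert (C * (e ^ 2 * / x) <= C * 1) by (apply Rmult_le_compat_l; lra).
  assert (C * e ^ 2 <= C * 1) by (apply Rmult_le_compat_l; lra).
  assert (C * e ^ 2 * x ^ 3 <= 1 / 8 * x ^ 3) by (apply Rmult_le_compat_r; lra).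
  lra.
Qed.

(** The slack between the cubic coefficients [7 / 8] of the potential and [1] of the
    conclusion pays for the discretization error. *)
Lemma lg_discrete_upper (A A1 : R -> R) (B c d m c0 e1 : R) :
  airy_profile A A1 B c0 -> 0 < e1 ->
  (forall e, 0 < e <= e1 -> c0 <= lg_p0 c d m e) ->
  exists C e0, 1 <= C /\ 0 < e0 <= 1 /\ forall e x, 0 < e <= e0 -> e ^ 2 <= x -> e * x <= 11 / 10 ->
    let w := lgw A 0 c d m e in
    w (x + e ^ 2) + w (x - e ^ 2) - 2 * w x
      <= e ^ 4 * w x * (lg_nu c d e + x + e * x ^ 2 + e ^ 2 * x ^ 3 + C * e ^ 2).
Proof.
  intros Hprof He1 Hc0. assert (Hsg : 0 <= 0 <= 1) by lra.
  destruct (lg_W_bounds 0 c d m Hsg) as [CW [HCW HW]].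
  destruct (lg_w_nonneg A A1 B 0 c d m c0 e1 Hprof Hsg He1 Hc0) as [en [Hen Hnn]].
  destruct (lg_trial_second_derivative A A1 B 0 c d m c0 e1 (7 / 8) (2 * CW) Hprof Hsg He1 ltac:(lra) ltac:(lra) Hc0)
    as [C2 [e2 [HC2 [He2 H2]]]].
  exists (CW + 2 * C2), (Rmin (Rmin en e2) (/ (10 * C2))).
  assert (Hi : 0 < / (10 * C2)) by (apply Rinv_0_lt_compat; lra).
  split; [lra | split].
  { split; [repeat apply Rmin_glb_lt; lra |].
    eapply Rle_trans; [apply Rmin_l |]. eapply Rle_trans; [apply Rmin_l | lra]. }
  intros e x [He Hee] Hx Hs w.
  assert (Ha : e <= Rmin en e2) by (eapply Rle_trans; [exact Hee | apply Rmin_l]).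
  assert (He_n : e <= en) by (eapply Rle_trans; [exact Ha | apply Rmin_l]).
  assert (He_2 : e <= e2) by (eapply Rle_trans; [exact Ha | apply Rmin_r]).
  assert (He_C : e <= / (10 * C2)) by (eapply Rle_trans; [exact Hee | apply Rmin_r]).
  assert (HeC : 10 * C2 * e <= 1).
  { apply Rle_trans with (10 * C2 * / (10 * C2)); [apply Rmult_le_compat_l; lra | rewrite Rinv_r; lra]. }
  assert (Hep : 0 < e ^ 2) by (apply pow_lt; lra).
  assert (Hep1 : e ^ 2 <= e) by (simpl; nra).
  assert (He3 : e * e ^ 2 <= 1 / 10) by nra.
  set (a := lg_nu c d e + CW * e ^ 2).
  assert (Hac : Rabs a <= 2 * CW).
  { destruct (HW e 0 ltac:(lra) ltac:(lra) ltac:(lra)) as [Bn _].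
    unfold a. eapply Rle_trans; [apply Rabs_triang |].
    rewrite (Rabs_pos_eq (CW * e ^ 2)) by (apply Rmult_le_pos; lra). nra. }
  destruct (H2 a e x ltac:(lra) Hac Hx ltac:(lra)) as [f1 [f2 Hf]].
  set (f := fun y => cubic_potential a (7 / 8) e y * w y).
  assert (S := second_difference_le w (lgw1 A A1 0 c d m e) (fun y => lgW 0 c d m e y * w y) f f1 f2 x (e ^ 2)
    (C2 * (1 + x ^ 3 + / x) * w x)).
  assert (Hwx : 0 <= w x) by (apply Hnn; lra).
  eapply Rle_trans; [apply S |].
  - lra.
  - intros y Hy. destruct (Hf y Hy) as [Y0 [Y1 _]].
    destruct (lg_b_range 0 e y Hsg ltac:(lra) Y0 Y1) as [Rb _].
    destruct (lg_w_derive A A1 B 0 e (lg_al c e) (lg_p0 c d m e) y (proj1 Hprof) ltac:(lra)) as [D1 D2].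
    split; [exact D1 | split; [exact D2 |]].
    unfold f. apply Rmult_le_compat_r; [apply Hnn; lra |].
    destruct (HW e y ltac:(lra) Y0 Y1) as [_ [_ [U _]]].
    assert (Hy6 : e * y <= 6 / 5).
    { apply Rabs_le_between in Hy. assert (e * y <= e * (x + e ^ 2)) by (apply Rmult_le_compat_l; lra). lra. }
    specialize (U eq_refl Hy6). unfold cubic_potential, a. lra.
  - intros y Hy. destruct (Hf y Hy) as [_ [_ F]]. exact F.
  - assert (Sm := lg_discretization_small C2 e x (w x) ltac:(lra) ltac:(lra) ltac:(lra) Hx Hwx).
    unfold f, cubic_potential, a.
    replace ((e ^ 2) ^ 2) with (e ^ 4) by ring.
    set (P := e ^ 4 * w x) in *.
    replace (e ^ 4 * ((lg_nu c d e + CW * e ^ 2 + x + e * x ^ 2 + 7 / 8 * e ^ 2 * x ^ 3) * w x))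
      with (P * (lg_nu c d e + CW * e ^ 2 + x + e * x ^ 2 + 7 / 8 * e ^ 2 * x ^ 3)) by (unfold P; ring).
    lra.
Qed.

(** Here the slack is between the cubic coefficients [3] and [2]. *)
Lemma lg_discrete_lower (A A1 : R -> R) (B c d m c0 e1 : R) :
  airy_profile A A1 B c0 -> 0 < e1 ->
  (forall e, 0 < e <= e1 -> c0 <= lg_p0 c d m e) ->
  exists C e0, 1 <= C /\ 0 < e0 <= 1 /\ forall e x, 0 < e <= e0 -> e ^ 2 <= x -> e * x <= 11 / 10 ->
    let w := lgw A 1 c d m e in
    e ^ 4 * w x * (lg_nu c d e + x + e * x ^ 2 + 2 * e ^ 2 * x ^ 3 - C * e ^ 2)
      <= w (x + e ^ 2) + w (x - e ^ 2) - 2 * w x.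
Proof.
  intros Hprof He1 Hc0. assert (Hsg : 0 <= 1 <= 1) by lra.
  destruct (lg_W_bounds 1 c d m Hsg) as [CW [HCW HW]].
  destruct (lg_w_nonneg A A1 B 1 c d m c0 e1 Hprof Hsg He1 Hc0) as [en [Hen Hnn]].
  destruct (lg_trial_second_derivative A A1 B 1 c d m c0 e1 3 (2 * CW) Hprof Hsg He1 ltac:(lra) ltac:(lra) Hc0)
    as [C2 [e2 [HC2 [He2 H2]]]].
  exists (CW + 2 * C2), (Rmin (Rmin en e2) (/ (10 * C2))).
  assert (Hi : 0 < / (10 * C2)) by (apply Rinv_0_lt_compat; lra).
  split; [lra | split].
  { split; [repeat apply Rmin_glb_lt; lra |].
    eapply Rle_trans; [apply Rmin_l |]. eapply Rle_trans; [apply Rmin_l | lra]. }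
  intros e x [He Hee] Hx Hs w.
  assert (Ha : e <= Rmin en e2) by (eapply Rle_trans; [exact Hee | apply Rmin_l]).
  assert (He_n : e <= en) by (eapply Rle_trans; [exact Ha | apply Rmin_l]).
  assert (He_2 : e <= e2) by (eapply Rle_trans; [exact Ha | apply Rmin_r]).
  assert (He_C : e <= / (10 * C2)) by (eapply Rle_trans; [exact Hee | apply Rmin_r]).
  assert (HeC : 10 * C2 * e <= 1).
  { apply Rle_trans with (10 * C2 * / (10 * C2)); [apply Rmult_le_compat_l; lra | rewrite Rinv_r; lra]. }
  assert (Hep : 0 < e ^ 2) by (apply pow_lt; lra).
  assert (Hep1 : e ^ 2 <= e) by (simpl; nra).
  assert (He3 : e * e ^ 2 <= 1 / 10) by nra.
  set (a := lg_nu c d e - CW * e ^ 2).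
  assert (Hac : Rabs a <= 2 * CW).
  { destruct (HW e 0 ltac:(lra) ltac:(lra) ltac:(lra)) as [Bn _].
    unfold a, Rminus. eapply Rle_trans; [apply Rabs_triang |].
    rewrite Rabs_Ropp, (Rabs_pos_eq (CW * e ^ 2)) by (apply Rmult_le_pos; lra). nra. }
  destruct (H2 a e x ltac:(lra) Hac Hx ltac:(lra)) as [f1 [f2 Hf]].
  set (f := fun y => cubic_potential a 3 e y * w y).
  assert (S := second_difference_ge w (lgw1 A A1 1 c d m e) (fun y => lgW 1 c d m e y * w y) f f1 f2 x (e ^ 2)
    (C2 * (1 + x ^ 3 + / x) * w x)).
  assert (Hwx : 0 <= w x) by (apply Hnn; lra).
  eapply Rle_trans; [| apply S].
  - assert (Sm := lg_discretization_small C2 e x (w x) ltac:(lra) ltac:(lra) ltac:(lra) Hx Hwx).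
    unfold f, cubic_potential, a.
    replace ((e ^ 2) ^ 2) with (e ^ 4) by ring.
    assert (Hx3 : 0 <= x ^ 3) by (apply pow_le; lra).
    set (P := e ^ 4 * w x) in *. assert (0 <= P) by (apply Rmult_le_pos; [apply pow_le; lra | exact Hwx]).
    replace (e ^ 4 * ((lg_nu c d e - CW * e ^ 2 + x + e * x ^ 2 + 3 * e ^ 2 * x ^ 3) * w x))
      with (P * (lg_nu c d e - CW * e ^ 2 + x + e * x ^ 2 + 3 * e ^ 2 * x ^ 3)) by (unfold P; ring).
    assert (0 <= P * (e ^ 2 * x ^ 3)) by (apply Rmult_le_pos; [assumption | apply Rmult_le_pos; lra]).
    lra.
  - lra.
  - intros y Hy. destruct (Hf y Hy) as [Y0 [Y1 _]].
    destruct (lg_b_range 1 e y Hsg ltac:(lra) Y0 Y1) as [Rb _].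
    destruct (lg_w_derive A A1 B 1 e (lg_al c e) (lg_p0 c d m e) y (proj1 Hprof) ltac:(lra)) as [D1 D2].
    split; [exact D1 | split; [exact D2 |]].
    unfold f. apply Rmult_le_compat_r; [apply Hnn; lra |].
    destruct (HW e y ltac:(lra) Y0 Y1) as [_ [_ [_ U]]].
    specialize (U eq_refl). unfold cubic_potential, a. lra.
  - intros y Hy. destruct (Hf y Hy) as [_ [_ F]]. exact F.
Qed.

(** * From the symmetrized recurrence to the generator *)

Definition off_diag (n : nat) : R := sqrt (INR n / INR (n + 1)).

Definition sym_trial (rho : R) (z : nat -> R) (n : nat) : R :=
  (/ sqrt rho) ^ n * z n / sqrt (INR (n + 1)).

(** Conjugation by [sqrt (rho ^ n * (n + 1))] makes the generator symmetric. The
    diagonal becomes constant and [rho] survives only as a factor and a shift, so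
    that all loads share one recurrence and differ in the boundary condition. *)
Lemma gen_sym_trial (rho mu : R) (z : nat -> R) (n : nat) :
  0 < rho ->
  gen rho (sym_trial rho z) n
    - (- (1 - sqrt rho) ^ 2 + sqrt rho * mu) * sym_trial rho z n
  = sqrt rho * (/ sqrt rho) ^ n / sqrt (INR (n + 1)) *
    (off_diag (n + 1) * z (n + 1)%nat + off_diag n * z (n - 1)%nat - (2 + mu) * z n).
Proof.
  intros Hr. set (r := sqrt rho).
  assert (Hr0 : 0 < r) by (apply sqrt_lt_R0; exact Hr).
  assert (Er : rho = r * r) by (symmetry; apply sqrt_sqrt; lra).
  assert (Ha : 0 < INR (n + 1)) by (apply lt_0_INR; lia).
  assert (Hb : 0 < INR (n + 1 + 1)) by (apply lt_0_INR; lia).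
  set (a := sqrt (INR (n + 1))). set (b := sqrt (INR (n + 1 + 1))).
  assert (Ha0 : 0 < a) by (apply sqrt_lt_R0; exact Ha).
  assert (Hb0 : 0 < b) by (apply sqrt_lt_R0; exact Hb).
  assert (Ea : INR (n + 1) = a * a) by (symmetry; apply sqrt_sqrt; lra).
  assert (E1 : off_diag (n + 1) = a / b).
  { unfold off_diag. rewrite sqrt_div_alt by exact Hb. reflexivity. }
  assert (E0 : off_diag n = sqrt (INR n) / a).
  { unfold off_diag. rewrite sqrt_div_alt by exact Ha. reflexivity. }
  unfold gen, sym_trial. fold r a b. rewrite E1, E0.
  assert (Em : INR n / INR (n + 1) * ((/ r) ^ (n - 1) * z (n - 1)%nat / sqrt (INR (n - 1 + 1)))
    = r * (/ r) ^ n / a * (sqrt (INR n) / a * z (n - 1)%nat)).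
  { destruct n as [|n].
    - simpl (INR 0). rewrite sqrt_0. field. repeat split; try lra.
      change (INR (0 - 1 + 1)) with 1. rewrite sqrt_1; lra.
    - replace (S n - 1 + 1)%nat with (S n) by lia. replace (S n - 1)%nat with n by lia.
      assert (Hc : 0 < INR (S n)) by (apply lt_0_INR; lia).
      set (c := sqrt (INR (S n))). assert (Hc0 : 0 < c) by (apply sqrt_lt_R0; exact Hc).
      assert (Ec : INR (S n) = c * c) by (symmetry; apply sqrt_sqrt; lra).
      rewrite Ea. rewrite Ec at 1. simpl pow. field. lra. }
  rewrite Em. rewrite Er at 1 2. rewrite pow_add. simpl (_ ^ 1). field. lra.
Qed.

Lemma off_diag_le (n : nat) : off_diag n <= 1 - / INR (n + 1) / 2.
Proof.
  assert (Ha : 1 <= INR (n + 1)) by (apply (le_INR 1); lia).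
  set (t := / INR (n + 1)).
  assert (Ht : 0 < t <= 1).
  { split; [apply Rinv_0_lt_compat; lra |]. unfold t. rewrite <- Rinv_1. apply Rinv_le_contravar; lra. }
  unfold off_diag. replace (INR n / INR (n + 1)) with (1 - t).
  - rewrite <- (sqrt_Rsqr (1 - t / 2)) by lra. apply sqrt_le_1_alt. unfold Rsqr. nra.
  - unfold t. rewrite plus_INR in *. simpl in *. field. lra.
Qed.

Lemma off_diag_ge (n : nat) : 1 - / INR (n + 1) / 2 - (/ INR (n + 1)) ^ 2 / 2 <= off_diag n.
Proof.
  assert (Ha : 1 <= INR (n + 1)) by (apply (le_INR 1); lia).
  set (t := / INR (n + 1)).
  assert (Ht : 0 < t <= 1).
  { split; [apply Rinv_0_lt_compat; lra |]. unfold t. rewrite <- Rinv_1. apply Rinv_le_contravar; lra. }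
  unfold off_diag. replace (INR n / INR (n + 1)) with (1 - t).
  - assert (0 <= 1 - t / 2 - t ^ 2 / 2) by (simpl; nra).
    rewrite <- (sqrt_Rsqr (1 - t / 2 - t ^ 2 / 2)) by assumption. apply sqrt_le_1_alt. unfold Rsqr.
    assert (0 <= t ^ 2) by apply pow2_ge_0. assert (t ^ 2 <= 1) by (simpl; nra).
    replace ((1 - t / 2 - t ^ 2 / 2) * (1 - t / 2 - t ^ 2 / 2))
      with (1 - t - t ^ 2 * (3 / 4 - t / 2 - t ^ 2 / 4)) by field.
    assert (0 <= t ^ 2 * (3 / 4 - t / 2 - t ^ 2 / 4)) by (apply Rmult_le_pos; simpl in *; nra). lra.
  - unfold t. rewrite plus_INR in *. simpl in *. field. lra.
Qed.

Lemma off_diag_nonneg (n : nat) : 0 <= off_diag n.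
Proof. apply sqrt_pos. Qed.

Lemma off_diag_0 : off_diag 0 = 0.
Proof. unfold off_diag. simpl. unfold Rdiv. rewrite Rmult_0_l. apply sqrt_0. Qed.

Lemma sym_trial_prefactor_pos (rho : R) (n : nat) :
  0 < rho -> 0 < sqrt rho * (/ sqrt rho) ^ n / sqrt (INR (n + 1)).
Proof.
  intros Hr. assert (0 < sqrt rho) by (apply sqrt_lt_R0; exact Hr).
  assert (0 < sqrt (INR (n + 1))) by (apply sqrt_lt_R0, lt_0_INR; lia).
  assert (0 < (/ sqrt rho) ^ n) by (apply pow_lt, Rinv_0_lt_compat; assumption).
  apply Rdiv_lt_0_compat; [apply Rmult_lt_0_compat |]; assumption.
Qed.

Lemma sym_trial_boundary (rho e : R) (K : nat) (z : nat -> R) :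
  0 < rho -> 0 < e -> (1 <= K)%nat -> INR K = / e ^ 3 ->
  sym_trial rho z K - sym_trial rho z (K - 1)
  = (/ sqrt rho) ^ K / sqrt (INR (K + 1)) * (z K - sqrt rho * sqrt (1 + e ^ 3) * z (K - 1)%nat).
Proof.
  intros Hr He HK HKe.
  assert (Hs : 0 < sqrt rho) by (apply sqrt_lt_R0; exact Hr).
  assert (He3 : 0 < e ^ 3) by (apply pow_lt; exact He).
  assert (HK0 : 0 < INR K) by (apply lt_0_INR; lia).
  assert (E1 : INR (K + 1) = INR K * (1 + e ^ 3)).
  { rewrite plus_INR. simpl (INR 1). rewrite HKe. field. lra. }
  assert (E2 : sqrt (INR (K + 1)) = sqrt (INR K) * sqrt (1 + e ^ 3)).
  { rewrite E1. apply sqrt_mult; lra. }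
  assert (0 < sqrt (INR K)) by (apply sqrt_lt_R0; exact HK0).
  assert (0 < sqrt (1 + e ^ 3)) by (apply sqrt_lt_R0; lra).
  unfold sym_trial. rewrite E2. replace (K - 1 + 1)%nat with K by lia.
  replace ((/ sqrt rho) ^ K) with ((/ sqrt rho) ^ (K - 1) * / sqrt rho).
  - field. lra.
  - replace K with (S (K - 1)) at 2 by lia. simpl. ring.
Qed.

(** ** Upper bound *)

(** The off-diagonal entries are below [1 - / (2 * (n + 2))], and [/ (n + 2)] is up
    to [O(e ^ 6)] a geometric series in [e * x] with positive terms. Its cubic
    truncation is what the comparison function solves, so [w] is a supersolution all
    the way to the empty queue. *)
Lemma langer_upper (A A1 : R -> R) (B c d m c0 e1 : R) :
  airy_profile A A1 B c0 -> 0 < e1 ->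
  (forall e, 0 < e <= e1 -> c0 <= lg_p0 c d m e) ->
  exists C e0, 0 < e0 <= 1 /\ forall K e rho theta Q,
    (1 <= K)%nat -> 0 < e <= e0 -> INR K = / e ^ 3 -> 0 < rho ->
    perron_vector rho K theta Q ->
    sqrt rho * sqrt (1 + e ^ 3) * lgw A 0 c d m e (e ^ 2) <= lgw A 0 c d m e 0 ->
    theta <= - (1 - sqrt rho) ^ 2 + sqrt rho * (- e ^ 3 + e ^ 4 * lg_nu c d e + C * e ^ 6).
Proof.
  intros Hprof He1 Hc0. assert (Hsg : 0 <= 0 <= 1) by lra.
  destruct (lg_discrete_upper A A1 B c d m c0 e1 Hprof He1 Hc0) as [C1 [ea [HC1 [Hea Hdisc]]]].
  destruct (lg_w_slope A A1 B 0 c d m c0 e1 Hprof Hsg He1 Hc0) as [Cs [eb [_ [Heb Hpos]]]].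
  destruct (lg_W_bounds 0 c d m Hsg) as [Cn [HCn HW]].
  exists (C1 + 12 + Cn), (Rmin (Rmin ea eb) (Rmin (1 / 10) (/ (2 * Cn)))).
  assert (Hi : 0 < / (2 * Cn)) by (apply Rinv_0_lt_compat; lra).
  split.
  { split; [repeat apply Rmin_glb_lt; lra |].
    eapply Rle_trans; [apply Rmin_l |]. eapply Rle_trans; [apply Rmin_l | lra]. }
  intros K e rho theta Q HK [He Hee] HKe Hrho HQ Hbd.
  assert (Hx1 := Rmin_l (Rmin ea eb) (Rmin (1 / 10) (/ (2 * Cn)))).
  assert (Hx2 := Rmin_r (Rmin ea eb) (Rmin (1 / 10) (/ (2 * Cn)))).
  assert (Hx3 := Rmin_l ea eb). assert (Hx4 := Rmin_r ea eb).
  assert (Hx5 := Rmin_l (1 / 10) (/ (2 * Cn))). assert (Hx6 := Rmin_r (1 / 10) (/ (2 * Cn))).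
  assert (HeCn : Cn * e <= 1 / 2).
  { apply Rle_trans with (Cn * / (2 * Cn)); [apply Rmult_le_compat_l; lra | right; field; lra]. }
  assert (He2 : 0 < e ^ 2) by (apply pow_lt; lra).
  assert (He3 : 0 < e ^ 3) by (apply pow_lt; lra).
  assert (He3s : e ^ 3 <= 1 / 1000).
  { replace (1 / 1000) with ((1 / 10) ^ 3) by field. apply pow_incr; lra. }
  set (w := lgw A 0 c d m e). set (nu := lg_nu c d e).
  assert (HposW : forall x, 0 < x -> e * x <= 2 -> 0 < w x).
  { intros x X1 X2. apply (proj1 (Hpos e x ltac:(lra) X1 X2)). }
  set (xx := fun n : nat => (INR K - INR n) * e ^ 2).
  set (z := fun n => w (xx n)).
  assert (Hxx : forall n, (n < K)%nat -> e ^ 2 <= xx n /\ e * xx n <= 1).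
  { intros n Hn. unfold xx.
    assert (1 <= INR K - INR n) by (rewrite <- minus_INR by lia; apply (le_INR 1); lia).
    split; [nra |]. replace (e * ((INR K - INR n) * e ^ 2)) with (INR K * e ^ 3 - INR n * e ^ 3) by ring.
    rewrite HKe, Rinv_l by lra. assert (0 <= INR n * e ^ 3) by (apply Rmult_le_pos; [apply pos_INR | lra]). lra. }
  assert (Hzpos : forall n, (n < K)%nat -> 0 < z n).
  { intros n Hn. destruct (Hxx n Hn). apply HposW; lra. }
  assert (HK1 : xx K = 0) by (unfold xx; ring).
  assert (HKm1 : xx (K - 1)%nat = e ^ 2).
  { unfold xx. rewrite minus_INR by lia. simpl (INR 1). ring. }
  set (mu := - e ^ 3 + e ^ 4 * nu + (C1 + 12 + Cn) * e ^ 6).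
  apply (perron_le_of_supersolution rho _ theta K Q (sym_trial rho z)); try assumption.
  - intros n Hn. unfold sym_trial.
    assert (0 < sqrt (INR (n + 1))) by (apply sqrt_lt_R0, lt_0_INR; lia).
    assert (0 < (/ sqrt rho) ^ n) by (apply pow_lt, Rinv_0_lt_compat, sqrt_lt_R0; exact Hrho).
    apply Rdiv_lt_0_compat; [apply Rmult_lt_0_compat; [assumption | apply Hzpos; exact Hn] | assumption].
  - intros n Hn. apply Rminus_le. rewrite gen_sym_trial by exact Hrho. fold nu mu.
    assert (Hpre := sym_trial_prefactor_pos rho n Hrho).
    enough (off_diag (n + 1) * z (n + 1)%nat + off_diag n * z (n - 1)%nat <= (2 + mu) * z n) by nra.
    destruct (Hxx n Hn) as [X1 X2]. set (x := xx n) in *.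
    assert (Ep : z (n + 1)%nat = w (x - e ^ 2)).
    { unfold z, x, xx. f_equal. rewrite plus_INR. simpl (INR 1). ring. }
    assert (Hn2 : 0 < INR (n + 2)) by (apply lt_0_INR; lia).
    set (t := / INR (n + 2)).
    assert (Ht0 : 0 < t) by (apply Rinv_0_lt_compat; exact Hn2).
    assert (Ht1 : t <= 1 / 2).
    { unfold t. replace (1 / 2) with (/ 2) by field. apply Rinv_le_contravar; [lra |]. apply (le_INR 2); lia. }
    assert (Hwx : 0 < w x) by (apply Hzpos; exact Hn).
    assert (Hwp : 0 <= w (x - e ^ 2)).
    { rewrite <- Ep. destruct (Nat.eq_dec (n + 1) K) as [E | E].
      - unfold z. rewrite E, HK1. eapply Rle_trans; [| exact Hbd].
        apply Rmult_le_pos; [apply Rmult_le_pos; apply sqrt_pos | left; apply HposW; [lra |]].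
        assert (e * e ^ 2 <= 1) by (simpl in *; lra). lra.
      - left. apply Hzpos; lia. }
    assert (Hwm : 0 < w (x + e ^ 2)).
    { apply HposW; [lra |]. assert (e * e ^ 2 <= 1) by (simpl in *; lra). lra. }
    (* both off-diagonal coefficients are below the common bound 1 - t / 2 *)
    assert (Hsum : off_diag (n + 1) * z (n + 1)%nat + off_diag n * z (n - 1)%nat
       <= (1 - t / 2) * (w (x + e ^ 2) + w (x - e ^ 2))).
    { assert (O1 := off_diag_le (n + 1)). replace (n + 1 + 1)%nat with (n + 2)%nat in O1 by lia. fold t in O1.
      rewrite Ep.
      assert (T1 : off_diag (n + 1) * w (x - e ^ 2) <= (1 - t / 2) * w (x - e ^ 2)).
      { apply Rmult_le_compat_r; [exact Hwp | lra]. }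
      assert (T2 : off_diag n * z (n - 1)%nat <= (1 - t / 2) * w (x + e ^ 2)).
      { destruct n as [|n].
        - rewrite off_diag_0, Rmult_0_l. apply Rmult_le_pos; lra.
        - replace (z (S n - 1)%nat) with (w (x + e ^ 2)).
          + apply Rmult_le_compat_r; [lra |].
            assert (O2 := off_diag_le (S n)).
            assert (t <= / INR (S n + 1)); [| lra].
            unfold t. apply Rinv_le_contravar; [apply lt_0_INR; lia | apply le_INR; lia].
          + unfold z, x, xx. f_equal. replace (S n - 1)%nat with n by lia. rewrite S_INR. ring. }
      lra. }
    eapply Rle_trans; [exact Hsum |].
    assert (D := Hdisc e x ltac:(lra) X1 ltac:(lra)). cbv zeta in D. fold w nu in D.
    set (Y := nu + x + e * x ^ 2 + e ^ 2 * x ^ 3 + C1 * e ^ 2) in *.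
    apply Rle_trans with ((1 - t / 2) * ((2 + e ^ 4 * Y) * w x)).
    { apply Rmult_le_compat_l; [lra |]. lra. }
    replace ((1 - t / 2) * ((2 + e ^ 4 * Y) * w x)) with ((1 - t / 2) * (2 + e ^ 4 * Y) * w x) by ring.
    change (z n) with (w x). apply Rmult_le_compat_r; [left; exact Hwx |].
    (* the true potential against its Taylor polynomial *)
    set (s := e * x) in *. assert (Hs0 : 0 < s) by (unfold s; nra).
    assert (EDn : e ^ 3 * INR (n + 2) = 1 + 2 * e ^ 3 - s).
    { unfold s, x, xx. rewrite plus_INR. simpl (INR 2).
      replace (e * ((INR K - INR n) * e ^ 2)) with (INR K * e ^ 3 - INR n * e ^ 3) by ring.
      rewrite HKe, Rinv_l by lra. ring. }
    set (Dn := 1 + 2 * e ^ 3 - s) in *.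
    assert (HDn : 0 < Dn) by (unfold Dn; lra).
    assert (Et : t * Dn = e ^ 3) by (rewrite <- EDn; unfold t; field; lra).
    assert (Htaylor : e ^ 3 * (1 + s + s ^ 2 + s ^ 3) - 12 * e ^ 6 <= t).
    { apply (Rmult_le_reg_r Dn); [exact HDn |]. rewrite Et.
      replace (e ^ 6) with (e ^ 3 * e ^ 3) by ring.
      set (q := e ^ 3) in *.
      replace ((q * (1 + s + s ^ 2 + s ^ 3) - 12 * (q * q)) * Dn) with (q * ((1 + s + s ^ 2 + s ^ 3 - 12 * q) * Dn)) by ring.
      rewrite <- (Rmult_1_r q) at 3. apply Rmult_le_compat_l; [lra |].
      replace ((1 + s + s ^ 2 + s ^ 3 - 12 * q) * Dn)
        with (1 - s ^ 4 + 2 * q * (1 + s + s ^ 2 + s ^ 3) - 12 * q * Dn) by (unfold Dn; ring).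
      assert (S2 : 0 <= s ^ 2 <= 1) by (split; [apply pow_le; lra | rewrite <- (pow1 2); apply pow_incr; lra]). assert (S3 : 0 <= s ^ 3 <= 1) by (split; [apply pow_le; lra | rewrite <- (pow1 3); apply pow_incr; lra]).
      assert (2 * q * (1 + s + s ^ 2 + s ^ 3) <= 2 * q * 4) by (apply Rmult_le_compat_l; lra).
      destruct (Rle_or_lt (2 / 3) Dn) as [H1 | H1].
      - assert (0 <= s ^ 4) by (apply pow_le; lra).
        assert (q * (2 / 3) <= q * Dn) by (apply Rmult_le_compat_l; lra). lra.
      - assert (H3 : 1 / 3 <= s) by (unfold Dn in H1; lra).
        assert (H4 : (1 / 3) ^ 4 <= s ^ 4) by (apply pow_incr; lra).
        assert (0 <= 12 * q * Dn) by nra. simpl in H4. simpl. lra. }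
    assert (He4 : 0 < e ^ 4) by (apply pow_lt; lra).
    assert (He6 : 0 < e ^ 6) by (apply pow_lt; lra).
    assert (HY : - (t / 2 * (e ^ 4 * Y)) <= Cn * e ^ 6).
    { destruct (Rle_or_lt 0 Y) as [H1 | H1].
      - assert (0 <= t / 2 * (e ^ 4 * Y)) by (repeat apply Rmult_le_pos; lra).
        assert (0 <= Cn * e ^ 6) by (apply Rmult_le_pos; lra). lra.
      - destruct (HW e x ltac:(lra) ltac:(lra) ltac:(unfold s in *; lra)) as [Bn _]. fold nu in Bn.
        apply Rabs_le_between in Bn.
        assert (0 <= e * x ^ 2) by (apply Rmult_le_pos; [lra | apply pow2_ge_0]).
        assert (0 <= e ^ 2 * x ^ 3) by (apply Rmult_le_pos; [lra | apply pow_le; lra]).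
        assert (0 <= C1 * e ^ 2) by (apply Rmult_le_pos; lra).
        assert (Hxc : x <= Cn) by (unfold Y in H1; lra).
        assert (Hs12 : s <= 1 / 2).
        { assert (e * x <= e * Cn) by (apply Rmult_le_compat_l; lra). unfold s; lra. }
        assert (HtD : t <= 2 * e ^ 3).
        { assert (t * (1 / 2) <= t * Dn) by (apply Rmult_le_compat_l; unfold Dn; lra). lra. }
        assert (HYn : - Y <= Cn) by (unfold Y; lra).
        replace (- (t / 2 * (e ^ 4 * Y))) with (e ^ 4 * (t / 2 * - Y)) by ring.
        assert (t / 2 * - Y <= e ^ 3 * Cn) by (apply Rmult_le_compat; lra).
        apply Rle_trans with (e ^ 4 * (e ^ 3 * Cn)); [apply Rmult_le_compat_l; lra |].
        replace (e ^ 4 * (e ^ 3 * Cn)) with (e * (Cn * e ^ 6)) by ring.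
        assert (0 <= Cn * e ^ 6) by (apply Rmult_le_pos; lra).
        rewrite <- (Rmult_1_l (Cn * e ^ 6)) at 2. apply Rmult_le_compat_r; lra. }
    assert (EY : e ^ 4 * Y = e ^ 4 * nu + e ^ 3 * (s + s ^ 2 + s ^ 3) + C1 * e ^ 6) by (unfold Y, s; ring).
    unfold mu.
    replace ((1 - t / 2) * (2 + e ^ 4 * Y)) with (2 - t + e ^ 4 * Y + - (t / 2 * (e ^ 4 * Y))) by field.
    rewrite EY at 1. lra.
  - apply Rminus_le.
    assert (Eb := sym_trial_boundary rho e K z Hrho He HK HKe).
    enough (0 <= sym_trial rho z K - sym_trial rho z (K - 1)) by lra.
    rewrite Eb. unfold z. rewrite HK1, HKm1. fold w in Hbd.
    assert (0 < sqrt (INR (K + 1))) by (apply sqrt_lt_R0, lt_0_INR; lia).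
    assert (0 < (/ sqrt rho) ^ K) by (apply pow_lt, Rinv_0_lt_compat, sqrt_lt_R0; exact Hrho).
    apply Rmult_le_pos; [left; apply Rdiv_lt_0_compat; assumption | lra].
Qed.

(** ** Lower bound *)

Lemma exp_neg_le_power (y : R) : 0 < y -> exp (- y) <= (7 / y) ^ 7.
Proof.
  intros Hy.
  assert (H1 : y / 7 <= exp (y / 7)) by (pose proof (exp_ineq1_le (y / 7)); lra).
  assert (H2 : (y / 7) ^ 7 <= exp y).
  { replace (exp y) with (exp (y / 7) ^ 7); [apply pow_incr; lra |].
    replace (exp (y / 7) ^ 7) with (exp (y / 7) * exp (y / 7) * exp (y / 7) * exp (y / 7) * exp (y / 7) * exp (y / 7) * exp (y / 7)) by ring.
    rewrite <- !exp_plus. f_equal. field. }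
  assert (H3 : 0 < (y / 7) ^ 7) by (apply pow_lt; lra).
  rewrite exp_Ropp. replace (7 / y) with (/ (y / 7)) by (field; lra). rewrite pow_inv.
  apply Rinv_le_contravar; assumption.
Qed.

(** A constant [kap * e ^ 6] can be subtracted from the comparison function: it is
    negligible on bounded sets and exceeds the function before the middle of the
    queue. *)
Lemma lg_w_size (A A1 : R -> R) (B sg c d m c0 e1 X : R) :
  airy_profile A A1 B c0 -> 0 <= sg <= 1 -> 0 < e1 ->
  (forall e, 0 < e <= e1 -> c0 <= lg_p0 c d m e) -> 1 <= X ->
  exists kap e0, 0 < kap /\ 0 < e0 <= 1 /\ forall e x, 0 < e <= e0 -> 0 <= x -> e * x <= 2 ->
    (1 <= x <= X -> kap <= lgw A sg c d m e x) /\
    (/ (4 * e) <= x -> lgw A sg c d m e x <= kap * e ^ 6).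
Proof.
  intros [HA [Hpos [_ Hk]]] Hsg He1 Hc0 HX.
  destruct (lg_phi_range sg c d m c0 e1 Hsg He1 Hc0) as [Cp [e0 [HCp [He0 Hphi]]]].
  destruct (Hk (Cp * (1 + X))) as [k [Hk0 Hkk]].
  destruct HA as [_ [_ [HB HAb]]].
  assert (He := exp_pos Cp).
  assert (HG : 0 <= B * exp Cp * 56 ^ 7) by (apply Rmult_le_pos; [apply Rmult_le_pos; lra | apply pow_le; lra]).
  set (G := B * exp Cp * 56 ^ 7) in *.
  exists (k / 12), (Rmin e0 (k / 12 / (G + 1))).
  assert (Hk12 : 0 < k / 12) by lra.
  split; [exact Hk12 | split].
  { split; [apply Rmin_glb_lt; [lra | apply Rdiv_lt_0_compat; lra] | eapply Rle_trans; [apply Rmin_l | lra]]. }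
  intros e x [Hep Hee] Hx Hs.
  assert (Hee0 : e <= e0) by (eapply Rle_trans; [exact Hee | apply Rmin_l]).
  assert (HeG : e <= k / 12 / (G + 1)) by (eapply Rle_trans; [exact Hee | apply Rmin_r]).
  destruct (Hphi e x ltac:(lra) Hx Hs) as [P1 [P2 [P3 _]]].
  destruct (lg_b_range sg e x Hsg ltac:(lra) Hx Hs) as [Rb _].
  unfold lg_w. set (p := lgphi sg c d m e x) in *. set (b := lg_b sg e x) in *.
  split; intros Hxx.
  - apply (proj1 (Rle_div_r (k / 12) (A p) b ltac:(lra))).
    apply Rabs_le_between in P2.
    assert (Cp * (1 + x) <= Cp * (1 + X)) by (apply Rmult_le_compat_l; lra).
    specialize (Hkk p ltac:(split; lra)).
    assert (k * (1 / 2) <= k * (p - c0)) by (apply Rmult_le_compat_l; lra).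
    assert (k / 12 * b <= k / 12 * 6) by (apply Rmult_le_compat_l; lra). lra.
  - destruct (HAb p) as [HAp _]. pose proof (Rle_abs (A p)).
    assert (HAp0 : 0 < A p \/ A p <= 0) by lra.
    assert (H1 : A p <= G * e ^ 7).
    { apply Rle_trans with (B * exp (- p)); [lra |].
      assert (H2 : exp (- p) <= exp Cp * (56 * e) ^ 7).
      { assert (Hi : / (4 * e) = / (8 * e) * 2) by (field; lra).
        assert (H3 : - p <= Cp + - / (8 * e)) by lra.
        apply Rle_trans with (exp (Cp + - / (8 * e))).
        - destruct (Rle_lt_or_eq _ _ H3) as [L | ->]; [left; apply exp_increasing; exact L | lra].
        - rewrite exp_plus. apply Rmult_le_compat_l; [lra |].
          assert (H8 : 0 < / (8 * e)) by (apply Rinv_0_lt_compat; lra).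
          eapply Rle_trans; [apply (exp_neg_le_power _ H8) |].
          right. f_equal. field. lra. }
      apply Rle_trans with (B * (exp Cp * (56 * e) ^ 7)); [apply Rmult_le_compat_l; lra |].
      right. unfold G. rewrite Rpow_mult_distr. ring. }
    assert (He6 : 0 < e ^ 6) by (apply pow_lt; lra).
    assert (H4 : G * e ^ 7 <= k / 12 * e ^ 6).
    { replace (G * e ^ 7) with (G * e * e ^ 6) by ring. apply Rmult_le_compat_r; [lra |].
      apply Rle_trans with ((G + 1) * (k / 12 / (G + 1))); [| right; field; lra].
      apply Rmult_le_compat; lra. }
    apply Rle_div_l; [lra |].
    assert (0 < k / 12 * e ^ 6) by (apply Rmult_lt_0_compat; lra). nra.
Qed.

(** The cubic coefficient [2] dominates the geometric series of the true potential
    up to half the queue only, [e * x <= 1 / 2]. The trial vector is therefore cut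
    off before: a constant of order [e ^ 6] is subtracted and the result truncated
    at zero, which takes effect before the halfway point because [w] decays
    exponentially. *)
Lemma langer_lower (A A1 : R -> R) (B c d m c0 e1 : R) :
  airy_profile A A1 B c0 -> 0 < e1 ->
  (forall e, 0 < e <= e1 -> c0 <= lg_p0 c d m e) ->
  exists C e0, 0 < e0 <= 1 /\ forall K e rho theta Q,
    (1 <= K)%nat -> 0 < e <= e0 -> INR K = / e ^ 3 -> 0 < rho ->
    perron_vector rho K theta Q ->
    lgw A 1 c d m e 0 <= sqrt rho * sqrt (1 + e ^ 3) * lgw A 1 c d m e (e ^ 2) ->
    - (1 - sqrt rho) ^ 2 + sqrt rho * (- e ^ 3 + e ^ 4 * lg_nu c d e - C * e ^ 6) <= theta.
Proof.
  intros Hprof He1 Hc0. assert (Hsg : 0 <= 1 <= 1) by lra.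
  destruct (lg_discrete_lower A A1 B c d m c0 e1 Hprof He1 Hc0) as [C1 [ea [HC1 [Hea Hdisc]]]].
  destruct (lg_w_slope A A1 B 1 c d m c0 e1 Hprof Hsg He1 Hc0) as [Cs [eb [_ [Heb Hpos]]]].
  destruct (lg_w_nonneg A A1 B 1 c d m c0 e1 Hprof Hsg He1 Hc0) as [ec [Hec Hnn]].
  destruct (lg_W_bounds 1 c d m Hsg) as [Cn [HCn HW]].
  set (X := Cn + 2).
  destruct (lg_w_size A A1 B 1 c d m c0 e1 X Hprof Hsg He1 Hc0 ltac:(unfold X; lra)) as [kap [ed [Hkap [Hed Hsize]]]].
  set (C2 := C1 + 4 + 2 * (Cn + 1)). set (C := C2 + 1).
  exists C, (Rmin (Rmin (Rmin ea eb) (Rmin ec ed)) (Rmin (/ (C + 10)) (/ (4 * (X + 1))))).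
  assert (HC : 1 <= C) by (unfold C, C2; lra).
  assert (Hi1 : 0 < / (C + 10)) by (apply Rinv_0_lt_compat; lra).
  assert (Hi2 : 0 < / (4 * (X + 1))) by (apply Rinv_0_lt_compat; unfold X; lra).
  split.
  { split; [repeat apply Rmin_glb_lt; lra |].
    eapply Rle_trans; [apply Rmin_l |]. eapply Rle_trans; [apply Rmin_l |]. eapply Rle_trans; [apply Rmin_l | lra]. }
  intros K e rho theta Q HK [He Hee] HKe Hrho HQ Hbd.
  assert (L1 : e <= Rmin (Rmin ea eb) (Rmin ec ed)) by (eapply Rle_trans; [exact Hee | apply Rmin_l]).
  assert (L2 : e <= Rmin (/ (C + 10)) (/ (4 * (X + 1)))) by (eapply Rle_trans; [exact Hee | apply Rmin_r]).
  assert (L3 : e <= Rmin ea eb) by (eapply Rle_trans; [exact L1 | apply Rmin_l]).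
  assert (L4 : e <= Rmin ec ed) by (eapply Rle_trans; [exact L1 | apply Rmin_r]).
  assert (Lea : e <= ea) by (eapply Rle_trans; [exact L3 | apply Rmin_l]).
  assert (Leb : e <= eb) by (eapply Rle_trans; [exact L3 | apply Rmin_r]).
  assert (Lec : e <= ec) by (eapply Rle_trans; [exact L4 | apply Rmin_l]).
  assert (Led : e <= ed) by (eapply Rle_trans; [exact L4 | apply Rmin_r]).
  assert (LC : (C + 10) * e <= 1).
  { apply Rle_trans with ((C + 10) * / (C + 10)); [| rewrite Rinv_r; lra].
    apply Rmult_le_compat_l; [lra |]. eapply Rle_trans; [exact L2 | apply Rmin_l]. }
  assert (LX : 4 * (X + 1) * e <= 1).
  { assert (0 < 4 * (X + 1)) by (unfold X; lra).
    apply Rle_trans with (4 * (X + 1) * / (4 * (X + 1))); [| rewrite Rinv_r; lra].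
    apply Rmult_le_compat_l; [lra |]. eapply Rle_trans; [exact L2 | apply Rmin_r]. }
  assert (He10 : e <= 1 / 11) by nra.
  assert (He2 : 0 < e ^ 2) by (apply pow_lt; lra).
  assert (He2e : e ^ 2 <= e / 10) by (simpl; nra).
  assert (He3 : 0 < e ^ 3) by (apply pow_lt; lra).
  assert (He3s : e ^ 3 <= e ^ 2 / 10) by (simpl in *; nra).
  assert (He4 : 0 < e ^ 4) by (apply pow_lt; lra).
  assert (He6 : 0 < e ^ 6) by (apply pow_lt; lra).
  set (w := lgw A 1 c d m e) in *. set (nu := lg_nu c d e).
  assert (HposW : forall x, 0 < x -> e * x <= 2 -> 0 < w x).
  { intros x X1 X2. apply (proj1 (Hpos e x ltac:(lra) X1 X2)). }
  set (xx := fun n : nat => (INR K - INR n) * e ^ 2).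
  assert (Hxx : forall n, (n < K)%nat -> e ^ 2 <= xx n /\ e * xx n <= 1).
  { intros n Hn. unfold xx.
    assert (1 <= INR K - INR n) by (rewrite <- minus_INR by lia; apply (le_INR 1); lia).
    split; [nra |]. replace (e * ((INR K - INR n) * e ^ 2)) with (INR K * e ^ 3 - INR n * e ^ 3) by ring.
    rewrite HKe, Rinv_l by lra. assert (0 <= INR n * e ^ 3) by (apply Rmult_le_pos; [apply pos_INR | lra]). lra. }
  assert (HK1 : xx K = 0) by (unfold xx; ring).
  assert (HKm1 : xx (K - 1)%nat = e ^ 2).
  { unfold xx. rewrite minus_INR by lia. simpl (INR 1). ring. }
  assert (Hxp : forall n, xx (n + 1)%nat = xx n - e ^ 2).
  { intros n. unfold xx. rewrite plus_INR. simpl (INR 1). ring. }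
  assert (Hxm : forall n, (1 <= n)%nat -> xx (n - 1)%nat = xx n + e ^ 2).
  { intros n Hn. unfold xx. rewrite minus_INR by exact Hn. simpl (INR 1). ring. }
  set (mu1 := - e ^ 3 + e ^ 4 * nu - C2 * e ^ 6).
  set (mu := - e ^ 3 + e ^ 4 * nu - C * e ^ 6).
  assert (Hmu : mu1 = mu + e ^ 6) by (unfold mu, mu1, C; ring).
  destruct (HW e 0 ltac:(lra) ltac:(lra) ltac:(lra)) as [Bn _]. fold nu in Bn. apply Rabs_le_between in Bn.
  assert (Hfree : forall n, (n < K)%nat -> e * xx n <= 1 / 2 ->
     (2 + mu1) * w (xx n) <= off_diag (n + 1) * w (xx n - e ^ 2) + off_diag n * w (xx n + e ^ 2)).
  { intros n Hn Hs12. destruct (Hxx n Hn) as [X1 X2]. set (x := xx n) in *.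
    assert (D := Hdisc e x ltac:(lra) X1 ltac:(lra)). cbv zeta in D. fold w nu in D.
    set (Y := nu + x + e * x ^ 2 + 2 * e ^ 2 * x ^ 3 - C1 * e ^ 2) in *.
    assert (Hwx : 0 < w x) by (apply HposW; lra).
    assert (Hwp : 0 <= w (x - e ^ 2)) by (apply Hnn; [lra | lra |]; nra).
    assert (Hwm : 0 <= w (x + e ^ 2)) by (apply Hnn; [lra | lra |]; nra).
    assert (Hn1 : 0 < INR (n + 1)) by (apply lt_0_INR; lia).
    set (t := / INR (n + 1)). assert (Ht0 : 0 < t) by (apply Rinv_0_lt_compat; exact Hn1).
    set (s := e * x) in *. assert (Hs0 : 0 < s) by (unfold s; apply Rmult_lt_0_compat; lra).
    assert (EDn : e ^ 3 * INR (n + 1) = 1 + e ^ 3 - s).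
    { unfold s, x, xx. rewrite plus_INR. simpl (INR 1).
      replace (e * ((INR K - INR n) * e ^ 2)) with (INR K * e ^ 3 - INR n * e ^ 3) by ring.
      rewrite HKe, Rinv_l by lra. ring. }
    assert (Et : t * (1 + e ^ 3 - s) = e ^ 3) by (rewrite <- EDn; unfold t; field; lra).
    assert (Ht2 : t <= 2 * e ^ 3).
    { assert (t * (1 / 2) <= t * (1 + e ^ 3 - s)) by (apply Rmult_le_compat_l; lra). lra. }
    assert (Ht1 : t <= 1) by lra.
    assert (Htaylor : t <= e ^ 3 * (1 + s + s ^ 2 + 2 * s ^ 3)).
    { apply (Rmult_le_reg_r (1 + e ^ 3 - s)); [lra |]. rewrite Et.
      assert (S3 : 0 <= s ^ 3) by (apply pow_le; lra). assert (S2 : 0 <= s ^ 2) by (apply pow_le; lra).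
      set (q := 1 + s + s ^ 2 + 2 * s ^ 3) in *.
      assert (1 <= q * (1 - s)).
      { replace (q * (1 - s)) with (1 + s ^ 3 * (1 - 2 * s)) by (unfold q; ring).
        assert (0 <= s ^ 3 * (1 - 2 * s)) by (apply Rmult_le_pos; lra). lra. }
      assert (0 <= q * e ^ 3) by (apply Rmult_le_pos; [unfold q; lra | lra]).
      replace (e ^ 3 * q * (1 + e ^ 3 - s)) with (e ^ 3 * (q * (1 - s) + q * e ^ 3)) by ring.
      rewrite <- (Rmult_1_r (e ^ 3)) at 1. apply Rmult_le_compat_l; lra. }
    set (bt := 1 - t / 2 - t ^ 2 / 2).
    assert (Ht21 : 0 <= t ^ 2 <= t).
    { split; [apply pow2_ge_0 |]. replace (t ^ 2) with (t * t) by ring.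
      rewrite <- (Rmult_1_r t) at 3. apply Rmult_le_compat_l; lra. }
    assert (Hbt : 0 <= bt) by (unfold bt; lra).
    assert (O1 : bt <= off_diag n) by (apply off_diag_ge).
    assert (O2 : bt <= off_diag (n + 1)).
    { assert (O := off_diag_ge (n + 1)). set (t' := / INR (n + 1 + 1)) in *.
      assert (0 < t' <= t).
      { split; [apply Rinv_0_lt_compat, lt_0_INR; lia |].
        apply Rinv_le_contravar; [exact Hn1 | apply le_INR; lia]. }
      assert (t' ^ 2 <= t ^ 2) by (apply pow_incr; lra). unfold bt; lra. }
    assert (Hsum : bt * (w (x + e ^ 2) + w (x - e ^ 2)) <= off_diag (n + 1) * w (x - e ^ 2) + off_diag n * w (x + e ^ 2)).
    { assert (bt * w (x - e ^ 2) <= off_diag (n + 1) * w (x - e ^ 2)) by (apply Rmult_le_compat_r; assumption).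
      assert (bt * w (x + e ^ 2) <= off_diag n * w (x + e ^ 2)) by (apply Rmult_le_compat_r; assumption). lra. }
    eapply Rle_trans; [| exact Hsum].
    apply Rle_trans with (bt * ((2 + e ^ 4 * Y) * w x)); [| apply Rmult_le_compat_l; lra].
    replace (bt * ((2 + e ^ 4 * Y) * w x)) with (bt * (2 + e ^ 4 * Y) * w x) by ring.
    apply Rmult_le_compat_r; [left; exact Hwx |].
    assert (HtY : (t / 2 + t ^ 2 / 2) * (e ^ 4 * Y) <= 2 * (Cn + 1) * e ^ 6).
    { assert (HY : e * Y <= Cn + 1).
      { unfold Y. replace (e * (nu + x + e * x ^ 2 + 2 * e ^ 2 * x ^ 3 - C1 * e ^ 2))
          with (e * nu + s + s ^ 2 + 2 * s ^ 3 - C1 * e ^ 3) by (unfold s; ring).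
        assert (s ^ 2 <= 1 / 4) by (replace (1 / 4) with ((1 / 2) ^ 2) by field; apply pow_incr; lra).
        assert (s ^ 3 <= 1 / 8) by (replace (1 / 8) with ((1 / 2) ^ 3) by field; apply pow_incr; lra).
        assert (e * nu <= 1 * Cn).
        { apply Rle_trans with (e * Cn); [apply Rmult_le_compat_l; lra | apply Rmult_le_compat_r; lra]. } assert (0 <= C1 * e ^ 3) by (apply Rmult_le_pos; lra). lra. }
      replace ((t / 2 + t ^ 2 / 2) * (e ^ 4 * Y)) with ((t / 2 + t ^ 2 / 2) * e ^ 3 * (e * Y)) by ring.
      apply Rle_trans with ((t / 2 + t ^ 2 / 2) * e ^ 3 * (Cn + 1)).
      - apply Rmult_le_compat_l; [apply Rmult_le_pos; lra | exact HY].
      - replace (2 * (Cn + 1) * e ^ 6) with (2 * e ^ 3 * e ^ 3 * (Cn + 1)) by ring.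
        apply Rmult_le_compat_r; [lra |]. apply Rmult_le_compat_r; lra. }
    assert (Ht26 : t ^ 2 <= 4 * e ^ 6).
    { replace (4 * e ^ 6) with ((2 * e ^ 3) ^ 2) by ring. apply pow_incr; lra. }
    assert (EY : e ^ 4 * Y = e ^ 4 * nu + e ^ 3 * (s + s ^ 2 + 2 * s ^ 3) - C1 * e ^ 6) by (unfold Y, s; ring).
    replace (bt * (2 + e ^ 4 * Y)) with (2 - t - t ^ 2 + e ^ 4 * Y - (t / 2 + t ^ 2 / 2) * (e ^ 4 * Y)) by (unfold bt; field).
    rewrite EY at 1. unfold mu1, C2. lra. }
  (* constants are subsolutions only from about [X] on, so the subtraction starts
     there; the jump it causes is paid for by the term [e ^ 6 * w] *)
  set (delta := kap * e ^ 6). assert (Hdelta : 0 < delta) by (apply Rmult_lt_0_compat; lra).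
  set (z := fun n => if Rlt_dec (xx n) X then w (xx n) else
     if Rle_dec (e * xx n) (1 / 2) then Rmax (w (xx n) - delta) 0 else 0).
  assert (Hznn : forall n, (n <= K)%nat -> 0 <= z n).
  { intros n Hn. unfold z. destruct (Rlt_dec (xx n) X) as [H | H].
    - apply Hnn; [lra | |].
      + unfold xx. apply Rmult_le_pos; [| lra]. apply le_INR in Hn. lra.
      + nra.
    - destruct (Rle_dec (e * xx n) (1 / 2)); [apply Rmax_r | lra]. }
  assert (HeX : e * (X + 1) <= 1 / 4) by lra.
  assert (Hzlow : forall n, e * xx n <= 1 / 2 -> w (xx n) - delta <= z n).
  { intros n H. unfold z. destruct (Rlt_dec (xx n) X); [lra |].
    destruct (Rle_dec (e * xx n) (1 / 2)); [apply Rmax_l | lra]. }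
  assert (Hz0 : z K = w 0).
  { unfold z. rewrite HK1. destruct (Rlt_dec 0 X) as [H | H]; [reflexivity | unfold X in H; lra]. }
  assert (Hz1 : z (K - 1)%nat = w (e ^ 2)).
  { unfold z. rewrite HKm1. destruct (Rlt_dec (e ^ 2) X) as [H | H]; [reflexivity | unfold X in H; lra]. }
  assert (Hoff1 : forall n, 0 <= off_diag n <= 1).
  { intros n. split; [apply off_diag_nonneg |]. assert (O := off_diag_le n).
    assert (0 < / INR (n + 1)) by (apply Rinv_0_lt_compat, lt_0_INR; lia). lra. }
  apply (perron_ge_of_subsolution rho _ theta K Q (sym_trial rho z)); try assumption.
  - intros n Hn. unfold sym_trial.
    assert (0 < sqrt (INR (n + 1))) by (apply sqrt_lt_R0, lt_0_INR; lia).
    assert (0 < (/ sqrt rho) ^ n) by (apply pow_lt, Rinv_0_lt_compat, sqrt_lt_R0; exact Hrho).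
    apply Rdiv_le_0_compat; [apply Rmult_le_pos; [lra | apply Hznn; lia] | assumption].
  - unfold sym_trial. rewrite Hz1.
    assert (0 < sqrt (INR (K - 1 + 1))) by (apply sqrt_lt_R0, lt_0_INR; lia).
    assert (0 < (/ sqrt rho) ^ (K - 1)) by (apply pow_lt, Rinv_0_lt_compat, sqrt_lt_R0; exact Hrho).
    apply Rdiv_lt_0_compat; [apply Rmult_lt_0_compat; [assumption | apply HposW; [lra |]] | assumption].
    simpl in *. nra.
  - intros n Hn. fold nu mu. apply Rminus_le.
    assert (Hpre := sym_trial_prefactor_pos rho n Hrho).
    assert (Eg := gen_sym_trial rho mu z n Hrho).
    enough ((2 + mu) * z n <= off_diag (n + 1) * z (n + 1)%nat + off_diag n * z (n - 1)%nat) by nra.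
    destruct (Hxx n Hn) as [X1 X2].
    assert (Hrhs : 0 <= off_diag (n + 1) * z (n + 1)%nat + off_diag n * z (n - 1)%nat).
    { assert (0 <= off_diag (n + 1) * z (n + 1)%nat) by (apply Rmult_le_pos; [apply Hoff1 | apply Hznn; lia]).
      assert (0 <= off_diag n * z (n - 1)%nat) by (apply Rmult_le_pos; [apply Hoff1 | apply Hznn; lia]). lra. }
    assert (Hn1 : e * xx n <= 1 / 2 -> (1 <= n)%nat).
    { intros H. destruct n as [|n]; [exfalso | lia].
      unfold xx in H. simpl (INR 0) in H.
      replace (e * ((INR K - 0) * e ^ 2)) with (INR K * e ^ 3) in H by ring.
      rewrite HKe, Rinv_l in H; lra. }
    unfold z at 1. destruct (Rlt_dec (xx n) X) as [HX | HX].
    + assert (Hs14 : e * xx n <= e * X) by (apply Rmult_le_compat_l; lra).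
      assert (Hs12 : e * xx n <= 1 / 2) by lra.
      assert (F := Hfree n Hn Hs12). specialize (Hn1 Hs12).
      assert (Hwx : 0 < w (xx n)) by (apply HposW; lra).
      assert (Ep : z (n + 1)%nat = w (xx n - e ^ 2)).
      { unfold z. rewrite Hxp. destruct (Rlt_dec (xx n - e ^ 2) X); [reflexivity | lra]. }
      rewrite Ep.
      destruct (Rlt_or_le (xx n + e ^ 2) X) as [HX2 | HX2].
      * assert (Em : z (n - 1)%nat = w (xx n + e ^ 2)).
        { unfold z. rewrite Hxm by exact Hn1. destruct (Rlt_dec (xx n + e ^ 2) X); [reflexivity | lra]. }
        rewrite Em. rewrite Hmu in F.
        assert (0 <= e ^ 6 * w (xx n)) by (apply Rmult_le_pos; lra). lra.
      * assert (Em := Hzlow (n - 1)%nat). rewrite Hxm in Em by exact Hn1.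
        specialize (Em ltac:(lra)).
        assert (Hk : kap <= w (xx n)).
        { apply (Hsize e (xx n)); try lra. unfold X in *. lra. }
        assert (T : off_diag n * (w (xx n + e ^ 2) - delta) <= off_diag n * z (n - 1)%nat)
          by (apply Rmult_le_compat_l; [apply Hoff1 | exact Em]).
        assert (off_diag n * delta <= 1 * delta) by (apply Rmult_le_compat_r; [lra | apply Hoff1]).
        assert (delta <= e ^ 6 * w (xx n)).
        { unfold delta. rewrite Rmult_comm. apply Rmult_le_compat_l; lra. }
        rewrite Hmu in F. lra.
    + destruct (Rle_dec (e * xx n) (1 / 2)) as [Hs12 | Hs12]; [| rewrite Rmult_0_r; exact Hrhs].
      destruct (Rle_or_lt (w (xx n)) delta) as [Hwd | Hwd].
      { rewrite Rmax_right by lra. rewrite Rmult_0_r; exact Hrhs. }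
      rewrite Rmax_left by lra.
      specialize (Hn1 Hs12). assert (F := Hfree n Hn Hs12).
      assert (Hx4 : xx n < / (4 * e)).
      { apply Rnot_le_lt; intros H. destruct (Hsize e (xx n) ltac:(lra) ltac:(lra) ltac:(lra)) as [_ S].
        specialize (S H). fold w delta in S. lra. }
      assert (Hs4 : e * xx n <= 1 / 4).
      { replace (1 / 4) with (e * / (4 * e)) by (field; lra). apply Rmult_le_compat_l; lra. }
      assert (Em := Hzlow (n - 1)%nat). rewrite Hxm in Em by exact Hn1.
      specialize (Em ltac:(lra)).
      assert (Ep := Hzlow (n + 1)%nat). rewrite Hxp in Ep. specialize (Ep ltac:(lra)).
      assert (Tm : off_diag n * (w (xx n + e ^ 2) - delta) <= off_diag n * z (n - 1)%nat)
        by (apply Rmult_le_compat_l; [apply Hoff1 | exact Em]).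
      assert (Tp : off_diag (n + 1) * (w (xx n - e ^ 2) - delta) <= off_diag (n + 1) * z (n + 1)%nat)
        by (apply Rmult_le_compat_l; [apply Hoff1 | exact Ep]).
      (* constants are subsolutions beyond the turning point *)
      assert (Hconst : off_diag (n + 1) + off_diag n <= 2 + mu).
      { assert (O1 := off_diag_le n). assert (O2 := off_diag_le (n + 1)).
        replace (n + 1 + 1)%nat with (n + 2)%nat in O2 by lia.
        assert (Hn2 : 0 < INR (n + 2)) by (apply lt_0_INR; lia).
        set (t := / INR (n + 2)) in *.
        assert (Ht0 : 0 < t) by (apply Rinv_0_lt_compat; exact Hn2).
        assert (Htt : t <= / INR (n + 1)) by (apply Rinv_le_contravar; [apply lt_0_INR; lia | apply le_INR; lia]).
        assert (EDn : e ^ 3 * INR (n + 2) = 1 + 2 * e ^ 3 - e * xx n).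
        { unfold xx. rewrite plus_INR. simpl (INR 2).
          replace (e * ((INR K - INR n) * e ^ 2)) with (INR K * e ^ 3 - INR n * e ^ 3) by ring.
          rewrite HKe, Rinv_l by lra. ring. }
        assert (Et : t * (1 + 2 * e ^ 3 - e * xx n) = e ^ 3) by (rewrite <- EDn; unfold t; field; lra).
        set (sg := e * xx n - 2 * e ^ 3) in *.
        assert (Ht : e ^ 3 * (1 + sg) <= t).
        { apply (Rmult_le_reg_r (1 - sg)); [unfold sg; lra |].
          replace (t * (1 - sg)) with (e ^ 3) by (rewrite <- Et; unfold sg; ring).
          replace (e ^ 3 * (1 + sg) * (1 - sg)) with (e ^ 3 * (1 - sg * sg)) by ring.
          assert (0 <= sg * sg) by apply Rle_0_sqr.
          rewrite <- (Rmult_1_r (e ^ 3)) at 2. apply Rmult_le_compat_l; lra. }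
        assert (Hsg2 : - (e * nu) + C * e ^ 3 <= sg).
        { assert (E1 : e * (Cn + 2) <= e * xx n) by (apply Rmult_le_compat_l; unfold X in HX; lra).
          assert (E2 : e * - nu <= e * Cn) by (apply Rmult_le_compat_l; lra).
          assert (E3 : (C + 2) * e ^ 3 <= e).
          { replace ((C + 2) * e ^ 3) with ((C + 2) * e * e ^ 2) by ring.
            assert (C2e : (C + 2) * e <= 1).
            { apply Rle_trans with ((C + 10) * e); [apply Rmult_le_compat_r; lra | exact LC]. }
            apply Rle_trans with (1 * e ^ 2); [apply Rmult_le_compat_r; lra | lra]. }
          unfold sg. lra. }
        assert (e ^ 3 * (- (e * nu) + C * e ^ 3) <= e ^ 3 * sg) by (apply Rmult_le_compat_l; lra).
        unfold mu. replace (e ^ 4 * nu) with (- (e ^ 3 * - (e * nu))) by ring.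
        replace (C * e ^ 6) with (e ^ 3 * (C * e ^ 3)) by ring. lra. }
      assert (delta * (off_diag (n + 1) + off_diag n) <= delta * (2 + mu)) by (apply Rmult_le_compat_l; lra).
      assert (0 <= e ^ 6 * w (xx n)) by (apply Rmult_le_pos; lra).
      rewrite Hmu in F. lra.
  - apply Rminus_le. rewrite (sym_trial_boundary rho e K z Hrho He HK HKe).
    rewrite Hz0, Hz1.
    assert (0 < sqrt (INR (K + 1))) by (apply sqrt_lt_R0, lt_0_INR; lia).
    assert (0 < (/ sqrt rho) ^ K) by (apply pow_lt, Rinv_0_lt_compat, sqrt_lt_R0; exact Hrho).
    assert (0 < (/ sqrt rho) ^ K / sqrt (INR (K + 1))) by (apply Rdiv_lt_0_compat; assumption).
    nra.
Qed.

(** * Boundary conditions *)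

Lemma lg_w_at_0 (A : R -> R) (sg e al p0 : R) : lg_w A sg e al p0 0 = A p0.
Proof.
  unfold lg_w, lg_phi, lg_b. rewrite !Rmult_0_r, !Rmult_0_l, Rmult_0_r, Rplus_0_r. simpl. field.
Qed.

Lemma lg_w1_at_0 (A A1 : R -> R) (sg e al p0 : R) :
  lg_w1 A A1 sg e al p0 0 = al * A1 p0 - e / 5 * A p0.
Proof.
  assert (E : lg_phi sg e al p0 0 = p0) by (unfold lg_phi; ring).
  unfold lg_w1. rewrite E. unfold lg_b, lg_b1. field.
Qed.

(** Dirichlet-like case: shifting the zero by [m] lattice steps turns the
    ratio of the last two values into [m / (m + 1)]. *)
Lemma dirichlet_boundary_upper (A A1 : R -> R) (B r0 r : R) :
  airy_decaying A A1 B -> A r0 = 0 -> 0 < A1 r0 -> 0 < r < 1 ->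
  let m := (1 + r) / (1 - r) in
  exists e0, 0 < e0 <= 1 /\ forall e, 0 < e <= e0 ->
    r * sqrt (1 + e ^ 3) * lgw A 0 r0 0 m e (e ^ 2) <= lgw A 0 r0 0 m e 0.
Proof.
  intros HA H0 H1 Hr m.
  assert (Hm : 1 <= m) by (unfold m; apply Rle_div_r; lra).
  assert (Em : m * (1 - r) = 1 + r) by (unfold m; field; lra).
  set (tau := 1 / (8 * (m + 2))).
  assert (Ht : 0 < tau) by (apply Rdiv_lt_0_compat; lra).
  assert (Htm : tau * (m + 2) = 1 / 8) by (unfold tau; field; lra).
  assert (Ht24 : tau <= 1 / 24) by nra.
  assert (Hloc : exists del, 0 < del /\ forall y, r0 <= y <= r0 + del ->
     (1 - tau) * A1 r0 * (y - r0) <= A y <= (1 + tau) * A1 r0 * (y - r0)).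
  { destruct (airy_continuous A A1 B r0 HA) as [_ Ca].
    assert (Hp : 0 < tau * A1 r0) by (apply Rmult_lt_0_compat; assumption).
    destruct (Ca _ (locally_ball _ (mkposreal _ Hp))) as [del Hdel]. pose proof (cond_pos del).
    assert (HA1 : forall x, r0 <= x <= r0 + del / 2 -> (1 - tau) * A1 r0 <= A1 x <= (1 + tau) * A1 r0).
    { intros x Hx. assert (Hb : ball (A1 r0) (tau * A1 r0) (A1 x)).
      { apply Hdel. apply R_ball.
        apply Rabs_def1; lra. }
      apply ball_R in Hb; cbn [pos] in Hb.
      apply Rabs_def2 in Hb. lra. }
    exists (del / 2). split; [lra |]. intros y Hy.
    assert (Dk : forall k x, is_derive (fun y => A y - k * (y - r0)) x (A1 x - k)).
    { intros k x. auto_derive; [exists (A1 x); exact (proj1 HA x) |].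
      rewrite (Derive_eta A _ _ (proj1 HA x)). ring. }
    assert (I1 := increasing_of_derive_nonneg (fun y => A y - (1 - tau) * A1 r0 * (y - r0)) _ r0 y (proj1 Hy)
      (fun x _ => Dk _ x)).
    assert (I2 := decreasing_of_derive_nonpos (fun y => A y - (1 + tau) * A1 r0 * (y - r0)) _ r0 y (proj1 Hy)
      (fun x _ => Dk _ x)).
    cbv beta in I1, I2. rewrite H0 in I1, I2.
    assert (J1 : 0 - (1 - tau) * A1 r0 * (r0 - r0) <= A y - (1 - tau) * A1 r0 * (y - r0)).
    { apply I1. intros x Hx. specialize (HA1 x ltac:(lra)). lra. }
    assert (J2 : A y - (1 + tau) * A1 r0 * (y - r0) <= 0 - (1 + tau) * A1 r0 * (r0 - r0)).
    { apply I2. intros x Hx. specialize (HA1 x ltac:(lra)). lra. }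
    rewrite Rminus_diag, Rmult_0_r in J1, J2. lra. }
  destruct Hloc as [del [Hdel HAl]].
  pose proof (Rabs_pos r0).
  set (k := 1 + 2 * Rabs r0).
  exists (Rmin (Rmin (1 / 2) tau) (Rmin (tau / k) (del / (m + 2)))).
  assert (Hk : 1 <= k) by (unfold k; lra).
  split.
  { split; [repeat apply Rmin_glb_lt; try lra; apply Rdiv_lt_0_compat; lra |].
    eapply Rle_trans; [apply Rmin_l |]. eapply Rle_trans; [apply Rmin_l | lra]. }
  intros e [He Hee].
  assert (L1 : e <= Rmin (1 / 2) tau) by (eapply Rle_trans; [exact Hee | apply Rmin_l]).
  assert (L2 : e <= Rmin (tau / k) (del / (m + 2))) by (eapply Rle_trans; [exact Hee | apply Rmin_r]).
  assert (E1 : e <= 1 / 2) by (eapply Rle_trans; [exact L1 | apply Rmin_l]).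
  assert (E2 : e <= tau) by (eapply Rle_trans; [exact L1 | apply Rmin_r]).
  assert (E3 : k * e <= tau).
  { apply Rle_trans with (k * (tau / k)); [| right; field; lra].
    apply Rmult_le_compat_l; [lra |]. eapply Rle_trans; [exact L2 | apply Rmin_l]. }
  assert (E4 : e * (m + 2) <= del).
  { apply Rle_trans with (del / (m + 2) * (m + 2)); [| right; field; lra].
    apply Rmult_le_compat_r; [lra |]. eapply Rle_trans; [exact L2 | apply Rmin_r]. }
  assert (He2 : 0 < e ^ 2) by (apply pow_lt; lra).
  assert (He2e : e ^ 2 <= e) by (simpl; nra).
  assert (He3 : 0 < e ^ 3 <= e) by (split; [apply pow_lt; lra | simpl in *; nra]).
  rewrite lg_w_at_0. unfold lg_w.
  set (p0 := lg_p0 r0 0 m e). assert (Ep0 : p0 = r0 + e ^ 2 * m) by (unfold p0, lg_p0; ring).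
  set (q := lg_al r0 e * (1 + e * e ^ 2 / 5 + (e * e ^ 2) ^ 2 * lg_F2 0 (e * e ^ 2))).
  assert (Ep : lg_phi 0 e (lg_al r0 e) p0 (e ^ 2) = r0 + e ^ 2 * (m + q)).
  { unfold lg_phi. fold q. rewrite Ep0. unfold q. ring. }
  assert (Hq : 0 <= q <= 1 + tau).
  { unfold q, lg_F2, lg_al. replace (e * e ^ 2) with (e ^ 3) by ring.
    set (s := e ^ 3) in *.
    replace (1 + s / 5 + s ^ 2 * ((1 / 25 + 2 * 0) / 3 + 0 * s / 10 + 0 ^ 2 * s ^ 2 / 5))
      with (1 + s / 5 + s * s / 75) by field.
    assert (0 <= s * s <= s) by nra.
    assert (Hab : Rabs (e * (-4 * r0 / 15)) <= e * Rabs r0).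
    { rewrite Rabs_mult, (Rabs_pos_eq e) by lra. apply Rmult_le_compat_l; [lra |].
      unfold Rdiv. rewrite !Rabs_mult, Rabs_inv. rewrite (Rabs_left (-4)), (Rabs_pos_eq 15) by lra. lra. }
    apply Rabs_le_between in Hab.
    set (u := e * (-4 * r0 / 15)) in *. set (v := e * Rabs r0) in *.
    assert (0 <= v) by (apply Rmult_le_pos; lra).
    assert (Hkv : e + 2 * v <= tau) by (unfold k in E3; unfold v; lra).
    split; nra. }
  rewrite Ep.
  assert (Hb : 1 <= lg_b 0 e (e ^ 2)) by (unfold lg_b; nra).
  assert (B0 := HAl p0). rewrite Ep0 in B0. specialize (B0 ltac:(nra)). rewrite <- Ep0 in B0.
  assert (Hy : e ^ 2 * (m + q) <= del) by nra.
  assert (B1 := HAl (r0 + e ^ 2 * (m + q)) ltac:(nra)).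
  set (A2 := A (r0 + e ^ 2 * (m + q))) in *.
  replace (p0 - r0) with (e ^ 2 * m) in B0 by (rewrite Ep0; ring).
  replace (r0 + e ^ 2 * (m + q) - r0) with (e ^ 2 * (m + q)) in B1 by ring.
  assert (HA2 : 0 <= A2).
  { eapply Rle_trans; [| apply B1]. repeat apply Rmult_le_pos; lra. }
  assert (Hdiv : A2 / lg_b 0 e (e ^ 2) <= A2) by (apply Rle_div_l; nra).
  assert (Hsq : sqrt (1 + e ^ 3) <= 1 + tau).
  { rewrite <- (sqrt_Rsqr (1 + tau)) by lra. apply sqrt_le_1_alt. unfold Rsqr. nra. }
  assert (Hsq0 : 0 <= sqrt (1 + e ^ 3)) by apply sqrt_pos.
  apply Rle_trans with (r * (1 + tau) * ((1 + tau) * A1 r0 * (e ^ 2 * (m + (1 + tau))))).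
  - apply Rmult_le_compat; [apply Rmult_le_pos; lra | apply Rdiv_le_0_compat; lra | apply Rmult_le_compat_l; lra |].
    eapply Rle_trans; [exact Hdiv |]. eapply Rle_trans; [apply B1 |].
    apply Rmult_le_compat_l; [apply Rmult_le_pos; lra |]. apply Rmult_le_compat_l; lra.
  - eapply Rle_trans; [| apply B0].
    replace (r * (1 + tau) * ((1 + tau) * A1 r0 * (e ^ 2 * (m + (1 + tau)))))
      with (A1 r0 * e ^ 2 * (r * ((1 + tau) * (1 + tau) * (m + (1 + tau))))) by ring.
    replace ((1 - tau) * A1 r0 * (e ^ 2 * m)) with (A1 r0 * e ^ 2 * ((1 - tau) * m)) by ring.
    apply Rmult_le_compat_l; [apply Rmult_le_pos; lra |].
    assert (T1 : (1 + tau) * (1 + tau) * (m + (1 + tau)) <= m + 1 + 1 / 2).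
    { replace ((1 + tau) * (1 + tau) * (m + (1 + tau)))
        with (m + 1 + (2 + tau) * (tau * (m + 2)) - (2 + tau) * tau * (1 - tau) + tau) by ring.
      rewrite Htm. nra. }
    assert (T2 : r * ((1 + tau) * (1 + tau) * (m + (1 + tau))) <= r * (m + 1 + 1 / 2)) by (apply Rmult_le_compat_l; lra).
    assert (tau * m <= 1 / 8) by nra.
    nra.
Qed.

Definition bounded_on {T : Type} (P : T -> Prop) (f : T -> R) : Prop :=
  exists C, 0 <= C /\ forall t, P t -> Rabs (f t) <= C.

Lemma bounded_on_le {T : Type} (P : T -> Prop) (f : T -> R) (C : R) :
  (forall t, P t -> Rabs (f t) <= C) -> bounded_on P f.
Proof.
  intros H. exists (Rabs C). split; [apply Rabs_pos |].
  intros t Ht. specialize (H t Ht). pose proof (Rle_abs C). lra.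
Qed.

Lemma bounded_on_const {T : Type} (P : T -> Prop) (c : R) : bounded_on P (fun _ => c).
Proof. apply (bounded_on_le _ _ (Rabs c)); intros; lra. Qed.

Lemma bounded_on_add {T : Type} (P : T -> Prop) (f g : T -> R) :
  bounded_on P f -> bounded_on P g -> bounded_on P (fun t => f t + g t).
Proof.
  intros [C [_ H]] [D [_ H']]. apply (bounded_on_le _ _ (C + D)). intros t Ht.
  specialize (H t Ht). specialize (H' t Ht). eapply Rle_trans; [apply Rabs_triang | lra].
Qed.

Lemma bounded_on_sub {T : Type} (P : T -> Prop) (f g : T -> R) :
  bounded_on P f -> bounded_on P g -> bounded_on P (fun t => f t - g t).
Proof.
  intros [C [_ H]] [D [_ H']]. apply (bounded_on_le _ _ (C + D)). intros t Ht.
  specialize (H t Ht). specialize (H' t Ht).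
  unfold Rminus. eapply Rle_trans; [apply Rabs_triang |]. rewrite Rabs_Ropp. lra.
Qed.

Lemma bounded_on_mul {T : Type} (P : T -> Prop) (f g : T -> R) :
  bounded_on P f -> bounded_on P g -> bounded_on P (fun t => f t * g t).
Proof.
  intros [C [HC H]] [D [HD H']]. apply (bounded_on_le _ _ (C * D)). intros t Ht.
  rewrite Rabs_mult. apply Rmult_le_compat; try apply Rabs_pos; auto.
Qed.

Ltac bounded_on :=
  repeat first [ assumption | apply bounded_on_const | apply bounded_on_sub
               | apply bounded_on_add | apply bounded_on_mul ].

Lemma airy_local_bounds (A A1 : R -> R) (B c : R) :
  airy_decaying A A1 B -> exists M, 0 <= M /\ forall z, Rabs (z - c) <= 5 ->
    Rabs (A z) <= M /\ Rabs (z * A z) <= M /\ Rabs (A z + z * A1 z) <= M.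
Proof.
  intros [_ [_ [HB Hb]]].
  set (E := B * exp (5 - c)).
  assert (HE : 0 <= E) by (apply Rmult_le_pos; [exact HB | left; apply exp_pos]).
  pose proof (Rabs_pos c).
  exists (E * (7 + Rabs c)). split; [apply Rmult_le_pos; lra |].
  intros z Hz. destruct (Hb z) as [B1 B2].
  assert (Hz5 : B * exp (- z) <= E).
  { unfold E. apply Rmult_le_compat_l; [exact HB |]. apply Rabs_le_between in Hz.
    destruct (Rle_lt_or_eq (- z) (5 - c)) as [L | ->]; [lra | left; apply exp_increasing; exact L | lra]. }
  assert (Hza : Rabs z <= 5 + Rabs c).
  { replace z with ((z - c) + c) by ring. eapply Rle_trans; [apply Rabs_triang | lra]. }
  assert (C1 : Rabs (z * A z) <= (5 + Rabs c) * E).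
  { rewrite Rabs_mult. apply Rmult_le_compat; try apply Rabs_pos; lra. }
  assert (C2 : Rabs (z * A1 z) <= (5 + Rabs c) * E).
  { rewrite Rabs_mult. apply Rmult_le_compat; try apply Rabs_pos; lra. }
  assert (0 <= Rabs c * E) by (apply Rmult_le_pos; lra).
  split; [lra | split; [lra |]].
  eapply Rle_trans; [apply Rabs_triang |]. lra.
Qed.

(** Bounds for [A] near [c] serve all phases [p0] close to [c] at once, so the constant
    does not depend on the phase shift chosen later. *)
Lemma lg_w_step (A A1 : R -> R) (B c : R) :
  airy_decaying A A1 B -> exists M, 0 <= M /\ forall sg e al p0,
    0 <= sg <= 1 -> 0 < e <= 1 -> 0 <= al <= 2 -> Rabs (p0 - c) <= 1 / 2 ->
    Rabs (lg_w A sg e al p0 (e ^ 2) - lg_w A sg e al p0 0 - e ^ 2 * lg_w1 A A1 sg e al p0 0) <= M * e ^ 4.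
Proof.
  intros HA. destruct (airy_local_bounds A A1 B c HA) as [M0 [HM0 HMb]].
  pose proof (Rabs_pos c).
  set (CW := 4 * (Rabs c + 5) * 81 + 60).
  exists (CW * (2 * M0)). split; [apply Rmult_le_pos; unfold CW; lra |].
  intros sg e al p0 Hsg He Hal Hp0.
  assert (He2 : 0 < e ^ 2 <= 1) by (split; [apply pow_lt; lra | simpl; nra]).
  replace (CW * (2 * M0) * e ^ 4) with (CW * (2 * M0) * (e ^ 2) ^ 2) by ring.
  replace (lg_w A sg e al p0 (e ^ 2)) with (lg_w A sg e al p0 (0 + e ^ 2)) by (rewrite Rplus_0_l; reflexivity).
  apply (taylor1_bound (lg_w A sg e al p0) (lg_w1 A A1 sg e al p0)
    (fun x => lg_W sg e al p0 x * lg_w A sg e al p0 x)).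
  intros x Hx. rewrite Rminus_0_r, (Rabs_pos_eq (e ^ 2)) in Hx by lra.
  apply Rabs_le_between in Hx.
  assert (Hs : - 1 <= e * x <= 1) by (split; nra).
  set (s := e * x) in *.
  assert (Hs2 : 0 <= s ^ 2 <= 1) by (split; [apply pow2_ge_0 | simpl; nra]).
  assert (Hsgs : 0 <= sg * s ^ 2 <= 1).
  { split; [apply Rmult_le_pos; lra |]. replace 1 with (1 * 1) by ring. apply Rmult_le_compat; lra. }
  set (b := lg_b sg e x). assert (Hb : 4 / 5 <= b <= 3) by (unfold b, lg_b; fold s; lra).
  destruct (lg_w_derive A A1 B sg e al p0 x HA ltac:(fold b; lra)) as [D1 D2].
  split; [exact D1 | split; [exact D2 |]].
  set (F := lg_F2 sg s).
  assert (HF : - 1 <= F <= 2).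
  { unfold F, lg_F2. assert (- 1 <= sg * s <= 1) by (split; nra).
    assert (0 <= sg ^ 2 * s ^ 2 <= 1).
    { replace (sg ^ 2 * s ^ 2) with (sg * (sg * s ^ 2)) by ring. split; [apply Rmult_le_pos; lra |].
      replace 1 with (1 * 1) by ring. apply Rmult_le_compat; lra. }
    lra. }
  set (p := lg_phi sg e al p0 x).
  assert (Hp : Rabs (p - c) <= 5).
  { unfold p, lg_phi. fold s F.
    assert (HsF : - 1 <= s ^ 2 * F <= 2) by (split; nra).
    assert (Hsf : Rabs (1 + s / 5 + s ^ 2 * F) <= 4) by (apply Rabs_le; lra).
    replace (p0 + al * (x * (1 + s / 5 + s ^ 2 * F)) - c)
      with ((p0 - c) + al * (x * (1 + s / 5 + s ^ 2 * F))) by ring.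
    assert (Hxx : Rabs x <= e ^ 2) by (apply Rabs_le; lra).
    eapply Rle_trans; [apply Rabs_triang |]. rewrite !Rabs_mult, (Rabs_pos_eq al) by lra.
    set (f := Rabs (1 + s / 5 + s ^ 2 * F)) in *.
    assert (Hsf2 : f <= 2.2).
    { unfold f. apply Rabs_le. split; [lra |].
      assert (F <= 1).
      { unfold F, lg_F2. assert (sg * s <= 1) by nra.
        assert (sg ^ 2 * s ^ 2 <= 1).
        { replace (sg ^ 2 * s ^ 2) with (sg * (sg * s ^ 2)) by ring.
          replace 1 with (1 * 1) by ring. apply Rmult_le_compat; lra. }
        lra. }
      nra. }
    pose proof (Rabs_pos x). assert (0 <= f) by apply Rabs_pos.
    assert (Rabs x * f <= 1 * 2.2) by (apply Rmult_le_compat; lra).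
    assert (al * (Rabs x * f) <= 2 * 2.2) by (apply Rmult_le_compat; [lra | apply Rmult_le_pos; lra | lra | lra]).
    lra. }
  destruct (HMb p Hp) as [HAp _].
  assert (Hib : 0 < / b <= 5 / 4).
  { split; [apply Rinv_0_lt_compat; lra |]. replace (5 / 4) with (/ (4 / 5)) by field. apply Rinv_le_contravar; lra. }
  rewrite Rabs_mult. apply Rmult_le_compat; try apply Rabs_pos.
  - unfold lg_W. fold p b.
    assert (Hpa : Rabs p <= Rabs c + 5).
    { replace p with ((p - c) + c) by ring. eapply Rle_trans; [apply Rabs_triang | lra]. }
    assert (Hb4 : 0 <= b ^ 4 <= 81) by (split; [apply pow_le; lra | replace 81 with (3 ^ 4) by ring; apply pow_incr; lra]).
    assert (Hal2 : 0 <= al ^ 2 <= 4) by (split; [apply pow2_ge_0 | replace 4 with (2 ^ 2) by ring; apply pow_incr; lra]).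
    assert (T1 : Rabs (al ^ 2 * p * b ^ 4) <= 4 * (Rabs c + 5) * 81).
    { rewrite !Rabs_mult, (Rabs_pos_eq (al ^ 2)), (Rabs_pos_eq (b ^ 4)) by lra.
      apply Rmult_le_compat; [apply Rmult_le_pos; [lra | apply Rabs_pos] | lra | | lra].
      apply Rmult_le_compat; [lra | apply Rabs_pos | lra | exact Hpa]. }
    assert (Hb1 : Rabs (lg_b1 sg e x) <= 3).
    { unfold lg_b1. replace (2 * sg * e ^ 2 * x) with (2 * (sg * (e * s))) by (unfold s; ring).
      assert (- 1 <= e * s <= 1) by (split; nra).
      assert (- 1 <= sg * (e * s) <= 1) by (split; nra). apply Rabs_le; lra. }
    assert (Hb2 : 0 <= lg_b2 sg e <= 2).
    { unfold lg_b2. split; [repeat apply Rmult_le_pos; lra |].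
      replace 2 with (2 * 1 * 1) at 2 by ring. apply Rmult_le_compat; lra. }
    assert (T2 : 0 <= 2 * lg_b1 sg e x ^ 2 / b ^ 2 <= 30).
    { assert (0 <= lg_b1 sg e x ^ 2 <= 9).
      { split; [apply pow2_ge_0 |]. rewrite <- pow2_abs. replace 9 with (3 ^ 2) by ring.
        apply pow_incr. split; [apply Rabs_pos | exact Hb1]. }
      assert (Hib2 : 0 < / b ^ 2 <= 25 / 16).
      { rewrite <- pow_inv. split; [apply pow_lt; lra |]. replace (25 / 16) with ((5 / 4) ^ 2) by field. apply pow_incr; lra. }
      unfold Rdiv. split; [apply Rmult_le_pos; lra |].
      assert (2 * lg_b1 sg e x ^ 2 * / b ^ 2 <= 18 * (25 / 16)) by (apply Rmult_le_compat; lra). lra. }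
    assert (T3 : 0 <= lg_b2 sg e / b <= 5 / 2).
    { unfold Rdiv. split; [apply Rmult_le_pos; lra |].
      assert (lg_b2 sg e * / b <= 2 * (5 / 4)) by (apply Rmult_le_compat; lra). lra. }
    apply Rabs_le_between in T1. unfold CW. apply Rabs_le. lra.
  - unfold lg_w. fold p b. unfold Rdiv. rewrite Rabs_mult, (Rabs_pos_eq (/ b)) by lra.
    apply Rle_trans with (M0 * (5 / 4)); [| lra].
    apply Rmult_le_compat; [apply Rabs_pos | lra | exact HAp | lra].
Qed.

Lemma sqrt_product_expansion (eta : R) :
  exists e0 M, 0 < e0 <= 1 /\ 0 <= M /\ forall e, 0 < e <= e0 ->
    0 < 1 + eta * e ^ 2 /\
    Rabs (sqrt (1 + eta * e ^ 2) * sqrt (1 + e ^ 3) - (1 + eta * e ^ 2 / 2 + e ^ 3 / 2)) <= M * e ^ 4.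
Proof.
  pose proof (Rabs_pos eta).
  exists (/ (2 * (Rabs eta + 1))), (2 * (Rabs eta + (Rabs eta + 1) ^ 2)).
  assert (Hi : 0 < / (2 * (Rabs eta + 1))) by (apply Rinv_0_lt_compat; lra).
  assert (Hi1 : / (2 * (Rabs eta + 1)) <= / 2) by (apply Rinv_le_contravar; lra).
  split; [lra | split].
  { assert (0 <= (Rabs eta + 1) ^ 2) by apply pow2_ge_0. lra. }
  intros e [He Hee].
  assert (Hk : (Rabs eta + 1) * e <= 1 / 2).
  { apply Rle_trans with ((Rabs eta + 1) * / (2 * (Rabs eta + 1))); [apply Rmult_le_compat_l; lra | right; field; lra]. }
  assert (He2 : 0 < e ^ 2 <= e / 2) by (split; [apply pow_lt; lra | simpl; nra]).
  assert (He3 : 0 < e ^ 3 <= e ^ 2 / 2) by (split; [apply pow_lt; lra | simpl in *; nra]).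
  assert (He4 : 0 < e ^ 4) by (apply pow_lt; lra).
  assert (Hee2 : Rabs (eta * e ^ 2) <= 1 / 4).
  { rewrite Rabs_mult, (Rabs_pos_eq (e ^ 2)) by lra. nra. }
  apply Rabs_le_between in Hee2.
  split; [lra |].
  set (g := sqrt (1 + eta * e ^ 2) * sqrt (1 + e ^ 3)).
  set (g0 := 1 + eta * e ^ 2 / 2 + e ^ 3 / 2).
  assert (Hg : 0 <= g) by (apply Rmult_le_pos; apply sqrt_pos).
  assert (Hg0 : 1 / 2 <= g0) by (unfold g0; lra).
  assert (Hgg : g * g = (1 + eta * e ^ 2) * (1 + e ^ 3)).
  { unfold g. replace (sqrt (1 + eta * e ^ 2) * sqrt (1 + e ^ 3) * (sqrt (1 + eta * e ^ 2) * sqrt (1 + e ^ 3)))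
      with ((sqrt (1 + eta * e ^ 2) * sqrt (1 + eta * e ^ 2)) * (sqrt (1 + e ^ 3) * sqrt (1 + e ^ 3))) by ring.
    rewrite !sqrt_sqrt by lra. reflexivity. }
  set (R0 := eta * e - (eta / 2 + e / 2) ^ 2).
  assert (E : (g - g0) * (g + g0) = e ^ 4 * R0).
  { replace ((g - g0) * (g + g0)) with (g * g - g0 * g0) by ring. rewrite Hgg. unfold g0, R0. field. }
  assert (HR : Rabs R0 <= Rabs eta + (Rabs eta + 1) ^ 2).
  { unfold R0, Rminus. eapply Rle_trans; [apply Rabs_triang |]. rewrite Rabs_Ropp.
    apply Rplus_le_compat.
    - rewrite Rabs_mult, (Rabs_pos_eq e) by lra. nra.
    - rewrite Rabs_pos_eq by apply pow2_ge_0. rewrite <- pow2_abs. apply pow_incr.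
      split; [apply Rabs_pos |]. eapply Rle_trans; [apply Rabs_triang |].
      rewrite (Rabs_pos_eq (e / 2)) by lra. unfold Rdiv. rewrite Rabs_mult, (Rabs_pos_eq (/ 2)) by lra. lra. }
  assert (H1 : Rabs (g - g0) * (1 / 2) <= e ^ 4 * (Rabs eta + (Rabs eta + 1) ^ 2)).
  { apply Rle_trans with (Rabs (g - g0) * (g + g0)).
    - apply Rmult_le_compat_l; [apply Rabs_pos | lra].
    - rewrite <- (Rabs_pos_eq (g + g0)) by lra. rewrite <- Rabs_mult, E, Rabs_mult, (Rabs_pos_eq (e ^ 4)) by lra.
      apply Rmult_le_compat_l; lra. }
  lra.
Qed.

(** The Robin condition on [A] and the equation for [d] cancel the mismatch in the
    boundary condition up to order [e ^ 3]. At order [e ^ 4] the phase shift [m] enters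
    linearly, with the coefficient [- A c * r1]. The constant is uniform in [m], which
    can therefore be chosen after it. *)
Lemma robin_boundary (A A1 : R -> R) (B c eta r1 d : R) :
  airy_decaying A A1 B -> c = r1 + eta ^ 2 / 4 -> A1 c = - (eta / 2) * A c ->
  r1 * d = (- 4 * c / 15) * eta / 2 - 3 / 10 ->
  exists C e0, 0 <= C /\ 0 < e0 <= 1 /\ forall sg m e, 0 <= sg <= 1 -> 0 < e <= e0 -> e * Rabs m <= 1 ->
    Rabs (lgw A sg c d m e 0 - sqrt (1 + eta * e ^ 2) * sqrt (1 + e ^ 3) * lgw A sg c d m e (e ^ 2)
          + A c * e ^ 4 * m * r1) <= C * e ^ 4.
Proof.
  intros HA Hc Hq Hd.
  destruct (airy_local_bounds A A1 B c HA) as [M0 [HM0 HMb]].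
  destruct (lg_w_step A A1 B c HA) as [M1 [HM1 Hstep]].
  destruct (sqrt_product_expansion eta) as [eg [M2 [Heg [HM2 Hg]]]].
  set (b0 := - 4 * c / 15) in *. set (a := A c) in *.
  pose proof (Rabs_pos d). pose proof (Rabs_pos b0).
  set (k := 2 * (Rabs d + 1) + Rabs b0).
  assert (Hk : 0 < / k <= 1 / 2).
  { split; [apply Rinv_0_lt_compat; unfold k; lra |]. replace (1 / 2) with (/ 2) by field.
    apply Rinv_le_contravar; unfold k; lra. }
  set (P := fun t : R * R * R => let '(sg, m, e) := t in
     0 <= sg <= 1 /\ 0 < e <= Rmin eg (/ k) /\ e * Rabs m <= 1).
  set (te := fun t : R * R * R => snd t). set (tm := fun t : R * R * R => snd (fst t)).
  set (tsg := fun t : R * R * R => fst (fst t)).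
  set (tY := fun t => d + te t * tm t).
  set (ty := fun t => te t * tY t).
  set (tF1 := fun t => (A (c + ty t) - a + ty t * (eta * a / 2)) / te t ^ 2).
  set (tF2 := fun t => (A1 (c + ty t) + eta * a / 2 - ty t * (c * a)) / te t ^ 2).
  set (tg := fun t => sqrt (1 + eta * te t ^ 2) * sqrt (1 + te t ^ 3)).
  set (tF3 := fun t => (tg t - (1 + eta * te t ^ 2 / 2 + te t ^ 3 / 2)) / te t ^ 4).
  set (tF4 := fun t => (lgw A (tsg t) c d (tm t) (te t) (te t ^ 2) - lgw A (tsg t) c d (tm t) (te t) 0
     - te t ^ 2 * lgw1 A A1 (tsg t) c d (tm t) (te t) 0) / te t ^ 4).
  assert (HP : forall t, P t -> 0 <= tsg t <= 1 /\ 0 < te t <= eg /\ te t <= 1 / 2 /\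
     Rabs (tY t) <= Rabs d + 1 /\ Rabs (ty t) <= 1 / 2 /\ te t * Rabs b0 <= 1).
  { intros [[sg m] e] [H1 [[H2 H3] H4]].
    change (0 <= sg <= 1 /\ 0 < e <= eg /\ e <= 1 / 2 /\ Rabs (d + e * m) <= Rabs d + 1 /\
      Rabs (e * (d + e * m)) <= 1 / 2 /\ e * Rabs b0 <= 1).
    assert (H5 := Rmin_l eg (/ k)). assert (H6 := Rmin_r eg (/ k)).
    assert (Hke : e * k <= 1).
    { assert (Hk0 : 0 < k) by (unfold k; lra).
      apply Rle_trans with (/ k * k); [apply Rmult_le_compat_r; lra | rewrite Rinv_l; lra]. }
    assert (HY : Rabs (d + e * m) <= Rabs d + 1).
    { eapply Rle_trans; [apply Rabs_triang |]. rewrite Rabs_mult, (Rabs_pos_eq e) by lra. lra. }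
    split; [exact H1 | split; [lra | split; [lra | split; [exact HY | split]]]].
    - rewrite Rabs_mult, (Rabs_pos_eq e) by lra.
      assert (e * Rabs (d + e * m) <= e * (Rabs d + 1)) by (apply Rmult_le_compat_l; lra).
      assert (0 <= e * Rabs b0) by (apply Rmult_le_pos; lra). unfold k in Hke. lra.
    - assert (0 <= e * (Rabs d + 1)) by (apply Rmult_le_pos; lra). unfold k in Hke. lra. }
  assert (Be : bounded_on P te).
  { apply (bounded_on_le _ _ 1). intros t Ht. destruct (HP t Ht) as [_ [H1 [H2 _]]]. rewrite Rabs_pos_eq; lra. }
  assert (BY : bounded_on P tY).
  { apply (bounded_on_le _ _ (Rabs d + 1)). intros t Ht. apply (HP t Ht). }
  assert (Hdiv : forall x y E M, 0 < y -> Rabs x <= M * E -> E = y -> Rabs (x / y) <= M).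
  { intros x y E M Hy Hx ->. unfold Rdiv. rewrite Rabs_mult, Rabs_inv, (Rabs_pos_eq y) by lra.
    apply Rle_div_l; assumption. }
  assert (Hy2 : forall t, P t -> M0 * ty t ^ 2 <= M0 * (Rabs d + 1) ^ 2 * te t ^ 2).
  { intros t Ht. destruct (HP t Ht) as [_ [_ [_ [H1 _]]]]. unfold ty. rewrite Rpow_mult_distr.
    assert (tY t ^ 2 <= (Rabs d + 1) ^ 2) by (rewrite <- pow2_abs; apply pow_incr; split; [apply Rabs_pos | exact H1]).
    assert (0 <= te t ^ 2) by apply pow2_ge_0.
    replace (M0 * (Rabs d + 1) ^ 2 * te t ^ 2) with (M0 * (te t ^ 2 * (Rabs d + 1) ^ 2)) by ring.
    apply Rmult_le_compat_l; [exact HM0 |]. apply Rmult_le_compat_l; assumption. }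
  assert (BF1 : bounded_on P tF1).
  { apply (bounded_on_le _ _ (M0 * (Rabs d + 1) ^ 2)). intros t Ht.
    destruct (HP t Ht) as [_ [H1 [_ [_ [H5 _]]]]].
    unfold tF1. apply (Hdiv _ _ (te t ^ 2)); [apply pow_lt; lra | | reflexivity].
    eapply Rle_trans; [| apply Hy2; exact Ht].
    replace (A (c + ty t) - a + ty t * (eta * a / 2)) with (A (c + ty t) - A c - ty t * A1 c)
      by (rewrite Hq; unfold a; field).
    apply (taylor1_bound A A1 (fun z => z * A z)). intros z Hz.
    split; [apply HA | split; [apply HA | apply HMb; lra]]. }
  assert (BF2 : bounded_on P tF2).
  { apply (bounded_on_le _ _ (M0 * (Rabs d + 1) ^ 2)). intros t Ht.
    destruct (HP t Ht) as [_ [H1 [_ [_ [H5 _]]]]].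
    unfold tF2. apply (Hdiv _ _ (te t ^ 2)); [apply pow_lt; lra | | reflexivity].
    eapply Rle_trans; [| apply Hy2; exact Ht].
    replace (A1 (c + ty t) + eta * a / 2 - ty t * (c * a)) with (A1 (c + ty t) - A1 c - ty t * (c * A c))
      by (rewrite Hq; unfold a; field).
    apply (taylor1_bound A1 (fun z => z * A z) (fun z => A z + z * A1 z)). intros z Hz.
    split; [apply HA | split; [| apply HMb; lra]].
    auto_derive; [exists (A1 z); exact (proj1 HA z) |]. rewrite (Derive_eta A _ _ (proj1 HA z)). ring. }
  assert (BF3 : bounded_on P tF3).
  { apply (bounded_on_le _ _ M2). intros t Ht. destruct (HP t Ht) as [_ [H1 _]].
    unfold tF3. apply (Hdiv _ _ (te t ^ 4)); [apply pow_lt; lra | | reflexivity].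
    apply Hg; exact H1. }
  assert (BF4 : bounded_on P tF4).
  { apply (bounded_on_le _ _ M1). intros t Ht. destruct (HP t Ht) as [Ht0 [H1 [H2 [_ [H5 H6]]]]].
    unfold tF4. apply (Hdiv _ _ (te t ^ 4)); [apply pow_lt; lra | | reflexivity].
    apply Hstep; [exact Ht0 | lra | |].
    - unfold lg_al. fold b0.
      assert (Rabs (te t * b0) <= 1) by (rewrite Rabs_mult, (Rabs_pos_eq (te t)) by lra; exact H6).
      assert (H8 : Rabs (te t * b0) <= 1) by assumption.
      apply Rabs_le_between in H8. lra.
    - unfold lg_p0. replace (c + te t * d + te t ^ 2 * tm t - c) with (ty t) by (unfold ty, tY; ring). exact H5. }
  set (tG := fun t => eta / 2 + te t * (1 / 2) + te t * te t * tF3 t).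
  set (tw0 := fun t => a - te t * tY t * (eta * a / 2) + te t * te t * tF1 t).
  set (tB1 := fun t => - (eta * a / 2) + te t * tY t * (c * a) + te t * te t * tF2 t).
  set (tw1 := fun t => (1 + te t * b0) * tB1 t - te t * (1 / 5) * tw0 t).
  set (tT := fun t => tY t * (a * b0 * c) - tY t * (3 * eta * a / 20)
     + (eta / 2 + te t * (3 / 10)) * tF1 t + (1 + te t * b0) * tF2 t + tF3 t * tw0 t
     + (tG t * tw1 t + (1 + te t * te t * tG t) * tF4 t)).
  assert (BT : bounded_on P tT).
  { unfold tT, tw1, tB1, tw0, tG. bounded_on. }
  destruct BT as [C [HC HT]].
  exists C, (Rmin eg (/ k)). split; [exact HC | split].
  { split; [apply Rmin_glb_lt; lra |]. eapply Rle_trans; [apply Rmin_l | lra]. }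
  intros sg m e Hsg He Hem.
  assert (Ht : P (sg, m, e)) by (unfold P; auto).
  specialize (HT _ Ht). destruct (HP _ Ht) as [_ [H1 _]].
  set (t := (sg, m, e)) in *.
  assert (Ee : te t = e) by reflexivity. assert (Em : tm t = m) by reflexivity. assert (Es : tsg t = sg) by reflexivity.
  assert (He4 : 0 < e ^ 4) by (apply pow_lt; lra).
  assert (Ep0 : lg_p0 c d m e = c + ty t) by (unfold lg_p0, ty, tY; rewrite Ee, Em; ring).
  assert (W0 : lgw A sg c d m e 0 = tw0 t).
  { rewrite lg_w_at_0, Ep0. unfold tw0, tF1. rewrite Ee. unfold ty. rewrite Ee. field. lra. }
  assert (WB : A1 (c + ty t) = tB1 t).
  { unfold tB1, tF2. rewrite Ee. unfold ty. rewrite Ee. field. lra. }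
  assert (W1 : lgw1 A A1 sg c d m e 0 = tw1 t).
  { rewrite lg_w1_at_0, Ep0, WB. rewrite <- Ep0.
    replace (A (lg_p0 c d m e)) with (tw0 t) by (rewrite <- W0; apply lg_w_at_0).
    unfold tw1, lg_al. rewrite Ee. fold b0. field. }
  assert (W2 : lgw A sg c d m e (e ^ 2) = tw0 t + e ^ 2 * tw1 t + e ^ 4 * tF4 t).
  { unfold tF4. rewrite Ee, Em, Es, W0, W1. field. lra. }
  assert (Wg : sqrt (1 + eta * e ^ 2) * sqrt (1 + e ^ 3) = 1 + e ^ 2 * tG t).
  { unfold tG, tF3, tg. rewrite Ee. field. lra. }
  rewrite W0, W2, Wg.
  assert (EQ : tw0 t - (1 + e ^ 2 * tG t) * (tw0 t + e ^ 2 * tw1 t + e ^ 4 * tF4 t) + a * e ^ 4 * m * r1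
    = - (e ^ 4 * tT t)).
  { assert (EGw : tG t * tw0 t + tw1 t = e ^ 2 * (a * r1 * m + (tY t * (a * b0 * c) - tY t * (3 * eta * a / 20)
     + (eta / 2 + e * (3 / 10)) * tF1 t + (1 + e * b0) * tF2 t + tF3 t * tw0 t))).
    { transitivity ((eta / 2 + 3 * e / 10) * tw0 t + (1 + e * b0) * tB1 t + e ^ 2 * (tF3 t * tw0 t)).
      { unfold tG, tw1. rewrite Ee. field. }
      unfold tw0 at 1, tB1. rewrite Ee.
      assert (EY : tY t = d + e * m) by reflexivity.
      assert (Key : a * (3 / 10 - b0 * eta / 2 + tY t * r1) = a * r1 * (e * m)).
      { rewrite EY. replace (3 / 10 - b0 * eta / 2) with (- (r1 * d)) by lra. ring. }
      transitivity (e * (a * (3 / 10 - b0 * eta / 2 + tY t * r1))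
        + e ^ 2 * ((tY t * (a * b0 * c) - tY t * (3 * eta * a / 20)
     + (eta / 2 + e * (3 / 10)) * tF1 t + (1 + e * b0) * tF2 t + tF3 t * tw0 t))).
      { replace r1 with (c - eta ^ 2 / 4) by lra. field. }
      rewrite Key. ring. }
    transitivity (- e ^ 2 * (tG t * tw0 t + tw1 t) - e ^ 4 * (tG t * tw1 t + (1 + e ^ 2 * tG t) * tF4 t) + a * e ^ 4 * m * r1).
    { ring. }
    rewrite EGw. unfold tT. rewrite Ee. ring. }
  rewrite EQ, Rabs_Ropp, Rabs_mult, (Rabs_pos_eq (e ^ 4)) by lra.
  rewrite (Rmult_comm C). apply Rmult_le_compat_l; lra.
Qed.

(** * The expansions *)

Definition cube_scale (K : nat) : R := Rpower (INR K) (- (1 / 3)).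

Lemma cube_scale_facts (K : nat) :
  (1 <= K)%nat ->
  0 < cube_scale K /\ INR K = / cube_scale K ^ 3 /\
  Rpower (INR K) (4 / 3) = / cube_scale K ^ 4 /\
  Rpower (INR K) (5 / 3) = / cube_scale K ^ 5 /\
  Rpower (INR K) (- (2 / 3)) = cube_scale K ^ 2.
Proof.
  intros HK. assert (HK0 : 0 < INR K) by (apply lt_0_INR; lia).
  assert (He : 0 < cube_scale K) by apply exp_pos.
  assert (Hp : forall n : nat, cube_scale K ^ n = Rpower (INR K) (- (1 / 3) * INR n)).
  { intros n. unfold cube_scale. rewrite <- Rpower_pow by apply exp_pos. apply Rpower_mult. }
  split; [exact He |]. rewrite !Hp, <- !Rpower_Ropp.
  repeat split.
  - rewrite <- (Rpower_1 (INR K)) at 1 by exact HK0. f_equal. simpl. field.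
  - f_equal. simpl. field.
  - f_equal. simpl. field.
  - f_equal. simpl. field.
Qed.

Lemma cube_scale_small (e0 : R) :
  0 < e0 -> exists K0, forall K, (K0 <= K)%nat -> (1 <= K)%nat /\ 0 < cube_scale K <= e0.
Proof.
  intros He0. assert (H3 : 0 < e0 ^ 3) by (apply pow_lt; exact He0).
  destruct (nfloor_ex (/ e0 ^ 3)) as [N [_ HN]]; [left; apply Rinv_0_lt_compat; exact H3 |].
  exists (S N). intros K HK. assert (HK1 : (1 <= K)%nat) by lia. split; [exact HK1 |].
  destruct (cube_scale_facts K HK1) as [He [EK _]]. split; [exact He |].
  apply Rnot_lt_le; intros Hlt.
  assert (Hc : e0 ^ 3 <= cube_scale K ^ 3) by (apply pow_incr; lra).
  apply le_INR in HK. rewrite S_INR in HK.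
  assert (/ cube_scale K ^ 3 <= / e0 ^ 3) by (apply Rinv_le_contravar; assumption). lra.
Qed.

(** For [rho < 1] the boundary condition tends to a Dirichlet condition on the scale
    of the Airy function. For the lower bound the phase starts exactly at the zero
    of [A]; for the upper bound it is shifted by [m] lattice steps. *)
Lemma subcritical (theta : nat -> R) (rho r0 : R) :
  0 < rho -> rho < 1 -> is_largest (fun x : R => Ai x = 0) r0 ->
  (forall K, (1 <= K)%nat -> exists Q, perron_vector rho K (theta K) Q) ->
  big_O
    (fun K : nat =>
       theta K
       - (- (1 - sqrt rho) ^ 2
          - sqrt rho / INR K
          + sqrt rho * r0 / Rpower (INR K) (4 / 3)
          - 8 * sqrt rho * r0 ^ 2 / (15 * Rpower (INR K) (5 / 3))))
    (fun K : nat => / INR K ^ 2).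
Proof.
  intros Hr0 Hr1 Hlargest HQ.
  destruct (airy_largest_zero r0 Hlargest) as [A [A1 [B [HA [Hz [Hs Hpos]]]]]].
  assert (Hprof : airy_profile A A1 B r0).
  { destruct (airy_ratio_facts A A1 B r0 HA Hpos (or_intror (conj Hz Hs))) as [F1 F2].
    split; [exact HA | split; [exact Hpos | split; [exact F2 | exact F1]]]. }
  set (r := sqrt rho).
  assert (Hr : 0 < r < 1).
  { split; [apply sqrt_lt_R0; exact Hr0 |]. unfold r. rewrite <- sqrt_1. apply sqrt_lt_1; lra. }
  set (m := (1 + r) / (1 - r)).
  assert (Hm : 0 < m) by (apply Rdiv_lt_0_compat; lra).
  assert (Hc0 : forall m', 0 <= m' -> forall e, 0 < e <= 1 -> r0 <= lg_p0 r0 0 m' e).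
  { intros m' Hm' e He. unfold lg_p0.
    assert (0 <= e ^ 2 * m') by (apply Rmult_le_pos; [apply pow2_ge_0 | exact Hm']). lra. }
  destruct (langer_upper A A1 B r0 0 m r0 1 Hprof Rlt_0_1 (Hc0 m ltac:(lra))) as [CU [eU [HeU HU]]].
  destruct (langer_lower A A1 B r0 0 0 r0 1 Hprof Rlt_0_1 (Hc0 0 ltac:(lra))) as [CL [eL [HeL HL]]].
  destruct (dirichlet_boundary_upper A A1 B r0 r HA Hz Hs Hr) as [eB [HeB HB]]. fold m in HB.
  destruct (lg_w_nonneg A A1 B 1 r0 0 0 r0 1 Hprof ltac:(lra) Rlt_0_1 (Hc0 0 ltac:(lra))) as [eN [HeN HN]].
  destruct (cube_scale_small (Rmin (Rmin eU eL) (Rmin eB eN))) as [K0 HK0].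
  { repeat apply Rmin_glb_lt; lra. }
  exists (r * (Rabs CU + Rabs CL)). exists K0. intros K HK.
  destruct (HK0 K HK) as [HK1 [He Hee]]. destruct (cube_scale_facts K HK1) as [_ [EK [E4 [E5 _]]]].
  set (e := cube_scale K) in *.
  assert (L1 : e <= Rmin eU eL) by (eapply Rle_trans; [exact Hee | apply Rmin_l]).
  assert (L2 : e <= Rmin eB eN) by (eapply Rle_trans; [exact Hee | apply Rmin_r]).
  assert (LU : e <= eU) by (eapply Rle_trans; [exact L1 | apply Rmin_l]).
  assert (LL : e <= eL) by (eapply Rle_trans; [exact L1 | apply Rmin_r]).
  assert (LB : e <= eB) by (eapply Rle_trans; [exact L2 | apply Rmin_l]).
  assert (LN : e <= eN) by (eapply Rle_trans; [exact L2 | apply Rmin_r]).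
  destruct (HQ K HK1) as [Q HQK].
  assert (Upper := HU K e rho (theta K) Q HK1 (conj He LU) EK Hr0 HQK (HB e (conj He LB))).
  assert (Lower := HL K e rho (theta K) Q HK1 (conj He LL) EK Hr0 HQK).
  assert (He2 : 0 < e ^ 2) by (apply pow_lt; exact He).
  assert (Hzero : lgw A 1 r0 0 0 e 0 = 0).
  { rewrite lg_w_at_0. replace (lg_p0 r0 0 0 e) with r0 by (unfold lg_p0; ring). exact Hz. }
  assert (Hone : 0 <= lgw A 1 r0 0 0 e (e ^ 2)) by (apply HN; [lra | lra |]; simpl; nra).
  rewrite Hzero in Lower.
  specialize (Lower ltac:(apply Rmult_le_pos; [apply Rmult_le_pos; apply sqrt_pos | exact Hone])).
  fold r in Upper, Lower |- *.
  assert (Enu : lg_nu r0 0 e = r0 - 8 * r0 ^ 2 / 15 * e) by (unfold lg_nu; field).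
  rewrite Enu in Upper, Lower.
  rewrite E4, E5. rewrite EK.
  assert (He6 : 0 < e ^ 6) by (apply pow_lt; exact He).
  replace (/ (/ e ^ 3) ^ 2) with (e ^ 6) by (field; lra).
  rewrite (Rabs_pos_eq (e ^ 6)) by lra.
  replace (r / / e ^ 3) with (r * e ^ 3) by (field; lra).
  replace (r * r0 / / e ^ 4) with (r * r0 * e ^ 4) by (field; lra).
  replace (8 * r * r0 ^ 2 / (15 * / e ^ 5)) with (r * (8 * r0 ^ 2 / 15) * e ^ 5) by (field; lra).
  assert (HCU : r * (CU * e ^ 6) <= r * (Rabs CU + Rabs CL) * e ^ 6).
  { pose proof (Rle_abs CU). pose proof (Rabs_pos CL).
    replace (r * (Rabs CU + Rabs CL) * e ^ 6) with (r * ((Rabs CU + Rabs CL) * e ^ 6)) by ring.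
    apply Rmult_le_compat_l; [lra |]. apply Rmult_le_compat_r; lra. }
  assert (HCL : r * (CL * e ^ 6) <= r * (Rabs CU + Rabs CL) * e ^ 6).
  { pose proof (Rle_abs CL). pose proof (Rabs_pos CU).
    replace (r * (Rabs CU + Rabs CL) * e ^ 6) with (r * ((Rabs CU + Rabs CL) * e ^ 6)) by ring.
    apply Rmult_le_compat_l; [lra |]. apply Rmult_le_compat_r; lra. }
  apply Rabs_le. split; lra.
Qed.

Lemma sqrt_expansion (x : R) : Rabs x <= 1 / 2 -> Rabs (sqrt (1 + x) - (1 + x / 2)) <= x ^ 2.
Proof.
  intros Hx. apply Rabs_le_between in Hx.
  assert (Hs := sqrt_pos (1 + x)). assert (E : sqrt (1 + x) * sqrt (1 + x) = 1 + x) by (apply sqrt_sqrt; lra).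
  set (g := sqrt (1 + x)) in *.
  assert (E2 : (g - (1 + x / 2)) * (g + (1 + x / 2)) = - (x ^ 2 / 4)).
  { replace ((g - (1 + x / 2)) * (g + (1 + x / 2))) with (g * g - (1 + x / 2) * (1 + x / 2)) by ring. rewrite E. field. }
  assert (0 <= x ^ 2) by apply pow2_ge_0.
  apply Rabs_le. split; nra.
Qed.

(** The value of [d] removes the mismatch of order [e ^ 3] in the boundary
    condition. As [A c * r1] is negative, a shift by [m] or [- m] outweighs the
    remaining mismatch of order [e ^ 4] in either direction. *)
Lemma near_critical (theta : nat -> R -> R) (eta r1 : R) :
  is_largest (Airy_quotient_root eta) r1 ->
  (forall K rho, (1 <= K)%nat -> 0 < rho -> exists Q, perron_vector rho K (theta K rho) Q) ->
  big_O
    (fun K : nat =>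
       theta K (1 + eta * Rpower (INR K) (- (2 / 3)))
       - (- (1 / INR K)
          + r1 / Rpower (INR K) (4 / 3)
          - (16 * r1 ^ 3 + 8 * eta ^ 2 * r1 ^ 2
             + (eta ^ 4 + 19 * eta) * r1 + eta ^ 3 + 9)
            / (30 * r1 * Rpower (INR K) (5 / 3))))
    (fun K : nat => / INR K ^ 2).
Proof.
  intros Hlargest HQ.
  destruct (airy_largest_quotient_root eta r1 Hlargest) as [A [A1 [B [HA [Hpos [Hq Hr1]]]]]].
  set (c := r1 + eta ^ 2 / 4) in *. set (b0 := - 4 * c / 15).
  set (d := (b0 * eta / 2 - 3 / 10) / r1).
  assert (Hd : r1 * d = b0 * eta / 2 - 3 / 10) by (unfold d; field; lra).
  assert (Ha : 0 < A c) by (apply Hpos; lra).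
  (* room below [c] for the phase shift [e * d + e ^ 2 * m] *)
  destruct (continuous_pos_nbhd A c (proj1 (airy_continuous A A1 B c HA)) Ha) as [del Hdel].
  pose proof (cond_pos del). set (c0 := c - del / 2).
  assert (HposD : forall x, c0 <= x -> 0 < A x).
  { intros x Hx. destruct (Rle_or_lt c x) as [H1 | H1]; [apply Hpos; exact H1 |].
    apply Hdel. apply R_ball.
    unfold c0 in Hx. apply Rabs_def1; lra. }
  assert (Hprof : airy_profile A A1 B c0).
  { destruct (airy_ratio_facts A A1 B c0 HA (fun x Hx => HposD x (Rlt_le _ _ Hx))
      (or_introl (HposD c0 (Rle_refl _)))) as [F1 F2].
    split; [exact HA | split; [intros x Hx; apply HposD; lra | split; [exact F2 | exact F1]]]. }
  destruct (robin_boundary A A1 B c eta r1 d HA eq_refl Hq Hd) as [CB [eB [HCB [HeB HB]]]].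
  assert (Har : 0 < - (A c * r1)) by nra.
  set (m := CB / (- (A c * r1))).
  assert (Hm : 0 <= m) by (apply Rdiv_le_0_compat; assumption).
  assert (Em : A c * m * r1 = - CB).
  { unfold m. assert (r1 <> 0) by lra. assert (A c <> 0) by lra. field. split; assumption. }
  pose proof (Rabs_pos d).
  set (e1 := Rmin 1 (del / 2 / (Rabs d + m + 1))).
  assert (He1 : 0 < e1) by (apply Rmin_glb_lt; [lra | repeat apply Rdiv_lt_0_compat; lra]).
  assert (Hc0 : forall m', Rabs m' <= m -> forall e, 0 < e <= e1 -> c0 <= lg_p0 c d m' e).
  { intros m' Hm' e [He Hee]. unfold lg_p0, c0.
    assert (L1 : e <= 1) by (eapply Rle_trans; [exact Hee | apply Rmin_l]).
    assert (L2 : e * (Rabs d + m + 1) <= del / 2).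
    { apply Rle_trans with (del / 2 / (Rabs d + m + 1) * (Rabs d + m + 1)); [| right; field; lra].
      apply Rmult_le_compat_r; [lra |]. eapply Rle_trans; [exact Hee | apply Rmin_r]. }
    assert (- (e * Rabs d) <= e * d).
    { pose proof (Rle_abs (- d)) as Hx. rewrite Rabs_Ropp in Hx. nra. }
    assert (- (e * m) <= e ^ 2 * m').
    { apply Rabs_le_between in Hm'. assert (0 <= e ^ 2 <= e) by (simpl; split; nra). nra. }
    lra. }
  assert (Hmm : Rabs m <= m) by (rewrite Rabs_pos_eq; lra).
  assert (Hmm2 : Rabs (- m) <= m) by (rewrite Rabs_Ropp; exact Hmm).
  destruct (langer_upper A A1 B c d m c0 e1 Hprof He1 (Hc0 m Hmm)) as [CU [eU [HeU HU]]].
  destruct (langer_lower A A1 B c d (- m) c0 e1 Hprof He1 (Hc0 (- m) Hmm2)) as [CL [eL [HeL HL]]].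
  pose proof (Rabs_pos eta).
  set (eM := Rmin (/ (m + 1)) (/ (2 * (Rabs eta + 1)))).
  assert (HeM : 0 < eM) by (apply Rmin_glb_lt; apply Rinv_0_lt_compat; lra).
  destruct (cube_scale_small (Rmin (Rmin eU eL) (Rmin eB eM))) as [K0 HK0].
  { apply Rmin_glb_lt; apply Rmin_glb_lt; lra. }
  set (N1 := d + 2 * b0 * c).
  assert (HZb : bounded_on (T := R * R) (fun t => 0 < fst t <= 1 /\ Rabs (snd t) <= eta ^ 2)
    (fun t => 0 - (eta * snd t + fst t * fst t * (snd t * snd t)) - fst t * snd t + eta / 2 * c
      + fst t * fst t * snd t * c + (eta / 2 * fst t + fst t * fst t * fst t * snd t) * N1)).
  { assert (B1 : bounded_on (T := R * R) (fun t => 0 < fst t <= 1 /\ Rabs (snd t) <= eta ^ 2) fst).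
    { apply (bounded_on_le _ _ 1). intros t [Ht _]. rewrite Rabs_pos_eq; lra. }
    assert (B2 : bounded_on (T := R * R) (fun t => 0 < fst t <= 1 /\ Rabs (snd t) <= eta ^ 2) snd).
    { apply (bounded_on_le _ _ (eta ^ 2)). intros t [_ Ht]. exact Ht. }
    bounded_on. }
  destruct HZb as [ZB [HZB0 HZB]].
  set (M := ZB + 2 * (Rabs CU + Rabs CL)).
  exists M. exists K0. intros K HK.
  destruct (HK0 K HK) as [HK1 [He Hee]]. destruct (cube_scale_facts K HK1) as [_ [EK [E4 [E5 E2]]]].
  set (e := cube_scale K) in *.
  assert (L1 : e <= Rmin eU eL) by (eapply Rle_trans; [exact Hee | apply Rmin_l]).
  assert (L2 : e <= Rmin eB eM) by (eapply Rle_trans; [exact Hee | apply Rmin_r]).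
  assert (LU : e <= eU) by (eapply Rle_trans; [exact L1 | apply Rmin_l]).
  assert (LL : e <= eL) by (eapply Rle_trans; [exact L1 | apply Rmin_r]).
  assert (LB : e <= eB) by (eapply Rle_trans; [exact L2 | apply Rmin_l]).
  assert (LM : e <= eM) by (eapply Rle_trans; [exact L2 | apply Rmin_r]).
  assert (Lm : e * m <= 1).
  { assert (e * (m + 1) <= 1); [| nra].
    apply Rle_trans with (/ (m + 1) * (m + 1)); [| rewrite Rinv_l; lra].
    apply Rmult_le_compat_r; [lra |]. eapply Rle_trans; [exact LM | apply Rmin_l]. }
  assert (Leta : (Rabs eta + 1) * e <= 1 / 2).
  { apply Rle_trans with ((Rabs eta + 1) * / (2 * (Rabs eta + 1))); [| right; field; lra].
    apply Rmult_le_compat_l; [lra |]. eapply Rle_trans; [exact LM | apply Rmin_r]. }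
  assert (He12 : e <= 1 / 2) by nra.
  assert (He2 : 0 < e ^ 2) by (apply pow_lt; exact He).
  assert (He2e : e ^ 2 <= e) by (simpl; nra).
  assert (He4 : 0 < e ^ 4) by (apply pow_lt; exact He).
  assert (Hx : Rabs (eta * e ^ 2) <= 1 / 2).
  { rewrite Rabs_mult, (Rabs_pos_eq (e ^ 2)) by lra. nra. }
  rewrite E2. set (rho := 1 + eta * e ^ 2) in *.
  assert (Hrho : 0 < rho) by (apply Rabs_le_between in Hx; unfold rho; lra).
  destruct (HQ K rho HK1 Hrho) as [Q HQK].
  set (th := theta K rho) in *.
  assert (HBU := HB 0 m e ltac:(lra) (conj He LB) ltac:(rewrite (Rabs_pos_eq m); lra)).
  assert (HBL := HB 1 (- m) e ltac:(lra) (conj He LB) ltac:(rewrite Rabs_Ropp, (Rabs_pos_eq m); lra)).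
  fold rho in HBU, HBL.
  replace (A c * e ^ 4 * m * r1) with (- CB * e ^ 4) in HBU by (rewrite <- Em; ring).
  replace (A c * e ^ 4 * - m * r1) with (CB * e ^ 4) in HBL by (replace CB with (- (A c * m * r1)) by lra; ring).
  apply Rabs_le_between in HBU. apply Rabs_le_between in HBL.
  assert (Upper := HU K e rho th Q HK1 (conj He LU) EK Hrho HQK ltac:(lra)).
  assert (Lower := HL K e rho th Q HK1 (conj He LL) EK Hrho HQK ltac:(lra)).
  assert (Enu : lg_nu c d e = c + e * N1) by (unfold lg_nu, N1, b0; ring).
  rewrite Enu in Upper, Lower.
  set (r := sqrt rho) in *.
  assert (Hr := sqrt_expansion (eta * e ^ 2) Hx). fold rho r in Hr.
  set (R0 := (r - (1 + eta * e ^ 2 / 2)) / e ^ 4).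
  assert (Er : r = 1 + eta * e ^ 2 / 2 + e ^ 4 * R0) by (unfold R0; field; lra).
  assert (HR0 : Rabs R0 <= eta ^ 2).
  { unfold R0, Rdiv. rewrite Rabs_mult, Rabs_inv, (Rabs_pos_eq (e ^ 4)) by lra.
    apply Rle_div_l; [exact He4 |]. replace (eta ^ 2 * e ^ 4) with ((eta * e ^ 2) ^ 2) by ring. exact Hr. }
  assert (Heta2 : 0 <= eta ^ 2) by apply pow2_ge_0.
  assert (He41 : e ^ 4 <= 1) by (rewrite <- (pow1 4); apply pow_incr; lra).
  assert (He6 : 0 < e ^ 6) by (apply pow_lt; exact He).
  assert (Hr2 : 0 < r <= 2).
  { split; [apply sqrt_lt_R0; exact Hrho |].
    unfold r. rewrite <- (sqrt_Rsqr 2) by lra. apply sqrt_le_1_alt. unfold Rsqr.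
    apply Rabs_le_between in Hx. unfold rho. lra. }
  set (target := - e ^ 3 + r1 * e ^ 4 + e ^ 5 * (N1 - eta / 2)).
  set (Z := - (eta * R0 + e ^ 2 * R0 ^ 2) - e * R0 + eta / 2 * c + e ^ 2 * R0 * c + (eta / 2 * e + e ^ 3 * R0) * N1).
  assert (Emain : - (1 - r) ^ 2 + r * (- e ^ 3 + e ^ 4 * (c + e * N1)) = target + e ^ 6 * Z).
  { rewrite Er. unfold target, Z. replace r1 with (c - eta ^ 2 / 4) by (unfold c; ring). field. }
  assert (HZ : Rabs Z <= ZB).
  { assert (Hle1 : e <= 1) by lra.
    specialize (HZB (e, R0) (conj (conj He Hle1) HR0)). cbn [fst snd] in HZB.
    replace Z with (0 - (eta * R0 + e * e * (R0 * R0)) - e * R0 + eta / 2 * c + e * e * R0 * c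
      + (eta / 2 * e + e * e * e * R0) * N1) by (unfold Z; ring). exact HZB. }
  assert (Etarget : - (1 / INR K) + r1 / Rpower (INR K) (4 / 3)
          - (16 * r1 ^ 3 + 8 * eta ^ 2 * r1 ^ 2 + (eta ^ 4 + 19 * eta) * r1 + eta ^ 3 + 9)
            / (30 * r1 * Rpower (INR K) (5 / 3)) = target).
  { rewrite E4, E5, EK. unfold target, N1, d, b0, c. field. lra. }
  rewrite Etarget. rewrite EK. replace (/ (/ e ^ 3) ^ 2) with (e ^ 6) by (field; lra).
  rewrite (Rabs_pos_eq (e ^ 6)) by lra.
  apply Rabs_le_between in HZ.
  assert (HZ1 : - (e ^ 6 * ZB) <= e ^ 6 * Z <= e ^ 6 * ZB) by (split;
    [replace (- (e ^ 6 * ZB)) with (e ^ 6 * - ZB) by ring |]; apply Rmult_le_compat_l; lra).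
  pose proof (Rle_abs CU). pose proof (Rle_abs CL). pose proof (Rabs_pos CU). pose proof (Rabs_pos CL).
  assert (HCU : r * (CU * e ^ 6) <= 2 * (Rabs CU + Rabs CL) * e ^ 6).
  { apply Rle_trans with (r * ((Rabs CU + Rabs CL) * e ^ 6)).
    - apply Rmult_le_compat_l; [lra |]. apply Rmult_le_compat_r; lra.
    - rewrite Rmult_assoc. apply Rmult_le_compat_r; [apply Rmult_le_pos; lra | lra]. }
  assert (HCL : r * (CL * e ^ 6) <= 2 * (Rabs CU + Rabs CL) * e ^ 6).
  { apply Rle_trans with (r * ((Rabs CU + Rabs CL) * e ^ 6)).
    - apply Rmult_le_compat_l; [lra |]. apply Rmult_le_compat_r; lra.
    - rewrite Rmult_assoc. apply Rmult_le_compat_r; [apply Rmult_le_pos; lra | lra]. }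
  unfold M. apply Rabs_le. split; lra.
Qed.

Lemma supercritical (theta : nat -> R) (rho : R) :
  1 < rho ->
  (forall K, (1 <= K)%nat -> exists Q, perron_vector rho K (theta K) Q) ->
  big_O
    (fun K : nat =>
       theta K
       - (- (1 / INR K)
          - 1 / ((rho - 1) * INR K ^ 2)
          - 1 / ((rho - 1) ^ 2 * INR K ^ 3)
          + (rho ^ 2 + 1) / ((rho - 1) ^ 4 * INR K ^ 4)))
    (fun K : nat => / INR K ^ 5).
Proof.
  intros Hrho HQ. set (d := rho - 1). assert (Hd : 0 < d) by (unfold d; lra).
  destruct (supercritical_expansion theta d Hd) as [M [K0 HM]].
  { replace (1 + d) with rho by (unfold d; ring). exact HQ. }
  exists M. exists (S K0). intros K HK. specialize (HM K ltac:(lia)).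
  assert (HK0 : 0 < INR K) by (apply lt_0_INR; lia).
  assert (H5 : 0 < / INR K ^ 5) by (apply Rinv_0_lt_compat, pow_lt; exact HK0).
  rewrite (Rabs_pos_eq (/ INR K ^ 5)) by lra.
  replace (- (1 / INR K) - 1 / (d * INR K ^ 2) - 1 / (d ^ 2 * INR K ^ 3) + (rho ^ 2 + 1) / (d ^ 4 * INR K ^ 4))
    with (sc_theta d (/ INR K)); [exact HM |].
  unfold sc_theta, sc_th4. replace rho with (1 + d) by (unfold d; ring). field. lra.
Qed.

Theorem theorem2p2 (theta_s : nat -> R -> R)
  (theta_sP : forall (K : nat) (rho : R), (1 <= K)%nat -> 0 < rho ->
     dominant_singularity K rho (theta_s K rho)) :
  (forall rho r0 : R, 0 < rho -> rho < 1 ->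
     is_largest (fun x : R => Ai x = 0) r0 ->
     big_O
       (fun K : nat =>
          theta_s K rho
          - (- (1 - sqrt rho) ^ 2
             - sqrt rho / INR K
             + sqrt rho * r0 / Rpower (INR K) (4 / 3)
             - 8 * sqrt rho * r0 ^ 2 / (15 * Rpower (INR K) (5 / 3))))
       (fun K : nat => / INR K ^ 2))
  /\
  (forall eta r1 : R,
     is_largest (Airy_quotient_root eta) r1 ->
     big_O
       (fun K : nat =>
          theta_s K (1 + eta * Rpower (INR K) (- (2 / 3)))
          - (- (1 / INR K)
             + r1 / Rpower (INR K) (4 / 3)
             - (16 * r1 ^ 3 + 8 * eta ^ 2 * r1 ^ 2
                + (eta ^ 4 + 19 * eta) * r1 + eta ^ 3 + 9)
               / (30 * r1 * Rpower (INR K) (5 / 3))))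
       (fun K : nat => / INR K ^ 2))
  /\
  (forall rho : R, 1 < rho ->
     big_O
       (fun K : nat =>
          theta_s K rho
          - (- (1 / INR K)
             - 1 / ((rho - 1) * INR K ^ 2)
             - 1 / ((rho - 1) ^ 2 * INR K ^ 3)
             + (rho ^ 2 + 1) / ((rho - 1) ^ 4 * INR K ^ 4)))
       (fun K : nat => / INR K ^ 5)).
Proof.
  assert (HQ : forall K rho, (1 <= K)%nat -> 0 < rho ->
     exists Q, perron_vector rho K (theta_s K rho) Q).
  { intros K rho HK Hrho. apply dominant_singularity_perron; auto. }
  split; [| split].
  - intros rho r0 H0 H1 Hr. apply (subcritical (fun K => theta_s K rho)); auto.
  - intros eta r1 Hr. apply near_critical; auto.
  - intros rho Hrho. apply (supercritical (fun K => theta_s K rho)); [exact Hrho |].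
    intros K HK. apply HQ; [exact HK | lra].
Qed.
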